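(* Let $d\in\{1,2,3\}$, $\omega_0>0$, $k_0=\omega_0/c$, let $\bm\mu_\imath,\bm\mu_\jmath\in\mathbb{R}^3$ be dipole vectors, and let $\bm r_{\imath\jmath}\in\mathbb{R}^d$ with $\bm r_{\imath\jmath}\neq\bm 0$. Define $$\omega_{\imath\jmath}=-\frac{2\pi}{c^d}\int\frac{d^{d-1}\Omega_{\hat{\bm k}}}{(2\pi)^{d-1}}\,\bm\mu_\imath\cdot\big[\mathds{1}_3-\hat{\bm k}\hat{\bm k}\big]\cdot\bm\mu_\jmath\;\sum_{\pm}\mathcal P\!\int_0^\infty\frac{d\omega}{2\pi}\,\frac{\omega^d}{\omega\pm\omega_0}\,e^{i\omega\hat{\bm k}\cdot\bm r_{\imath\jmath}/c},$$ $$\gamma_{\imath\jmath}=\frac{2\pi\omega_0^d}{c^d}\int\frac{d^{d-1}\Omega_{\hat{\bm k}}}{(2\pi)^{d-1}}\,\bm\mu_\imath\cdot\big[\mathds{1}_3-\hat{\bm k}\hat{\bm k}\big]\cdot\bm\mu_\jmath\,e^{i\omega_0\hat{\bm k}\cdot\bm r_{\imath\jmath}/c}.$$ Then the complex collective frequency shift satisfies $$\Gamma_{\imath\jmath}:=-\omega_{\imath\jmath}+\frac{i}{2}\gamma_{\imath\jmath}=4\pi k_0^2\,\bm\mu_\imath\cdot\overleftrightarrow{G}_d(\bm r_{\imath\jmath},\omega_0)\cdot\bm\mu_\jmath,$$ where $\overleftrightarrow{G}_d$ is the $d$-dimensional dyadic Green's function defined below.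
   Context: $\mathbb{R}^d$ is identified with the span of the first $d$ Cartesian unit vectors $\hat{\bm x}_1,\dots,\hat{\bm x}_d$ in $\mathbb{R}^3$; $\mathds{1}_d=\sum_{l=1}^d\hat{\bm x}_l\hat{\bm x}_l$ and $\mathds 1_3$ is the identity dyad on $\mathbb{R}^3$. $c>0$ is a constant (speed of light). $d^{d-1}\Omega_{\hat{\bm k}}$ is the solid-angle measure over unit vectors $\hat{\bm k}\in\mathbb{R}^d$ (for $d=1$ counting measure on $\{\pm\hat{\bm x}_1\}$). $\mathcal P$ denotes the Cauchy principal value. $\nabla_d$ is the gradient with respect to the first $d$ coordinates. The dyadic Green's function is $\overleftrightarrow{G}_d:=\mathcal D G_d$ with the dyadic operator $\mathcal D:=\mathds 1_3+\frac{1}{k_0^2}\nabla_d\nabla_d$, where $G_d(\bm r,\omega_0)$ is the solution of the $d$-dimensional Helmholtz equation $(\nabla_d^2+k_0^2)G_d(\bm r,\omega_0)=-\delta(\bm r)$ satisfying the Sommerfeld outgoing radiation condition $\lim_{\tilde r\to\infty}|\bm r|^{(d-1)/2}\big(\partial_{\tilde r}-i\big)G_d=0$, $\tilde r=k_0|\bm r|$; explicitly $G_d(\bm r,\omega_0)=\frac{i}{4}\big(\frac{k_0^2}{2\pi}\big)^{d/2-1}\check H^{(1)}_{d/2-1}(k_0|\bm r|)$, where $\check H^{(1)}_\alpha(x):=H^{(1)}_\alpha(x)/x^\alpha$ and $H^{(1)}_\alpha$ is the Hankel function of the first kind.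
   Formalization: The frequency integrals in ω_ij diverge at infinity as written; a convergence factor e^{-εω}, ε>0, is inserted in them, and the identity is stated as the limit ε→0+ taken after the ω and angular integrals. *)

(* Defs.v *)
From Stdlib Require Import Reals Lra ClassicalEpsilon Factorial List.
From Coquelicot Require Import Coquelicot.
Open Scope R_scope.

(* ---------- vectors of R^3 (only coordinates 0,1,2 are used);
   R^d is the span of the first d unit vectors ---------- *)
Definition vec := nat -> R.
Definition dot (u v : vec) : R := u 0%nat * v 0%nat + u 1%nat * v 1%nat + u 2%nat * v 2%nat.
Definition vnorm (u : vec) : R := sqrt (dot u u).
Definition mkvec (x y z : R) : vec :=
  fun k => match k with 0%nat => x | 1%nat => y | 2%nat => z | _ => 0 end.
Definition vupd (u : vec) (l : nat) (t : R) : vec :=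
  fun k => if Nat.eqb k l then t else u k.
Definition in_Rd (d : nat) (u : vec) : Prop := forall l, (d <= l < 3)%nat -> u l = 0.

Definition transv (mu nu k : vec) : R := dot mu nu - dot mu k * dot k nu.

Definition eiC (t : R) : C := (cos t, sin t).
Definition rscal (x : R) (z : C) : C := Cmult (RtoC x) z.

Definition C_CompleteSpace : CompleteSpace := C_R_CompleteNormedModule.

Definition limC_right (f : R -> C) (x : R) : C :=
  @iota C_CompleteSpace (fun l : C => filterlim f (at_right x) (locally l)).
Definition limC (f : R -> C) (x : R) : C :=
  @iota C_CompleteSpace (fun l : C => filterlim f (locally' x) (locally l)).

Definition solid_int (d : nat) (F : vec -> C) : C :=
  match d with
  | 1%nat => Cplus (F (mkvec 1 0 0)) (F (mkvec (-1) 0 0))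
  | 2%nat => @RInt C_R_CompleteNormedModule (fun th => F (mkvec (cos th) (sin th) 0)) 0 (2 * PI)
  | 3%nat => @RInt C_R_CompleteNormedModule (fun th =>
               @RInt C_R_CompleteNormedModule (fun ph => rscal (sin th)
                   (F (mkvec (sin th * cos ph) (sin th * sin ph) (cos th)))) 0 (2 * PI))
             0 PI
  | _ => RtoC 0
  end.

Definition PV_int_0_oo (f : R -> C) (w0 : R) : C :=
  limC_right (fun delta =>
      Cplus (@RInt C_R_CompleteNormedModule f 0 (w0 - delta))
            (@RInt_gen C_R_CompleteNormedModule f (at_point (w0 + delta)) (Rbar_locally p_infty))) 0.

(* Euler's integral (used only for positive arguments) *)
Definition Gamma (s : R) : R :=
  RInt_gen (fun t => Rpower t (s - 1) * exp (- t)) (at_right 0) (Rbar_locally p_infty).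

Definition besselJ (a x : R) : R :=
  Series (fun m => (-1) ^ m / (INR (fact m) * Gamma (INR m + a + 1))
                   * Rpower (x / 2) (2 * INR m + a)).

Definition hankel1_nonint (a x : R) : C :=
  Cdiv (Cminus (RtoC (besselJ (- a) x)) (rscal (besselJ a x) (eiC (- a * PI))))
       (Cmult Ci (RtoC (sin (a * PI)))).

Definition hankel1 (a x : R) : C :=
  match excluded_middle_informative (exists z : Z, a = IZR z) with
  | left _ => limC (fun b => hankel1_nonint b x) a
  | right _ => hankel1_nonint a x
  end.

Definition hankel1_check (a x : R) : C := rscal (Rpower x (- a)) (hankel1 a x).

Definition Gd (d : nat) (k0 : R) (r : vec) : C :=
  Cmult (Cmult (Cdiv Ci (RtoC 4)) (RtoC (Rpower (k0 ^ 2 / (2 * PI)) (INR d / 2 - 1))))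
        (hankel1_check (INR d / 2 - 1) (k0 * vnorm r)).

Definition partialC (l : nat) (f : vec -> C) (r : vec) : C :=
  (Derive (fun t => fst (f (vupd r l t))) (r l),
   Derive (fun t => snd (f (vupd r l t))) (r l)).

(* mu . [ D G_d ](r) . nu   with  D = 1_3 + k0^{-2} nabla_d nabla_d *)
Definition dyadic_form (d : nat) (k0 : R) (mu nu r : vec) : C :=
  Cplus (rscal (dot mu nu) (Gd d k0 r))
        (rscal (/ k0 ^ 2)
           (fold_right Cplus (RtoC 0)
              (map (fun l => fold_right Cplus (RtoC 0)
                      (map (fun m => rscal (mu l * nu m)
                                (partialC l (partialC m (Gd d k0)) r))
                           (seq 0 d)))
                   (seq 0 d)))).

(* ---------- omega_ij (Abel-regularised by e^{-eps w}, eps > 0) and gamma_ij ---------- *)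
Definition freq_integrand (d : nat) (c w0 eps s a : R) (w : R) : C :=
  rscal (/ (2 * PI) * (w ^ d / (w + s * w0)) * exp (- eps * w)) (eiC (w * a)).

Definition omega_reg (d : nat) (c w0 : R) (mu nu r : vec) (eps : R) : C :=
  rscal (- (2 * PI / c ^ d))
    (solid_int d (fun k =>
       rscal (transv mu nu k / (2 * PI) ^ (d - 1))
         (Cplus
            (@RInt_gen C_R_CompleteNormedModule (freq_integrand d c w0 eps 1 (dot k r / c))
                      (at_point 0) (Rbar_locally p_infty))
            (PV_int_0_oo (freq_integrand d c w0 eps (-1) (dot k r / c)) w0)))).

Definition gamma_ij (d : nat) (c w0 : R) (mu nu r : vec) : C :=
  rscal (2 * PI * w0 ^ d / c ^ d)
    (solid_int d (fun k =>
       rscal (transv mu nu k / (2 * PI) ^ (d - 1)) (eiC (w0 * dot k r / c)))).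

(* Main.v *)
(* Write k.r = c a. Since w^d / (w + w0) and w^d / (w - w0) are polynomials plus multiples of the simple poles, the
   regularised frequency integral is a sum of derivatives of 1 / (eps - i a) and of pole integrals of
   exp (- eps w) exp (i w a); the latter are elementary integrals over [0, a] plus their values at a = 0, which
   are exponential integrals at eps w0.  Terms odd in a vanish by the symmetry k -> -k.  Turning the polar axis
   onto r leaves a one-dimensional integral over the polar angle, while the dyadic Green's function only involves
   radial derivatives of G_d.

   For d = 1 there is no integral, and as eps -> 0 the even part at a <> 0 tends to - pi w0 sin (w0 |a|).  For d = 3 the
   integrand is minus the second a-derivative of that of d = 1, so two integrations by parts reduce the integral
   to boundary values.  For d = 2 the even part has a logarithmic singularity at a = 0: its moments against cos^(2p)
   are computed as power series in w0 |r| / c, from the moments of ln |cos|, and the result is recognised as the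
   series of Y_0 and of its second derivative; Bessel's equation supplies the remaining first derivative. *)

Require Import Defs.
From Stdlib Require Import Reals Lra Lia ClassicalEpsilon Factorial List.
From Coquelicot Require Import Coquelicot.
From Corelib Require Import ssreflect.
Open Scope R_scope.

(** * Integrals, parameters and series *)

(** The limit [eps -> 0] has to be taken after the angular integration: at [a = 0] the moments blow
    up, and for [d = 2] and [d = 3] only the integrated quantity converges. Divergent parts are
    therefore tracked exactly. The two exponential integrals each behave like [- ln eps]; the even
    part sees their difference for odd [d] and their sum for [d = 2], where [ln (eps^2 + a^2)]
    restores the balance. Euler's constant enters twice: on the left through the exponential
    integral near [0], on the right through the derivative of Gamma at [1], because the Hankel
    function of order [0] is a limit in its order. Turning the polar axis is a shift of the angle
    for [d = 2]. On the sphere a general rotation mixes both angles, so invariance is proved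
    infinitesimally: the derivative of the integral along a one-parameter group of rotations
    vanishes. The mean of [ln |cos|] is forced by a doubling identity, and its higher moments follow
    by a recursion of Wallis type. *)

Lemma is_RInt_gen_infty {V : NormedModule R_AbsRing} (f F : R -> V) (A : R) (l : V) :
  (forall X, A <= X -> is_RInt f A X (F X)) ->
  filterlim F (Rbar_locally p_infty) (locally l) ->
  is_RInt_gen f (at_point A) (Rbar_locally p_infty) l.
Proof.
  move=> H1 H2 P HP.
  have H := H2 P HP.
  rewrite /filtermapi.
  apply: (Filter_prod _ _ _ (fun x => x = A) (fun X => A < X /\ P (F X))).
  - by rewrite /at_point.
  - apply: filter_and; [by exists A | exact: H].
  - move=> x y -> [Hy HPy] /=. exists (F y); split=> //. apply: H1. lra.
Qed.

Lemma filterlim_C {T : Type} (F : (T -> Prop) -> Prop) {FF : Filter F} (f : T -> C) (l : C) :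
  filterlim (fun x => fst (f x)) F (locally (fst l)) ->
  filterlim (fun x => snd (f x)) F (locally (snd l)) ->
  filterlim f F (locally l).
Proof.
  move=> H1 H2 P [e He].
  have h1 : F (fun x => ball (fst l) e (fst (f x))) by apply: H1; exists e.
  have h2 : F (fun x => ball (snd l) e (snd (f x))) by apply: H2; exists e.
  rewrite /filtermap.
  apply: filter_imp (filter_and _ _ h1 h2) => x [h3 h4].
  apply: He. by split.
Qed.

Lemma is_RInt_gen_C (f : R -> C) (Fa Fb : (R -> Prop) -> Prop) {FFa : Filter Fa} {FFb : Filter Fb} (l : C) :
  is_RInt_gen (fun t => fst (f t)) Fa Fb (fst l) ->
  is_RInt_gen (fun t => snd (f t)) Fa Fb (snd l) ->
  is_RInt_gen (V := C_R_NormedModule) f Fa Fb l.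
Proof.
  move=> H1 H2 P [e He].
  have h1 := H1 (ball (fst l) e) (ex_intro _ e (fun y Hy => Hy)).
  have h2 := H2 (ball (snd l) e) (ex_intro _ e (fun y Hy => Hy)).
  rewrite /filtermapi in h1 h2 *.
  apply: filter_imp (filter_and _ _ h1 h2) => ab [[y1 [h3 h3']] [y2 [h4 h4']]].
  exists (y1, y2); split; last by apply: He; split.
  apply: is_RInt_fct_extend_pair; assumption.
Qed.

Lemma is_RInt_C (f : R -> C) (a b : R) (l : C) :
  is_RInt (fun t => fst (f t)) a b (fst l) ->
  is_RInt (fun t => snd (f t)) a b (snd l) ->
  is_RInt (V := C_R_NormedModule) f a b l.
Proof.
  move=> H1 H2. rewrite (surjective_pairing l).
  by apply: is_RInt_fct_extend_pair.
Qed.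

Lemma RInt_minusR (f g : R -> R) (a b : R) : ex_RInt f a b -> ex_RInt g a b ->
  RInt (fun t => f t - g t) a b = RInt f a b - RInt g a b.
Proof. exact: (RInt_minus (V := R_CompleteNormedModule)). Qed.

Lemma RInt_plusR (f g : R -> R) (a b : R) : ex_RInt f a b -> ex_RInt g a b ->
  RInt (fun t => f t + g t) a b = RInt f a b + RInt g a b.
Proof. exact: (RInt_plus (V := R_CompleteNormedModule)). Qed.

Lemma RInt_scalR (f : R -> R) (a b k : R) : ex_RInt f a b ->
  RInt (fun t => k * f t) a b = k * RInt f a b.
Proof. move=> H; exact: (RInt_scal (V := R_CompleteNormedModule) f a b k H). Qed.

Lemma RInt_oppR (f : R -> R) (a b : R) : ex_RInt f a b ->
  RInt (fun t => - f t) a b = - RInt f a b.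
Proof. move=> H; exact: (RInt_opp (V := R_CompleteNormedModule) f a b H). Qed.

Lemma ex_RInt_cont (f : R -> R) (a b : R) : (forall t, continuous f t) -> ex_RInt f a b.
Proof. move=> H. apply: (ex_RInt_continuous (V := R_CompleteNormedModule)) => t _. exact: H. Qed.

(** Retraction of the line onto [[a, b]]. Composing an integrand with it extends properties known on
    the segment to all [t], and the integral over [[a, b]] does not see the change. *)
Definition clamp (a b t : R) : R := Rmax a (Rmin t b).

Lemma clamp_in (a b t : R) : a <= b -> a <= clamp a b t <= b.
Proof.
  move=> Hab. rewrite /clamp. split; first exact: Rmax_l.
  apply: Rmax_lub => //. exact: Rmin_r.
Qed.

Lemma clamp_id (a b t : R) : a <= t <= b -> clamp a b t = t.
Proof. move=> Ht. rewrite /clamp Rmin_left ?Rmax_right; lra. Qed.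

Lemma clamp_lipschitz (a b s t : R) : Rabs (clamp a b s - clamp a b t) <= Rabs (s - t).
Proof.
  have Hmin : Rabs (Rmin s b - Rmin t b) <= Rabs (s - t).
  { rewrite /Rmin; destruct (Rle_dec s b), (Rle_dec t b);
      rewrite /Rabs; repeat destruct Rcase_abs; lra. }
  apply: Rle_trans Hmin. rewrite /clamp. move: (Rmin s b) (Rmin t b) => u v.
  rewrite /Rmax; destruct (Rle_dec a u), (Rle_dec a v);
      rewrite /Rabs; repeat destruct Rcase_abs; lra.
Qed.

(** Differentiation under the integral asks for joint continuity of the partial derivative in full
    neighbourhoods of [(x, t)], end points included. Composing with [clamp] in [t] supplies this
    from data on the segment alone, as is needed for integrands with a pole outside it. *)
Lemma is_derive_RInt_param_continuous (f df : R -> R -> R) (a b x : R) :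
  (forall y t, Rmin a b <= t <= Rmax a b -> is_derive (fun u => f u t) y (df y t)) ->
  (forall t, Rmin a b <= t <= Rmax a b ->
     continuous (fun p : R * R => df (fst p) (snd p)) (x, t)) ->
  (forall y t, Rmin a b <= t <= Rmax a b -> continuous (f y) t) ->
  is_derive (fun y => RInt (f y) a b) x (RInt (df x) a b).
Proof.
  move=> H1 H2 H3.
  set g := fun y t => f y (clamp (Rmin a b) (Rmax a b) t).
  set dg := fun y t => df y (clamp (Rmin a b) (Rmax a b) t).
  have Hcl := fun t => clamp_in (Rmin a b) (Rmax a b) t (Rmin_Rmax a b).
  have Hid := clamp_id (Rmin a b) (Rmax a b).
  have Hg : forall y t, is_derive (fun u => g u t) y (dg y t).
  { move=> y t. apply: H1. exact: Hcl. }
  apply: (is_derive_ext (fun y => RInt (g y) a b)).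
  { move=> y. apply: RInt_ext => t Ht. rewrite /g Hid //. lra. }
  have -> : RInt (df x) a b = RInt (fun t => Derive (fun u => g u t) x) a b.
  { apply: RInt_ext => t Ht. rewrite (is_derive_unique _ _ _ (Hg x t)) /dg Hid //. lra. }
  apply: is_derive_RInt_param.
  - apply: filter_forall => y t _. exists (dg y t). exact: Hg.
  - move=> t Ht. apply/continuity_2d_pt_filterlim.
    rewrite (is_derive_unique _ _ _ (Hg x t)).
    apply: (filterlim_ext (fun z => df (fst z) (clamp (Rmin a b) (Rmax a b) (snd z)))).
    { move=> z. by rewrite (is_derive_unique _ _ _ (Hg _ _)). }
    rewrite /dg.
    apply: (continuous_comp (fun z : R * R => (fst z, clamp (Rmin a b) (Rmax a b) (snd z)))
              (fun z => df (fst z) (snd z)) (x, t)); last first.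
    { apply: H2. exact: Hcl. }
    apply: continuous_comp_2 (fun z : R * R => fst z)
       (fun z : R * R => clamp (Rmin a b) (Rmax a b) (snd z)) (fun u v => (u, v)) _ _ _ _.
    + exact: continuous_fst.
    + move=> P [e He]. exists e => z [_ Hz]. apply: He.
      apply: Rle_lt_trans (clamp_lipschitz _ _ _ _) _. exact: Hz.
    + apply: (continuous_ext (fun z => z)); [by case | exact: continuous_id].
  - apply: filter_forall => y. apply: (ex_RInt_ext (f y)).
    { move=> t Ht. rewrite /g Hid //. lra. }
    apply: ex_RInt_continuous => t Ht. exact: H3.
Qed.

(** Compactness of [[a, b]] turns joint continuity at every [(x, t)] into a single radius in the
    parameter that serves all [t]. The parameter space is arbitrary so that nested integrals can
    depend on a pair. *)
Lemma continuous_RInt_uniform {T : UniformSpace} (F : T -> R -> R) (a b : R) (x : T) :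
  a <= b ->
  (forall t, a <= t <= b -> continuous (fun p : T * R => F (fst p) (snd p)) (x, t)) ->
  locally x (fun y => ex_RInt (F y) a b) ->
  continuous (fun y => RInt (F y) a b) x.
Proof.
  move=> Hab HF Hex.
  apply/filterlim_locally => e.
  set e1 := e / (2 * (b - a + 1)).
  have He1 : 0 < e1 by apply: Rdiv_lt_0_compat; [exact: cond_pos | lra].
  have Hd : forall t, exists d : posreal, a <= t <= b -> forall y s, ball x d y -> ball t d s ->
     Rabs (F y s - F x t) < e1 / 2.
  { move=> t. case: (Rle_dec a t) => h1; last by (exists (mkposreal _ Rlt_0_1); lra).
    case: (Rle_dec t b) => h2; last by (exists (mkposreal _ Rlt_0_1); lra).
    have := HF t (conj h1 h2). move/filterlim_locally.
    have h3 : 0 < e1 / 2 by lra.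
    move/(_ (mkposreal _ h3)) => [d Hd]. exists d => _ y s Hy Hs.
    exact: (Hd (y, s) (conj Hy Hs)). }
  set dl := fun t => proj1_sig (constructive_indefinite_description _ (Hd t)).
  have Hdl : forall t, a <= t <= b -> forall y s, ball x (dl t) y -> ball t (dl t) s ->
     Rabs (F y s - F x t) < e1 / 2.
  { move=> t. rewrite /dl. by case: constructive_indefinite_description. }
  case: (compactness_value_1d a b dl) => d Hcomp.
  have Hloc : locally x (ball x d) by exists d.
  apply: filter_imp (filter_and _ _ Hex Hloc) => y [Hy1 Hy2].
  have Hx : ex_RInt (F x) a b by exact: locally_singleton Hex.
  have Hdiff : forall s, a <= s <= b -> Rabs (F y s - F x s) <= e1.
  (* The finite covering is available only under a double negation, hence the argument by
     contradiction. Both [F y s] and [F x s] are compared with [F x t] at the centre [t], each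
     within [e1 / 2]. *)
  { move=> s Hs. apply: Rnot_lt_le => Hlt.
    apply: (Hcomp s Hs) => -[t [Ht [Hst Hdt]]].
    have b1 : ball x (dl t) y by apply: ball_le Hy2.
    have b2 : ball t (dl t) s by [].
    have := Hdl t Ht y s b1 b2. have := Hdl t Ht x s (ball_center _ _) b2.
    have := Rabs_triang (F y s - F x t) (F x t - F x s).
    rewrite (Rabs_minus_sym (F x t)).
    replace (F y s - F x t + (F x t - F x s)) with (F y s - F x s) by ring. lra. }
  change (Rabs (RInt (F y) a b - RInt (F x) a b) < e).
  rewrite -(RInt_minusR (F y) (F x) a b Hy1 Hx).
  apply: (Rle_lt_trans _ ((b - a) * e1)).
  - apply: (abs_RInt_le_const (fun t => F y t - F x t) a b e1) => //.
    exact: (ex_RInt_minus (V := R_CompleteNormedModule) (F y) (F x) a b Hy1 Hx).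
  - rewrite /e1. have := cond_pos e => he.
    have -> : (b - a) * (e / (2 * (b - a + 1))) = e * ((b - a) / (2 * (b - a + 1))) by field; lra.
    rewrite -{2}(Rmult_1_r e). apply: Rmult_lt_compat_l => //.
    apply: (Rmult_lt_reg_r (2 * (b - a + 1))); first lra.
    have -> : (b - a) / (2 * (b - a + 1)) * (2 * (b - a + 1)) = b - a by field; lra. lra.
Qed.

Lemma Series_tail_le (u M : nat -> R) (N : nat) :
  (forall n, Rabs (u n) <= M n) -> ex_series M ->
  Rabs (Series u - sum_n u N) <= Series M - sum_n M N.
Proof.
  move=> Hu HM.
  have Hexu : ex_series u by apply: ex_series_le HM => n; exact: Hu.
  rewrite (Series_incr_n u (S N) (Nat.lt_0_succ N) Hexu) (Series_incr_n M (S N) (Nat.lt_0_succ N) HM).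
  rewrite !sum_n_Reals /=.
  have Hr : forall p q : R, p + q - p = q by move=> p q; ring.
  rewrite !Hr.
  have HexM : ex_series (fun k => M (S (N + k))).
  { apply: (ex_series_ext (fun k => M (S N + k)%nat)) => //. exact: (proj1 (ex_series_incr_n M (S N)) HM). }
  have Habs : ex_series (fun k => Rabs (u (S (N + k)))).
  { apply: ex_series_le HexM => n /=. rewrite /norm /= /abs /= Rabs_Rabsolu. exact: Hu. }
  apply: Rle_trans (Series_Rabs _ Habs) _.
  apply: Series_le HexM => n; split; [exact: Rabs_pos | exact: Hu].
Qed.

Lemma sum_n_Series_lim (M : nat -> R) (e : posreal) :
  ex_series M -> exists N, forall n, (N <= n)%nat -> Rabs (Series M - sum_n M n) < e.
Proof.
  move=> /Series_correct HM.
  have := HM. rewrite /is_series. move/filterlim_locally/(_ e) => [N HN].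
  exists N => n Hn. rewrite Rabs_minus_sym. exact: HN.
Qed.

(** Tannery's theorem: the majorant [M] makes all tails small at once, for the terms and for their
    limits, and a finite sum passes to the limit term by term. *)
Lemma filterlim_Series {T : Type} (F : (T -> Prop) -> Prop) {FF : ProperFilter F}
  (f : nat -> T -> R) (l M : nat -> R) :
  ex_series M -> F (fun x => forall n, Rabs (f n x) <= M n) ->
  (forall n, filterlim (f n) F (locally (l n))) ->
  filterlim (fun x => Series (fun n => f n x)) F (locally (Series l)).
Proof.
  move=> HM Hb Hl.
  have HlM : forall n, Rabs (l n) <= M n.
  { move=> n.
    apply: (filterlim_le (F := F) (fun x => Rabs (f n x)) (fun _ => M n) (Rabs (l n)) (M n)).
    - by apply: filter_imp Hb.
    - apply: filterlim_comp (Hl n) _. exact: (continuous_Rabs (l n)).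
    - exact: filterlim_const. }
  apply/filterlim_locally => e.
  have He4 : 0 < e / 4 by have := cond_pos e; lra.
  case: (sum_n_Series_lim M (mkposreal _ He4) HM) => N /(_ N (le_n _)) /= HN.
  have Hsum : filterlim (fun x => sum_n (fun n => f n x) N) F (locally (sum_n l N)).
  { elim: N {HN} => [|N IH].
    - apply: (filterlim_ext (f 0%nat)); first by move=> x; rewrite sum_O.
      rewrite sum_O. exact: Hl.
    - apply: (filterlim_ext (fun x => plus (sum_n (fun n => f n x) N) (f (S N) x))).
      { move=> x. by rewrite sum_Sn. }
      rewrite sum_Sn. apply: filterlim_comp_2 IH (Hl _) _. exact: filterlim_plus. }
  move/filterlim_locally/(_ (mkposreal _ He4)): Hsum => Hs.
  apply: filter_imp (filter_and _ _ Hb Hs) => x [Hx1 Hx2].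
  have := Series_tail_le _ _ N Hx1 HM.
  have := Series_tail_le _ _ N HlM HM.
  move: Hx2. rewrite /ball /= /AbsRing_ball /abs /minus /plus /opp /=.
  have := Rabs_def2 _ _ HN.
  set A := Series (fun n => f n x). set B := sum_n (fun n => f n x) N.
  move=> h1 /Rabs_def2 h2 /Rabs_le_between h3 /Rabs_le_between h4.
  apply: Rabs_def1; lra.
Qed.

(** Weierstrass' test: the partial sums converge uniformly. Uniformity is meant on the whole line,
    which is why the terms are first composed with [clamp]. *)
Lemma is_RInt_Series (f : nat -> R -> R) (M : nat -> R) (a b : R) :
  a <= b -> ex_series M ->
  (forall n t, a <= t <= b -> Rabs (f n t) <= M n) ->
  (forall n, ex_RInt (f n) a b) ->
  is_RInt (fun t => Series (fun n => f n t)) a b (Series (fun n => RInt (f n) a b)).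
Proof.
  move=> Hab HM Hb Hex.
  have HM0 : forall n, 0 <= M n.
  { move=> n. apply: Rle_trans (Hb n a _); [exact: Rabs_pos | lra]. }
  set cl := clamp a b.
  have Hcl := fun t => clamp_in a b t Hab.
  have Hid : forall t, a <= t <= b -> cl t = t by exact: clamp_id.
  have Hmm : forall t, Rmin a b < t < Rmax a b -> a <= t <= b.
  { move=> t. rewrite Rmin_left // Rmax_right //. lra. }
  have Hsum : forall N, is_RInt (fun t => sum_n (fun n => f n (cl t)) N) a b
                          (sum_n (fun n => RInt (f n) a b) N).
  { elim=> [|N IH].
    - rewrite sum_O. apply: (is_RInt_ext (f 0%nat)).
      { move=> t /Hmm Ht. by rewrite sum_O Hid. }
      exact: RInt_correct.
    - rewrite sum_Sn. apply: (is_RInt_ext (fun t => plus (sum_n (fun n => f n (cl t)) N) (f (S N) t))).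
      { move=> t /Hmm Ht. by rewrite sum_Sn Hid. }
      apply: is_RInt_plus IH _. exact: RInt_correct. }
  have Hu : filterlim (fun N t => sum_n (fun n => f n (cl t)) N) eventually
    (locally (T := fct_UniformSpace R R_UniformSpace) (fun t => Series (fun n => f n (cl t)))).
  { apply/filterlim_locally => e.
    case: (sum_n_Series_lim M e HM) => N HN. exists N => n Hn t.
    change (Rabs (sum_n (fun n => f n (cl t)) n - Series (fun n => f n (cl t))) < e).
    rewrite Rabs_minus_sym.
    apply: Rle_lt_trans (HN n Hn).
    apply: Rle_trans (Rle_abs _).
    apply: Series_tail_le => // m. exact: Hb. }
  have [If [H1 H2]] := filterlim_RInt (V := R_CompleteNormedModule) _ a b
    eventually _ _ _ Hsum Hu.
  have -> : Series (fun n => RInt (f n) a b) = If.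
  { apply: is_series_unique. exact: H1. }
  apply: (is_RInt_ext (fun t => Series (fun n => f n (cl t)))) => //.
  move=> t /Hmm Ht. apply: Series_ext => n. by rewrite Hid.
Qed.

Lemma ex_RInt_gt (f : R -> R) (p a b : R) :
  p < a -> p < b -> (forall t, p < t -> continuous f t) -> ex_RInt f a b.
Proof.
  move=> Ha Hb Hf. apply: (ex_RInt_continuous (V := R_CompleteNormedModule)) => t [Ht _].
  apply: Hf. apply: Rlt_le_trans Ht. by apply: Rmin_glb_lt.
Qed.

Lemma RInt_ChaslesR (f : R -> R) (a b c : R) :
  ex_RInt f a b -> ex_RInt f b c -> RInt f a c = RInt f a b + RInt f b c.
Proof. move=> H1 H2. by rewrite -(RInt_Chasles (V := R_CompleteNormedModule) f a b c). Qed.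

Lemma RInt_swapR (f : R -> R) (a b : R) : ex_RInt f a b -> RInt f b a = - RInt f a b.
Proof. move=> H. by rewrite -(opp_RInt_swap (V := R_CompleteNormedModule)). Qed.

Lemma RInt_diffR (f : R -> R) (c x y : R) :
  ex_RInt f c x -> ex_RInt f c y -> RInt f c y - RInt f c x = RInt f x y.
Proof.
  move=> Hx Hy. have Hs := ex_RInt_swap _ _ _ Hx.
  rewrite (RInt_ChaslesR f c x y) //; last exact: ex_RInt_Chasles Hs Hy. ring.
Qed.

Lemma abs_RInt_dominated (f g : R -> R) (x y : R) :
  ex_RInt f x y -> ex_RInt g x y ->
  (forall t, Rmin x y <= t <= Rmax x y -> Rabs (f t) <= g t) ->
  Rabs (RInt f x y) <= Rabs (RInt g x y).
Proof.
  have main : forall x y, x <= y -> ex_RInt f x y -> ex_RInt g x y ->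
    (forall t, x <= t <= y -> Rabs (f t) <= g t) -> Rabs (RInt f x y) <= RInt g x y.
  { move=> {}x {}y Hxy Hf Hg H.
    apply: (norm_RInt_le f g x y) => //; exact: (RInt_correct (V := R_CompleteNormedModule)). }
  move=> Hf Hg H. case: (Rle_dec x y) => Hxy.
  - apply: Rle_trans (Rle_abs _). apply: main => // t Ht. apply: H.
    by rewrite Rmin_left // Rmax_right.
  - have {}Hxy : y <= x by lra.
    rewrite (RInt_swapR f y x) ?(RInt_swapR g y x); try exact: ex_RInt_swap.
    rewrite !Rabs_Ropp. apply: Rle_trans (Rle_abs _).
    apply: main => //; try exact: ex_RInt_swap.
    move=> t Ht. apply: H. by rewrite Rmin_right // Rmax_left.
Qed.

Lemma abs_RInt_le_mul (f : R -> R) (x y M : R) :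
  ex_RInt f x y -> (forall t, Rmin x y <= t <= Rmax x y -> Rabs (f t) <= M) ->
  Rabs (RInt f x y) <= M * Rabs (y - x).
Proof.
  move=> Hf H. have HM : 0 <= M.
  { apply: Rle_trans (H (Rmin x y) _); first exact: Rabs_pos. split; [lra | exact: Rmin_Rmax]. }
  apply: Rle_trans (abs_RInt_dominated f (fun _ => M) x y Hf _ H) _.
  - exact: ex_RInt_const.
  - rewrite RInt_const /scal /= /mult /= Rabs_mult (Rabs_pos_eq M) //. lra.
Qed.

(** Cauchy's criterion, with the increments of the integral of [f] bounded by those of [g]. The
    filter may sit at either end of the half line above [p], so one statement serves convergence at
    [0] and at infinity. *)
Lemma ex_lim_RInt_dominated (F : (R -> Prop) -> Prop) {FF : ProperFilter F} (f g : R -> R) (p c lg : R) :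
  p < c -> F (fun x => p < x) ->
  (forall t, p < t -> continuous f t) -> (forall t, p < t -> continuous g t) ->
  (forall t, p < t -> Rabs (f t) <= g t) ->
  filterlim (fun x => RInt g c x) F (locally lg) ->
  exists lf, filterlim (fun x => RInt f c x) F (locally lf).
Proof.
  move=> Hc HF Hf Hg Hfg Hl.
  apply/(filterlim_locally_cauchy (U := R_CompleteSpace)) => e.
  have [P [HP1 HP2]] : exists P : R -> Prop, F P /\
     forall u v, P u -> P v -> ball (RInt g c u) e (RInt g c v).
  { apply (filterlim_locally_cauchy (U := R_CompleteSpace)). by exists lg. }
  exists (fun x => P x /\ p < x); split; first exact: filter_and.
  move=> u v [Pu Hu] [Pv Hv]. have := HP2 u v Pu Pv.
  rewrite /ball /= /AbsRing_ball /abs /minus /plus /opp /= -!/(Rminus _ _).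
  rewrite !RInt_diffR; try exact: ex_RInt_gt Hc _ _.
  apply: Rle_lt_trans. apply: abs_RInt_dominated; try exact: ex_RInt_gt Hu Hv _.
  move=> t [Ht _]. apply: Hfg. apply: Rlt_le_trans Ht. by apply: Rmin_glb_lt.
Qed.

Lemma is_RInt_gen_0_infty (f : R -> R) (l1 l2 : R) :
  (forall t, 0 < t -> continuous f t) ->
  filterlim (fun x => RInt f 1 x) (at_right 0) (locally l1) ->
  filterlim (fun x => RInt f 1 x) (Rbar_locally p_infty) (locally l2) ->
  is_RInt_gen f (at_right 0) (Rbar_locally p_infty) (l2 - l1).
Proof.
  move=> Hf H1 H2 P HP.
  have H : filterlim (fun ab : R * R => RInt f 1 (snd ab) - RInt f 1 (fst ab))
      (filter_prod (at_right 0) (Rbar_locally p_infty)) (locally (l2 - l1)).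
  { apply: (filterlim_comp_2 (fun ab => RInt f 1 (snd ab)) (fun ab => - RInt f 1 (fst ab)) Rplus).
    - apply: filterlim_comp H2. exact: filterlim_snd.
    - apply: (filterlim_comp _ _ _ (fun ab => RInt f 1 (fst ab)) Ropp _ (locally l1)).
      + apply: filterlim_comp H1. exact: filterlim_fst.
      + exact: (filterlim_opp (V := R_NormedModule)).
    - exact: (filterlim_plus (V := R_NormedModule)). }
  have Hpos : filter_prod (at_right 0) (Rbar_locally p_infty)
     (fun ab : R * R => 0 < fst ab /\ 0 < snd ab).
  { eapply (Filter_prod _ _ _ (fun x => 0 < x) (fun x => 0 < x)); last by [].
    - by exists (mkposreal _ Rlt_0_1).
    - by exists 0. }
  rewrite /filtermapi. have HPp : locally (l2 - l1) P := HP.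
  have HH := H P HPp.
  rewrite /filtermap in HH. generalize (filter_and _ _ HH Hpos). apply filter_imp.
  move=> [a b] /= [HPab [Ha Hb]].
  exists (RInt f 1 b - RInt f 1 a); split => //.
  have h1 : 0 < 1 by lra.
  rewrite RInt_diffR; try exact: ex_RInt_gt h1 _ Hf.
  apply: (RInt_correct (V := R_CompleteNormedModule)). exact: ex_RInt_gt Ha Hb Hf.
Qed.

(** Removes the singularity of [f t / t]: the totalised quotient has the value [0] at [t = 0],
    whereas the continuous extension has to take the value [l] there. *)
Lemma slope_continuous (f : R -> R) (l : R) :
  f 0 = 0 -> is_derive f 0 l -> (forall t, continuous f t) ->
  exists k : R -> R, (forall t, continuous k t) /\ (forall t, t <> 0 -> k t = f t / t).
Proof.
  move=> H0 Hd Hc.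
  set k := fun t => match Req_dec_T t 0 with left _ => l | right _ => f t / t end.
  have Hk : forall t, t <> 0 -> k t = f t / t by move=> t Ht; rewrite /k; case: Req_dec_T.
  exists k; split => // t. case: (Req_dec_T t 0) => Ht.
  - subst t. have Hk0 : k 0 = l by rewrite /k; case: Req_dec_T.
    apply/filterlim_locally => e. rewrite Hk0.
    move/is_derive_Reals: Hd => /(_ e (cond_pos e)) [d Hd].
    exists d => y Hy. case: (Req_dec_T y 0) => Hy0; first by rewrite Hy0 Hk0; exact: ball_center.
    rewrite Hk //. have := Hd y Hy0.
    rewrite H0 Rplus_0_l Rminus_0_r. apply.
    move: Hy. rewrite /ball /= /AbsRing_ball /abs /minus /plus /opp /=.
    by rewrite Ropp_0 Rplus_0_r.
  - apply: (continuous_ext_loc _ (fun y => f y / y)).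
    + have Hp : 0 < Rabs t by apply: Rabs_pos_lt.
      exists (mkposreal _ Hp) => y.
      rewrite /ball /= /AbsRing_ball /abs /minus /plus /opp /= => Hy.
      rewrite Hk // => Hy0. move: Hy. rewrite Hy0 Rplus_0_l Rabs_Ropp. lra.
    + apply: (continuous_mult (K := R_AbsRing)); first exact: Hc.
      exact: continuous_Rinv.
Qed.

Lemma is_derive_RInt_upper (f : R -> R) (c x : R) :
  (forall t, continuous f t) -> is_derive (fun y => RInt f c y) x (f x).
Proof.
  move=> Hf. apply: (is_derive_RInt (V := R_NormedModule) f _ c x) => //.
  apply: filter_forall => y. apply: (RInt_correct (V := R_CompleteNormedModule)). exact: ex_RInt_cont.
Qed.

Lemma RInt_of_derive (f df : R -> R) (a b : R) :
  (forall x, Rmin a b <= x <= Rmax a b -> is_derive f x (df x)) ->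
  (forall x, Rmin a b <= x <= Rmax a b -> continuous df x) ->
  is_RInt df a b (f b - f a).
Proof. move=> H1 H2. exact: (is_RInt_derive (V := R_CompleteNormedModule)). Qed.

Lemma ex_derive_continuousR (f : R -> R) (x : R) : ex_derive f x -> continuous f x.
Proof. exact: (ex_derive_continuous (V := R_NormedModule)). Qed.

Lemma eq_by_derive (f g df : R -> R) (a b : R) :
  (forall x, is_derive f x (df x)) -> (forall x, is_derive g x (df x)) ->
  f b - f a = g b - g a.
Proof.
  move=> Hf Hg.
  have H : forall x, Rmin a b <= x <= Rmax a b -> is_derive (fun x => f x - g x) x 0.
  { move=> x _. have -> : 0 = minus (df x) (df x) by rewrite /minus plus_opp_r.
    exact: (is_derive_minus (V := R_NormedModule)). }
  have := RInt_of_derive _ (fun _ => 0) a b H (fun x _ => continuous_const _ _).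
  move/is_RInt_unique. rewrite RInt_const /scal /= /mult /=. lra.
Qed.

(** * Pole integrals *)

(** [bdc] and [bds] are the real and imaginary part of [exp (- eps w + i (w - q) s) / (i s - eps)],
    a primitive in [w] of the exponential in the numerator. *)
Definition bdc (eps q w s : R) : R :=
  exp (- eps * w) * (- eps * cos ((w - q) * s) + s * sin ((w - q) * s)) / (eps ^ 2 + s ^ 2).
Definition bds (eps q w s : R) : R :=
  exp (- eps * w) * (- eps * sin ((w - q) * s) - s * cos ((w - q) * s)) / (eps ^ 2 + s ^ 2).

Lemma sumsq_pos (eps s : R) : 0 < eps -> 0 < eps ^ 2 + s ^ 2.
Proof. move=> He. have := pow2_ge_0 s. have : 0 < eps ^ 2 by apply: pow_lt. lra. Qed.

Lemma RInt_exp_cos (eps q a al be : R) : 0 < eps ->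
  is_RInt (fun w => exp (- eps * w) * cos ((w - q) * a)) al be (bdc eps q be a - bdc eps q al a).
Proof.
  move=> He. have Hp := sumsq_pos eps a He.
  apply: (RInt_of_derive (fun w => bdc eps q w a)) => x _.
  - rewrite /bdc. auto_derive => //. rewrite /Rminus. field. simpl in Hp. lra.
  - apply: ex_derive_continuousR. auto_derive => //.
Qed.

Lemma RInt_exp_sin (eps q a al be : R) : 0 < eps ->
  is_RInt (fun w => exp (- eps * w) * sin ((w - q) * a)) al be (bds eps q be a - bds eps q al a).
Proof.
  move=> He. have Hp := sumsq_pos eps a He.
  apply: (RInt_of_derive (fun w => bds eps q w a)) => x _.
  - rewrite /bds. auto_derive => //. rewrite /Rminus. field. simpl in Hp. lra.
  - apply: ex_derive_continuousR. auto_derive => //.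
Qed.

Lemma continuous_bdc (eps q w s : R) : 0 < eps -> continuous (bdc eps q w) s.
Proof.
  move=> He. have Hp := sumsq_pos eps s He.
  apply: ex_derive_continuousR. rewrite /bdc. auto_derive. simpl in Hp. lra.
Qed.

Lemma continuous_bds (eps q w s : R) : 0 < eps -> continuous (bds eps q w) s.
Proof.
  move=> He. have Hp := sumsq_pos eps s He.
  apply: ex_derive_continuousR. rewrite /bds. auto_derive. simpl in Hp. lra.
Qed.

Definition kcos (eps q a w : R) : R := exp (- eps * w) * cos (w * a) / (w - q).
Definition ksin (eps q a w : R) : R := exp (- eps * w) * sin (w * a) / (w - q).
Definition kexp (eps q w : R) : R := exp (- eps * w) / (w - q).
Definition Bc (eps q w a : R) : R := RInt (bdc eps q w) 0 a.
Definition Bs (eps q w a : R) : R := RInt (bds eps q w) 0 a.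

Lemma ct_plus {T : UniformSpace} (f g : T -> R) (x : T) :
  continuous f x -> continuous g x -> continuous (fun y => f y + g y) x.
Proof. exact: (continuous_plus (V := R_NormedModule)). Qed.

Lemma ct_minus {T : UniformSpace} (f g : T -> R) (x : T) :
  continuous f x -> continuous g x -> continuous (fun y => f y - g y) x.
Proof. exact: (continuous_minus (V := R_NormedModule)). Qed.

Lemma ct_opp {T : UniformSpace} (f : T -> R) (x : T) :
  continuous f x -> continuous (fun y => - f y) x.
Proof. exact: (continuous_opp (V := R_NormedModule)). Qed.

Lemma ct_mult {T : UniformSpace} (f g : T -> R) (x : T) :
  continuous f x -> continuous g x -> continuous (fun y => f y * g y) x.
Proof. exact: (continuous_mult (K := R_AbsRing)). Qed.

Lemma ct_comp {T : UniformSpace} (f : T -> R) (h : R -> R) (x : T) :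
  continuous f x -> continuous h (f x) -> continuous (fun y => h (f y)) x.
Proof. exact: continuous_comp. Qed.

Lemma ct_comp_derive {T : UniformSpace} (f : T -> R) (h : R -> R) (x : T) :
  continuous f x -> ex_derive h (f x) -> continuous (fun y => h (f y)) x.
Proof. move=> Hf Hh. apply: ct_comp => //. exact: ex_derive_continuousR. Qed.

Lemma ct_inv {T : UniformSpace} (f : T -> R) (x : T) :
  continuous f x -> f x <> 0 -> continuous (fun y => / f y) x.
Proof. move=> Hf H0. apply: ct_comp => //. exact: continuous_Rinv. Qed.

Lemma ct_pow {T : UniformSpace} (f : T -> R) (n : nat) (x : T) :
  continuous f x -> continuous (fun y => f y ^ n) x.
Proof. move=> Hf. apply: (ct_comp_derive f (fun u => u ^ n)) => //. by auto_derive. Qed.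

Lemma ct_fst (U V : UniformSpace) (x : U * V) : continuous (fun y : U * V => fst y) x.
Proof. exact: continuous_fst. Qed.

Lemma ct_snd (U V : UniformSpace) (x : U * V) : continuous (fun y : U * V => snd y) x.
Proof. exact: continuous_snd. Qed.

(* Equalities stated at a carrier such as [R_NormedModule] are not recognised by [ring] and [field]. *)
Ltac rring := match goal with |- ?a = ?b => cut (@eq R a b); [exact (fun e => e) | ring] end.

Ltac rfield := match goal with |- ?a = ?b => cut (@eq R a b); [exact (fun e => e) | field] end.

Ltac ctn := repeat match goal with
  | |- continuous (fun _ => ?c) _ => apply continuous_const
  | |- continuous (fun y => y) _ => apply continuous_id
  | |- continuous (fun y => fst y) _ => apply ct_fst
  | |- continuous (fun y => snd y) _ => apply ct_snd
  | |- continuous (fun y => fst (@?g y)) _ => apply (continuous_comp g (fun z => fst z)); [ | apply ct_fst]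
  | |- continuous (fun y => snd (@?g y)) _ => apply (continuous_comp g (fun z => snd z)); [ | apply ct_snd]
  | |- continuous (fun y => @?f y + @?g y) _ => apply (ct_plus f g)
  | |- continuous (fun y => @?f y - @?g y) _ => apply (ct_minus f g)
  | |- continuous (fun y => @?f y * @?g y) _ => apply (ct_mult f g)
  | |- continuous (fun y => @?f y / @?g y) _ => apply (ct_mult f (fun y => / g y))
  | |- continuous (fun y => - @?f y) _ => apply (ct_opp f)
  | |- continuous (fun y => / @?f y) _ => apply (ct_inv f)
  | |- continuous (fun y => @?f y ^ ?n) _ => apply (ct_pow f n)
  | |- continuous cos _ => apply continuous_cos
  | |- continuous sin _ => apply continuous_sin
  | |- continuous (fun y => cos (@?f y)) _ => apply (ct_comp_derive f cos); [ | by auto_derive]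
  | |- continuous (fun y => sin (@?f y)) _ => apply (ct_comp_derive f sin); [ | by auto_derive]
  | |- continuous (fun y => exp (@?f y)) _ => apply (ct_comp_derive f exp); [ | by auto_derive]
  end.

Lemma eq_derive_RInt (f df : R -> R) (a : R) :
  (forall x, is_derive f x (df x)) -> (forall x, continuous df x) ->
  f a = f 0 + RInt df 0 a.
Proof.
  move=> H1 H2. rewrite (is_RInt_unique _ _ _ _ (RInt_of_derive f df 0 a _ _)) //. ring.
Qed.

(* Differentiating in [a] cancels the pole, so the dependence on [a] is an integral from [0] of a pole-free integrand. *)
Lemma RInt_kernel_shifted (eps q al be a : R) : 0 < eps ->
  (forall w, Rmin al be <= w <= Rmax al be -> w <> q) ->
  RInt (fun w => kexp eps q w * cos ((w - q) * a)) al be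
    = RInt (kexp eps q) al be - (Bs eps q be a - Bs eps q al a) /\
  RInt (fun w => kexp eps q w * sin ((w - q) * a)) al be = Bc eps q be a - Bc eps q al a.
Proof.
  move=> He Hq.
  have Hk : forall w, Rmin al be <= w <= Rmax al be -> continuous (kexp eps q) w.
  { move=> w /Hq Hw. apply: ex_derive_continuousR. rewrite /kexp. auto_derive. lra. }
  have HexB : forall w, ex_RInt (bds eps q w) 0 a /\ ex_RInt (bdc eps q w) 0 a.
  { move=> w; split; apply: ex_RInt_cont => s; [exact: continuous_bds | exact: continuous_bdc]. }
  split.
  - rewrite (eq_derive_RInt (fun a => RInt (fun w => kexp eps q w * cos ((w - q) * a)) al be)
       (fun x => - (bds eps q be x - bds eps q al x)) a).
    + have -> : RInt (fun w => kexp eps q w * cos ((w - q) * 0)) al be = RInt (kexp eps q) al be.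
      { apply: RInt_ext => w _. by rewrite Rmult_0_r cos_0 Rmult_1_r. }
      rewrite RInt_oppR.
      * rewrite (RInt_minusR _ _ _ _ (proj1 (HexB be)) (proj1 (HexB al))) /Bs. rring.
      * exact: (ex_RInt_minus (V := R_NormedModule) _ _ _ _ (proj1 (HexB be)) (proj1 (HexB al))).
    + move=> x.
      have -> : - (bds eps q be x - bds eps q al x) =
         RInt (fun w => - (exp (- eps * w) * sin ((w - q) * x))) al be.
      { symmetry. apply: is_RInt_unique.
        apply: (is_RInt_opp (V := R_NormedModule)). exact: RInt_exp_sin. }
      apply: (is_derive_RInt_param_continuous (fun a w => kexp eps q w * cos ((w - q) * a))
         (fun a w => - (exp (- eps * w) * sin ((w - q) * a)))).
      * move=> y t /Hq Ht. rewrite /kexp. auto_derive => //. rewrite /Rminus. field. lra.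
      * move=> t Ht. ctn.
      * move=> y t Ht. apply: ct_mult; [exact: Hk | ctn].
    + move=> x. apply: ct_opp. apply: ct_minus; exact: continuous_bds.
  - rewrite (eq_derive_RInt (fun a => RInt (fun w => kexp eps q w * sin ((w - q) * a)) al be)
       (fun x => bdc eps q be x - bdc eps q al x) a).
    + have -> : RInt (fun w => kexp eps q w * sin ((w - q) * 0)) al be = 0.
      { rewrite (RInt_ext _ (fun _ => 0)) ?RInt_const /scal /= /mult /= ?Rmult_0_r //.
        move=> w _. by rewrite Rmult_0_r sin_0 Rmult_0_r. }
      rewrite (RInt_minusR _ _ _ _ (proj2 (HexB be)) (proj2 (HexB al))) /Bc. rring.
    + move=> x.
      have -> : bdc eps q be x - bdc eps q al x =
         RInt (fun w => exp (- eps * w) * cos ((w - q) * x)) al be.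
      { symmetry. apply: is_RInt_unique. exact: RInt_exp_cos. }
      apply: (is_derive_RInt_param_continuous (fun a w => kexp eps q w * sin ((w - q) * a))
         (fun a w => exp (- eps * w) * cos ((w - q) * a))).
      * move=> y t /Hq Ht. rewrite /kexp. auto_derive => //. rewrite /Rminus. field. lra.
      * move=> t Ht. ctn.
      * move=> y t Ht. apply: ct_mult; [exact: Hk | ctn].
    + move=> x. apply: ct_minus; exact: continuous_bdc.
Qed.

(** Since [w a = (w - q) a + q a], the addition theorems merely rotate the pair of shifted integrals
    by the angle [q a]. *)
Lemma is_RInt_kernel (eps q al be a : R) : 0 < eps ->
  (forall w, Rmin al be <= w <= Rmax al be -> w <> q) ->
  let Ck := RInt (kexp eps q) al be - (Bs eps q be a - Bs eps q al a) in
  let Sk := Bc eps q be a - Bc eps q al a in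
  is_RInt (kcos eps q a) al be (cos (q * a) * Ck - sin (q * a) * Sk) /\
  is_RInt (ksin eps q a) al be (sin (q * a) * Ck + cos (q * a) * Sk).
Proof.
  move=> He Hq Ck Sk. have [HC HS] := RInt_kernel_shifted eps q al be a He Hq.
  have Hk : forall w, Rmin al be <= w <= Rmax al be -> continuous (kexp eps q) w.
  { move=> w /Hq Hw. apply: ex_derive_continuousR. rewrite /kexp. auto_derive. lra. }
  have H1 : is_RInt (fun w => kexp eps q w * cos ((w - q) * a)) al be Ck.
  { rewrite /Ck -HC. apply: (RInt_correct (V := R_CompleteNormedModule)).
    apply: (ex_RInt_continuous (V := R_CompleteNormedModule)) => t Ht.
    apply: ct_mult; [exact: Hk | ctn]. }
  have H2 : is_RInt (fun w => kexp eps q w * sin ((w - q) * a)) al be Sk.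
  { rewrite /Sk -HS. apply: (RInt_correct (V := R_CompleteNormedModule)).
    apply: (ex_RInt_continuous (V := R_CompleteNormedModule)) => t Ht.
    apply: ct_mult; [exact: Hk | ctn]. }
  have Hsplit : forall w, w * a = (w - q) * a + q * a by move=> w; rring.
  have Hs := fun k f l H => is_RInt_scal (V := R_NormedModule) f al be k l H.
  split.
  - apply: (is_RInt_ext (fun w => cos (q * a) * (kexp eps q w * cos ((w - q) * a))
        - sin (q * a) * (kexp eps q w * sin ((w - q) * a)))).
    { move=> w _. rewrite /kcos /kexp (Hsplit w) cos_plus /Rdiv. rring. }
    by apply: (is_RInt_minus (V := R_NormedModule)); apply: Hs.
  - apply: (is_RInt_ext (fun w => sin (q * a) * (kexp eps q w * cos ((w - q) * a))
        + cos (q * a) * (kexp eps q w * sin ((w - q) * a)))).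
    { move=> w _. rewrite /ksin /kexp (Hsplit w) sin_plus /Rdiv. rring. }
    by apply: (is_RInt_plus (V := R_NormedModule)); apply: Hs.
Qed.

Lemma filterlim_squeeze0 {T : Type} (F : (T -> Prop) -> Prop) {FF : Filter F} (f g : T -> R) (l : R) :
  F (fun x => Rabs (f x - l) <= g x) -> filterlim g F (locally 0) -> filterlim f F (locally l).
Proof.
  move=> H Hg. apply/filterlim_locally => e.
  move/filterlim_locally/(_ e): Hg => Hg.
  apply: filter_imp (filter_and _ _ H Hg) => x [h1 h2].
  apply: Rle_lt_trans h1 _.
  move: h2. rewrite /ball /= /AbsRing_ball /abs /minus /plus /opp /= Ropp_0 Rplus_0_r.
  move/Rabs_def2. lra.
Qed.

Lemma fl_plus {T : Type} (F : (T -> Prop) -> Prop) {FF : Filter F} (f g : T -> R) (l m : R) :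
  filterlim f F (locally l) -> filterlim g F (locally m) ->
  filterlim (fun x => f x + g x) F (locally (l + m)).
Proof. move=> Hf Hg. apply: filterlim_comp_2 Hf Hg _. exact: (filterlim_plus (V := R_NormedModule)). Qed.

Lemma fl_opp {T : Type} (F : (T -> Prop) -> Prop) {FF : Filter F} (f : T -> R) (l : R) :
  filterlim f F (locally l) -> filterlim (fun x => - f x) F (locally (- l)).
Proof. move=> Hf. apply: filterlim_comp Hf _. exact: (filterlim_opp (V := R_NormedModule)). Qed.

Lemma fl_minus {T : Type} (F : (T -> Prop) -> Prop) {FF : Filter F} (f g : T -> R) (l m : R) :
  filterlim f F (locally l) -> filterlim g F (locally m) ->
  filterlim (fun x => f x - g x) F (locally (l - m)).
Proof. move=> Hf Hg. apply: fl_plus => //. exact: fl_opp. Qed.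

Lemma fl_mult {T : Type} (F : (T -> Prop) -> Prop) {FF : Filter F} (f g : T -> R) (l m : R) :
  filterlim f F (locally l) -> filterlim g F (locally m) ->
  filterlim (fun x => f x * g x) F (locally (l * m)).
Proof. move=> Hf Hg. apply: filterlim_comp_2 Hf Hg _. exact: (filterlim_mult (K := R_AbsRing)). Qed.

Lemma fl_cont {T : Type} (F : (T -> Prop) -> Prop) {FF : Filter F} (f : T -> R) (h : R -> R) (l : R) :
  filterlim f F (locally l) -> continuous h l -> filterlim (fun x => h (f x)) F (locally (h l)).
Proof. move=> Hf Hh. exact: filterlim_comp Hf Hh. Qed.

Lemma fl_val {T : Type} (F : (T -> Prop) -> Prop) (f : T -> R) (l m : R) :
  filterlim f F (locally l) -> l = m -> filterlim f F (locally m).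
Proof. by move=> H <-. Qed.

Lemma fl_id_right : filterlim (fun x : R => x) (at_right 0) (locally 0).
Proof. move=> P HP. exact: filter_le_within. Qed.

Lemma fl_at_right (f : R -> R) (l : R) : continuous f 0 -> f 0 = l ->
  filterlim f (at_right 0) (locally l).
Proof. move=> Hf <-. apply: (fl_cont _ (fun x => x) f) => //. exact: fl_id_right. Qed.

Lemma at_right_lt (d : R) : 0 < d -> at_right 0 (fun x => 0 < x < d).
Proof.
  move=> Hd. exists (mkposreal _ Hd) => y.
  rewrite /ball /= /AbsRing_ball /abs /minus /plus /opp /= => Hy H0. split=> //.
  move: Hy => /Rabs_def2. lra.
Qed.

Lemma filterlim_exp_infty (eps : R) : 0 < eps ->
  filterlim (fun X => exp (- eps * X)) (Rbar_locally p_infty) (locally 0).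
Proof.
  move=> He. apply/filterlim_locally => e. exists (- ln e / eps) => X HX.
  rewrite /ball /= /AbsRing_ball /abs /minus /plus /opp /= Ropp_0 Rplus_0_r.
  rewrite Rabs_pos_eq; last exact: Rlt_le (exp_pos _).
  rewrite -(exp_ln e (cond_pos e)). apply: exp_increasing.
  have : - ln e < X * eps by apply/Rlt_div_l. lra.
Qed.

Lemma filterlim_affine_infty (u v : R) : 0 < u ->
  filterlim (fun X => u * X + v) (Rbar_locally p_infty) (Rbar_locally p_infty).
Proof.
  move=> Hu P [M HM]. exists ((M - v) / u) => x Hx. apply: HM.
  have : M - v < x * u by apply/Rlt_div_l. lra.
Qed.

(** The bound is uniform in [s], so after integration over [[0, a]] the factor [exp (- eps w)] alone
    makes [Bc] and [Bs] vanish as [w] goes to infinity. *)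
Lemma bd_bound (eps u v s : R) : 0 < eps -> -1 <= u <= 1 -> -1 <= v <= 1 ->
  Rabs ((- eps * u + s * v) / (eps ^ 2 + s ^ 2)) <= 2 / eps.
Proof.
  move=> He Hu Hv. have Hp := sumsq_pos eps s He.
  rewrite Rabs_div; last lra. rewrite (Rabs_pos_eq (eps ^ 2 + s ^ 2)); last lra.
  apply/Rle_div_l => //.
  have H1 : Rabs (- eps * u + s * v) <= eps + Rabs s.
  { apply: Rle_trans (Rabs_triang _ _) _. rewrite !Rabs_mult Rabs_Ropp (Rabs_pos_eq eps); last lra.
    have Hu' : Rabs u <= 1 by apply: Rabs_le. have Hv' : Rabs v <= 1 by apply: Rabs_le.
    have h1 := Rmult_le_compat_l eps _ _ (Rlt_le _ _ He) Hu'.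
    have h2 := Rmult_le_compat_l _ _ _ (Rabs_pos s) Hv'. lra. }
  apply: Rle_trans H1 _.
  have -> : s ^ 2 = Rabs s ^ 2 by rewrite RPow_abs Rabs_pos_eq //; apply: pow2_ge_0.
  have -> : 2 / eps * (eps ^ 2 + Rabs s ^ 2) = 2 * eps + 2 * (Rabs s ^ 2) / eps by field; lra.
  have H0 := Rabs_pos s.
  have : Rabs s <= eps + 2 * Rabs s ^ 2 / eps; last lra.
  have -> : eps + 2 * Rabs s ^ 2 / eps = (eps ^ 2 + 2 * Rabs s ^ 2) / eps by field; lra.
  apply/Rle_div_r => //. nra.
Qed.

Lemma bdc_bound (eps q w s : R) : 0 < eps -> Rabs (bdc eps q w s) <= 2 / eps * exp (- eps * w).
Proof.
  move=> He. rewrite /bdc /Rdiv Rmult_assoc Rabs_mult (Rabs_pos_eq (exp _)); last exact: Rlt_le (exp_pos _).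
  rewrite (Rmult_comm _ (exp _)). apply: Rmult_le_compat_l; first exact: Rlt_le (exp_pos _).
  apply: (bd_bound eps _ (sin ((w - q) * s)) s) => //; [exact: COS_bound | exact: SIN_bound].
Qed.

Lemma bds_bound (eps q w s : R) : 0 < eps -> Rabs (bds eps q w s) <= 2 / eps * exp (- eps * w).
Proof.
  move=> He. rewrite /bds /Rdiv Rmult_assoc Rabs_mult (Rabs_pos_eq (exp _)); last exact: Rlt_le (exp_pos _).
  rewrite (Rmult_comm _ (exp _)). apply: Rmult_le_compat_l; first exact: Rlt_le (exp_pos _).
  have -> : - eps * sin ((w - q) * s) - s * cos ((w - q) * s) =
            - eps * sin ((w - q) * s) + s * (- cos ((w - q) * s)) by ring.
  apply: bd_bound => //; [exact: SIN_bound |].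
  have := COS_bound ((w - q) * s). lra.
Qed.

Lemma Bc_infty (eps q a : R) : 0 < eps ->
  filterlim (fun X => Bc eps q X a) (Rbar_locally p_infty) (locally 0).
Proof.
  move=> He. apply: (filterlim_squeeze0 _ _ (fun X => 2 / eps * Rabs a * exp (- eps * X))).
  - apply: filter_forall => X. rewrite Rminus_0_r.
    apply: Rle_trans (abs_RInt_le_mul _ _ _ (2 / eps * exp (- eps * X)) _ _) _.
    + apply: ex_RInt_cont => s. exact: continuous_bdc.
    + move=> t _. exact: bdc_bound.
    + rewrite Rminus_0_r. lra.
  - apply: fl_val (Rmult_0_r (2 / eps * Rabs a)).
    apply: fl_mult; [exact: filterlim_const | exact: filterlim_exp_infty].
Qed.

Lemma Bs_infty (eps q a : R) : 0 < eps ->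
  filterlim (fun X => Bs eps q X a) (Rbar_locally p_infty) (locally 0).
Proof.
  move=> He. apply: (filterlim_squeeze0 _ _ (fun X => 2 / eps * Rabs a * exp (- eps * X))).
  - apply: filter_forall => X. rewrite Rminus_0_r.
    apply: Rle_trans (abs_RInt_le_mul _ _ _ (2 / eps * exp (- eps * X)) _ _) _.
    + apply: ex_RInt_cont => s. exact: continuous_bds.
    + move=> t _. exact: bds_bound.
    + rewrite Rminus_0_r. lra.
  - apply: fl_val (Rmult_0_r (2 / eps * Rabs a)).
    apply: fl_mult; [exact: filterlim_const | exact: filterlim_exp_infty].
Qed.

Lemma continuous_RInt_param {T : UniformSpace} (F : T -> R -> R) (a b : R) (x : T) :
  (forall t, continuous (fun p : T * R => F (fst p) (snd p)) (x, t)) ->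
  (forall y t, continuous (F y) t) ->
  continuous (fun y => RInt (F y) a b) x.
Proof.
  move=> H1 H2. case: (Rle_dec a b) => Hab.
  - apply: continuous_RInt_uniform => //. apply: filter_forall => y. exact: ex_RInt_cont.
  - apply: (continuous_ext (fun y => - RInt (F y) b a)).
    { move=> y. rewrite (RInt_swapR _ b a) //. exact: ex_RInt_cont. }
    apply: ct_opp. apply: continuous_RInt_uniform => //; first lra.
    apply: filter_forall => y. exact: ex_RInt_cont.
Qed.

Lemma continuous_Bc (eps q a w : R) : 0 < eps -> continuous (fun w => Bc eps q w a) w.
Proof.
  move=> He. apply: continuous_RInt_param.
  - move=> t. rewrite /bdc. have := sumsq_pos eps t He => Hp. ctn. simpl in *. lra.
  - move=> y t. exact: continuous_bdc.
Qed.

Lemma continuous_Bs (eps q a w : R) : 0 < eps -> continuous (fun w => Bs eps q w a) w.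
Proof.
  move=> He. apply: continuous_RInt_param.
  - move=> t. rewrite /bds. have := sumsq_pos eps t He => Hp. ctn. simpl in *. lra.
  - move=> y t. exact: continuous_bds.
Qed.

(** Relational form of the principal value. The values of the two excised integrals are carried
    along as functions of [delta], so that linear combinations and changes of the integrand raise no
    separate question of existence. *)
Definition PVr (u : R -> R) (w0 l : R) : Prop :=
  exists L1 L2 : R -> R,
    (forall delta, 0 < delta < w0 ->
       is_RInt u 0 (w0 - delta) (L1 delta) /\
       is_RInt_gen u (at_point (w0 + delta)) (Rbar_locally p_infty) (L2 delta)) /\
    filterlim (fun delta => L1 delta + L2 delta) (at_right 0) (locally l).

Lemma PVr_lin (u v : R -> R) (w0 k m lu lv : R) : PVr u w0 lu -> PVr v w0 lv ->
  PVr (fun w => k * u w + m * v w) w0 (k * lu + m * lv).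
Proof.
  move=> [L1 [L2 [H1 H2]]] [M1 [M2 [H3 H4]]].
  exists (fun d => k * L1 d + m * M1 d), (fun d => k * L2 d + m * M2 d); split.
  - move=> d Hd. have [h1 h2] := H1 d Hd. have [h3 h4] := H3 d Hd. split.
    + apply: (is_RInt_plus (V := R_NormedModule)); exact: (is_RInt_scal (V := R_NormedModule)).
    + apply: (is_RInt_gen_plus (V := R_NormedModule)); exact: (is_RInt_gen_scal (V := R_NormedModule)).
  - apply: (filterlim_ext (fun d => k * (L1 d + L2 d) + m * (M1 d + M2 d))); first by move=> d; ring.
    apply: fl_plus; apply: fl_mult => //; exact: filterlim_const.
Qed.

Lemma PVr_ext (u v : R -> R) (w0 l : R) : (forall w, w <> w0 -> u w = v w) -> PVr u w0 l -> PVr v w0 l.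
Proof.
  move=> Huv [L1 [L2 [H1 H2]]]. exists L1, L2; split=> // d Hd.
  have [h1 h2] := H1 d Hd. split.
  - apply: is_RInt_ext h1 => x. rewrite Rmin_left ?Rmax_right; try lra. move=> Hx. apply: Huv. lra.
  - apply: is_RInt_gen_ext h2.
    eapply (Filter_prod _ _ _ (fun x => x = w0 + d) (fun x => w0 + d < x)); [by [] | by exists (w0 + d) |].
    move=> x y -> Hy t /= . rewrite Rmin_left ?Rmax_right; try lra. move=> Ht. apply: Huv. lra.
Qed.

(** A primitive that is continuous across [w0] closes the excised gap in the limit, so the principal
    value coincides with the ordinary integral. *)
Lemma PVr_primitive (u A : R -> R) (w0 : R) : 0 < w0 ->
  (forall w, is_derive A w (u w)) -> (forall w, continuous u w) ->
  filterlim A (Rbar_locally p_infty) (locally 0) ->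
  PVr u w0 (- A 0) /\ is_RInt_gen u (at_point 0) (Rbar_locally p_infty) (- A 0).
Proof.
  move=> Hw0 HA Hu Hlim.
  have Hgen : forall p, is_RInt_gen u (at_point p) (Rbar_locally p_infty) (- A p).
  { move=> p. apply: (is_RInt_gen_infty _ (fun X => A X - A p)).
    - move=> X _. exact: RInt_of_derive.
    - apply: fl_val (Rminus_0_l (A p)). apply: fl_minus => //. exact: filterlim_const. }
  split => //.
  exists (fun d => A (w0 - d) - A 0), (fun d => - A (w0 + d)); split.
  - move=> d Hd; split => //. exact: RInt_of_derive.
  - apply: fl_at_right; last by rewrite Rplus_0_r Rminus_0_r; ring.
    have HcA : forall w, continuous A w by move=> w; apply: ex_derive_continuousR; exists (u w).
    apply: ct_plus; first (apply: ct_minus; last exact: continuous_const).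
    + apply: (ct_comp (fun d => w0 - d) A) => //. ctn.
    + apply: ct_opp. apply: (ct_comp (fun d => w0 + d) A) => //. ctn.
Qed.

Lemma kernel_infty (eps q al a K0 : R) : 0 < eps -> q < al ->
  filterlim (fun X => RInt (kexp eps q) al X) (Rbar_locally p_infty) (locally K0) ->
  is_RInt_gen (kcos eps q a) (at_point al) (Rbar_locally p_infty)
    (cos (q * a) * (K0 + Bs eps q al a) + sin (q * a) * Bc eps q al a) /\
  is_RInt_gen (ksin eps q a) (at_point al) (Rbar_locally p_infty)
    (sin (q * a) * (K0 + Bs eps q al a) - cos (q * a) * Bc eps q al a).
Proof.
  move=> He Hq HK.
  have Hne : forall X, al <= X -> forall w, Rmin al X <= w <= Rmax al X -> w <> q.
  { move=> X HX w. rewrite Rmin_left //. lra. }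
  have HC : filterlim (fun X => RInt (kexp eps q) al X - (Bs eps q X a - Bs eps q al a))
     (Rbar_locally p_infty) (locally (K0 - (0 - Bs eps q al a))).
  { apply: fl_minus => //. apply: fl_minus; [exact: Bs_infty | exact: filterlim_const]. }
  have HS : filterlim (fun X => Bc eps q X a - Bc eps q al a)
     (Rbar_locally p_infty) (locally (0 - Bc eps q al a)).
  { apply: fl_minus; [exact: Bc_infty | exact: filterlim_const]. }
  split.
  - eapply is_RInt_gen_infty.
    + move=> X HX. exact: (proj1 (is_RInt_kernel eps q al X a He (Hne X HX))).
    + eapply fl_val.
      * apply: fl_minus; (apply: fl_mult; [exact: filterlim_const |]); [exact: HC | exact: HS].
      * ring.
  - eapply is_RInt_gen_infty.
    + move=> X HX. exact: (proj2 (is_RInt_kernel eps q al X a He (Hne X HX))).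
    + eapply fl_val.
      * apply: fl_plus; (apply: fl_mult; [exact: filterlim_const |]); [exact: HC | exact: HS].
      * ring.
Qed.

(** The whole singularity sits in the integrals at [a = 0], whose limit is the hypothesis on [g0].
    The functions [Bs] and [Bc] are continuous in [w] across the pole, so their values at [w0 + d]
    and [w0 - d] cancel as [d] tends to [0]. *)
Lemma kernel_PV (eps w0 a g0 : R) (K2 : R -> R) : 0 < eps -> 0 < w0 ->
  (forall d, 0 < d -> filterlim (fun X => RInt (kexp eps w0) (w0 + d) X) (Rbar_locally p_infty) (locally (K2 d))) ->
  filterlim (fun d => RInt (kexp eps w0) 0 (w0 - d) + K2 d) (at_right 0) (locally g0) ->
  PVr (kcos eps w0 a) w0
    (cos (w0 * a) * (g0 + Bs eps w0 0 a) + sin (w0 * a) * Bc eps w0 0 a) /\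
  PVr (ksin eps w0 a) w0
    (sin (w0 * a) * (g0 + Bs eps w0 0 a) - cos (w0 * a) * Bc eps w0 0 a).
Proof.
  move=> He Hw0 HK2 Hg0.
  have Hne : forall d, 0 < d < w0 -> forall w, Rmin 0 (w0 - d) <= w <= Rmax 0 (w0 - d) -> w <> w0.
  { move=> d Hd w. rewrite Rmax_right; lra. }
  have Hinf : forall d, 0 < d -> _ := fun d Hd =>
     kernel_infty eps w0 (w0 + d) a (K2 d) He ltac:(lra) (HK2 d Hd).
  have Hs1 : filterlim (fun d => Bs eps w0 (w0 + d) a - Bs eps w0 (w0 - d) a) (at_right 0) (locally 0).
  { apply: fl_at_right; last by rewrite Rplus_0_r Rminus_0_r; ring.
    apply: ct_minus.
    - apply: (ct_comp (fun d => w0 + d) (fun w => Bs eps w0 w a)); [ctn | exact: continuous_Bs].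
    - apply: (ct_comp (fun d => w0 - d) (fun w => Bs eps w0 w a)); [ctn | exact: continuous_Bs]. }
  have Hc1 : filterlim (fun d => Bc eps w0 (w0 + d) a - Bc eps w0 (w0 - d) a) (at_right 0) (locally 0).
  { apply: fl_at_right; last by rewrite Rplus_0_r Rminus_0_r; ring.
    apply: ct_minus.
    - apply: (ct_comp (fun d => w0 + d) (fun w => Bc eps w0 w a)); [ctn | exact: continuous_Bc].
    - apply: (ct_comp (fun d => w0 - d) (fun w => Bc eps w0 w a)); [ctn | exact: continuous_Bc]. }
  split.
  - eexists; eexists; split.
    { move=> d Hd; split; first exact: (proj1 (is_RInt_kernel eps w0 0 (w0 - d) a He (Hne d Hd))).
      exact: (proj1 (Hinf d (proj1 Hd))). }
    apply: (filterlim_ext (fun d => cos (w0 * a) * (RInt (kexp eps w0) 0 (w0 - d) + K2 d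
        + (Bs eps w0 (w0 + d) a - Bs eps w0 (w0 - d) a) + Bs eps w0 0 a)
        + sin (w0 * a) * (Bc eps w0 0 a + (Bc eps w0 (w0 + d) a - Bc eps w0 (w0 - d) a)))).
    { move=> d. ring. }
    eapply fl_val.
    + apply: fl_plus; (apply: fl_mult; first exact: filterlim_const).
      * apply: fl_plus; last exact: filterlim_const. apply: fl_plus; [exact: Hg0 | exact: Hs1].
      * apply: fl_plus; [exact: filterlim_const | exact: Hc1].
    + ring.
  - eexists; eexists; split.
    { move=> d Hd; split; first exact: (proj2 (is_RInt_kernel eps w0 0 (w0 - d) a He (Hne d Hd))).
      exact: (proj2 (Hinf d (proj1 Hd))). }
    apply: (filterlim_ext (fun d => sin (w0 * a) * (RInt (kexp eps w0) 0 (w0 - d) + K2 d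
        + (Bs eps w0 (w0 + d) a - Bs eps w0 (w0 - d) a) + Bs eps w0 0 a)
        - cos (w0 * a) * (Bc eps w0 0 a + (Bc eps w0 (w0 + d) a - Bc eps w0 (w0 - d) a)))).
    { move=> d. ring. }
    eapply fl_val.
    + apply: fl_minus; (apply: fl_mult; first exact: filterlim_const).
      * apply: fl_plus; last exact: filterlim_const. apply: fl_plus; [exact: Hg0 | exact: Hs1].
      * apply: fl_plus; [exact: filterlim_const | exact: Hc1].
    + ring.
Qed.

(** * Moments of the regularised exponential *)

(** Induction on [n] for all [eps]: one half of the decay bounds a factor [w] by [2 / eps], the
    other half is left for the remaining power. *)
Lemma filterlim_pow_exp_infty (n : nat) (eps : R) : 0 < eps ->
  filterlim (fun w => w ^ n * exp (- eps * w)) (Rbar_locally p_infty) (locally 0).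
Proof.
  elim: n eps => [|n IH] eps He.
  - apply: (filterlim_ext (fun w => exp (- eps * w))); first by move=> w /=; ring.
    exact: filterlim_exp_infty.
  - have He2 : 0 < eps / 2 by lra.
    apply: (filterlim_squeeze0 _ _ (fun w => 2 / eps * (w ^ n * exp (- (eps / 2) * w)))).
    + exists 0 => w Hw. rewrite Rminus_0_r.
      have Hs : exp (- eps * w) = exp (- (eps / 2) * w) * exp (- (eps / 2) * w).
      { rewrite -exp_plus. congr exp. field. }
      have Hx : w * exp (- (eps / 2) * w) <= 2 / eps.
      { have := exp_ineq1_le (eps / 2 * w).
        have -> : - (eps / 2) * w = - (eps / 2 * w) by ring. rewrite exp_Ropp.
        have Hp := exp_pos (eps / 2 * w). move=> h.
        apply/Rle_div_l => //. apply: (Rmult_le_reg_l (eps / 2)); first lra.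
        have -> : eps / 2 * (2 / eps * exp (eps / 2 * w)) = exp (eps / 2 * w) by field; lra. lra. }
      have Hpw := pow_lt _ n Hw. have Hp := exp_pos (- (eps / 2) * w).
      rewrite Rabs_pos_eq; last first.
      { apply: Rmult_le_pos; last exact: Rlt_le (exp_pos _). apply: pow_le. lra. }
      rewrite Hs /=.
      have -> : w * w ^ n * (exp (- (eps / 2) * w) * exp (- (eps / 2) * w)) =
        (w * exp (- (eps / 2) * w)) * (w ^ n * exp (- (eps / 2) * w)) by ring.
      apply: Rmult_le_compat_r => //. apply: Rlt_le. exact: Rmult_lt_0_compat.
    + apply: fl_val (Rmult_0_r (2 / eps)). apply: fl_mult; [exact: filterlim_const | exact: IH].
Qed.

Definition wexp (eps : R) (T : R -> R) (n : nat) (w : R) : R := w ^ n * exp (- eps * w) * T w.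

Lemma wexp_infty (eps : R) (T : R -> R) (n : nat) : 0 < eps -> (forall w, Rabs (T w) <= 1) ->
  filterlim (wexp eps T n) (Rbar_locally p_infty) (locally 0).
Proof.
  move=> He HT. apply: filterlim_squeeze0 (filterlim_pow_exp_infty n eps He).
  exists 0 => w Hw. rewrite Rminus_0_r /wexp Rabs_mult Rabs_pos_eq.
  - rewrite -{2}(Rmult_1_r (w ^ n * _)). apply: Rmult_le_compat_l; last exact: HT.
    apply: Rmult_le_pos; last exact: Rlt_le (exp_pos _). apply: pow_le. lra.
  - apply: Rmult_le_pos; last exact: Rlt_le (exp_pos _). apply: pow_le. lra.
Qed.

Lemma polyexp_infty (eps u0 u1 u2 v0 v1 v2 a : R) : 0 < eps ->
  filterlim (fun w => - ((u2 * w ^ 2 + u1 * w + u0) * (exp (- eps * w) * cos (w * a))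
                       - (v2 * w ^ 2 + v1 * w + v0) * (exp (- eps * w) * sin (w * a))))
    (Rbar_locally p_infty) (locally 0).
Proof.
  move=> He.
  have Hc : forall w, Rabs (cos (w * a)) <= 1 by move=> w; apply: Rabs_le; exact: COS_bound.
  have Hs : forall w, Rabs (sin (w * a)) <= 1 by move=> w; apply: Rabs_le; exact: SIN_bound.
  have HC := fun n => wexp_infty eps (fun w => cos (w * a)) n He Hc.
  have HS := fun n => wexp_infty eps (fun w => sin (w * a)) n He Hs.
  have Hk : forall k f, filterlim f (Rbar_locally p_infty) (locally 0) ->
     filterlim (fun w : R => k * f w) (Rbar_locally p_infty) (locally 0).
  { move=> k f Hf. apply: fl_val (Rmult_0_r k). apply: fl_mult => //. exact: filterlim_const. }
  apply: (filterlim_ext (fun w =>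
     (v2 * wexp eps (fun w => sin (w * a)) 2 w + v1 * wexp eps (fun w => sin (w * a)) 1 w
        + v0 * wexp eps (fun w => sin (w * a)) 0 w)
   - (u2 * wexp eps (fun w => cos (w * a)) 2 w + u1 * wexp eps (fun w => cos (w * a)) 1 w
        + u0 * wexp eps (fun w => cos (w * a)) 0 w))).
  { move=> w. rewrite /wexp. ring. }
  eapply fl_val.
  - apply: fl_minus; (apply: fl_plus; first apply: fl_plus); apply: Hk;
      solve [exact: HC | exact: HS].
  - ring.
Qed.

Definition zp (eps a : R) : R := eps / (eps ^ 2 + a ^ 2).
Definition zq (eps a : R) : R := a / (eps ^ 2 + a ^ 2).

(* Real and imaginary part of [n! / z^(n+1)] for [z = eps - i a], where [1/z = zp + i zq]. *)
Definition momR (eps a : R) (n : nat) : R :=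
  let p := zp eps a in let q := zq eps a in
  match n with 0%nat => p | 1%nat => p ^ 2 - q ^ 2 | _ => 2 * (p ^ 3 - 3 * p * q ^ 2) end.
Definition momI (eps a : R) (n : nat) : R :=
  let p := zp eps a in let q := zq eps a in
  match n with 0%nat => q | 1%nat => 2 * p * q | _ => 2 * (3 * p ^ 2 * q - q ^ 3) end.

Definition IG (u : R -> R) (l : R) : Prop := is_RInt_gen u (at_point 0) (Rbar_locally p_infty) l.

Lemma moments (eps a w0 : R) (n : nat) : 0 < eps -> 0 < w0 -> (n <= 2)%nat ->
  (PVr (wexp eps (fun w => cos (w * a)) n) w0 (momR eps a n) /\
   IG (wexp eps (fun w => cos (w * a)) n) (momR eps a n)) /\
  (PVr (wexp eps (fun w => sin (w * a)) n) w0 (momI eps a n) /\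
   IG (wexp eps (fun w => sin (w * a)) n) (momI eps a n)).
Proof.
  move=> He Hw0 Hn.
  have Hz : eps * zp eps a + a * zq eps a = 1 /\ eps * zq eps a = a * zp eps a.
  { have := sumsq_pos eps a He => Hp. rewrite /zp /zq. split; field; simpl in Hp; lra. }
  move: Hz. rewrite /momR /momI. move: (zp eps a) (zq eps a) => p q [Hz1 Hz2].
  (* Undetermined coefficients: [- (U + i V) exp (- z w)] with [z = eps - i a] is a primitive of
     [w ^ n exp (- z w)] exactly if [z (U + i V) - (U + i V)' = w ^ n]. The two identities are the
     real and imaginary part of this equation, and the integral from [0] is the constant coefficient
     [u0 + i v0]. *)
  have gen : forall u0 u1 u2 v0 v1 v2 : R,
    (forall w, (eps * (u2 * w ^ 2 + u1 * w + u0) + a * (v2 * w ^ 2 + v1 * w + v0) - (2 * u2 * w + u1) = w ^ n)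
     /\ (a * (u2 * w ^ 2 + u1 * w + u0) - eps * (v2 * w ^ 2 + v1 * w + v0) + (2 * v2 * w + v1) = 0)) ->
    (PVr (wexp eps (fun w => cos (w * a)) n) w0 u0 /\ IG (wexp eps (fun w => cos (w * a)) n) u0) /\
    (PVr (wexp eps (fun w => sin (w * a)) n) w0 v0 /\ IG (wexp eps (fun w => sin (w * a)) n) v0).
  { move=> u0 u1 u2 v0 v1 v2 H. split.
    - have HA := PVr_primitive (wexp eps (fun w => cos (w * a)) n)
        (fun w => - ((u2 * w ^ 2 + u1 * w + u0) * (exp (- eps * w) * cos (w * a))
                       - (v2 * w ^ 2 + v1 * w + v0) * (exp (- eps * w) * sin (w * a)))) w0 Hw0.
      have {HA} := HA _ _ (polyexp_infty _ _ _ _ _ _ _ _ He).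
      rewrite !Rmult_0_l sin_0 cos_0 !Rmult_0_r exp_0.
      match goal with |- (_ -> _ -> _ /\ is_RInt_gen _ _ _ ?X) -> _ => have -> : X = u0 by ring end.
      apply.
      + move=> w. have [h1 h2] := H w. auto_derive => //. rewrite /wexp -h1.
        move: h2 => h2.
        replace (v2 * (w * (w * 1)) + v1 * w + v0) with (v2 * w ^ 2 + v1 * w + v0) by ring.
        replace (u2 * (w * (w * 1)) + u1 * w + u0) with (u2 * w ^ 2 + u1 * w + u0) by ring.
        set X := u2 * w ^ 2 + u1 * w + u0 in h1 h2 *. set Y := v2 * w ^ 2 + v1 * w + v0 in h1 h2 *.
        have h3 : v1 = eps * Y - a * X - 2 * v2 * w by lra. rewrite h3. ring.
      + move=> w. rewrite /wexp. ctn.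
    - have HA := PVr_primitive (wexp eps (fun w => sin (w * a)) n)
        (fun w => - ((v2 * w ^ 2 + v1 * w + v0) * (exp (- eps * w) * cos (w * a))
                       - (- u2 * w ^ 2 + - u1 * w + - u0) * (exp (- eps * w) * sin (w * a)))) w0 Hw0.
      have {HA} := HA _ _ (polyexp_infty _ _ _ _ _ _ _ _ He).
      rewrite !Rmult_0_l sin_0 cos_0 !Rmult_0_r exp_0.
      match goal with |- (_ -> _ -> _ /\ is_RInt_gen _ _ _ ?X) -> _ => have -> : X = v0 by ring end.
      apply.
      + move=> w. have [h1 h2] := H w. auto_derive => //. rewrite /wexp -h1.
        replace (v2 * (w * (w * 1)) + v1 * w + v0) with (v2 * w ^ 2 + v1 * w + v0) by ring.
        replace (- u2 * (w * (w * 1)) + - u1 * w + - u0) with (- (u2 * w ^ 2 + u1 * w + u0)) by ring.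
        set X := u2 * w ^ 2 + u1 * w + u0 in h1 h2 *. set Y := v2 * w ^ 2 + v1 * w + v0 in h1 h2 *.
        have h3 : v1 = eps * Y - a * X - 2 * v2 * w by lra. rewrite h3. ring.
      + move=> w. rewrite /wexp. ctn. }
  (* The witnesses are the real and imaginary parts of the coefficients of
     [w^n / z + n w^(n-1) / z^2 + ...], with [1 / z = p + i q]. The verifications use only [Hz1] and
     [Hz2], that is, [z (p + i q) = 1]. *)
  case: n Hn gen => [|[|[|n]]] Hn gen; last lia.
  - apply: (gen p 0 0 q 0 0) => w /=. split; nra.
  - apply: (gen (p ^ 2 - q ^ 2) p 0 (2 * p * q) q 0) => w. split.
    + replace (w ^ 1) with (w * (eps * p + a * q) + (p * (eps * p + a * q) + q * (eps * q - eps * q)) - p * 1 ) by (rewrite Hz1; ring).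
      have -> : eps * q - eps * q = 0 by ring.
      have -> : eps * (0 * w ^ 2 + p * w + (p ^ 2 - q ^ 2)) + a * (0 * w ^ 2 + q * w + 2 * p * q) - (2 * 0 * w + p)
        = w * (eps * p + a * q) + p * (eps * p + a * q) - p - q * (eps * q - a * p) by ring.
      rewrite Hz2. ring.
    + have -> : a * (0 * w ^ 2 + p * w + (p ^ 2 - q ^ 2)) - eps * (0 * w ^ 2 + q * w + 2 * p * q) + (2 * 0 * w + q)
        = - w * (eps * q - a * p) - p * (eps * q - a * p) - q * (eps * p + a * q) + q by ring.
      rewrite Hz1 Hz2. ring.
  - apply: (gen (2 * (p ^ 3 - 3 * p * q ^ 2)) (2 * (p ^ 2 - q ^ 2)) p
              (2 * (3 * p ^ 2 * q - q ^ 3)) (2 * (2 * p * q)) q) => w. split.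
    + transitivity (w ^ 2 * (eps * p + a * q) - 2 * w * q * (eps * q - a * p) + 2 * w * p * (eps * p + a * q) - 2 * p * w
         + 2 * ((p ^ 2 - q ^ 2) * (eps * p + a * q) - 2 * p * q * (eps * q - a * p)) - 2 * (p ^ 2 - q ^ 2)).
      { ring. } rewrite Hz1 Hz2. ring.
    + transitivity (- w ^ 2 * (eps * q - a * p) - 2 * w * p * (eps * q - a * p) - 2 * w * q * (eps * p + a * q) + 2 * q * w
        - 2 * ((p ^ 2 - q ^ 2) * (eps * q - a * p) + 2 * p * q * (eps * p + a * q)) + 4 * p * q).
      { ring. } rewrite Hz1 Hz2. ring.
Qed.

Lemma IG_lin (u v : R -> R) (k m lu lv : R) : IG u lu -> IG v lv ->
  IG (fun w => k * u w + m * v w) (k * lu + m * lv).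
Proof.
  move=> h1 h2. apply: (is_RInt_gen_plus (V := R_NormedModule)); exact: (is_RInt_gen_scal (V := R_NormedModule)).
Qed.

Lemma IG_ext (u v : R -> R) (q l : R) : q < 0 -> (forall w, w <> q -> u w = v w) -> IG u l -> IG v l.
Proof.
  move=> Hq Huv h2. apply: is_RInt_gen_ext h2.
  eapply (Filter_prod _ _ _ (fun x => x = 0) (fun x => 0 < x)); [by [] | by exists 0 |].
  move=> x y -> Hy t /= . rewrite Rmin_left ?Rmax_right; try lra. move=> Ht. apply: Huv. lra.
Qed.

(** Quotient and remainder of [w ^ d] by [w - q]: [K] stands for the integral of the pole and [M0],
    [M1], [M2] for the moments of the quotient. *)
Definition pole_value (d : nat) (q M0 M1 M2 K : R) : R :=
  match d with
  | 1%nat => M0 + q * K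
  | 2%nat => M1 + q * M0 + q ^ 2 * K
  | _ => M2 + q * M1 + q ^ 2 * M0 + q ^ 3 * K
  end.

(** The predicate [P] is meant for two notions: the ordinary integral with the pole at [- w0], and
    the principal value with the pole at [w0]. Both are linear and blind to the value of the
    integrand at [q]. *)
Lemma pole_reduction (P : (R -> R) -> R -> Prop) (eps q : R) (T : R -> R) (d : nat) (M : nat -> R) (K x : R) :
  (forall u v k m lu lv, P u lu -> P v lv -> P (fun w => k * u w + m * v w) (k * lu + m * lv)) ->
  (forall u v l, (forall w, w <> q -> u w = v w) -> P u l -> P v l) ->
  (1 <= d <= 3)%nat ->
  (forall n, (n <= 2)%nat -> P (wexp eps T n) (M n)) ->
  P (fun w => exp (- eps * w) * T w / (w - q)) K ->
  P (fun w => x * (w ^ d / (w - q)) * exp (- eps * w) * T w) (x * pole_value d q (M 0%nat) (M 1%nat) (M 2%nat) K).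
Proof.
  move=> Hlin Hext Hd HM HK.
  have h0 := HM 0%nat ltac:(lia). have h1 := HM 1%nat ltac:(lia). have h2 := HM 2%nat ltac:(lia).
  case: d Hd => [|[|[|[|d]]]] Hd; try lia.
  - have := Hlin _ _ x (x * q) _ _ h0 HK.
    have -> : x * M 0%nat + x * q * K = x * pole_value 1 q (M 0%nat) (M 1%nat) (M 2%nat) K by rewrite /=; ring.
    apply: Hext => w Hw. rewrite /wexp. field. lra.
  - have := Hlin _ _ x x _ _ h1 (Hlin _ _ q (q ^ 2) _ _ h0 HK).
    have -> : x * M 1%nat + x * (q * M 0%nat + q ^ 2 * K) = x * pole_value 2 q (M 0%nat) (M 1%nat) (M 2%nat) K by rewrite /=; ring.
    apply: Hext => w Hw. rewrite /wexp. field. lra.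
  - have := Hlin _ _ x x _ _ (Hlin _ _ 1 q _ _ h2 h1) (Hlin _ _ (q ^ 2) (q ^ 3) _ _ h0 HK).
    have -> : x * (1 * M 2%nat + q * M 1%nat) + x * (q ^ 2 * M 0%nat + q ^ 3 * K) = x * pole_value 3 q (M 0%nat) (M 1%nat) (M 2%nat) K by rewrite /=; ring.
    apply: Hext => w Hw. rewrite /wexp. field. lra.
Qed.

(** * The exponential integral *)

Definition gexp (s : R) : R := exp (- s) / s.

Lemma continuous_gexp (s : R) : s <> 0 -> continuous gexp s.
Proof. move=> Hs. apply: ex_derive_continuousR. rewrite /gexp. by auto_derive. Qed.

Lemma ex_RInt_gexp (a b : R) : 0 < a -> 0 < b -> ex_RInt gexp a b.
Proof. move=> Ha Hb. apply: (ex_RInt_gt _ 0) => // t Ht. apply: continuous_gexp. lra. Qed.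

Lemma expint_ex : exists l, filterlim (fun X => RInt gexp 1 X) (Rbar_locally p_infty) (locally l).
Proof.
  (* The domination must hold on an open half line that contains the base point [1]; starting it at
     [1 / 2] costs the factor [2]. *)
  apply: (ex_lim_RInt_dominated _ gexp (fun s => 2 * exp (- s)) (1 / 2) 1 (2 * exp (- (1)))); first lra.
  - by exists (1 / 2).
  - move=> t Ht. apply: continuous_gexp. lra.
  - move=> t _. ctn.
  - move=> t Ht. rewrite /gexp Rabs_pos_eq.
    + apply/Rle_div_l; first lra. have := exp_pos (- t). nra.
    + apply: Rlt_le. apply: Rdiv_lt_0_compat; [exact: exp_pos | lra].
  - apply: (filterlim_ext (fun X => -2 * exp (- (1) * X) + 2 * exp (- (1)))).
    { move=> X. symmetry. apply: is_RInt_unique.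
      have -> : -2 * exp (- (1) * X) + 2 * exp (- (1)) = (-2 * exp (- X)) - (-2 * exp (- (1))).
      { have -> : - (1) * X = - X by ring. ring. }
      apply: (RInt_of_derive (fun t => -2 * exp (- t))) => t _.
      - auto_derive => //. ring.
      - ctn. }
    eapply fl_val.
    + apply: fl_plus; last exact: filterlim_const.
      apply: fl_mult; [exact: filterlim_const | apply: filterlim_exp_infty; lra].
    + ring.
Qed.

(** The number [E_1(1)]. *)
Definition expint_const : R := proj1_sig (constructive_indefinite_description _ expint_ex).

Lemma expint_const_spec : filterlim (fun X => RInt gexp 1 X) (Rbar_locally p_infty) (locally expint_const).
Proof. rewrite /expint_const. by case: constructive_indefinite_description. Qed.

(* The exponential integral [E_1]. *)
Definition expint (y : R) : R := expint_const - RInt gexp 1 y.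

Lemma expint_infty (y : R) : 0 < y ->
  filterlim (fun X => RInt gexp y X) (Rbar_locally p_infty) (locally (expint y)).
Proof.
  move=> Hy. apply: (filterlim_ext_loc (fun X => RInt gexp 1 X - RInt gexp 1 y)).
  - exists 0 => X HX. apply: RInt_diffR; apply: ex_RInt_gexp; lra.
  - apply: fl_minus; [exact: expint_const_spec | exact: filterlim_const].
Qed.

(** This is [- 2 Shi(y)], with the hyperbolic sine integral [Shi]; it is what the two sides of the
    pole leave over after their singularities have cancelled. *)
Definition Shi2 (y : R) : R := RInt (fun s => (exp (- s) - exp s) / s) 0 y.

Lemma slope_RInt (f : R -> R) (l : R) : f 0 = 0 -> is_derive f 0 l -> (forall t, continuous f t) ->
  exists k, (forall t, continuous k t) /\ (forall t, t <> 0 -> k t = f t / t) /\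
   forall x y, (0 <= x /\ 0 <= y) -> is_RInt (fun s => f s / s) x y (RInt k x y).
Proof.
  move=> H0 H1 H2. have [k [Hk1 Hk2]] := slope_continuous f l H0 H1 H2.
  exists k; split=> //; split=> // x y [Hx Hy].
  apply: (is_RInt_ext k).
  { move=> t [Ht _]. apply: Hk2. have : 0 <= Rmin x y by apply: Rmin_glb. lra. }
  apply: (RInt_correct (V := R_CompleteNormedModule)). exact: ex_RInt_cont.
Qed.

Lemma slope_RInt_lim (f : R -> R) (l y : R) : f 0 = 0 -> is_derive f 0 l -> (forall t, continuous f t) ->
  0 < y ->
  filterlim (fun d => RInt (fun s => f s / s) d y) (at_right 0) (locally (RInt (fun s => f s / s) 0 y)) /\
  filterlim (fun d => RInt (fun s => f s / s) 0 d) (at_right 0) (locally 0).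
Proof.
  move=> H0 H1 H2 Hy. have [k [Hk1 [_ Hk3]]] := slope_RInt f l H0 H1 H2.
  have Hpos : at_right 0 (fun d => 0 < d) by exists (mkposreal _ Rlt_0_1).
  have Hex : forall u v, ex_RInt k u v by move=> u v; exact: ex_RInt_cont.
  have Hc : forall u v, continuous (fun x => RInt k u x) v.
  { move=> u v. apply: ex_derive_continuousR. exists (k v). exact: is_derive_RInt_upper. }
  split.
  - rewrite (is_RInt_unique _ _ _ _ (Hk3 0 y ltac:(lra))).
    apply: (filterlim_ext_loc (fun d => RInt k 0 y - RInt k 0 d)).
    { apply: filter_imp Hpos => d Hd.
      rewrite (is_RInt_unique _ _ _ _ (Hk3 d y ltac:(lra))). exact: RInt_diffR. }
    apply: fl_at_right.
    + apply: ct_minus; [exact: continuous_const | exact: Hc].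
    + rewrite RInt_point /zero /=. ring.
  - apply: (filterlim_ext_loc (fun d => RInt k 0 d)).
    { apply: filter_imp Hpos => d Hd. by rewrite (is_RInt_unique _ _ _ _ (Hk3 0 d ltac:(lra))). }
    apply: fl_at_right; [exact: Hc | exact: RInt_point].
Qed.

Lemma shi_slope : (fun s => exp (- s) - exp s) 0 = 0 /\ is_derive (fun s => exp (- s) - exp s) 0 (-2)
  /\ forall t, continuous (fun s => exp (- s) - exp s) t.
Proof.
  split; last split.
  - rewrite Ropp_0. ring.
  - auto_derive => //. rewrite Ropp_0 exp_0. ring.
  - move=> t. ctn.
Qed.

(** Substitution [s = eps (w - q)]; the prefactor is the value of the damping at the pole. *)
Lemma kexp_RInt (eps q al be : R) : 0 < eps -> (forall w, Rmin al be <= w <= Rmax al be -> w <> q) ->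
  RInt (kexp eps q) al be = exp (- (eps * q)) * RInt gexp (eps * (al - q)) (eps * (be - q)).
Proof.
  move=> He Hq.
  have Hne : forall s, Rmin (eps * (al - q)) (eps * (be - q)) <= s <= Rmax (eps * (al - q)) (eps * (be - q)) -> s <> 0.
  { move=> s. rewrite -Rmult_min_distr_l; last lra. rewrite -Rmult_max_distr_l; last lra.
    move=> Hs Hs0. apply: (Hq q) => //. subst s.
    have Hm : Rmin (al - q) (be - q) <= 0 <= Rmax (al - q) (be - q).
    { have [h1 h2] := Hs. split.
      - apply: (Rmult_le_reg_l eps) => //. lra.
      - apply: (Rmult_le_reg_l eps) => //. lra. }
    move: Hm. rewrite /Rmin /Rmax. repeat destruct Rle_dec; lra. }
  have Hex : ex_RInt gexp (eps * (al - q)) (eps * (be - q)).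
  { apply: (ex_RInt_continuous (V := R_CompleteNormedModule)) => s Hs. apply: continuous_gexp. exact: Hne. }
  have H1 : is_RInt (fun w => scal eps (gexp (eps * w + - (eps * q)))) al be
     (RInt gexp (eps * (al - q)) (eps * (be - q))).
  { apply: (is_RInt_comp_lin (V := R_NormedModule)).
    have -> : eps * al + - (eps * q) = eps * (al - q) by ring.
    have -> : eps * be + - (eps * q) = eps * (be - q) by ring.
    exact: (RInt_correct (V := R_CompleteNormedModule)). }
  apply: is_RInt_unique.
  apply: (is_RInt_ext (fun w => scal (exp (- (eps * q))) (scal eps (gexp (eps * w + - (eps * q)))))).
  { move=> w Hw. rewrite /scal /= /mult /= /gexp /kexp.
    have -> : - (eps * w + - (eps * q)) = - eps * w + eps * q by ring.
    rewrite exp_plus exp_Ropp. have := exp_pos (eps * q) => He'.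
    have Hwq : w <> q by apply: Hq; lra.
    field. split; first lra. split; last lra.
    have -> : eps * w + - (eps * q) = eps * (w - q) by ring.
    apply: Rmult_integral_contrapositive_currified; lra. }
  exact: (is_RInt_scal (V := R_NormedModule)).
Qed.

Lemma f0_lim (eps w0 : R) : 0 < eps -> 0 < w0 ->
  filterlim (fun X => RInt (kexp eps (- w0)) 0 X) (Rbar_locally p_infty)
    (locally (exp (eps * w0) * expint (eps * w0))).
Proof.
  move=> He Hw0.
  apply: (filterlim_ext_loc (fun X => exp (eps * w0) * RInt gexp (eps * w0) (eps * X + eps * w0))).
  - exists 0 => X HX. rewrite kexp_RInt //.
    + congr (exp _ * RInt gexp _ _); ring.
    + move=> w. rewrite Rmin_left; lra.
  - apply: fl_mult; first exact: filterlim_const.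
    apply: (filterlim_comp _ _ _ (fun X => eps * X + eps * w0) (fun Y => RInt gexp (eps * w0) Y) _ (Rbar_locally p_infty)).
    + exact: filterlim_affine_infty.
    + apply: expint_infty. exact: Rmult_lt_0_compat.
Qed.

Lemma g0_lim_infty (eps w0 d : R) : 0 < eps -> 0 < w0 -> 0 < d ->
  filterlim (fun X => RInt (kexp eps w0) (w0 + d) X) (Rbar_locally p_infty)
    (locally (exp (- (eps * w0)) * expint (eps * d))).
Proof.
  move=> He Hw0 Hd.
  apply: (filterlim_ext_loc (fun X => exp (- (eps * w0)) * RInt gexp (eps * d) (eps * X + - (eps * w0)))).
  - exists (w0 + d) => X HX. rewrite kexp_RInt //.
    + congr (exp _ * RInt gexp _ _); ring.
    + move=> w. rewrite Rmin_left; lra.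
  - apply: fl_mult; first exact: filterlim_const.
    apply: (filterlim_comp _ _ _ (fun X => eps * X + - (eps * w0)) (fun Y => RInt gexp (eps * d) Y) _ (Rbar_locally p_infty)).
    + exact: filterlim_affine_infty.
    + apply: expint_infty. exact: Rmult_lt_0_compat.
Qed.

Lemma RInt_gexp_neg (a b : R) : 0 < a -> 0 < b ->
  RInt gexp (- a) (- b) = RInt (fun s => exp s / s) a b.
Proof.
  move=> Ha Hb. symmetry. apply: is_RInt_unique.
  have H1 : is_RInt (fun w => scal (-1) (gexp (-1 * w + 0))) a b (RInt gexp (- a) (- b)).
  { apply: (is_RInt_comp_lin (V := R_NormedModule)).
    have -> : -1 * a + 0 = - a by ring. have -> : -1 * b + 0 = - b by ring.
    apply: (RInt_correct (V := R_CompleteNormedModule)).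
    apply: (ex_RInt_continuous (V := R_CompleteNormedModule)) => s Hs. apply: continuous_gexp.
    move: Hs. rewrite /Rmin /Rmax. destruct Rle_dec; lra. }
  apply: is_RInt_ext H1 => s Hs. rewrite /scal /= /mult /= /gexp.
  have -> : - (-1 * s + 0) = s by ring. have Hs0 : 0 < s.
  { move: Hs. rewrite /Rmin /Rmax. destruct Rle_dec; lra. }
  field. lra.
Qed.

(** Reflected in the pole, the left piece is minus the integral of [exp s / s] over [[eps d, y]],
    while [expint (eps d)] splits off the integral of [exp (- s) / s] over the same interval. The
    gap being symmetric, the singularities [1 / s] cancel. *)
Lemma g0_lim (eps w0 : R) : 0 < eps -> 0 < w0 ->
  filterlim (fun d => RInt (kexp eps w0) 0 (w0 - d) + exp (- (eps * w0)) * expint (eps * d)) (at_right 0)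
    (locally (exp (- (eps * w0)) * (expint (eps * w0) + Shi2 (eps * w0)))).
Proof.
  move=> He Hw0. set y := eps * w0. have Hy : 0 < y by exact: Rmult_lt_0_compat.
  have [s1 [s2 s3]] := shi_slope.
  apply: (filterlim_ext_loc (fun d => exp (- y) * (expint y + RInt (fun s => (exp (- s) - exp s) / s) (eps * d) y))).
  - apply: filter_imp (at_right_lt w0 Hw0) => d Hd.
    have Hed : 0 < eps * d by apply: Rmult_lt_0_compat; lra.
    rewrite kexp_RInt //; last by (move=> w; rewrite Rmax_right; lra).
    have -> : eps * (0 - w0) = - y by rewrite /y; ring.
    have -> : eps * (w0 - d - w0) = - (eps * d) by ring.
    rewrite RInt_gexp_neg //.
    have Hexp : ex_RInt (fun s => exp s / s) (eps * d) y.
    { apply: (ex_RInt_gt _ 0) => // t Ht. apply: ex_derive_continuousR. auto_derive. lra. }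
    rewrite (RInt_swapR _ (eps * d) y) //.
    rewrite (RInt_ext _ (fun s => gexp s - exp s / s)); last first.
    { move=> s. rewrite /Rmin. destruct Rle_dec; move=> Hs; rewrite /gexp; rfield; lra. }
    rewrite RInt_minusR //; last exact: ex_RInt_gexp.
    rewrite /expint -(RInt_diffR gexp 1 (eps * d) y); try (apply: ex_RInt_gexp; lra).
    rewrite -/y. ring.
  - apply: fl_mult; first exact: filterlim_const.
    apply: fl_plus; first exact: filterlim_const.
    have [Hl _] := slope_RInt_lim _ _ y s1 s2 s3 Hy.
    apply: (filterlim_comp _ _ _ (fun d => eps * d) (fun d => RInt (fun s => (exp (- s) - exp s) / s) d y) _ (at_right 0)); last exact: Hl.
    move=> P [e HP]. have Hee : 0 < e / eps by apply: Rdiv_lt_0_compat => //; exact: cond_pos.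
    exists (mkposreal _ Hee) => d. rewrite /ball /= /AbsRing_ball /abs /minus /plus /opp /= Ropp_0 Rplus_0_r => Hd Hd0.
    have Hed : 0 < eps * d by apply: Rmult_lt_0_compat.
    apply: HP => //. rewrite /ball /= /AbsRing_ball /abs /minus /plus /opp /= Ropp_0 Rplus_0_r.
    rewrite Rabs_pos_eq in Hd; last lra. rewrite Rabs_pos_eq; last lra.
    have : d * eps < e by apply/Rlt_div_r. lra.
Qed.

(** The pole integrals at [a = 0]. With [y = eps w0] they are [e^y E_1(y)] for the pole at [- w0]
    and [- e^(-y) Ei(y)] for the pole at [w0], because [expint y + Shi2 y = - Ei(y)]. *)
Definition f0v (eps w0 : R) : R := exp (eps * w0) * expint (eps * w0).
Definition g0v (eps w0 : R) : R := exp (- (eps * w0)) * (expint (eps * w0) + Shi2 (eps * w0)).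

(* The integral of [exp (- eps w) exp (i w a) / (w - q)], where [K0] is its value at [a = 0]. *)
Definition pole (eps q K0 : R) (a : R) : C :=
  (cos (q * a) * (K0 + Bs eps q 0 a) + sin (q * a) * Bc eps q 0 a,
   sin (q * a) * (K0 + Bs eps q 0 a) - cos (q * a) * Bc eps q 0 a).

Definition innerC (d : nat) (w0 eps a : R) : C :=
  (/ (2 * PI) * (pole_value d (- w0) (momR eps a 0) (momR eps a 1) (momR eps a 2) (fst (pole eps (- w0) (f0v eps w0) a))
               + pole_value d w0 (momR eps a 0) (momR eps a 1) (momR eps a 2) (fst (pole eps w0 (g0v eps w0) a))),
   / (2 * PI) * (pole_value d (- w0) (momI eps a 0) (momI eps a 1) (momI eps a 2) (snd (pole eps (- w0) (f0v eps w0) a))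
               + pole_value d w0 (momI eps a 0) (momI eps a 1) (momI eps a 2) (snd (pole eps w0 (g0v eps w0) a)))).

(** [limC_right] is a definite description, so it suffices to exhibit a limit. The excised integrals
    are known for [delta < w0], which holds eventually. *)
Lemma PV_int_0_oo_eq (f : R -> C) (w0 l1 l2 : R) : 0 < w0 ->
  PVr (fun w => fst (f w)) w0 l1 -> PVr (fun w => snd (f w)) w0 l2 ->
  PV_int_0_oo f w0 = (l1, l2).
Proof.
  move=> Hw0 [L1 [L2 [H1 H2]]] [M1 [M2 [H3 H4]]].
  apply: (@iota_filterlim_locally R_AbsRing C_R_CompleteNormedModule R (at_right 0)
    (Proper_StrongProper _ _)).
  apply: (filterlim_ext_loc (fun d => ((L1 d + L2 d, M1 d + M2 d) : C))).
  - apply: filter_imp (at_right_lt w0 Hw0) => d Hd.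
    have [h1 h2] := H1 d Hd. have [h3 h4] := H3 d Hd.
    rewrite (is_RInt_unique (V := C_R_CompleteNormedModule) f 0 (w0 - d) (L1 d, M1 d)); last by apply: is_RInt_C.
    rewrite (is_RInt_gen_unique (V := C_R_CompleteNormedModule) (Fa := at_point _) (Fb := Rbar_locally p_infty) f (L2 d, M2 d)); last by apply: is_RInt_gen_C.
    by [].
  - by apply: filterlim_C.
Qed.

Lemma inner_eq (d : nat) (c w0 eps a : R) : (1 <= d <= 3)%nat -> 0 < w0 -> 0 < eps ->
  Cplus (@RInt_gen C_R_CompleteNormedModule (freq_integrand d c w0 eps 1 a) (at_point 0) (Rbar_locally p_infty))
        (PV_int_0_oo (freq_integrand d c w0 eps (-1) a) w0) = innerC d w0 eps a.
Proof.
  move=> Hd Hw0 He.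
  have [f1 f2] := kernel_infty eps (- w0) 0 a _ He ltac:(lra) (f0_lim eps w0 He Hw0).
  have [g1 g2] := kernel_PV eps w0 a _ _ He Hw0 (fun d Hd => g0_lim_infty eps w0 d He Hw0 Hd) (g0_lim eps w0 He Hw0).
  have Hmom := fun n Hn => moments eps a w0 n He Hw0 Hn.
  have Hfst : forall s w, fst (freq_integrand d c w0 eps s a w) = / (2 * PI) * (w ^ d / (w + s * w0)) * exp (- eps * w) * cos (w * a).
  { move=> s w. rewrite /freq_integrand /rscal /=. ring. }
  have Hsnd : forall s w, snd (freq_integrand d c w0 eps s a w) = / (2 * PI) * (w ^ d / (w + s * w0)) * exp (- eps * w) * sin (w * a).
  { move=> s w. rewrite /freq_integrand /rscal /=. ring. }
  have I1 := pole_reduction IG eps (- w0) (fun w => cos (w * a)) d (momR eps a) _ (/ (2 * PI)) IG_lin (fun u v l => IG_ext u v (- w0) l ltac:(lra)) Hd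
     (fun n Hn => proj2 (proj1 (Hmom n Hn))) f1.
  have I2 := pole_reduction IG eps (- w0) (fun w => sin (w * a)) d (momI eps a) _ (/ (2 * PI)) IG_lin (fun u v l => IG_ext u v (- w0) l ltac:(lra)) Hd
     (fun n Hn => proj2 (proj2 (Hmom n Hn))) f2.
  have I3 := pole_reduction (fun u l => PVr u w0 l) eps w0 (fun w => cos (w * a)) d (momR eps a) _ (/ (2 * PI))
      (fun u v => PVr_lin u v w0) (fun u v l => PVr_ext u v w0 l) Hd (fun n Hn => proj1 (proj1 (Hmom n Hn))) g1.
  have I4 := pole_reduction (fun u l => PVr u w0 l) eps w0 (fun w => sin (w * a)) d (momI eps a) _ (/ (2 * PI))
      (fun u v => PVr_lin u v w0) (fun u v l => PVr_ext u v w0 l) Hd (fun n Hn => proj1 (proj2 (Hmom n Hn))) g2.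
  have Hm1 : forall w, w - - w0 = w + 1 * w0 by move=> w; ring.
  have Hm2 : forall w, w - w0 = w + -1 * w0 by move=> w; ring.
  have e3 : forall w, w <> w0 -> / (2 * PI) * (w ^ d / (w - w0)) * exp (- eps * w) * cos (w * a)
     = fst (freq_integrand d c w0 eps (-1) a w) by move=> w _; rewrite Hfst Hm2.
  have e4 : forall w, w <> w0 -> / (2 * PI) * (w ^ d / (w - w0)) * exp (- eps * w) * sin (w * a)
     = snd (freq_integrand d c w0 eps (-1) a w) by move=> w _; rewrite Hsnd Hm2.
  have J1 := PVr_ext _ _ _ _ e3 I3. have J2 := PVr_ext _ _ _ _ e4 I4.
  rewrite (PV_int_0_oo_eq _ w0 _ _ Hw0 J1 J2).
  rewrite (is_RInt_gen_unique (V := C_R_CompleteNormedModule) (Fa := at_point _) (Fb := Rbar_locally p_infty) _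
    ((/ (2 * PI) * pole_value d (- w0) (momR eps a 0) (momR eps a 1) (momR eps a 2) (fst (pole eps (- w0) (f0v eps w0) a)),
      / (2 * PI) * pole_value d (- w0) (momI eps a 0) (momI eps a 1) (momI eps a 2) (snd (pole eps (- w0) (f0v eps w0) a))) : C)).
  - rewrite /innerC /Cplus /pole /f0v /g0v. cbn [fst snd]. congr pair; ring.
  - apply: is_RInt_gen_C.
    + apply: IG_ext I1; first by (instantiate (1 := - w0); lra). by move=> w _; rewrite Hfst Hm1.
    + apply: IG_ext I2; first by (instantiate (1 := - w0); lra). by move=> w _; rewrite Hsnd Hm1.
Qed.

(** * Behaviour of the exponential integrals as [eps] tends to [0] *)

Lemma at_right_pos : at_right 0 (fun x : R => 0 < x).
Proof. by exists (mkposreal _ Rlt_0_1). Qed.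

(** The inequality [ln u <= u] at [u = 1 / sqrt y] bounds [|y ln y|] by [2 sqrt y] for [y < 1]. *)
Lemma x_ln_x_lim : filterlim (fun y => y * ln y) (at_right 0) (locally 0).
Proof.
  apply: (filterlim_squeeze0 _ _ (fun y => 2 * sqrt y)).
  - apply: filter_imp (at_right_lt 1 Rlt_0_1) => y [Hy0 Hy1]. rewrite Rminus_0_r.
    have Hs : 0 < sqrt y by apply: sqrt_lt_R0.
    have Hss : sqrt y * sqrt y = y by apply: sqrt_sqrt; lra.
    have Hl : ln y < 0 by rewrite -ln_1; apply: ln_increasing.
    have Hln : ln y = - (2 * ln (/ sqrt y)).
    { rewrite ln_Rinv // -{1}Hss ln_mult //. ring. }
    have H1 : ln (/ sqrt y) <= / sqrt y.
    { have Hp : 0 < / sqrt y by apply: Rinv_0_lt_compat.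
      have := exp_ineq1_le (ln (/ sqrt y)). rewrite exp_ln //. lra. }
    rewrite Rabs_left; last nra.
    have -> : - (y * ln y) = 2 * (y * ln (/ sqrt y)) by rewrite Hln; ring.
    apply: Rmult_le_compat_l; first lra.
    have Hq : y * / sqrt y = sqrt y by rewrite -{1}Hss; field; lra.
    rewrite -{2}Hq. apply: Rmult_le_compat_l => //; lra.
  - apply: fl_at_right; last by rewrite sqrt_0; ring.
    apply: ct_mult; [exact: continuous_const | exact: continuous_sqrt].
Qed.

(* Minus the Euler-Mascheroni constant. *)
Definition gamma1 : R := expint_const - RInt (fun s => (1 - exp (- s)) / s) 0 1.

Lemma ein_slope : (fun s => 1 - exp (- s)) 0 = 0 /\ is_derive (fun s => 1 - exp (- s)) 0 1
  /\ forall t, continuous (fun s => 1 - exp (- s)) t.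
Proof.
  split; last split.
  - rewrite Ropp_0 exp_0. ring.
  - auto_derive => //. rewrite Ropp_0 exp_0. ring.
  - move=> t. ctn.
Qed.

Lemma RInt_inv (y : R) : 0 < y -> is_RInt (fun s => / s) y 1 (- ln y).
Proof.
  move=> Hy. have -> : - ln y = ln 1 - ln y by rewrite ln_1; ring.
  apply: RInt_of_derive => x; rewrite /Rmin /Rmax; destruct Rle_dec => Hx.
  1,2: auto_derive; [lra | field; lra].
  all: apply: continuous_Rinv; lra.
Qed.

(** Subtracting [1 / s] from the integrand produces the logarithm, and the rest
    [(1 - exp (- s)) / s] is integrable up to [0]. *)
Lemma expint_right0 : filterlim (fun y => expint y + ln y) (at_right 0) (locally gamma1).
Proof.
  have [s1 [s2 s3]] := ein_slope.
  have [Hl _] := slope_RInt_lim _ _ 1 s1 s2 s3 Rlt_0_1.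
  apply: (filterlim_ext_loc (fun y => expint_const - RInt (fun s => (1 - exp (- s)) / s) y 1)).
  - apply: filter_imp at_right_pos => y Hy.
    have Hex : ex_RInt (fun s => / s) y 1 by eexists; exact: RInt_inv.
    have Hexg := ex_RInt_gexp y 1 Hy Rlt_0_1.
    rewrite /expint (RInt_swapR gexp y 1) //.
    rewrite (RInt_ext _ (fun s => / s - gexp s)); last first.
    { move=> s. rewrite /Rmin. destruct Rle_dec => Hs; rewrite /gexp; rfield; lra. }
    rewrite RInt_minusR // (is_RInt_unique _ _ _ _ (RInt_inv y Hy)). ring.
  - apply: fl_minus; [exact: filterlim_const | exact: Hl].
Qed.

Lemma mul_expint_right0 : filterlim (fun y => y * expint y) (at_right 0) (locally 0).
Proof.
  apply: (filterlim_ext (fun y => y * (expint y + ln y) - y * ln y)); first by move=> y; ring.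
  eapply fl_val.
  - apply: fl_minus; last exact: x_ln_x_lim. apply: fl_mult; [exact: fl_id_right | exact: expint_right0].
  - ring.
Qed.

Lemma small_mul_expint_right0 (f : R -> R) (l : R) : f 0 = 0 -> is_derive f 0 l -> (forall t, continuous f t) ->
  filterlim (fun y => f y * expint y) (at_right 0) (locally 0).
Proof.
  move=> H0 H1 H2. have [k [Hk1 Hk2]] := slope_continuous f l H0 H1 H2.
  apply: (filterlim_ext_loc (fun y => k y * (y * expint y))).
  - apply: filter_imp at_right_pos => y Hy. rewrite Hk2; last lra. field. lra.
  - apply: fl_val (Rmult_0_r (k 0)). apply: fl_mult; last exact: mul_expint_right0.
    exact: fl_at_right.
Qed.

Lemma fl_scale_right (w0 : R) (f : R -> R) (l : R) : 0 < w0 ->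
  filterlim f (at_right 0) (locally l) -> filterlim (fun eps => f (eps * w0)) (at_right 0) (locally l).
Proof.
  move=> Hw. apply: filterlim_comp.
  move=> P [e HP]. have Hee : 0 < e / w0 by apply: Rdiv_lt_0_compat => //; exact: cond_pos.
  exists (mkposreal _ Hee) => d. rewrite /ball /= /AbsRing_ball /abs /minus /plus /opp /= Ropp_0 Rplus_0_r => Hd Hd0.
  have Hed : 0 < d * w0 by apply: Rmult_lt_0_compat.
  apply: HP => //. rewrite /ball /= /AbsRing_ball /abs /minus /plus /opp /= Ropp_0 Rplus_0_r.
  rewrite Rabs_pos_eq in Hd; last lra. rewrite Rabs_pos_eq; last lra.
  by apply/Rlt_div_r.
Qed.

Lemma Shi2_lim : filterlim Shi2 (at_right 0) (locally 0).
Proof.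
  have [s1 [s2 s3]] := shi_slope.
  exact: (proj2 (slope_RInt_lim _ _ 1 s1 s2 s3 Rlt_0_1)).
Qed.

(** Both constants behave like [- ln eps]. Their difference, which enters [mR] and [pI], loses the
    divergence. Their sum enters [pR], where the missing [2 ln eps] will be taken from
    [ln (eps^2 + a^2)]. The exponential prefactors are harmless since they differ from [1] by a
    factor that outweighs the logarithm. *)
Lemma pole_const_limits (w0 : R) : 0 < w0 ->
  filterlim (fun eps => g0v eps w0 + f0v eps w0 + 2 * ln eps) (at_right 0) (locally (2 * gamma1 - 2 * ln w0)) /\
  filterlim (fun eps => g0v eps w0 - f0v eps w0) (at_right 0) (locally 0).
Proof.
  move=> Hw0.
  have H1 : filterlim (fun y => (exp y + exp (- y) - 2) * expint y) (at_right 0) (locally 0).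
  { apply: (small_mul_expint_right0 _ 0).
    - rewrite Ropp_0 exp_0. ring.
    - auto_derive => //. rewrite Ropp_0. ring.
    - move=> t. ctn. }
  have H2 : filterlim (fun y => (exp (- y) - exp y) * expint y) (at_right 0) (locally 0).
  { have [s1 [s2 s3]] := shi_slope. exact: (small_mul_expint_right0 _ (-2)). }
  have H3 : filterlim (fun y => exp (- y) * Shi2 y) (at_right 0) (locally 0).
  { apply: fl_val (Rmult_0_r (exp (- 0))). apply: fl_mult; last exact: Shi2_lim.
    apply: fl_at_right => //. ctn. }
  split.
  - apply: (filterlim_ext_loc (fun eps => (fun y => (exp y + exp (- y) - 2) * expint y) (eps * w0)
      + (fun y => exp (- y) * Shi2 y) (eps * w0) + 2 * (fun y => expint y + ln y) (eps * w0) - 2 * ln w0)).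
    + apply: filter_imp at_right_pos => eps He. rewrite /g0v /f0v ln_mult //. ring.
    + eapply fl_val.
      * apply: fl_minus; last exact: filterlim_const.
        apply: fl_plus; first apply: fl_plus.
        -- exact: (fl_scale_right w0 _ _ Hw0 H1).
        -- exact: (fl_scale_right w0 _ _ Hw0 H3).
        -- apply: fl_mult; [exact: filterlim_const | exact: (fl_scale_right w0 _ _ Hw0 expint_right0)].
      * ring.
  - apply: (filterlim_ext (fun eps => (fun y => (exp (- y) - exp y) * expint y) (eps * w0)
      + (fun y => exp (- y) * Shi2 y) (eps * w0))).
    + move=> eps. rewrite /g0v /f0v. ring.
    + apply: fl_val (Rplus_0_r 0). apply: fl_plus; [exact: (fl_scale_right w0 _ _ Hw0 H2) | exact: (fl_scale_right w0 _ _ Hw0 H3)].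
Qed.

(** * The Gamma function *)

Definition gint (s t : R) : R := Rpower t (s - 1) * exp (- t).

Lemma continuous_gint (s t : R) : 0 < t -> continuous (gint s) t.
Proof. move=> Ht. apply: ex_derive_continuousR. rewrite /gint /Rpower. by auto_derive. Qed.

Lemma ex_RInt_gint (s a b : R) : 0 < a -> 0 < b -> ex_RInt (gint s) a b.
Proof. move=> Ha Hb. apply: (ex_RInt_gt _ 0) => // t Ht. exact: continuous_gint. Qed.

Lemma Rpower_right0 (s : R) : 0 < s -> filterlim (fun x => Rpower x s) (at_right 0) (locally 0).
Proof.
  move=> Hs. apply/filterlim_locally => e.
  have Hd : 0 < Rpower e (/ s) by apply: exp_pos.
  apply: filter_imp (at_right_lt _ Hd) => x [Hx0 Hx].
  rewrite /ball /= /AbsRing_ball /abs /minus /plus /opp /= Ropp_0 Rplus_0_r.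
  rewrite Rabs_pos_eq; last exact: Rlt_le (exp_pos _).
  have -> : (e : R) = Rpower (Rpower e (/ s)) s.
  { rewrite Rpower_mult Rinv_l; last lra. rewrite Rpower_1 //. exact: cond_pos. }
  rewrite /Rpower. apply: exp_increasing. apply: Rmult_lt_compat_l => //. exact: ln_increasing.
Qed.

Lemma Rpower_exp_bound (s : R) : exists K, 0 < K /\ forall t, 1 / 2 < t -> Rpower t s <= K * exp (t / 2).
Proof.
  set p := Rabs s. have Hp : 0 <= p by exact: Rabs_pos.
  (* On [t > 1 / 2] one has [|ln t| <= ln t + 2 ln 2]. Comparing [ln] with a linear function at
     scale [2 p + 1] gives [p ln t <= p t / (2 p + 1) + p ln (2 p + 1)], and the first term is at
     most [t / 2], also for [p = 0]. *)
  exists (exp (p * (ln (2 * p + 1) + 2 * ln 2))); split; first exact: exp_pos.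
  move=> t Ht. rewrite -exp_plus /Rpower.
  have Hln2 : 0 < ln 2 by rewrite -ln_1; apply: ln_increasing; lra.
  have Hln : ln t > - ln 2.
  { rewrite -ln_Rinv; last lra. apply: ln_increasing; lra. }
  have H1 : s * ln t <= p * (ln t + 2 * ln 2).
  { apply: Rle_trans (Rle_abs _) _. rewrite Rabs_mult. apply: Rmult_le_compat_l => //.
    apply: Rabs_le. lra. }
  have H2 : ln t <= t / (2 * p + 1) + ln (2 * p + 1).
  { have Hq : 0 < t / (2 * p + 1) by apply: Rdiv_lt_0_compat; lra.
    have := exp_ineq1_le (ln (t / (2 * p + 1))). rewrite exp_ln // ln_div; lra. }
  have H3 : p * (t / (2 * p + 1)) <= t / 2.
  { have -> : p * (t / (2 * p + 1)) = t * (p / (2 * p + 1)) by field; lra.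
    apply: Rmult_le_compat_l; first lra. apply/Rle_div_l; lra. }
  have H4 : s * ln t <= p * (ln (2 * p + 1) + 2 * ln 2) + t / 2.
  { apply: Rle_trans H1 _. have := Rmult_le_compat_l p _ _ Hp H2. lra. }
  case: H4 => H4; [left; exact: exp_increasing | right; by rewrite H4].
Qed.

Lemma gint_limits (s : R) : 0 < s -> exists l1 l2,
  filterlim (fun x => RInt (gint s) 1 x) (at_right 0) (locally l1) /\
  filterlim (fun x => RInt (gint s) 1 x) (Rbar_locally p_infty) (locally l2).
Proof.
  move=> Hs.
  have [l1 H1] : exists l1, filterlim (fun x => RInt (gint s) 1 x) (at_right 0) (locally l1).
  { apply: (ex_lim_RInt_dominated _ (gint s) (fun t => Rpower t (s - 1)) 0 1 ((0 - 1) / s)) => //.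
    - lra.
    - exact: at_right_pos.
    - move=> t Ht. exact: continuous_gint.
    - move=> t Ht. apply: ex_derive_continuousR. rewrite /Rpower. by auto_derive.
    - move=> t Ht. rewrite /gint Rabs_pos_eq; last by apply: Rmult_le_pos; apply: Rlt_le; apply: exp_pos.
      rewrite -{2}(Rmult_1_r (Rpower _ _)). apply: Rmult_le_compat_l; first exact: Rlt_le (exp_pos _).
      rewrite -exp_0. left. apply: exp_increasing. lra.
    - apply: (filterlim_ext_loc (fun x => (Rpower x s - 1) / s)).
      + apply: filter_imp at_right_pos => x Hx. symmetry. apply: is_RInt_unique.
        have -> : (Rpower x s - 1) / s = Rpower x s / s - Rpower 1 s / s.
        { rewrite {3}/Rpower ln_1 Rmult_0_r exp_0. field. lra. }
        have Hpos : forall t, Rmin 1 x <= t <= Rmax 1 x -> 0 < t.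
        { move=> t. rewrite /Rmin. destruct Rle_dec; lra. }
        apply: (RInt_of_derive (fun t => Rpower t s / s)) => t /Hpos Ht.
        * rewrite /Rpower. auto_derive => //.
          have -> : (s - 1) * ln t = s * ln t + - ln t by ring.
          rewrite exp_plus exp_Ropp exp_ln //. field. lra.
        * apply: ex_derive_continuousR. rewrite /Rpower. by auto_derive.
      + apply: fl_mult; last exact: filterlim_const.
        apply: fl_minus; [exact: Rpower_right0 | exact: filterlim_const]. }
  have [K [HK Hb]] := Rpower_exp_bound (s - 1).
  have [l2 H2] : exists l2, filterlim (fun x => RInt (gint s) 1 x) (Rbar_locally p_infty) (locally l2).
  { apply: (ex_lim_RInt_dominated _ (gint s) (fun t => K * exp (- (1 / 2) * t)) (1 / 2) 1 (2 * K * exp (- (1 / 2)) - 2 * K * 0)).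
    - lra.
    - by exists (1 / 2).
    - move=> t Ht. apply: continuous_gint. lra.
    - move=> t Ht. ctn.
    - move=> t Ht. rewrite /gint Rabs_pos_eq; last by apply: Rmult_le_pos; apply: Rlt_le; apply: exp_pos.
      have -> : - (1 / 2) * t = t / 2 + - t by field.
      rewrite exp_plus -Rmult_assoc. apply: Rmult_le_compat_r; [exact: Rlt_le (exp_pos _) | exact: Hb].
    - apply: (filterlim_ext (fun x => 2 * K * exp (- (1 / 2)) - 2 * K * exp (- (1 / 2) * x))).
      + move=> x. symmetry. apply: is_RInt_unique.
        have -> : 2 * K * exp (- (1 / 2)) - 2 * K * exp (- (1 / 2) * x)
           = (- 2 * K * exp (- (1 / 2) * x)) - (- 2 * K * exp (- (1 / 2) * 1)).
        { rewrite Rmult_1_r. ring. }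
        apply: (RInt_of_derive (fun x => - 2 * K * exp (- (1 / 2) * x))) => t _.
        * auto_derive => //. field.
        * ctn.
      + apply: fl_minus; first exact: filterlim_const.
        apply: fl_mult; first exact: filterlim_const. apply: filterlim_exp_infty. lra. }
  by exists l1, l2.
Qed.

Lemma Gamma_eq (s l1 l2 : R) :
  filterlim (fun x => RInt (gint s) 1 x) (at_right 0) (locally l1) ->
  filterlim (fun x => RInt (gint s) 1 x) (Rbar_locally p_infty) (locally l2) ->
  is_RInt_gen (gint s) (at_right 0) (Rbar_locally p_infty) (l2 - l1) /\ Gamma s = l2 - l1.
Proof.
  move=> H1 H2.
  have H : is_RInt_gen (gint s) (at_right 0) (Rbar_locally p_infty) (l2 - l1).
  { apply: is_RInt_gen_0_infty => // t Ht. exact: continuous_gint. }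
  split => //. exact: (is_RInt_gen_unique (V := R_CompleteNormedModule) (Fa := at_right 0) (Fb := Rbar_locally p_infty)).
Qed.

Lemma Gamma_correct (s : R) : 0 < s ->
  is_RInt_gen (gint s) (at_right 0) (Rbar_locally p_infty) (Gamma s).
Proof.
  move=> Hs. have [l1 [l2 [H1 H2]]] := gint_limits s Hs.
  by have [H ->] := Gamma_eq s l1 l2 H1 H2.
Qed.

Lemma filterlim_unique_R {T : Type} (F : (T -> Prop) -> Prop) {FF : ProperFilter F} (f : T -> R) (l m : R) :
  filterlim f F (locally l) -> filterlim f F (locally m) -> l = m.
Proof. exact: (@filterlim_locally_unique T R_AbsRing R_NormedModule F (Proper_StrongProper F FF) f l m). Qed.

(** Integration by parts from the base point [1] towards either end. The boundary term [exp (- 1)]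
    at the base point appears in both limits and cancels in their difference. *)
Lemma Gamma_succ (s : R) : 0 < s -> Gamma (s + 1) = s * Gamma s.
Proof.
  move=> Hs. have [l1 [l2 [H1 H2]]] := gint_limits s Hs.
  have Hs1 : 0 < s + 1 by lra.
  have [m1 [m2 [H3 H4]]] := gint_limits (s + 1) Hs1.
  have [_ ->] := Gamma_eq _ _ _ H1 H2. have [_ ->] := Gamma_eq _ _ _ H3 H4.
  have Hparts : forall x, 0 < x -> RInt (gint (s + 1)) 1 x = s * RInt (gint s) 1 x + (exp (- (1)) - Rpower x s * exp (- x)).
  { move=> x Hx. apply: is_RInt_unique.
    have Hpos : forall t, Rmin 1 x <= t <= Rmax 1 x -> 0 < t.
    { move=> t. rewrite /Rmin. destruct Rle_dec; lra. }
    have HI : is_RInt (fun t => gint (s + 1) t - s * gint s t) 1 x (exp (- (1)) - Rpower x s * exp (- x)).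
    { have -> : exp (- (1)) - Rpower x s * exp (- x) = - (Rpower x s * exp (- x)) - (- (Rpower 1 s * exp (- (1)))).
      { rewrite {3}/Rpower ln_1 Rmult_0_r exp_0. ring. }
      apply: (RInt_of_derive (fun x => - (Rpower x s * exp (- x)))) => t /Hpos Ht.
      - rewrite /gint /Rpower. auto_derive => //.
        have -> : (s - 1) * ln t = s * ln t + - ln t by ring.
        have -> : (s + 1 - 1) * ln t = s * ln t by ring.
        rewrite exp_plus (exp_Ropp (ln t)) exp_ln //. field. lra.
      - apply: ct_minus; last apply: ct_mult; try exact: continuous_const; exact: continuous_gint. }
    apply: (is_RInt_ext (fun t => s * gint s t + (gint (s + 1) t - s * gint s t))).
    { move=> t _. rring. }
    apply: (is_RInt_plus (V := R_NormedModule)) => //.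
    apply: (is_RInt_scal (V := R_NormedModule)). apply: (RInt_correct (V := R_CompleteNormedModule)).
    apply: ex_RInt_gint; lra. }
  have Hm1 : m1 = s * l1 + (exp (- (1)) - 0 * 1).
  { apply: (filterlim_unique_R _ _ _ _ H3).
    apply: (filterlim_ext_loc (fun x => s * RInt (gint s) 1 x + (exp (- (1)) - Rpower x s * exp (- x)))).
    { apply: filter_imp at_right_pos => x Hx. by rewrite Hparts. }
    apply: fl_plus; first by apply: fl_mult => //; exact: filterlim_const.
    apply: fl_minus; first exact: filterlim_const.
    apply: fl_mult; first exact: Rpower_right0.
    apply: fl_at_right; [ctn | by rewrite Ropp_0 exp_0]. }
  have Hm2 : m2 = s * l2 + (exp (- (1)) - 0).
  { apply: (filterlim_unique_R _ _ _ _ H4).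
    apply: (filterlim_ext_loc (fun x => s * RInt (gint s) 1 x + (exp (- (1)) - Rpower x s * exp (- x)))).
    { exists 0 => x Hx. by rewrite Hparts. }
    apply: fl_plus; first by apply: fl_mult => //; exact: filterlim_const.
    apply: fl_minus; first exact: filterlim_const.
    have [K [HK Hb]] := Rpower_exp_bound s.
    apply: (filterlim_squeeze0 _ _ (fun x => K * exp (- (1 / 2) * x))).
    - exists (1 / 2) => x Hx. rewrite Rminus_0_r Rabs_pos_eq; last by apply: Rmult_le_pos; apply: Rlt_le; apply: exp_pos.
      have -> : - (1 / 2) * x = x / 2 + - x by field.
      rewrite exp_plus -Rmult_assoc. apply: Rmult_le_compat_r; [exact: Rlt_le (exp_pos _) | exact: Hb].
    - apply: fl_val (Rmult_0_r K). apply: fl_mult; first exact: filterlim_const.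
      apply: filterlim_exp_infty. lra. }
  rewrite Hm1 Hm2. ring.
Qed.

Lemma Gamma_1 : Gamma 1 = 1.
Proof.
  have Hint : forall x, 0 < x -> RInt (gint 1) 1 x = exp (- (1)) - exp (- (1) * x).
  { move=> x Hx. apply: is_RInt_unique.
    have -> : exp (- (1)) - exp (- (1) * x) = - exp (- x) - - exp (- (1)).
    { have -> : - (1) * x = - x by ring. ring. }
    have Hpos : forall t, Rmin 1 x <= t <= Rmax 1 x -> 0 < t.
    { move=> t. rewrite /Rmin. destruct Rle_dec; lra. }
    apply: (RInt_of_derive (fun x => - exp (- x))) => t /Hpos Ht.
    - rewrite /gint Rminus_diag Rpower_O //. auto_derive => //. ring.
    - exact: continuous_gint. }
  apply: eq_trans (proj2 (Gamma_eq 1 (exp (- (1)) - 1) (exp (- (1)) - 0) _ _)) _.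
  - apply: (filterlim_ext_loc (fun x => exp (- (1)) - exp (- (1) * x))).
    { apply: filter_imp at_right_pos => x Hx. by rewrite Hint. }
    apply: fl_at_right; first ctn. by rewrite Rmult_0_r exp_0.
  - apply: (filterlim_ext_loc (fun x => exp (- (1)) - exp (- (1) * x))).
    { exists 0 => x Hx. by rewrite Hint. }
    apply: fl_minus; first exact: filterlim_const. apply: filterlim_exp_infty. lra.
  - ring.
Qed.

Definition gauss (x : R) : R := RInt (fun u => exp (- u ^ 2)) 0 x.

Lemma gauss_derive (x : R) : is_derive gauss x (exp (- x ^ 2)).
Proof.
  apply: (is_derive_RInt_upper (fun u => exp (- u ^ 2))) => t.
  apply: ex_derive_continuousR. by auto_derive.
Qed.

(* Both sides have the derivative [2 exp (- x ^ 2) gauss x]. *)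
Lemma gauss_sqr (x : R) :
  gauss x ^ 2 = PI / 4 - RInt (fun t => exp (- x ^ 2 * (1 + t ^ 2)) / (1 + t ^ 2)) 0 1.
Proof.
  have Hp : forall t : R, 0 < 1 + t ^ 2 by move=> t; have := pow2_ge_0 t; lra.
  have Hd : forall x, is_derive (fun x => - RInt (fun t => exp (- x ^ 2 * (1 + t ^ 2)) / (1 + t ^ 2)) 0 1) x
      (2 * exp (- x ^ 2) * gauss x).
  { move=> {}x.
    have -> : 2 * exp (- x ^ 2) * gauss x = - RInt (fun t => - 2 * x * exp (- x ^ 2 * (1 + t ^ 2))) 0 1.
    { have H : is_RInt (fun y => scal x (exp (- (x * y + 0) ^ 2))) 0 1 (gauss x).
      { apply: (is_RInt_comp_lin (V := R_NormedModule) (fun u => exp (- u ^ 2))).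
        have -> : x * 0 + 0 = 0 by ring. have -> : x * 1 + 0 = x by ring.
        apply: (RInt_correct (V := R_CompleteNormedModule)). apply: ex_RInt_cont => t.
        apply: ex_derive_continuousR. by auto_derive. }
      have H2 := is_RInt_scal (V := R_NormedModule) _ _ _ (-2 * exp (- x ^ 2)) _ H.
      rewrite (RInt_ext _ (fun y => scal (-2 * exp (- x ^ 2)) (scal x (exp (- (x * y + 0) ^ 2))))).
      - rewrite (is_RInt_unique _ _ _ _ H2) /scal /= /mult /=. ring.
      - move=> t _. rewrite /scal /= /mult /=.
        have -> : - (x * (x * 1)) * (1 + t * (t * 1)) = - (x * (x * 1)) + - ((x * t + 0) * ((x * t + 0) * 1)) by ring.
        rewrite exp_plus. rring. }
    apply: (is_derive_opp (V := R_NormedModule)).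
    apply: (is_derive_RInt_param_continuous (fun x t => exp (- x ^ 2 * (1 + t ^ 2)) / (1 + t ^ 2))
        (fun x t => - 2 * x * exp (- x ^ 2 * (1 + t ^ 2)))).
    - move=> y t _. have := Hp t => Ht. auto_derive; first (simpl in Ht; lra). simpl in *. field. lra.
    - move=> t _. ctn.
    - move=> y t _. have := Hp t => Ht. ctn. lra. }
  have Hg : forall x, is_derive (fun x => gauss x ^ 2) x (2 * exp (- x ^ 2) * gauss x).
  { move=> {}x. have H := is_derive_pow gauss 2 x _ (gauss_derive x).
    have -> : 2 * exp (- x ^ 2) * gauss x = INR 2 * exp (- x ^ 2) * gauss x ^ Init.Nat.pred 2 by rewrite /=; ring.
    exact: H. }
  have := eq_by_derive _ _ _ 0 x Hg Hd.
  have -> : gauss 0 = 0 by exact: RInt_point.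
  have -> : RInt (fun t => exp (- 0 ^ 2 * (1 + t ^ 2)) / (1 + t ^ 2)) 0 1 = PI / 4.
  { apply: is_RInt_unique. have -> : PI / 4 = atan 1 - atan 0 by rewrite atan_1 atan_0; ring.
    apply: (is_RInt_ext (fun t => / (1 + t ^ 2))).
    { move=> t _. have -> : - 0 ^ 2 * (1 + t ^ 2) = 0 by ring. rewrite exp_0 /Rdiv. rring. }
    apply: (RInt_of_derive atan) => t _.
    - apply/is_derive_Reals. exact: derivable_pt_lim_atan.
    - have := Hp t => Ht. ctn. lra. }
  lra.
Qed.

Lemma gauss_nonneg (x : R) : 0 <= x -> 0 <= gauss x.
Proof.
  move=> Hx. apply: RInt_ge_0 => //.
  - apply: ex_RInt_cont => t. apply: ex_derive_continuousR. by auto_derive.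
  - move=> t _. exact: Rlt_le (exp_pos _).
Qed.

Lemma gauss_infty : filterlim gauss (Rbar_locally p_infty) (locally (sqrt PI / 2)).
Proof.
  have HP := PI_RGT_0.
  have Hlim : filterlim (fun x => gauss x ^ 2) (Rbar_locally p_infty) (locally (PI / 4)).
  { apply: (filterlim_squeeze0 _ _ (fun x => exp (- (1) * x))); last by apply: filterlim_exp_infty; lra.
    exists 1 => x Hx. rewrite gauss_sqr.
    set I := RInt _ 0 1. have -> : PI / 4 - I - PI / 4 = - I by ring. rewrite Rabs_Ropp /I.
    have Hp : forall t : R, 0 < 1 + t ^ 2 by move=> t; have := pow2_ge_0 t; lra.
    have -> : exp (- (1) * x) = (1 - 0) * exp (- (1) * x) by ring.
    apply: abs_RInt_le_const; first lra.
    - apply: ex_RInt_cont => t. have := Hp t => Ht. ctn. lra.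
    - move=> t _. have Ht := Hp t. have Ht2 := pow2_ge_0 t. rewrite Rabs_pos_eq.
      + apply/Rle_div_l => //.
        apply: (Rle_trans _ (exp (- (1) * x) * 1)); last (apply: Rmult_le_compat_l; [exact: Rlt_le (exp_pos _) | lra]).
        rewrite Rmult_1_r. left. apply: exp_increasing. nra.
      + apply: Rlt_le. apply: Rdiv_lt_0_compat => //. exact: exp_pos. }
  have H2 : filterlim (fun x => sqrt (gauss x ^ 2)) (Rbar_locally p_infty) (locally (sqrt (PI / 4))).
  { apply: (fl_cont _ _ sqrt) => //. exact: continuous_sqrt. }
  have Heq : sqrt (PI / 4) = sqrt PI / 2.
  { have -> : PI / 4 = (sqrt PI / 2) ^ 2.
    { have H := sqrt_sqrt PI ltac:(lra). have -> : (sqrt PI / 2) ^ 2 = (sqrt PI * sqrt PI) / 4 by field. by rewrite H. }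
    rewrite sqrt_pow2 //. have := sqrt_pos PI. lra. }
  rewrite -Heq. apply: (filterlim_ext_loc (fun x => sqrt (gauss x ^ 2))) => //.
  exists 0 => x Hx. rewrite sqrt_pow2 //. apply: gauss_nonneg. lra.
Qed.

(** The substitution [t = u ^ 2] turns the integrand into twice the Gaussian. *)
Lemma Gamma_half : Gamma (1 / 2) = sqrt PI.
Proof.
  have Hint : forall x, 0 < x -> RInt (gint (1 / 2)) 1 x = 2 * (gauss (sqrt x) - gauss 1).
  { move=> x Hx. apply: is_RInt_unique.
    have -> : 2 * (gauss (sqrt x) - gauss 1) = 2 * gauss (sqrt x) - 2 * gauss (sqrt 1) by rewrite sqrt_1; ring.
    have Hpos : forall t, Rmin 1 x <= t <= Rmax 1 x -> 0 < t.
    { move=> t. rewrite /Rmin. destruct Rle_dec; lra. }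
    apply: (RInt_of_derive (fun x => 2 * gauss (sqrt x))) => t /Hpos Ht; last exact: continuous_gint.
    have Hs : 0 < sqrt t by apply: sqrt_lt_R0.
    have -> : gint (1 / 2) t = 2 * (/ (2 * sqrt t) * exp (- sqrt t ^ 2)).
    { rewrite /gint. have -> : 1 / 2 - 1 = - / 2 by field.
      rewrite Rpower_Ropp Rpower_sqrt //.
      have -> : sqrt t ^ 2 = t by rewrite /= Rmult_1_r sqrt_sqrt; lra.
      field. lra. }
    apply: is_derive_scal.
    apply: (is_derive_comp (V := R_NormedModule) gauss sqrt); first exact: gauss_derive.
    have := is_derive_sqrt id t 1 (is_derive_id _) Ht.
    rewrite /id. have -> : 1 / (2 * sqrt t) = / (2 * sqrt t) by field; lra. apply. }
  apply: eq_trans (proj2 (Gamma_eq (1 / 2) (2 * (0 - gauss 1)) (2 * (sqrt PI / 2 - gauss 1)) _ _)) _.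
  - apply: (filterlim_ext_loc (fun x => 2 * (gauss (sqrt x) - gauss 1))).
    { apply: filter_imp at_right_pos => x Hx. by rewrite Hint. }
    have Hg0 : gauss 0 = 0 by exact: RInt_point.
    apply: fl_at_right; last by rewrite sqrt_0 Hg0.
    apply: ct_mult; first exact: continuous_const. apply: ct_minus; last exact: continuous_const.
    apply: (ct_comp sqrt gauss); first exact: continuous_sqrt.
    apply: ex_derive_continuousR. eexists. exact: gauss_derive.
  - apply: (filterlim_ext_loc (fun x => 2 * (gauss (sqrt x) - gauss 1))).
    { exists 0 => x Hx. by rewrite Hint. }
    apply: fl_mult; first exact: filterlim_const. apply: fl_minus; last exact: filterlim_const.
    apply: filterlim_comp gauss_infty.
    move=> P [M HM]. exists (Rmax M 0 ^ 2) => x Hx. apply: HM.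
    apply: Rle_lt_trans (Rmax_l M 0) _. rewrite -(sqrt_pow2 (Rmax M 0)); last exact: Rmax_r.
    apply: sqrt_lt_1_alt. split => //. exact: pow2_ge_0.
  - field.
Qed.

(** This identifies the constant of the exponential integral with the derivative of Gamma at [1].
    Integration by parts on either side of [1] uses the primitive [1 - exp (- t)] of [exp (- t)]
    near [0] and [- exp (- t)] near infinity, so that no boundary term survives. *)
Lemma is_RInt_gen_ln_exp :
  is_RInt_gen (fun t => ln t * exp (- t)) (at_right 0) (Rbar_locally p_infty) gamma1.
Proof.
  have Hc : forall t, 0 < t -> continuous (fun t => ln t * exp (- t)) t.
  { move=> t Ht. apply: ex_derive_continuousR. by auto_derive. }
  have [s1 [s2 s3]] := ein_slope.
  have [Hl1 _] := slope_RInt_lim _ _ 1 s1 s2 s3 Rlt_0_1.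
  have -> : gamma1 = (0 + expint_const) - (RInt (fun s => (1 - exp (- s)) / s) 0 1 + 0) by rewrite /gamma1; ring.
  have Hpos : forall x, 0 < x -> forall t, Rmin 1 x <= t <= Rmax 1 x -> 0 < t.
  { move=> x Hx t. rewrite /Rmin. destruct Rle_dec; lra. }
  apply: is_RInt_gen_0_infty => //.
  - apply: (filterlim_ext_loc (fun x => RInt (fun s => (1 - exp (- s)) / s) x 1 + (1 - exp (- x)) * ln x)).
    + apply: filter_imp at_right_pos => x Hx.
      have Hex : ex_RInt (fun s => (1 - exp (- s)) / s) x 1.
      { apply: (ex_RInt_gt _ 0) => //; first lra. move=> t Ht. apply: ex_derive_continuousR. auto_derive. lra. }
      symmetry. apply: is_RInt_unique.
      have H1 : is_RInt (fun t => ln t * exp (- t) + (1 - exp (- t)) / t) 1 x ((1 - exp (- x)) * ln x).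
      { have -> : (1 - exp (- x)) * ln x = (1 - exp (- x)) * ln x - (1 - exp (- (1))) * ln 1 by rewrite ln_1; ring.
        apply: (RInt_of_derive (fun x => (1 - exp (- x)) * ln x)) => t /(Hpos x Hx) Ht.
        - auto_derive => //. field. lra.
        - apply: ex_derive_continuousR. auto_derive. lra. }
      apply: (is_RInt_ext (fun t => - ((1 - exp (- t)) / t) + (ln t * exp (- t) + (1 - exp (- t)) / t))).
      { move=> t _. rring. }
      apply: (is_RInt_plus (V := R_NormedModule)) => //.
      have -> : RInt (fun s => (1 - exp (- s)) / s) x 1 = - RInt (fun s => (1 - exp (- s)) / s) 1 x.
      { rewrite (RInt_swapR _ x 1) //. by rewrite Ropp_involutive. }
      apply: (is_RInt_opp (V := R_NormedModule)). apply: (RInt_correct (V := R_CompleteNormedModule)).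
      exact: ex_RInt_swap.
    + apply: fl_plus; first exact: Hl1.
      have [k [Hk1 Hk2]] := slope_continuous _ _ s1 s2 s3.
      apply: (filterlim_ext_loc (fun y => k y * (y * ln y))).
      * apply: filter_imp at_right_pos => y Hy. rewrite Hk2; last lra. field. lra.
      * apply: fl_val (Rmult_0_r (k 0)). apply: fl_mult; last exact: x_ln_x_lim.
        exact: fl_at_right.
  - apply: (filterlim_ext_loc (fun x => - (exp (- x) * ln x) + RInt gexp 1 x)).
    + exists 1 => x Hx. symmetry. apply: is_RInt_unique.
      have H1 : is_RInt (fun t => ln t * exp (- t) - gexp t) 1 x (- (exp (- x) * ln x)).
      { have -> : - (exp (- x) * ln x) = - (exp (- x) * ln x) - - (exp (- (1)) * ln 1) by rewrite ln_1; ring.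
        apply: (RInt_of_derive (fun x => - (exp (- x) * ln x))) => t /(Hpos x ltac:(lra)) Ht.
        - rewrite /gexp. auto_derive => //. field. lra.
        - apply: ct_minus; [exact: Hc | apply: continuous_gexp; lra]. }
      apply: (is_RInt_ext (fun t => (ln t * exp (- t) - gexp t) + gexp t)).
      { move=> t _. rring. }
      apply: (is_RInt_plus (V := R_NormedModule)) => //.
      apply: (RInt_correct (V := R_CompleteNormedModule)). apply: ex_RInt_gexp; lra.
    + apply: fl_plus; last exact: expint_const_spec.
      apply: fl_val Ropp_0. apply: fl_opp.
      apply: filterlim_squeeze0 (filterlim_pow_exp_infty 1 1 Rlt_0_1).
      exists 1 => x Hx. rewrite Rminus_0_r.
      have Hl0 : 0 < ln x by rewrite -ln_1; apply: ln_increasing; lra.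
      have Hl1' : ln x <= x.
      { have := exp_ineq1_le (ln x). rewrite exp_ln; lra. }
      rewrite Rabs_pos_eq; last by apply: Rmult_le_pos; [exact: Rlt_le (exp_pos _) | lra].
      have -> : - (1) * x = - x by ring. rewrite /= Rmult_1_r Rmult_comm.
      apply: Rmult_le_compat_r => //. exact: Rlt_le (exp_pos _).
Qed.

Lemma exp_taylor2 (x : R) : Rabs (exp x - 1 - x) <= x ^ 2 * exp (Rabs x).
Proof.
  have H0 := exp_ineq1_le x. rewrite Rabs_pos_eq; last lra.
  have H1 := exp_ineq1_le (- x). rewrite exp_Ropp in H1. have Hp := exp_pos x.
  have H2 : exp x * / exp x = 1 by apply: Rinv_r; lra.
  case: (Rle_dec 0 x) => Hx.
  - rewrite Rabs_pos_eq //.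
    have H3 : exp x - 1 <= x * exp x.
    { have := Rmult_le_compat_l (exp x) _ _ (Rlt_le _ _ Hp) H1. rewrite H2. lra. }
    have := Rmult_le_compat_l x _ _ Hx H3. simpl. nra.
  - have H3 : 1 <= exp (Rabs x) by have := exp_ineq1_le (Rabs x); have := Rabs_pos x; lra.
    have H4 : exp x - 1 - x <= x ^ 2.
    { have H5 : exp x * (1 - x) <= 1.
      { have := Rmult_le_compat_l (exp x) _ _ (Rlt_le _ _ Hp) H1. rewrite H2. lra. }
      have H6 : exp x <= / (1 - x).
      { apply: (Rmult_le_reg_r (1 - x)); first lra. rewrite Rinv_l; lra. }
      have H7 : / (1 - x) - 1 - x <= x ^ 2.
      { apply: (Rmult_le_reg_r (1 - x)); first lra.
        have -> : (/ (1 - x) - 1 - x) * (1 - x) = x ^ 2 by field; lra. simpl. nra. }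
      lra. }
    have := pow2_ge_0 x. nra.
Qed.

(** The second order Taylor remainder of [t ^ b = exp (b ln t)] is integrated against [exp (- t)]. A
    quadratic error bound is the form in which the derivative at [b = 0] is used later. *)
Lemma Gamma_near_1 : exists K, forall b, Rabs b <= 1 / 2 ->
  Rabs (Gamma (1 + b) - 1 - b * gamma1) <= K * b ^ 2.
Proof.
  (* With [u = ln t] the remainder is at most [(b u)^2 exp (|u| / 2)], and
     [u^2 <= 64 exp (|u| / 4)]. The resulting [exp (3 |u| / 4)] is below [t^(3/4) + t^(-3/4)], which
     integrates to Gamma at [7 / 4] and [1 / 4]. *)
  exists (64 * (Gamma (1 / 4) + Gamma (7 / 4))) => b Hb.
  have Hb' := proj1 (Rabs_le_between _ _) Hb.
  have HG : is_RInt_gen (fun t => gint (1 + b) t - gint 1 t - b * (ln t * exp (- t)))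
     (at_right 0) (Rbar_locally p_infty) (Gamma (1 + b) - 1 - b * gamma1).
  { apply: (is_RInt_gen_minus (V := R_NormedModule)).
    - apply: (is_RInt_gen_minus (V := R_NormedModule)); first by apply: Gamma_correct; lra.
      have H1 := Gamma_correct 1 Rlt_0_1. by rewrite Gamma_1 in H1.
    - apply: (is_RInt_gen_scal (V := R_NormedModule)). exact: is_RInt_gen_ln_exp. }
  have HD : is_RInt_gen (fun t => 64 * b ^ 2 * (gint (1 / 4) t + gint (7 / 4) t))
     (at_right 0) (Rbar_locally p_infty) (64 * b ^ 2 * (Gamma (1 / 4) + Gamma (7 / 4))).
  { apply: (is_RInt_gen_scal (V := R_NormedModule)). apply: (is_RInt_gen_plus (V := R_NormedModule)); apply: Gamma_correct; lra. }
  have -> : 64 * (Gamma (1 / 4) + Gamma (7 / 4)) * b ^ 2 = 64 * b ^ 2 * (Gamma (1 / 4) + Gamma (7 / 4)) by ring.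
  apply: (RInt_gen_norm (V := R_CompleteNormedModule) (Fa := at_right 0) (Fb := Rbar_locally p_infty) _ _ _ _ _ _ HG HD).
  - eapply (Filter_prod _ _ _ (fun x => 0 < x < 1) (fun x => 1 < x)).
    + apply: at_right_lt. lra. + by exists 1. + move=> x y /=. lra.
  - eapply (Filter_prod _ _ _ (fun x => 0 < x < 1) (fun x => 1 < x)).
    + apply: at_right_lt. lra. + by exists 1.
    + move=> x y Hx Hy t /= Ht. have Ht0 : 0 < t by lra.
      rewrite /norm /= /abs /= /gint /Rpower.
      set u := ln t.
      have -> : exp ((1 + b - 1) * u) * exp (- t) - exp ((1 - 1) * u) * exp (- t) - b * (u * exp (- t))
        = (exp (b * u) - 1 - b * u) * exp (- t).
      { have -> : (1 + b - 1) * u = b * u by ring. have -> : (1 - 1) * u = 0 by ring. rewrite exp_0. ring. }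
      have -> : 64 * (b * (b * 1)) * (exp ((1 / 4 - 1) * u) * exp (- t) + exp ((7 / 4 - 1) * u) * exp (- t)) =
        64 * b ^ 2 * (exp (- (3 / 4 * u)) + exp (3 / 4 * u)) * exp (- t).
      { have -> : (1 / 4 - 1) * u = - (3 / 4 * u) by field. have -> : (7 / 4 - 1) * u = 3 / 4 * u by field. ring. }
      rewrite Rabs_mult (Rabs_pos_eq (exp (- t))); last exact: Rlt_le (exp_pos _).
      apply: Rmult_le_compat_r; first exact: Rlt_le (exp_pos _).
      apply: Rle_trans (exp_taylor2 _) _.
      have Hu0 := Rabs_pos u.
      have H1 : exp (Rabs (b * u)) <= exp (Rabs u / 2).
      { rewrite Rabs_mult. have : Rabs b * Rabs u <= Rabs u / 2 by nra.
        case=> h; [left; exact: exp_increasing | right; by rewrite h]. }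
      have H2 : u ^ 2 <= 64 * exp (Rabs u / 4).
      { have -> : u ^ 2 = Rabs u ^ 2 by rewrite RPow_abs Rabs_pos_eq //; apply: pow2_ge_0.
        have h := exp_ineq1_le (Rabs u / 8).
        have -> : Rabs u / 4 = Rabs u / 8 + Rabs u / 8 by field. rewrite exp_plus. simpl. nra. }
      have H3 : exp (Rabs u / 4) * exp (Rabs u / 2) <= exp (- (3 / 4 * u)) + exp (3 / 4 * u).
      { rewrite -exp_plus. have := exp_pos (- (3 / 4 * u)). have := exp_pos (3 / 4 * u).
        rewrite /Rabs. destruct Rcase_abs.
        - have -> : - u / 4 + - u / 2 = - (3 / 4 * u) by field. lra.
        - have -> : u / 4 + u / 2 = 3 / 4 * u by field. lra. }
      have -> : (b * u) ^ 2 * exp (Rabs (b * u)) = b ^ 2 * (u ^ 2 * exp (Rabs (b * u))) by ring.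
      have -> : 64 * b ^ 2 * (exp (- (3 / 4 * u)) + exp (3 / 4 * u)) = b ^ 2 * (64 * (exp (- (3 / 4 * u)) + exp (3 / 4 * u))) by ring.
      apply: Rmult_le_compat_l; first exact: pow2_ge_0.
      apply: Rle_trans (Rmult_le_compat_l _ _ _ (pow2_ge_0 u) H1) _.
      apply: Rle_trans (Rmult_le_compat_r _ _ _ (Rlt_le _ _ (exp_pos _)) H2) _.
      rewrite Rmult_assoc. apply: Rmult_le_compat_l => //. lra.
Qed.

(** * Hankel functions of half-integer order *)

Lemma is_series_ext_eq (a b : nat -> R) (l : R) : (forall n, a n = b n) -> is_series a l -> is_series b l.
Proof. move=> H. exact: is_series_ext. Qed.

Lemma ex_series_exp (x : R) : ex_series (fun n => x ^ n / INR (fact n)).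
Proof.
  exists (exp x). have := is_exp_Reals x. rewrite /is_pseries. apply: is_series_ext_eq => n.
  rewrite pow_n_pow /scal /= /mult /=. rfield. exact: INR_fact_neq_0.
Qed.

Lemma pow_fact_le (x : R) (n : nat) : 0 <= x -> x ^ n / INR (fact n) <= exp x.
Proof.
  move=> Hx.
  have Hs : is_series (fun n => x ^ n / INR (fact n)) (exp x).
  { have := is_exp_Reals x. rewrite /is_pseries. apply: is_series_ext_eq => m.
    rewrite pow_n_pow /scal /= /mult /=. rfield. exact: INR_fact_neq_0. }
  have Hpos : forall m, 0 <= x ^ m / INR (fact m).
  { move=> m. apply: Rmult_le_pos; first exact: pow_le. apply: Rlt_le. apply: Rinv_0_lt_compat. exact: INR_fact_lt_0. }
  have H1 : Rabs (Series (fun m => x ^ m / INR (fact m)) - sum_n (fun m => x ^ m / INR (fact m)) n) <=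
            Series (fun m => x ^ m / INR (fact m)) - sum_n (fun m => x ^ m / INR (fact m)) n.
  { apply: Series_tail_le; last by exists (exp x). move=> m. rewrite Rabs_pos_eq //. lra. }
  rewrite (is_series_unique _ _ Hs) in H1.
  have H2 := Rle_trans _ _ _ (Rabs_pos _) H1.
  have H3 : x ^ n / INR (fact n) <= sum_n (fun m => x ^ m / INR (fact m)) n.
  { case: n {H1 H2} => [|n]; first by rewrite sum_O; lra.
    rewrite sum_Sn /plus /=.
    have : 0 <= sum_n (fun m => x ^ m / INR (fact m)) n.
    { elim: n => [|n IH]; first by rewrite sum_O. rewrite sum_Sn /plus /=. have := Hpos (S n). simpl. simpl in IH. lra. }
    simpl. lra. }
  lra.
Qed.

Lemma CV_radius_fact (a : nat -> R) (C : R) : 0 <= C ->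
  (forall n, Rabs (a n) <= C ^ n / INR (fact n)) -> CV_radius a = p_infty.
Proof.
  move=> HC Ha. have [Hub _] := CV_radius_bounded a.
  have H : forall r : R, Rbar_le r (CV_radius a).
  { move=> r. apply: Hub. exists (exp (C * Rabs r)) => n.
    rewrite Rabs_mult -RPow_abs.
    apply: Rle_trans (pow_fact_le (C * Rabs r) n _); last by apply: Rmult_le_pos => //; exact: Rabs_pos.
    rewrite Rpow_mult_distr.
    have -> : C ^ n * Rabs r ^ n / INR (fact n) = C ^ n / INR (fact n) * Rabs r ^ n by rewrite /Rdiv; ring.
    apply: Rmult_le_compat_r; [apply: pow_le; exact: Rabs_pos | exact: Ha]. }
  case: (CV_radius a) H => [r | |] H //.
  - have := H (r + 1). rewrite /=. lra.
  - by have := H 0.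
Qed.

Lemma cos_series (x : R) : is_series (fun m => (-1) ^ m * x ^ (2 * m) / INR (fact (2 * m))) (cos x).
Proof.
  have : is_series (fun i => cos_n i * (Rsqr x) ^ i) (cos x).
  { apply/is_series_Reals. rewrite /cos. by case: exist_cos. }
  apply: is_series_ext_eq => m. rewrite /cos_n /Rsqr pow_mult /= Rmult_1_r /Rdiv. ring.
Qed.

Lemma sin_series (x : R) : is_series (fun m => (-1) ^ m * x ^ (2 * m + 1) / INR (fact (2 * m + 1))) (sin x).
Proof.
  have [l [Hl ->]] : exists l, is_series (fun i => sin_n i * (Rsqr x) ^ i) l /\ sin x = x * l.
  { rewrite /sin. case: exist_sin => l Hl. exists l; split => //. by apply/is_series_Reals. }
  have := is_series_scal (K := R_AbsRing) (V := R_NormedModule) x _ _ Hl. apply: is_series_ext_eq => m.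
  rewrite /scal /= /mult /= /sin_n /Rsqr.
  have -> : x ^ (2 * m + 1) = (x * x) ^ m * x by rewrite pow_add pow_mult /= !Rmult_1_r.
  simpl. rewrite /Rdiv. rring.
Qed.

Lemma Gamma_pos_half (m : nat) : Gamma (INR m + 1 / 2) = INR (fact (2 * m)) * sqrt PI / (4 ^ m * INR (fact m)).
Proof.
  elim: m => [|m IH].
  - rewrite /= Rplus_0_l Gamma_half. field.
  - have -> : INR (S m) + 1 / 2 = (INR m + 1 / 2) + 1 by rewrite S_INR; ring.
    have Hm := pos_INR m.
    rewrite Gamma_succ ?IH; last lra.
    have -> : (2 * S m = S (S (2 * m)))%nat by lia.
    rewrite (fact_simpl (S (2 * m))) (fact_simpl (2 * m)) (fact_simpl m) !mult_INR !S_INR mult_INR.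
    have -> : INR 2 = 2 by []. have -> : 4 ^ S m = 4 * 4 ^ m by [].
    field. have := INR_fact_neq_0 m. have : 4 ^ m <> 0 by apply: pow_nonzero; lra. move=> h1 h2. repeat split => //. lra.
Qed.

(** The value of Gamma at [m + 1 / 2] completes [m!] to [(2 m)!], so the Bessel series becomes the
    cosine series. *)
Lemma besselJ_mhalf (x : R) : 0 < x -> besselJ (- (1 / 2)) x = sqrt (2 / (PI * x)) * cos x.
Proof.
  move=> Hx. have HP := PI_RGT_0.
  have Hsq : Rpower (x / 2) (- (1 / 2)) / sqrt PI = sqrt (2 / (PI * x)).
  { rewrite Rpower_Ropp. have -> : 1 / 2 = / 2 by field. rewrite Rpower_sqrt; last lra.
    rewrite -sqrt_inv /Rdiv -sqrt_inv -sqrt_mult_alt.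
    - congr sqrt. field. lra.
    - apply: Rlt_le. apply: Rinv_0_lt_compat. lra. }
  rewrite -Hsq. apply: is_series_unique.
  have := is_series_scal (K := R_AbsRing) (V := R_NormedModule) (Rpower (x / 2) (- (1 / 2)) / sqrt PI) _ _ (cos_series x).
  apply: is_series_ext_eq => m. rewrite /scal /= /mult /=.
  have -> : INR m + - (1 / 2) + 1 = INR m + 1 / 2 by field.
  rewrite Gamma_pos_half Rpower_plus.
  have -> : 2 * INR m = INR (2 * m) by rewrite mult_INR.
  rewrite Rpower_pow; last lra.
  have -> : (m + (m + 0) = 2 * m)%nat by lia.
  have -> : (x / 2) ^ (2 * m) = x ^ (2 * m) / 4 ^ m.
  { rewrite /Rdiv Rpow_mult_distr. congr Rmult. rewrite pow_inv pow_mult. congr (/ (_ ^ _)). ring. }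
  have h1 := INR_fact_neq_0 m. have h2 := INR_fact_neq_0 (2 * m).
  have h3 : 4 ^ m <> 0 by apply: pow_nonzero; lra.
  have h4 : sqrt PI <> 0 by apply: Rgt_not_eq; apply: sqrt_lt_R0.
  rfield. repeat split => //.
Qed.

Lemma besselJ_half (x : R) : 0 < x -> besselJ (1 / 2) x = sqrt (2 / (PI * x)) * sin x.
Proof.
  move=> Hx. have HP := PI_RGT_0.
  have Hsq : Rpower (x / 2) (- (1 / 2)) / sqrt PI = sqrt (2 / (PI * x)).
  { rewrite Rpower_Ropp. have -> : 1 / 2 = / 2 by field. rewrite Rpower_sqrt; last lra.
    rewrite -sqrt_inv /Rdiv -sqrt_inv -sqrt_mult_alt.
    - congr sqrt. field. lra.
    - apply: Rlt_le. apply: Rinv_0_lt_compat. lra. }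
  rewrite -Hsq. apply: is_series_unique.
  have := is_series_scal (K := R_AbsRing) (V := R_NormedModule) (Rpower (x / 2) (- (1 / 2)) / sqrt PI) _ _ (sin_series x).
  apply: is_series_ext_eq => m. rewrite /scal /= /mult /=.
  have Hm := pos_INR m.
  rewrite Gamma_succ; last lra. rewrite Gamma_pos_half.
  have -> : 2 * INR m + 1 / 2 = - (1 / 2) + (INR (2 * m) + 1) by rewrite mult_INR /=; field.
  rewrite !Rpower_plus Rpower_1; last lra.
  rewrite Rpower_pow; last lra.
  have -> : (m + (m + 0) = 2 * m)%nat by lia.
  have -> : (x / 2) ^ (2 * m) = x ^ (2 * m) / 4 ^ m.
  { rewrite /Rdiv Rpow_mult_distr. congr Rmult. rewrite pow_inv pow_mult. congr (/ (_ ^ _)). ring. }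
  have -> : (2 * m + 1 = S (2 * m))%nat by lia.
  rewrite (fact_simpl (2 * m)) mult_INR S_INR mult_INR.
  have h1 := INR_fact_neq_0 m. have h2 := INR_fact_neq_0 (2 * m).
  have h3 : 4 ^ m <> 0 by apply: pow_nonzero; lra.
  have h4 : sqrt PI <> 0 by apply: Rgt_not_eq; apply: sqrt_lt_R0.
  have -> : INR 2 = 2 by []. have -> : x ^ S (2 * m) = x * x ^ (2 * m) by [].
  rfield. repeat split => //; lra.
Qed.

Lemma not_Z_half (a : R) : (a = 1 / 2 \/ a = - (1 / 2)) -> ~ exists z : Z, a = IZR z.
Proof.
  move=> Ha [z Hz].
  have : IZR (2 * z) = IZR 1 \/ IZR (2 * z) = IZR (-1).
  { rewrite mult_IZR -Hz. case: Ha => ->; [left | right]; field. }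
  case=> /eq_IZR; lia.
Qed.

Lemma hankel1_half (x : R) : 0 < x ->
  hankel1 (1 / 2) x = rscal (sqrt (2 / (PI * x))) (sin x, - cos x).
Proof.
  move=> Hx. rewrite /hankel1.
  case: excluded_middle_informative => [H | _]; first by case: (not_Z_half (1 / 2) (or_introl eq_refl)).
  rewrite /hankel1_nonint besselJ_half // besselJ_mhalf // /eiC.
  have -> : - (1 / 2) * PI = - (PI / 2) by field.
  have -> : 1 / 2 * PI = PI / 2 by field.
  rewrite cos_neg sin_neg cos_PI2 sin_PI2.
  apply: injective_projections; rewrite /rscal /=; field; lra.
Qed.

Lemma hankel1_mhalf (x : R) : 0 < x ->
  hankel1 (- (1 / 2)) x = rscal (sqrt (2 / (PI * x))) (cos x, sin x).
Proof.
  move=> Hx. rewrite /hankel1.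
  case: excluded_middle_informative => [H | _]; first by case: (not_Z_half (- (1 / 2)) (or_intror eq_refl)).
  rewrite /hankel1_nonint Ropp_involutive besselJ_half // besselJ_mhalf // /eiC.
  have -> : 1 / 2 * PI = PI / 2 by field.
  have -> : - (1 / 2) * PI = - (PI / 2) by field.
  rewrite sin_neg cos_PI2 sin_PI2.
  apply: injective_projections; rewrite /rscal /=; field; lra.
Qed.

Lemma Gd_1 (k0 : R) (r : vec) : 0 < k0 -> 0 < vnorm r ->
  Gd 1 k0 r = (- sin (k0 * vnorm r) / (2 * k0), cos (k0 * vnorm r) / (2 * k0)).
Proof.
  move=> Hk Hr. have Hx : 0 < k0 * vnorm r by exact: Rmult_lt_0_compat.
  have HP := PI_RGT_0.
  rewrite /Gd /hankel1_check. move: (k0 * vnorm r) Hx => x Hx.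
  have -> : INR 1 / 2 - 1 = - (1 / 2) by rewrite /=; field.
  rewrite hankel1_mhalf // Ropp_involutive.
  have H : Rpower (k0 ^ 2 / (2 * PI)) (- (1 / 2)) * Rpower x (1 / 2) * sqrt (2 / (PI * x)) = 2 / k0.
  { have Hk2 : 0 < k0 ^ 2 by apply: pow_lt.
    have Hk3 : 0 < k0 ^ 2 / (2 * PI) by apply: Rdiv_lt_0_compat; lra.
    have -> : 1 / 2 = / 2 by field. rewrite Rpower_Ropp !Rpower_sqrt // -sqrt_inv.
    have Hi : 0 < / (k0 ^ 2 / (2 * PI)) by apply: Rinv_0_lt_compat.
    rewrite -sqrt_mult_alt; last lra. rewrite -sqrt_mult_alt; last nra.
    have -> : / (k0 ^ 2 / (2 * PI)) * x * (2 / (PI * x)) = (2 / k0) ^ 2 by field; lra.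
    rewrite sqrt_pow2 //. apply: Rlt_le. apply: Rdiv_lt_0_compat; lra. }
  move: H. set A := Rpower _ (- _). set B := Rpower x _. set D := sqrt _ => H.
  apply: injective_projections; rewrite /rscal /=.
  - transitivity (- (A * B * D) * sin x / 4); first by field. rewrite H. field. lra.
  - transitivity ((A * B * D) * cos x / 4); first by field. rewrite H. field. lra.
Qed.

Lemma Gd_3 (k0 : R) (r : vec) : 0 < k0 -> 0 < vnorm r ->
  Gd 3 k0 r = (k0 / (4 * PI) * (cos (k0 * vnorm r) / (k0 * vnorm r)), k0 / (4 * PI) * (sin (k0 * vnorm r) / (k0 * vnorm r))).
Proof.
  move=> Hk Hr. have Hx : 0 < k0 * vnorm r by exact: Rmult_lt_0_compat.
  have HP := PI_RGT_0.
  rewrite /Gd /hankel1_check. move: (k0 * vnorm r) Hx => x Hx.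
  have -> : INR 3 / 2 - 1 = 1 / 2 by rewrite /=; field.
  rewrite hankel1_half //.
  have H : Rpower (k0 ^ 2 / (2 * PI)) (1 / 2) * Rpower x (- (1 / 2)) * sqrt (2 / (PI * x)) = k0 / (PI * x).
  { have Hk2 : 0 < k0 ^ 2 by apply: pow_lt.
    have Hk3 : 0 < k0 ^ 2 / (2 * PI) by apply: Rdiv_lt_0_compat; lra.
    have -> : 1 / 2 = / 2 by field. rewrite Rpower_Ropp !Rpower_sqrt // -sqrt_inv.
    have Hi : 0 < / x by apply: Rinv_0_lt_compat.
    rewrite -sqrt_mult_alt; last lra. rewrite -sqrt_mult_alt; last nra.
    have HPx : 0 < PI * x by nra.
    have -> : k0 ^ 2 / (2 * PI) * / x * (2 / (PI * x)) = (k0 / (PI * x)) ^ 2 by field; lra.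
    rewrite sqrt_pow2 //. apply: Rlt_le. by apply: Rdiv_lt_0_compat. }
  move: H. set A := Rpower _ (1 / 2). set B := Rpower x _. set D := sqrt _ => H.
  apply: injective_projections; rewrite /rscal /=.
  - transitivity ((A * B * D) * cos x / 4); first by field. rewrite H. field. lra.
  - transitivity ((A * B * D) * sin x / 4); first by field. rewrite H. field. lra.
Qed.

(** * Hankel function of order 0 *)

Fixpoint harm (n : nat) : R := match n with 0%nat => 0 | S m => harm m + / INR (S m) end.

(** The product of [1 + b / k] for [k] up to [n]. It carries the dependence of [Gamma (n + b + 1)]
    on [b] beyond the factor [Gamma (1 + b)], and its derivative at [b = 0] is [harm n]. *)
Fixpoint prodh (b : R) (n : nat) : R :=
  match n with 0%nat => 1 | S m => prodh b m * (1 + b / INR (S m)) end.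

Lemma harm_bound (n : nat) : 0 <= harm n <= INR n.
Proof.
  elim: n => [|n IH]; first by rewrite /=; lra.
  have Hn := pos_INR n.
  have H : 0 < / INR (S n) <= 1.
  { rewrite S_INR. split; first by apply: Rinv_0_lt_compat; lra.
    rewrite -{2}Rinv_1. apply: Rinv_le_contravar; lra. }
  change (harm (S n)) with (harm n + / INR (S n)). rewrite S_INR in H *. lra.
Qed.

Lemma INR_S_inv (n : nat) : 0 < / INR (S n) <= 1.
Proof.
  have Hn := pos_INR n. rewrite S_INR. split; first by apply: Rinv_0_lt_compat; lra.
  rewrite -{2}Rinv_1. apply: Rinv_le_contravar; lra.
Qed.

Lemma prodh_factor (b : R) (n : nat) : Rabs b <= 1 / 2 -> 1 / 2 <= 1 + b / INR (S n).
Proof.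
  move=> Hb. have [h1 h2] := INR_S_inv n.
  have : Rabs (b / INR (S n)) <= 1 / 2.
  { rewrite /Rdiv Rabs_mult (Rabs_pos_eq (/ _)); last lra. have := Rabs_pos b. nra. }
  move/Rabs_le_between. lra.
Qed.

Lemma prodh_pos (b : R) (n : nat) : Rabs b <= 1 / 2 -> 0 < prodh b n.
Proof.
  move=> Hb. elim: n => [|n IH]; first by rewrite /=; lra.
  change (0 < prodh b n * (1 + b / INR (S n))). have := prodh_factor b n Hb. nra.
Qed.

Lemma pow4_ge (n : nat) : INR n + 1 <= 4 ^ n.
Proof. elim: n => [|n IH]; first by rewrite /=; lra. rewrite S_INR. simpl pow. have := pos_INR n. lra. Qed.

(** Each further factor at most doubles the old error and adds at most [2 b^2 4^n]. The growth
    [4 ^ n] is affordable because the coefficients [aJ] contain its inverse. *)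
Lemma prodh_inv_expand (b : R) (n : nat) : Rabs b <= 1 / 2 ->
  Rabs (/ prodh b n - 1 + b * harm n) <= b ^ 2 * 4 ^ n.
Proof.
  move=> Hb. elim: n => [|n IH].
  - rewrite /=. have -> : / 1 - 1 + b * 0 = 0 by field. rewrite Rabs_R0. nra.
  - have Hpp := prodh_pos b n Hb. have Hf := prodh_factor b n Hb. have [h1 h2] := INR_S_inv n.
    have Hh := harm_bound n. have Hp4 := pow4_ge n.
    change (prodh b (S n)) with (prodh b n * (1 + b / INR (S n))).
    change (harm (S n)) with (harm n + / INR (S n)).
    move: Hf h1 h2. rewrite /Rdiv. set v := / INR (S n). move=> Hf h1 h2.
    have -> : / (prodh b n * (1 + b * v)) - 1 + b * (harm n + v) =
      (/ prodh b n - 1 + b * harm n) * / (1 + b * v) + b ^ 2 * (v * (v + harm n)) * / (1 + b * v).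
    { field. lra. }
    have Hi : 0 < / (1 + b * v) <= 2.
    { split; first by apply: Rinv_0_lt_compat; lra.
      have -> : 2 = / (1 / 2) by field. apply: Rinv_le_contravar; lra. }
    apply: Rle_trans (Rabs_triang _ _) _.
    have Hb2 := pow2_ge_0 b.
    rewrite Rabs_mult (Rabs_pos_eq (/ (1 + b * v))); last lra.
    rewrite (Rabs_pos_eq (b ^ 2 * _ * _)); last first.
    { apply: Rmult_le_pos; last lra. apply: Rmult_le_pos => //. apply: Rmult_le_pos; lra. }
    have H1 : Rabs (/ prodh b n - 1 + b * harm n) * / (1 + b * v) <= b ^ 2 * 4 ^ n * 2.
    { apply: Rmult_le_compat; [exact: Rabs_pos | lra | exact: IH | lra]. }
    have H2 : b ^ 2 * (v * (v + harm n)) * / (1 + b * v) <= b ^ 2 * 4 ^ n * 2.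
    { apply: Rmult_le_compat; [| lra | | lra].
      - apply: Rmult_le_pos => //. apply: Rmult_le_pos; lra.
      - apply: Rmult_le_compat_l => //. nra. }
    simpl pow. simpl pow in H1, H2. lra.
Qed.

Lemma Gamma_prodh (b : R) (m : nat) : Rabs b <= 1 / 2 ->
  Gamma (INR m + b + 1) = Gamma (1 + b) * INR (fact m) * prodh b m.
Proof.
  move=> Hb. have Hb' := proj1 (Rabs_le_between _ _) Hb.
  elim: m => [|m IH].
  - rewrite /=. have -> : 0 + b + 1 = 1 + b by ring. ring.
  - have Hm := pos_INR m.
    have -> : INR (S m) + b + 1 = (INR m + b + 1) + 1 by rewrite S_INR; ring.
    rewrite Gamma_succ ?IH; last lra.
    change (prodh b (S m)) with (prodh b m * (1 + b / INR (S m))).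
    rewrite fact_simpl mult_INR S_INR. field. lra.
Qed.

(* Coefficients, as power series in [x ^ 2], of [J_0] and of the non-logarithmic part of [Y_0]. *)
Definition aJ (m : nat) : R := (-1) ^ m / (4 ^ m * INR (fact m) ^ 2).
Definition aN (m : nat) : R := aJ m * harm m.
Definition J0 (x : R) : R := PSeries aJ (x ^ 2).
Definition N0ser (x : R) : R := PSeries aN (x ^ 2).

Lemma aJ_abs (m : nat) : Rabs (aJ m) = / (4 ^ m * INR (fact m) ^ 2).
Proof.
  rewrite /aJ /Rdiv Rabs_mult -RPow_abs Rabs_Ropp Rabs_R1 pow1 Rmult_1_l Rabs_pos_eq //.
  apply: Rlt_le. apply: Rinv_0_lt_compat. apply: Rmult_lt_0_compat; apply: pow_lt; [lra | exact: INR_fact_lt_0].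
Qed.

Lemma fact_ge_1 (m : nat) : 1 <= INR (fact m).
Proof. have := lt_O_fact m. move=> H. apply: (le_INR 1). lia. Qed.

Lemma aJ_bound (m : nat) : Rabs (aJ m) * 4 ^ m <= 1 / INR (fact m).
Proof.
  rewrite aJ_abs. have h1 := fact_ge_1 m. have h4 : 0 < 4 ^ m by apply: pow_lt; lra.
  have -> : / (4 ^ m * INR (fact m) ^ 2) * 4 ^ m = (1 / INR (fact m)) * (1 / INR (fact m)).
  { field. split; lra. }
  have h5 : 0 < 1 / INR (fact m) <= 1.
  { split; first by apply: Rdiv_lt_0_compat; lra. apply/Rle_div_l; lra. }
  nra.
Qed.

Lemma aJ_CV : CV_radius aJ = p_infty.
Proof.
  apply: (CV_radius_fact _ 1); first lra. move=> n. rewrite pow1.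
  apply: Rle_trans (aJ_bound n). have := Rabs_pos (aJ n). have := pow4_ge n. have := pos_INR n. nra.
Qed.

Lemma aN_CV : CV_radius aN = p_infty.
Proof.
  apply: (CV_radius_fact _ 1); first lra. move=> n. rewrite pow1.
  apply: Rle_trans (aJ_bound n). rewrite /aN Rabs_mult.
  have := harm_bound n => Hh. rewrite (Rabs_pos_eq (harm n)); last lra.
  have := Rabs_pos (aJ n). have := pow4_ge n. nra.
Qed.

Lemma Rbar_lt_infty (x : R) (a : nat -> R) : CV_radius a = p_infty -> Rbar_lt (Rabs x) (CV_radius a).
Proof. by move=> ->. Qed.

Definition besselT (x b : R) : R := Series (fun m => aJ m * (x ^ 2) ^ m * / prodh b m).

Lemma besselJ_factor (b x : R) : 0 < x -> Rabs b <= 1 / 2 ->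
  besselJ b x = Rpower (x / 2) b / Gamma (1 + b) * besselT x b.
Proof.
  move=> Hx Hb. rewrite /besselT -Series_scal_l. apply: Series_ext => m.
  rewrite Gamma_prodh // Rpower_plus.
  have -> : 2 * INR m = INR (2 * m) by rewrite mult_INR.
  rewrite Rpower_pow; last lra.
  have -> : (x / 2) ^ (2 * m) = (x ^ 2) ^ m / 4 ^ m.
  { rewrite /Rdiv Rpow_mult_distr pow_mult. congr Rmult. rewrite pow_inv pow_mult. congr (/ (_ ^ _)). ring. }
  rewrite /aJ /Rdiv !Rinv_mult -!pow_inv. rewrite ?Rinv_1. ring.
Qed.

Lemma is_derive_quadratic (f : R -> R) (l K : R) :
  (forall b, Rabs b <= 1 / 2 -> Rabs (f b - f 0 - b * l) <= K * b ^ 2) -> is_derive f 0 l.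
Proof.
  move=> H. apply/is_derive_Reals => e He.
  have HK : 0 < Rabs K + 1 by have := Rabs_pos K; lra.
  have Hd : 0 < Rmin (1 / 2) (e / (Rabs K + 1)).
  { apply: Rmin_glb_lt; first lra. exact: Rdiv_lt_0_compat. }
  exists (mkposreal _ Hd) => h Hh0 /= Hh.
  have h1 : Rabs h <= 1 / 2 by have := Rmin_l (1 / 2) (e / (Rabs K + 1)); lra.
  have h2 : Rabs h < e / (Rabs K + 1) by have := Rmin_r (1 / 2) (e / (Rabs K + 1)); lra.
  rewrite Rplus_0_l.
  have Hp : 0 < Rabs h by exact: Rabs_pos_lt.
  have -> : (f h - f 0) / h - l = (f h - f 0 - h * l) / h by field.
  rewrite Rabs_div //. apply/Rlt_div_l => //.
  apply: Rle_lt_trans (H h h1) _.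
  have -> : h ^ 2 = Rabs h * Rabs h by rewrite -Rabs_mult Rabs_pos_eq /=; [ring | nra].
  have h3 : Rabs h * (Rabs K + 1) < e by apply/Rlt_div_r.
  have := Rle_abs K. nra.
Qed.

(** The first order terms of [1 / prodh b m] are minus harmonic numbers, which yields [N0ser]. The
    second order remainders, summed against [|aJ m| x^(2m)], are a constant times [b^2], so no
    differentiation of the series term by term is needed. *)
Lemma besselT_derive (x : R) : is_derive (besselT x) 0 (- N0ser x).
Proof.
  set y := x ^ 2. have Hy : 0 <= y by exact: pow2_ge_0.
  have HexJ : ex_series (fun m => aJ m * y ^ m).
  { apply: (ex_series_ext (fun k => scal (pow_n y k) (aJ k))); last exact: CV_radius_inside (Rbar_lt_infty y _ aJ_CV).
    move=> k. rewrite pow_n_pow /scal /= /mult /=. rring. }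
  have HexN : ex_series (fun m => aN m * y ^ m).
  { apply: (ex_series_ext (fun k => scal (pow_n y k) (aN k))); last exact: CV_radius_inside (Rbar_lt_infty y _ aN_CV).
    move=> k. rewrite pow_n_pow /scal /= /mult /=. rring. }
  have HJ : J0 x = Series (fun m => aJ m * y ^ m) by rewrite /J0 /PSeries.
  have HN : N0ser x = Series (fun m => aN m * y ^ m) by rewrite /N0ser /PSeries.
  have HexB : ex_series (fun m => Rabs (aJ m * y ^ m) * 4 ^ m).
  { apply: ex_series_le (ex_series_exp y) => m.
    rewrite /norm /= /abs /= Rabs_pos_eq; last by apply: Rmult_le_pos; [exact: Rabs_pos | apply: pow_le; lra].
    rewrite Rabs_mult (Rabs_pos_eq (y ^ m)); last exact: pow_le.
    have := aJ_bound m. have := pow_le y m Hy.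
    have -> : Rabs (aJ m) * y ^ m * 4 ^ m = y ^ m * (Rabs (aJ m) * 4 ^ m) by ring.
    have -> : y ^ m / INR (fact m) = y ^ m * (1 / INR (fact m)) by rewrite /Rdiv; ring.
    move=> h1 h2. exact: Rmult_le_compat_l. }
  have HT0 : besselT x 0 = J0 x.
  { rewrite HJ. apply: Series_ext => m.
    have -> : prodh 0 m = 1.
    { elim: m => [//|m IH]. change (prodh 0 m * (1 + 0 / INR (S m)) = 1). rewrite IH /Rdiv. ring. }
    rewrite Rinv_1. rewrite -/y. ring. }
  apply: (is_derive_quadratic _ _ (Series (fun m => Rabs (aJ m * y ^ m) * 4 ^ m))) => b Hb.
  set e := fun m => aJ m * y ^ m * (/ prodh b m - 1 + b * harm m).
  have He : forall m, Rabs (e m) <= b ^ 2 * (Rabs (aJ m * y ^ m) * 4 ^ m).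
  { move=> m. rewrite /e Rabs_mult.
    have -> : b ^ 2 * (Rabs (aJ m * y ^ m) * 4 ^ m) = Rabs (aJ m * y ^ m) * (b ^ 2 * 4 ^ m) by ring.
    apply: Rmult_le_compat_l; [exact: Rabs_pos | exact: prodh_inv_expand]. }
  have HexE : ex_series (fun m => Rabs (e m)).
  { apply: (ex_series_le (K := R_AbsRing) (V := R_CompleteNormedModule) _ (fun m => b ^ 2 * (Rabs (aJ m * y ^ m) * 4 ^ m))).
    - move=> m. rewrite /norm /= /abs /= Rabs_Rabsolu. exact: He.
    - exact: (ex_series_scal (K := R_AbsRing) (V := R_NormedModule) (b ^ 2)). }
  have HexE' := ex_series_Rabs _ HexE.
  have HTb : besselT x b = Series e + (J0 x - b * N0ser x).
  { rewrite HJ HN -Series_scal_l -Series_minus //; last exact: (ex_series_scal (K := R_AbsRing) (V := R_NormedModule) b).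
    rewrite -Series_plus //; last first.
    { apply: (ex_series_minus (K := R_AbsRing) (V := R_NormedModule)) => //.
      exact: (ex_series_scal (K := R_AbsRing) (V := R_NormedModule) b). }
    apply: Series_ext => m. rewrite /e /aN -/y. ring. }
  rewrite HTb HT0.
  have -> : Series e + (J0 x - b * N0ser x) - J0 x - b * - N0ser x = Series e by ring.
  apply: Rle_trans (Series_Rabs _ HexE) _.
  rewrite Rmult_comm -Series_scal_l. apply: Series_le.
  - move=> m. split; [exact: Rabs_pos | exact: He].
  - exact: (ex_series_scal (K := R_AbsRing) (V := R_NormedModule) (b ^ 2)).
Qed.

Lemma besselT_0 (x : R) : besselT x 0 = J0 x.
Proof.
  apply: Series_ext => m. have -> : prodh 0 m = 1.
  { elim: m => [//|m IH]. change (prodh 0 m * (1 + 0 / INR (S m)) = 1). rewrite IH /Rdiv. ring. }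
  rewrite Rinv_1. rewrite /=. ring.
Qed.

(** The Neumann function [Y_0] in its classical expansion; [- gamma1] is Euler's constant. *)
Definition Y0 (x : R) : R := 2 / PI * ((ln (x / 2) - gamma1) * J0 x - N0ser x).

(** The three terms of [Y0] are the derivatives in the order of the three factors of [besselJ]: the
    logarithm from [(x / 2) ^ b], Euler's constant from [1 / Gamma (1 + b)] and [N0ser] from
    [besselT]. *)
Lemma besselJ_order_derive (x : R) : 0 < x ->
  is_derive (fun b => besselJ b x) 0 (PI / 2 * Y0 x) /\ besselJ 0 x = J0 x.
Proof.
  move=> Hx. have HP := PI_RGT_0.
  have [K HK] := Gamma_near_1.
  have HG0 : Gamma (1 + 0) = 1 by rewrite Rplus_0_r Gamma_1.
  have HG : is_derive (fun b => Gamma (1 + b)) 0 gamma1.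
  { apply: (is_derive_quadratic _ _ K) => b Hb. rewrite HG0. exact: HK. }
  have Hpw : is_derive (fun b => Rpower (x / 2) b) 0 (ln (x / 2)).
  { rewrite /Rpower. auto_derive => //. rewrite Rmult_0_l exp_0. ring. }
  split.
  - apply: (is_derive_ext_loc (fun b => Rpower (x / 2) b / Gamma (1 + b) * besselT x b)).
    { have Hh : 0 < 1 / 2 by lra. exists (mkposreal _ Hh) => b.
      rewrite /ball /= /AbsRing_ball /abs /minus /plus /opp /= Ropp_0 Rplus_0_r => Hb.
      rewrite besselJ_factor //. lra. }
    have Hne : Gamma (1 + 0) <> 0 by rewrite HG0; lra.
    have Hq := is_derive_div _ _ _ _ _ Hpw HG Hne.
    have Hm := is_derive_mult (K := R_AbsRing) _ _ _ _ _ Hq (besselT_derive x) Rmult_comm.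
    apply: eq_ind Hm _ _.
    rewrite /plus /mult /= HG0 besselT_0 Rpower_O; last lra. rewrite /Y0. field. lra.
  - rewrite besselJ_factor //; last by rewrite Rabs_R0; lra.
    rewrite HG0 besselT_0 Rpower_O; lra.
Qed.

Lemma slope_lim (f : R -> R) (l : R) : is_derive f 0 l -> f 0 = 0 ->
  filterlim (fun t => f t / t) (locally' 0) (locally l).
Proof.
  move=> /is_derive_Reals Hd H0. apply/filterlim_locally => e.
  have [d Hd'] := Hd e (cond_pos e). exists d => t Ht Ht0.
  have := Hd' t Ht0. rewrite H0 Rplus_0_l Rminus_0_r. apply.
  move: Ht. rewrite /ball /= /AbsRing_ball /abs /minus /plus /opp /=. by rewrite Ropp_0 Rplus_0_r.
Qed.

(** Near order [0] the real part of the quotient is [J_b]. In the imaginary part, numerator and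
    denominator both vanish at [b = 0] and the limit is the quotient of their derivatives; [J_b] and
    [- J_(-b)] contribute equally, giving [PI Y0 / PI]. *)
Lemma hankel1_0 (x : R) : 0 < x -> hankel1 0 x = (J0 x, Y0 x).
Proof.
  move=> Hx. have HP := PI_RGT_0. have [HJ HJ0] := besselJ_order_derive x Hx.
  rewrite /hankel1. case: excluded_middle_informative => [_ | H]; last by case: H; exists 0%Z.
  apply: (@iota_filterlim_locally R_AbsRing C_R_CompleteNormedModule R (locally' 0)
    (Proper_StrongProper _ (Rbar_locally'_filter (Finite 0)))).
  set phi := fun b => besselJ b x * cos (b * PI) - besselJ (- b) x.
  have Hphi : is_derive phi 0 (PI * Y0 x).
  { have Hneg : is_derive (fun b => besselJ (- b) x) 0 (- (PI / 2 * Y0 x)).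
    { have := is_derive_comp (V := R_NormedModule) (fun b => besselJ b x) Ropp 0 (PI / 2 * Y0 x) (- 1).
      rewrite /scal /= /mult /= Ropp_0. have -> : -1 * (PI / 2 * Y0 x) = - (PI / 2 * Y0 x) by ring.
      apply => //. auto_derive => //. }
    have Hcos : is_derive (fun b => cos (b * PI)) 0 0.
    { auto_derive => //. rewrite Rmult_0_l sin_0. ring. }
    have Hm := is_derive_mult (K := R_AbsRing) _ _ _ _ _ HJ Hcos Rmult_comm.
    have Hmin := is_derive_minus (V := R_NormedModule) _ _ _ _ _ Hm Hneg.
    apply: eq_ind Hmin _ _.
    rewrite /minus /plus /mult /opp /= Rmult_0_l cos_0. field. }
  have Hphi0 : phi 0 = 0 by rewrite /phi Rmult_0_l cos_0 Ropp_0; ring.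
  have Hsin : is_derive (fun b => sin (b * PI)) 0 PI.
  { auto_derive => //. rewrite Rmult_0_l cos_0. ring. }
  have Hsin0 : sin (0 * PI) = 0 by rewrite Rmult_0_l sin_0.
  have Hnz : locally' 0 (fun b : R => sin (b * PI) <> 0 /\ b <> 0).
  { have Hh : 0 < 1 / 2 by lra. exists (mkposreal _ Hh) => b.
    rewrite /ball /= /AbsRing_ball /abs /minus /plus /opp /= Ropp_0 Rplus_0_r => Hb Hb0. split => //.
    have [h1 h2] := Rabs_def2 _ _ Hb.
    case: (Rlt_dec 0 b) => Hs.
    - apply: Rgt_not_eq. apply: sin_gt_0; nra.
    - apply: Rlt_not_eq. have -> : b * PI = - (- b * PI) by ring. rewrite sin_neg.
      have := sin_gt_0 (- b * PI). nra. }
  apply (filterlim_ext_loc (F := locally' 0) (fun b => ((besselJ b x, (phi b / b) * / (sin (b * PI) / b)) : C))).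
  { apply: filter_imp Hnz => b [Hs Hb]. rewrite /hankel1_nonint /eiC.
    have -> : - b * PI = - (b * PI) by ring. rewrite cos_neg sin_neg /phi.
    apply: injective_projections; rewrite /rscal /=; field; repeat split => //; nra. }
  have Hc : filterlim (fun b => besselJ b x) (locally' 0) (locally (besselJ 0 x)).
  { apply: filterlim_filter_le_1 (ex_derive_continuousR _ _ (ex_intro _ _ HJ)). exact: filter_le_within. }
  apply: filterlim_C => /=.
  - by rewrite -HJ0.
  - have -> : Y0 x = PI * Y0 x * / PI by field; lra.
    apply: fl_mult; first exact: slope_lim.
    apply: (fl_cont _ _ Rinv); first exact: (slope_lim (fun b => sin (b * PI))).
    apply: continuous_Rinv. lra.
Qed.

Lemma Gd_2 (k0 : R) (r : vec) : 0 < k0 -> 0 < vnorm r ->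
  Gd 2 k0 r = (- Y0 (k0 * vnorm r) / 4, J0 (k0 * vnorm r) / 4).
Proof.
  move=> Hk Hr. have Hx : 0 < k0 * vnorm r by exact: Rmult_lt_0_compat.
  have HP := PI_RGT_0.
  rewrite /Gd /hankel1_check. move: (k0 * vnorm r) Hx => x Hx.
  have -> : INR 2 / 2 - 1 = 0 by rewrite /=; field.
  rewrite hankel1_0 // Ropp_0 !Rpower_O //; last by apply: Rdiv_lt_0_compat; [apply: pow_lt | lra].
  apply: injective_projections; rewrite /rscal /=; field.
Qed.

(** * The frequency integral *)

(** The four pieces of [Bs] and [Bc] at [w = 0], common to both poles. The second letter names the
    factor [eps] or [s] of the numerator, the third one names [sin] or [cos]. *)
Definition jes (w0 eps a : R) : R := RInt (fun s => eps * sin (w0 * s) / (eps ^ 2 + s ^ 2)) 0 a.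
Definition jsc (w0 eps a : R) : R := RInt (fun s => s * cos (w0 * s) / (eps ^ 2 + s ^ 2)) 0 a.
Definition jec (w0 eps a : R) : R := RInt (fun s => eps * cos (w0 * s) / (eps ^ 2 + s ^ 2)) 0 a.
Definition jss (w0 eps a : R) : R := RInt (fun s => s * sin (w0 * s) / (eps ^ 2 + s ^ 2)) 0 a.

(* With [f] and [g] the pole integrals at [-w0] and [w0]: real and imaginary part of [g - f], then of [g + f]. *)
Definition mR (w0 eps a : R) : R :=
  cos (w0 * a) * (g0v eps w0 - f0v eps w0 + 2 * jes w0 eps a) - 2 * sin (w0 * a) * jec w0 eps a.
Definition mI (w0 eps a : R) : R :=
  sin (w0 * a) * (g0v eps w0 + f0v eps w0 - 2 * jsc w0 eps a) + 2 * cos (w0 * a) * jss w0 eps a.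
Definition pR (w0 eps a : R) : R :=
  cos (w0 * a) * (g0v eps w0 + f0v eps w0 - 2 * jsc w0 eps a) - 2 * sin (w0 * a) * jss w0 eps a.
Definition pI (w0 eps a : R) : R :=
  sin (w0 * a) * (g0v eps w0 - f0v eps w0 + 2 * jes w0 eps a) + 2 * cos (w0 * a) * jec w0 eps a.

Lemma quot_continuous (eps : R) (f : R -> R) (s : R) : 0 < eps -> continuous f s ->
  continuous (fun s => f s / (eps ^ 2 + s ^ 2)) s.
Proof. move=> He Hf. have Hp := sumsq_pos eps s He. ctn => //. simpl in *. lra. Qed.

Lemma j_continuous (w0 eps : R) : 0 < eps ->
  (forall s : R, continuous (fun s : R => eps * sin (w0 * s) / (eps ^ 2 + s ^ 2)) s) /\
  (forall s : R, continuous (fun s : R => s * cos (w0 * s) / (eps ^ 2 + s ^ 2)) s) /\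
  (forall s : R, continuous (fun s : R => eps * cos (w0 * s) / (eps ^ 2 + s ^ 2)) s) /\
  (forall s : R, continuous (fun s : R => s * sin (w0 * s) / (eps ^ 2 + s ^ 2)) s).
Proof.
  move=> He. split; [|split; [|split]] => s;
  [apply: (quot_continuous eps (fun s => eps * sin (w0 * s))) | apply: (quot_continuous eps (fun s => s * cos (w0 * s)))
  | apply: (quot_continuous eps (fun s => eps * cos (w0 * s))) | apply: (quot_continuous eps (fun s => s * sin (w0 * s)))] => //;
  ctn.
Qed.

Lemma Bs_j (w0 eps a : R) : 0 < eps ->
  Bs eps w0 0 a = jes w0 eps a - jsc w0 eps a /\ Bs eps (- w0) 0 a = - jes w0 eps a - jsc w0 eps a.
Proof.
  move=> He. have [h1 [h2 _]] := j_continuous w0 eps He.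
  have e1 := ex_RInt_cont _ 0 a h1. have e2 := ex_RInt_cont _ 0 a h2.
  have H1 : bds eps w0 0 = (fun s => eps * sin (w0 * s) / (eps ^ 2 + s ^ 2) - s * cos (w0 * s) / (eps ^ 2 + s ^ 2)) :> (R -> R).
  { apply: FunctionalExtensionality.functional_extensionality => s. rewrite /bds Rmult_0_r exp_0.
    have -> : (0 - w0) * s = - (w0 * s) by ring. rewrite sin_neg cos_neg /Rdiv. ring. }
  have H2 : bds eps (- w0) 0 = (fun s => - (eps * sin (w0 * s) / (eps ^ 2 + s ^ 2)) - s * cos (w0 * s) / (eps ^ 2 + s ^ 2)) :> (R -> R).
  { apply: FunctionalExtensionality.functional_extensionality => s. rewrite /bds Rmult_0_r exp_0.
    have -> : (0 - - w0) * s = w0 * s by ring. rewrite /Rdiv. ring. }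
  rewrite /Bs H1 H2 /jes /jsc. split.
  - by rewrite RInt_minusR.
  - rewrite RInt_minusR //; last exact: (ex_RInt_opp (V := R_NormedModule)). by rewrite RInt_oppR.
Qed.

Lemma Bc_j (w0 eps a : R) : 0 < eps ->
  Bc eps w0 0 a = - jec w0 eps a - jss w0 eps a /\ Bc eps (- w0) 0 a = - jec w0 eps a + jss w0 eps a.
Proof.
  move=> He. have [_ [_ [h1 h2]]] := j_continuous w0 eps He.
  have e1 := ex_RInt_cont _ 0 a h1. have e2 := ex_RInt_cont _ 0 a h2.
  have H1 : bdc eps w0 0 = (fun s => - (eps * cos (w0 * s) / (eps ^ 2 + s ^ 2)) - s * sin (w0 * s) / (eps ^ 2 + s ^ 2)) :> (R -> R).
  { apply: FunctionalExtensionality.functional_extensionality => s. rewrite /bdc Rmult_0_r exp_0.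
    have -> : (0 - w0) * s = - (w0 * s) by ring. rewrite sin_neg cos_neg /Rdiv. ring. }
  have H2 : bdc eps (- w0) 0 = (fun s => - (eps * cos (w0 * s) / (eps ^ 2 + s ^ 2)) + s * sin (w0 * s) / (eps ^ 2 + s ^ 2)) :> (R -> R).
  { apply: FunctionalExtensionality.functional_extensionality => s. rewrite /bdc Rmult_0_r exp_0.
    have -> : (0 - - w0) * s = w0 * s by ring. rewrite /Rdiv. ring. }
  have e3 := ex_RInt_opp (V := R_NormedModule) _ _ _ e1.
  rewrite /Bc H1 H2 /jec /jss. split.
  - by rewrite RInt_minusR // RInt_oppR.
  - by rewrite RInt_plusR // RInt_oppR.
Qed.

(* [2 pi] times the real and imaginary part of the frequency integral in dimension [d]. *)
Definition hR (d : nat) (w0 eps a : R) : R :=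
  match d with
  | 1%nat => 2 * momR eps a 0 + w0 * mR w0 eps a
  | 2%nat => 2 * momR eps a 1 + w0 ^ 2 * pR w0 eps a
  | _ => 2 * momR eps a 2 + 2 * w0 ^ 2 * momR eps a 0 + w0 ^ 3 * mR w0 eps a
  end.
Definition hI (d : nat) (w0 eps a : R) : R :=
  match d with
  | 1%nat => 2 * momI eps a 0 + w0 * mI w0 eps a
  | 2%nat => 2 * momI eps a 1 + w0 ^ 2 * pI w0 eps a
  | _ => 2 * momI eps a 2 + 2 * w0 ^ 2 * momI eps a 0 + w0 ^ 3 * mI w0 eps a
  end.

Lemma innerC_h (d : nat) (w0 eps a : R) : (1 <= d <= 3)%nat -> 0 < eps ->
  innerC d w0 eps a = (/ (2 * PI) * hR d w0 eps a, / (2 * PI) * hI d w0 eps a).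
Proof.
  move=> Hd He. have [b1 b2] := Bs_j w0 eps a He. have [b3 b4] := Bc_j w0 eps a He.
  have hs : sin (- w0 * a) = - sin (w0 * a) by rewrite -sin_neg; congr sin; ring.
  have hc : cos (- w0 * a) = cos (w0 * a) by rewrite -cos_neg; congr cos; ring.
  rewrite /innerC /pole b1 b2 b3 b4 hs hc. cbn [fst snd].
  case: d Hd => [|[|[|[|d]]]] Hd; try lia;
    rewrite /pole_value /hR /hI /mR /mI /pR /pI; congr pair; congr Rmult; ring.
Qed.

Lemma j_parity (w0 eps a : R) : 0 < eps ->
  jes w0 eps (- a) = jes w0 eps a /\ jsc w0 eps (- a) = jsc w0 eps a /\
  jec w0 eps (- a) = - jec w0 eps a /\ jss w0 eps (- a) = - jss w0 eps a.
Proof.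
  move=> He. have [h1 [h2 [h3 h4]]] := j_continuous w0 eps He.
  have gen : forall (f : R -> R) (sg : R), (forall s, continuous f s) -> (forall s, f (- s) = sg * f s) ->
     RInt f 0 (- a) = - sg * RInt f 0 a.
  { move=> f sg Hf Hs.
    have Hex := ex_RInt_cont _ 0 a Hf.
    have H1 : is_RInt (fun w => scal (-1) (f (-1 * w + 0))) 0 a (RInt f 0 (- a)).
    { apply: (is_RInt_comp_lin (V := R_NormedModule)).
      have -> : -1 * 0 + 0 = 0 by ring. have -> : -1 * a + 0 = - a by ring.
      apply: (RInt_correct (V := R_CompleteNormedModule)). exact: ex_RInt_cont. }
    rewrite -(is_RInt_unique _ _ _ _ H1) -RInt_scalR //. apply: RInt_ext => s _.
    have -> : -1 * s + 0 = - s by ring. rewrite Hs /scal /= /mult /=. rring. }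
  rewrite /jes /jsc /jec /jss.
  have Hsn : forall s, sin (w0 * - s) = - sin (w0 * s) by move=> s; rewrite -sin_neg; congr sin; ring.
  have Hcn : forall s, cos (w0 * - s) = cos (w0 * s) by move=> s; rewrite -cos_neg; congr cos; ring.
  have Hq : forall s : R, (- s) ^ 2 = s ^ 2 by move=> s; ring.
  rewrite (gen _ (-1) h1) ?(gen _ (-1) h2) ?(gen _ 1 h3) ?(gen _ 1 h4); try by (move=> s; rewrite Hq ?Hsn ?Hcn /Rdiv; ring).
  repeat split; ring.
Qed.

Lemma mom_parity (eps a : R) (n : nat) : momR eps (- a) n = momR eps a n /\ momI eps (- a) n = - momI eps a n.
Proof.
  have H2 : (- a) ^ 2 = a ^ 2 by ring.
  have Hp : zp eps (- a) = zp eps a by rewrite /zp H2.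
  have Hq : zq eps (- a) = - zq eps a by rewrite /zq H2 /Rdiv; ring.
  rewrite /momR /momI Hp Hq. case: n => [|[|n]]; split; ring.
Qed.

Lemma h_parity (d : nat) (w0 eps a : R) : 0 < eps ->
  hR d w0 eps (- a) = hR d w0 eps a /\ hI d w0 eps (- a) = - hI d w0 eps a.
Proof.
  move=> He. have [j1 [j2 [j3 j4]]] := j_parity w0 eps a He.
  have M := mom_parity eps a.
  have Hsn : sin (w0 * - a) = - sin (w0 * a) by rewrite -sin_neg; congr sin; ring.
  have Hcn : cos (w0 * - a) = cos (w0 * a) by rewrite -cos_neg; congr cos; ring.
  rewrite /hR /hI /mR /mI /pR /pI j1 j2 j3 j4 Hsn Hcn !(proj1 (M _)) !(proj2 (M _)).
  case: d => [|[|[|d]]]; split; ring.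
Qed.

Lemma j_derive (w0 eps a : R) : 0 < eps ->
  is_derive (jes w0 eps) a (eps * sin (w0 * a) / (eps ^ 2 + a ^ 2)) /\
  is_derive (jsc w0 eps) a (a * cos (w0 * a) / (eps ^ 2 + a ^ 2)) /\
  is_derive (jec w0 eps) a (eps * cos (w0 * a) / (eps ^ 2 + a ^ 2)) /\
  is_derive (jss w0 eps) a (a * sin (w0 * a) / (eps ^ 2 + a ^ 2)).
Proof.
  move=> He. have [h1 [h2 [h3 h4]]] := j_continuous w0 eps He.
  split; [|split; [|split]];
  [exact: (is_derive_RInt_upper _ 0 a h1) | exact: (is_derive_RInt_upper _ 0 a h2)
  | exact: (is_derive_RInt_upper _ 0 a h3) | exact: (is_derive_RInt_upper _ 0 a h4)].
Qed.

(** Differentiation in [a] multiplies the integrand by [i w], and [w / (w - q) = 1 + q / (w - q)].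
    Hence the pole integrals solve a linear oscillator system driven by the zeroth moment. *)
Lemma mp_derive (w0 eps a : R) : 0 < eps ->
  is_derive (mR w0 eps) a (- w0 * pI w0 eps a) /\
  is_derive (pI w0 eps) a (w0 * mR w0 eps a + 2 * zp eps a) /\
  is_derive (mI w0 eps) a (w0 * pR w0 eps a) /\
  is_derive (pR w0 eps) a (- w0 * mI w0 eps a - 2 * zq eps a).
Proof.
  move=> He. have [h1 [h2 [h3 h4]]] := j_derive w0 eps a He.
  have Hp := sumsq_pos eps a He.
  have Hsc : sin (w0 * a) ^ 2 + cos (w0 * a) ^ 2 = 1 by rewrite -(sin2_cos2 (w0 * a)) /Rsqr; ring.
  have Hc : forall f df, is_derive f a df -> is_derive (fun a => cos (w0 * a) * f a) a (- w0 * sin (w0 * a) * f a + cos (w0 * a) * df).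
  { move=> f df Hf. have Hcos : is_derive (fun a => cos (w0 * a)) a (- w0 * sin (w0 * a)) by auto_derive => //; ring.
    exact: (is_derive_mult (K := R_AbsRing) _ _ _ _ _ Hcos Hf Rmult_comm). }
  have Hs : forall f df, is_derive f a df -> is_derive (fun a => sin (w0 * a) * f a) a (w0 * cos (w0 * a) * f a + sin (w0 * a) * df).
  { move=> f df Hf. have Hsin : is_derive (fun a => sin (w0 * a)) a (w0 * cos (w0 * a)) by auto_derive => //; ring.
    exact: (is_derive_mult (K := R_AbsRing) _ _ _ _ _ Hsin Hf Rmult_comm). }
  have Haff : forall f df k m, is_derive f a df -> is_derive (fun a => k + m * f a) a (m * df).
  { move=> f df k m Hf. have -> : m * df = 0 + m * df by ring.
    apply: (is_derive_plus (V := R_NormedModule)); [exact: is_derive_const | exact: is_derive_scal]. }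
  have Hmin : forall f g df dg e, is_derive f a df -> is_derive g a dg -> df - dg = e -> is_derive (fun a => f a - g a) a e.
  { move=> f g df dg e Hf Hg <-. exact: (is_derive_minus (V := R_NormedModule)). }
  have Hpl : forall f g df dg e, is_derive f a df -> is_derive g a dg -> df + dg = e -> is_derive (fun a => f a + g a) a e.
  { move=> f g df dg e Hf Hg <-. exact: (is_derive_plus (V := R_NormedModule)). }
  split; [|split; [|split]].
  - apply: (is_derive_ext (fun a => cos (w0 * a) * (g0v eps w0 - f0v eps w0 + 2 * jes w0 eps a) - sin (w0 * a) * (0 + 2 * jec w0 eps a))).
    { move=> t. rewrite /mR. rring. }
    apply: Hmin; [apply: Hc; exact: Haff h1 | apply: Hs; exact: Haff h3 |].
    rewrite /pI /Rdiv. ring.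
  - apply: (is_derive_ext (fun a => sin (w0 * a) * (g0v eps w0 - f0v eps w0 + 2 * jes w0 eps a) + cos (w0 * a) * (0 + 2 * jec w0 eps a))).
    { move=> t. rewrite /pI. rring. }
    apply: Hpl; [apply: Hs; exact: Haff h1 | apply: Hc; exact: Haff h3 |].
    rewrite /mR /zp. transitivity (w0 * mR w0 eps a + 2 * (eps * (sin (w0 * a) ^ 2 + cos (w0 * a) ^ 2) / (eps ^ 2 + a ^ 2))).
    + rewrite /mR. field. simpl in Hp. lra.
    + rewrite Hsc /mR. field. simpl in Hp. lra.
  - apply: (is_derive_ext (fun a => sin (w0 * a) * (g0v eps w0 + f0v eps w0 + (-2) * jsc w0 eps a) + cos (w0 * a) * (0 + 2 * jss w0 eps a))).
    { move=> t. rewrite /mI. rring. }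
    apply: Hpl; [apply: Hs; exact: Haff h2 | apply: Hc; exact: Haff h4 |].
    rewrite /pR /Rdiv. ring.
  - apply: (is_derive_ext (fun a => cos (w0 * a) * (g0v eps w0 + f0v eps w0 + (-2) * jsc w0 eps a) - sin (w0 * a) * (0 + 2 * jss w0 eps a))).
    { move=> t. rewrite /pR. rring. }
    apply: Hmin; [apply: Hc; exact: Haff h2 | apply: Hs; exact: Haff h4 |].
    transitivity (- w0 * mI w0 eps a - 2 * (a * (sin (w0 * a) ^ 2 + cos (w0 * a) ^ 2) / (eps ^ 2 + a ^ 2))).
    + rewrite /mI. field. simpl in Hp. lra.
    + rewrite Hsc /zq. field. simpl in Hp. lra.
Qed.

(* [u . 1_d . v]. *)
Definition dotd (d : nat) (u v : vec) : R :=
  match d with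
  | 1%nat => u 0%nat * v 0%nat
  | 2%nat => u 0%nat * v 0%nat + u 1%nat * v 1%nat
  | _ => dot u v
  end.

(** * Radial functions and the dyadic form *)

Definition kron (l m : nat) : R := if Nat.eqb l m then 1 else 0.

Lemma dot_vupd (r : vec) (l : nat) (t : R) : (l < 3)%nat ->
  dot (vupd r l t) (vupd r l t) = dot r r - r l ^ 2 + t ^ 2.
Proof. move=> Hl. case: l Hl => [|[|[|l]]] Hl; try lia; rewrite /dot /vupd /=; ring. Qed.

Lemma vupd_id (r : vec) (l : nat) (k : nat) : vupd r l (r l) k = r k.
Proof. rewrite /vupd. by case: Nat.eqb_spec => [->|]. Qed.

Lemma vnorm_vupd_id (r : vec) (l : nat) : vnorm (vupd r l (r l)) = vnorm r.
Proof. by rewrite /vnorm /dot !vupd_id. Qed.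

Lemma radial_derive (phi phi1 : R -> R) (r : vec) (l : nat) (t : R) : (l < 3)%nat ->
  0 < vnorm (vupd r l t) -> (forall x, 0 < x -> is_derive phi x (phi1 x)) ->
  is_derive (fun t => phi (vnorm (vupd r l t))) t
    (phi1 (vnorm (vupd r l t)) * (t / vnorm (vupd r l t))).
Proof.
  move=> Hl Hpos Hphi.
  have Hs : 0 < dot (vupd r l t) (vupd r l t).
  { apply: Rnot_le_lt => Hle. move: Hpos. rewrite /vnorm sqrt_neg_0 //. lra. }
  have Hin : is_derive (fun t => vnorm (vupd r l t)) t (t / vnorm (vupd r l t)).
  { apply: (is_derive_ext (fun t => sqrt (dot r r - r l ^ 2 + t ^ 2))).
    { move=> s. by rewrite /vnorm dot_vupd. }
    rewrite /vnorm !dot_vupd // in Hs Hpos *.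
    auto_derive; first by simpl in Hs.
    have Hs' := Hpos. field_simplify_eq; first (simpl; ring). simpl in *. lra. }
  have := is_derive_comp (V := R_NormedModule) phi _ t _ _ (Hphi _ Hpos) Hin.
  rewrite /scal /= /mult /= Rmult_comm. apply.
Qed.

Lemma vnorm_locally (r : vec) (l : nat) : (l < 3)%nat -> 0 < vnorm r ->
  locally (r l) (fun t => 0 < vnorm (vupd r l t)).
Proof.
  move=> Hl Hr.
  have Hc : continuous (fun t => vnorm (vupd r l t)) (r l).
  { apply: ex_derive_continuousR. eexists. apply: (radial_derive (fun x => x) (fun _ => 1)) => //.
    - by rewrite vnorm_vupd_id.
    - move=> x _. exact: is_derive_id. }
  apply: (Hc (fun y => 0 < y)). rewrite vnorm_vupd_id. exact: open_gt.
Qed.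

(** The Hessian of [phi(|r|)], with [phi1] and [phi2] the first two derivatives of [phi]. *)
Definition hess (phi1 phi2 : R -> R) (r : vec) (l m : nat) : R :=
  (phi2 (vnorm r) / vnorm r ^ 2 - phi1 (vnorm r) / vnorm r ^ 3) * (r l * r m)
    + phi1 (vnorm r) / vnorm r * kron l m.

Lemma radial_hessian (phi phi1 phi2 : R -> R) (F : vec -> R) (r : vec) (l m : nat) :
  (l < 3)%nat -> (m < 3)%nat -> 0 < vnorm r ->
  (forall x, 0 < x -> is_derive phi x (phi1 x)) ->
  (forall x, 0 < x -> is_derive phi1 x (phi2 x)) ->
  (forall r, 0 < vnorm r -> F r = phi (vnorm r)) ->
  Derive (fun t => Derive (fun s => F (vupd (vupd r l t) m s)) (vupd r l t m)) (r l) = hess phi1 phi2 r l m.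
Proof.
  move=> Hl Hm Hr H1 H2 HF.
  have HD : forall v, 0 < vnorm v -> Derive (fun s => F (vupd v m s)) (v m) = phi1 (vnorm v) / vnorm v * v m.
  { move=> v Hv. apply: is_derive_unique.
    apply: (is_derive_ext_loc (fun s => phi (vnorm (vupd v m s)))).
    { apply: filter_imp (vnorm_locally v m Hm Hv) => s Hs. by rewrite HF. }
    have := radial_derive phi phi1 v m (v m) Hm. rewrite vnorm_vupd_id => /(_ Hv H1) H.
    apply: eq_ind H _ _. field. lra. }
  apply: is_derive_unique.
  apply: (is_derive_ext_loc (fun t => phi1 (vnorm (vupd r l t)) / vnorm (vupd r l t) * vupd r l t m)).
  { apply: filter_imp (vnorm_locally r l Hl Hr) => t Ht. by rewrite HD. }
  have Hg : forall x, 0 < x -> is_derive (fun x => phi1 x / x) x (phi2 x / x - phi1 x / x ^ 2).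
  { move=> x Hx. have Hid : is_derive (fun x : R => x) x 1 by exact: is_derive_id.
    have := is_derive_div _ _ _ _ _ (H2 x Hx) Hid ltac:(lra) => H.
    apply: eq_ind H _ _. field. lra. }
  have Hd1 := radial_derive (fun x => phi1 x / x) (fun x => phi2 x / x - phi1 x / x ^ 2) r l (r l) Hl.
  rewrite vnorm_vupd_id in Hd1. have {}Hd1 := Hd1 Hr Hg.
  have Hd2 : is_derive (fun t => vupd r l t m) (r l) (kron l m).
  { rewrite /vupd /kron Nat.eqb_sym. case: Nat.eqb; [exact: is_derive_id | exact: is_derive_const]. }
  have := is_derive_mult (K := R_AbsRing) _ _ _ _ _ Hd1 Hd2 Rmult_comm => H.
  apply: eq_ind H _ _. rewrite /plus /mult /= /hess vupd_id vnorm_vupd_id. field. lra.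
Qed.

(** Contraction of [hess] with both dipoles. Since [r] lies in the span of the first [d] axes, the
    partial sums of [mu_l r_l] are already the full scalar products, and only the Kronecker term
    sees the projection [dotd]. *)
Lemma dyadic_radial (d : nat) (k0 : R) (mu nu r : vec) (phi phi1 phi2 psi psi1 psi2 : R -> R) :
  (1 <= d <= 3)%nat -> in_Rd d r -> 0 < vnorm r ->
  (forall x, 0 < x -> is_derive phi x (phi1 x)) -> (forall x, 0 < x -> is_derive phi1 x (phi2 x)) ->
  (forall x, 0 < x -> is_derive psi x (psi1 x)) -> (forall x, 0 < x -> is_derive psi1 x (psi2 x)) ->
  (forall r, 0 < vnorm r -> Gd d k0 r = (phi (vnorm r), psi (vnorm r))) ->
  let R0 := vnorm r in let M := dot mu r * dot nu r / R0 ^ 2 in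
  dyadic_form d k0 mu nu r =
    (dot mu nu * phi R0 + / k0 ^ 2 * (M * phi2 R0 + (dotd d mu nu - M) * (phi1 R0 / R0)),
     dot mu nu * psi R0 + / k0 ^ 2 * (M * psi2 R0 + (dotd d mu nu - M) * (psi1 R0 / R0))).
Proof.
  move=> Hd Hin Hr P1 P2 S1 S2 HG R0 M.
  have HC : forall l m, (l < 3)%nat -> (m < 3)%nat ->
     partialC l (partialC m (Gd d k0)) r = (hess phi1 phi2 r l m, hess psi1 psi2 r l m).
  { move=> l m Hl Hm. rewrite /partialC /=. congr pair.
    - apply: (radial_hessian phi _ _ (fun v => fst (Gd d k0 v))) => // v Hv. by rewrite HG.
    - apply: (radial_hessian psi _ _ (fun v => snd (Gd d k0 v))) => // v Hv. by rewrite HG. }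
  have HR0 : R0 <> 0 by rewrite /R0; lra.
  rewrite /dyadic_form HG // -/R0. move: (/ k0 ^ 2) => ik.
  case: d Hd Hin HG HC => [|[|[|[|d]]]] Hd Hin HG HC; try lia; cbn [seq map fold_right]; rewrite !HC; try lia;
    rewrite /hess -/R0 /M /kron; clear M; move: (phi2 R0) (phi1 R0) (phi R0) (psi2 R0) (psi1 R0) (psi R0) HR0 => f2 f1 f0 g2 g1 g0;
    move: R0 => R0 HR0.
  - have h1 : r 1%nat = 0 by apply: Hin; lia. have h2 : r 2%nat = 0 by apply: Hin; lia.
    rewrite /dotd /dot h1 h2. apply: injective_projections; rewrite /rscal /=; field; lra.
  - have h2 : r 2%nat = 0 by apply: Hin; lia.
    rewrite /dotd /dot h2. apply: injective_projections; rewrite /rscal /=; field; lra.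
  - rewrite /dotd /dot. apply: injective_projections; rewrite /rscal /=; field; lra.
Qed.

(* The integral over unit vectors [k] of [(mu . (1_3 - k k) . nu) h (k . r)] when the polar axis points along [r], with
   [rho = |r|], [D = mu . nu], [Dd = mu . 1_d . nu] and [M = (mu . r) (nu . r) / |r|^2]; the azimuth is integrated out. *)
Definition ang (d : nat) (D Dd M rho : R) (h : R -> R) : R :=
  match d with
  | 1%nat => (D - M) * (h rho + h (- rho))
  | 2%nat => RInt (fun th => (D - M * cos th ^ 2 - (Dd - M) * sin th ^ 2) * h (rho * cos th)) 0 (2 * PI)
  | _ => PI * RInt (fun u => (2 * D - 2 * M * u ^ 2 - (Dd - M) * (1 - u ^ 2)) * h (rho * u)) (-1) 1
  end.

Definition contdiff (h : R -> R) : Prop := exists dh, (forall x, is_derive h x (dh x)) /\ (forall x, continuous dh x).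

Lemma solid_int_ext (d : nat) (F G : vec -> C) : (forall k, F k = G k) -> solid_int d F = solid_int d G.
Proof. move=> H. by have -> : F = G by apply: FunctionalExtensionality.functional_extensionality. Qed.

(** A property of [d], so that [reduction] can be shared while the proofs differ: a reflection for
    [d = 1], a shift of the angle for [d = 2], a flow of rotations for [d = 3]. The pair [hr], [hi]
    is the real and imaginary part of the frequency integral as a function of [k . r]. *)
Definition aligned (d : nat) : Prop := forall (mu nu r : vec) (kappa : R) (hr hi : R -> R),
  in_Rd d r -> 0 < vnorm r -> contdiff hr -> contdiff hi ->
  let D := dot mu nu in let Dd := dotd d mu nu in
  let M := dot mu r * dot nu r / vnorm r ^ 2 in
  solid_int d (fun k => rscal (transv mu nu k * kappa) (hr (dot k r), hi (dot k r))) =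
    (kappa * ang d D Dd M (vnorm r) hr, kappa * ang d D Dd M (vnorm r) hi).

Lemma RInt_periodic (f : R -> R) (s : R) : (forall t, continuous f t) -> (forall t, f (t + 2 * PI) = f t) ->
  RInt (fun t => f (t + s)) 0 (2 * PI) = RInt f 0 (2 * PI).
Proof.
  move=> Hf Hp. have Hex := fun a b => ex_RInt_cont f a b Hf.
  have H1 : RInt (fun t => f (t + s)) 0 (2 * PI) = RInt f s (2 * PI + s).
  { have := is_RInt_comp_lin (V := R_NormedModule) f 1 s 0 (2 * PI) (RInt f s (2 * PI + s)).
    have -> : 1 * 0 + s = s by ring. have -> : 1 * (2 * PI) + s = 2 * PI + s by ring.
    move/(_ (RInt_correct (V := R_CompleteNormedModule) _ _ _ (Hex _ _))) => H.
    rewrite -(is_RInt_unique _ _ _ _ H). apply: RInt_ext => t _. rewrite /scal /= /mult /= !Rmult_1_l. by []. }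
  have H2 : RInt f (2 * PI) (2 * PI + s) = RInt f 0 s.
  { have := is_RInt_comp_lin (V := R_NormedModule) f 1 (2 * PI) 0 s (RInt f (2 * PI) (2 * PI + s)).
    have -> : 1 * 0 + 2 * PI = 2 * PI by ring. have -> : 1 * s + 2 * PI = 2 * PI + s by ring.
    move/(_ (RInt_correct (V := R_CompleteNormedModule) _ _ _ (Hex _ _))) => H.
    rewrite -(is_RInt_unique _ _ _ _ H). apply: RInt_ext => t _. rewrite /scal /= /mult /= !Rmult_1_l. exact: Hp. }
  rewrite H1 -(RInt_diffR f 0 s (2 * PI + s)) // (RInt_ChaslesR f 0 (2 * PI) (2 * PI + s)) // H2. rring.
Qed.

Lemma contdiff_continuous (h : R -> R) (x : R) : contdiff h -> continuous h x.
Proof. move=> [dh [H _]]. apply: ex_derive_continuousR. by exists (dh x). Qed.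

Lemma RInt_reflect (f : R -> R) : (forall t, continuous f t) -> RInt (fun u => f (- u)) (-1) 1 = RInt f (-1) 1.
Proof.
  move=> Hf. have Hex := fun a b => ex_RInt_cont f a b Hf.
  have := is_RInt_comp_lin (V := R_NormedModule) f (-1) 0 (-1) 1 (RInt f 1 (-1)).
  have -> : -1 * -1 + 0 = 1 by ring. have -> : -1 * 1 + 0 = -1 by ring.
  move/(_ (RInt_correct (V := R_CompleteNormedModule) _ _ _ (Hex _ _))) => H.
  have H2 := is_RInt_opp (V := R_NormedModule) _ _ _ _ H.
  rewrite (RInt_swapR f 1 (-1)) //. apply: is_RInt_unique. apply: is_RInt_ext H2 => u _.
  rewrite /scal /= /mult /= /opp /=. have -> : -1 * u + 0 = - u by ring. rring.
Qed.

(** The weight is invariant under [k -> - k], which is a half turn of the angle for [d = 2] and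
    [u -> - u] for [d = 3]. *)
Lemma ang_odd (d : nat) (D Dd M rho : R) (h : R -> R) : (1 <= d <= 3)%nat ->
  (forall x, continuous h x) -> (forall x, h (- x) = - h x) -> ang d D Dd M rho h = 0.
Proof.
  move=> Hd Hc Ho. case: d Hd => [|[|[|[|d]]]] Hd; try lia.
  - rewrite /= Ho. ring.
  - rewrite /ang. set f := fun th => _.
    have Hf : forall t, continuous f t.
    { move=> t. rewrite /f. apply: ct_mult; first ctn. apply: (ct_comp (fun th => rho * cos th) h) => //. ctn. }
    have H := RInt_periodic f PI Hf.
    have Hopp : RInt (fun t => f (t + PI)) 0 (2 * PI) = - RInt f 0 (2 * PI).
    { rewrite -RInt_oppR; last exact: ex_RInt_cont. apply: RInt_ext => t _.
      rewrite /f !neg_cos !neg_sin. have -> : rho * - cos t = - (rho * cos t) by ring. rewrite Ho. rring. }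
    have Hp : forall t, f (t + 2 * PI) = f t.
    { move=> t. rewrite /f. have -> : t + 2 * PI = t + 2 * INR 1 * PI by rewrite /=; ring.
      by rewrite cos_period sin_period. }
    have {}H := H Hp. rewrite Hopp in H. lra.
  - rewrite /ang. set f := fun u => _.
    have Hf : forall t, continuous f t.
    { move=> t. rewrite /f. apply: ct_mult; first ctn. apply: (ct_comp (fun th => rho * th) h) => //. ctn. }
    have H := RInt_reflect f Hf.
    have Hopp : RInt (fun t => f (- t)) (-1) 1 = - RInt f (-1) 1.
    { rewrite -RInt_oppR; last exact: ex_RInt_cont. apply: RInt_ext => t _.
      rewrite /f. have -> : rho * - t = - (rho * t) by ring. rewrite Ho. rring. }
    rewrite Hopp in H. have -> : RInt f (-1) 1 = 0 by lra. ring.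
Qed.

Lemma contdiff_const (k : R) : contdiff (fun _ => k).
Proof. exists (fun _ => 0). split => x; [exact: is_derive_const | exact: continuous_const]. Qed.

Lemma contdiff_plus (f g : R -> R) : contdiff f -> contdiff g -> contdiff (fun x => f x + g x).
Proof.
  move=> [df [H1 H2]] [dg [H3 H4]]. exists (fun x => df x + dg x). split => x.
  - exact: (is_derive_plus (V := R_NormedModule)).
  - exact: ct_plus.
Qed.

Lemma contdiff_mult (f g : R -> R) : contdiff f -> contdiff g -> contdiff (fun x => f x * g x).
Proof.
  move=> Cf Cg. have hf := fun x => contdiff_continuous f x Cf. have hg := fun x => contdiff_continuous g x Cg.
  case: Cf => [df [H1 H2]]. case: Cg => [dg [H3 H4]]. exists (fun x => df x * g x + f x * dg x). split => x.
  - exact: (is_derive_mult (K := R_AbsRing) _ _ _ _ _ (H1 x) (H3 x) Rmult_comm).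
  - apply: ct_plus; exact: ct_mult.
Qed.

Lemma contdiff_ext (f g : R -> R) : (forall x, f x = g x) -> contdiff f -> contdiff g.
Proof. move=> H [df [H1 H2]]. exists df. split=> // x. exact: is_derive_ext (H1 x). Qed.

Lemma contdiff_pow (f : R -> R) (n : nat) : contdiff f -> contdiff (fun x => f x ^ n).
Proof. move=> Hf. elim: n => [|n IH] /=; [exact: contdiff_const | exact: contdiff_mult]. Qed.

Lemma contdiff_trig (w : R) : contdiff (fun x => cos (w * x)) /\ contdiff (fun x => sin (w * x)).
Proof.
  split; [exists (fun x => - w * sin (w * x)) | exists (fun x => w * cos (w * x))]; split => x.
  - auto_derive => //. ring.
  - ctn.
  - auto_derive => //. ring.
  - ctn.
Qed.

Lemma contdiff_z (eps : R) : 0 < eps -> contdiff (zp eps) /\ contdiff (zq eps).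
Proof.
  move=> He. have Hp := fun a => sumsq_pos eps a He. rewrite /zp /zq.
  split; [exists (fun a => - 2 * eps * a / (eps ^ 2 + a ^ 2) ^ 2) | exists (fun a => (eps ^ 2 - a ^ 2) / (eps ^ 2 + a ^ 2) ^ 2)];
   split => x; have Hx := Hp x.
  - auto_derive; first (simpl in Hx; lra). simpl in *. field. lra.
  - ctn. apply: pow_nonzero. lra.
  - auto_derive; first (simpl in Hx; lra). simpl in *. field. lra.
  - ctn. apply: pow_nonzero. lra.
Qed.

Lemma contdiff_mp (w0 eps : R) : 0 < eps ->
  contdiff (mR w0 eps) /\ contdiff (pI w0 eps) /\ contdiff (mI w0 eps) /\ contdiff (pR w0 eps).
Proof.
  move=> He. have H := fun a => mp_derive w0 eps a He. have [Z1 Z2] := contdiff_z eps He.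
  have c1 : forall a, continuous (mR w0 eps) a by move=> a; apply: ex_derive_continuousR; eexists; exact: (proj1 (H a)).
  have c2 : forall a, continuous (pI w0 eps) a by move=> a; apply: ex_derive_continuousR; eexists; exact: (proj1 (proj2 (H a))).
  have c3 : forall a, continuous (mI w0 eps) a by move=> a; apply: ex_derive_continuousR; eexists; exact: (proj1 (proj2 (proj2 (H a)))).
  have c4 : forall a, continuous (pR w0 eps) a by move=> a; apply: ex_derive_continuousR; eexists; exact: (proj2 (proj2 (proj2 (H a)))).
  have c5 := fun a => contdiff_continuous _ a Z1. have c6 := fun a => contdiff_continuous _ a Z2.
  split; [|split; [|split]].
  - exists (fun a => - w0 * pI w0 eps a). split => a; first exact: (proj1 (H a)).
    exact: (ct_mult _ _ _ (continuous_const _ _) (c2 a)).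
  - exists (fun a => w0 * mR w0 eps a + 2 * zp eps a). split => a; first exact: (proj1 (proj2 (H a))).
    exact: (ct_plus _ _ _ (ct_mult _ _ _ (continuous_const _ _) (c1 a)) (ct_mult _ _ _ (continuous_const _ _) (c5 a))).
  - exists (fun a => w0 * pR w0 eps a). split => a; first exact: (proj1 (proj2 (proj2 (H a)))).
    exact: (ct_mult _ _ _ (continuous_const _ _) (c4 a)).
  - exists (fun a => - w0 * mI w0 eps a - 2 * zq eps a). split => a; first exact: (proj2 (proj2 (proj2 (H a)))).
    exact: (ct_minus _ _ _ (ct_mult _ _ _ (continuous_const _ _) (c3 a)) (ct_mult _ _ _ (continuous_const _ _) (c6 a))).
Qed.

Lemma contdiff_scal (k : R) (f : R -> R) : contdiff f -> contdiff (fun x => k * f x).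
Proof. apply: contdiff_mult. exact: contdiff_const. Qed.

Lemma contdiff_mom (eps : R) (n : nat) : 0 < eps -> contdiff (fun a => momR eps a n) /\ contdiff (fun a => momI eps a n).
Proof.
  move=> He. have [Z1 Z2] := contdiff_z eps He. rewrite /momR /momI.
  case: n => [|[|n]]; split => //.
  - apply: (contdiff_ext (fun a => zp eps a ^ 2 + (-1) * zq eps a ^ 2)); first by move=> x; ring.
    apply: contdiff_plus; [exact: contdiff_pow | apply: contdiff_scal; exact: contdiff_pow].
  - apply: (contdiff_mult (fun a => 2 * zp eps a)) => //. exact: contdiff_scal.
  - apply: contdiff_scal. apply: (contdiff_ext (fun a => zp eps a ^ 3 + (-3) * (zp eps a * zq eps a ^ 2))); first by move=> x; ring.
    apply: contdiff_plus; [exact: contdiff_pow | apply: contdiff_scal; apply: contdiff_mult => //; exact: contdiff_pow].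
  - apply: contdiff_scal. apply: (contdiff_ext (fun a => 3 * (zp eps a ^ 2 * zq eps a) + (-1) * zq eps a ^ 3)); first by move=> x; ring.
    apply: contdiff_plus; [apply: contdiff_scal; apply: contdiff_mult => //; exact: contdiff_pow | apply: contdiff_scal; exact: contdiff_pow].
Qed.

Lemma contdiff_h (d : nat) (w0 eps : R) : 0 < eps -> contdiff (hR d w0 eps) /\ contdiff (hI d w0 eps).
Proof.
  move=> He. have [c1 [c2 [c3 c4]]] := contdiff_mp w0 eps He. have M := fun n => contdiff_mom eps n He.
  rewrite /hR /hI. case: d => [|[|[|d]]]; split; repeat apply: contdiff_plus; apply: contdiff_scal => //; solve [exact: (proj1 (M _)) | exact: (proj2 (M _))].
Qed.

Lemma ang_scal (d : nat) (D Dd M rho k : R) (h : R -> R) : (1 <= d <= 3)%nat -> (forall x, continuous h x) ->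
  ang d D Dd M rho (fun x => k * h x) = k * ang d D Dd M rho h.
Proof.
  move=> Hd Hc. case: d Hd => [|[|[|[|d]]]] Hd; try lia; rewrite /ang.
  - ring.
  - rewrite -RInt_scalR.
    + apply: RInt_ext => t _. rring.
    + apply: ex_RInt_cont => t. apply: ct_mult; first ctn. apply: (ct_comp (fun th => rho * cos th) h) => //. ctn.
  - set f := fun u : R => (2 * D - 2 * M * u ^ 2 - (Dd - M) * (1 - u ^ 2)) * h (rho * u).
    transitivity (PI * RInt (fun u => k * f u) (-1) 1).
    + congr Rmult. apply: RInt_ext => t _. rewrite /f. rring.
    + rewrite RInt_scalR; first ring.
      apply: ex_RInt_cont => t. apply: ct_mult; first ctn. apply: (ct_comp (fun th => rho * th) h) => //. ctn.
Qed.

Definition vscal (k : R) (r : vec) : vec := fun i => k * r i.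

(** The odd parts integrate to zero, so the shift and the decay rate are both real. The claim then
    separates: its real part is a limit statement about the angular integral of [hR], its imaginary
    part an exact identity for the angular integral of [cos (w0 x)]. *)
Lemma reduction (d : nat) (c w0 : R) (mu nu r : vec) (phi phi1 phi2 psi psi1 psi2 : R -> R) (LR : R) :
  aligned d -> (1 <= d <= 3)%nat -> 0 < c -> 0 < w0 -> in_Rd d r -> 0 < vnorm r ->
  (forall x, 0 < x -> is_derive phi x (phi1 x)) -> (forall x, 0 < x -> is_derive phi1 x (phi2 x)) ->
  (forall x, 0 < x -> is_derive psi x (psi1 x)) -> (forall x, 0 < x -> is_derive psi1 x (psi2 x)) ->
  (forall r, 0 < vnorm r -> Gd d (w0 / c) r = (phi (vnorm r), psi (vnorm r))) ->
  let R0 := vnorm r in let D := dot mu nu in let Dd := dotd d mu nu in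
  let M := dot mu r * dot nu r / R0 ^ 2 in let kappa := / (2 * PI) ^ (d - 1) in
  filterlim (fun eps => ang d D Dd M (R0 / c) (hR d w0 eps)) (at_right 0) (locally LR) ->
  kappa / c ^ d * LR =
    4 * PI * (w0 / c) ^ 2 * (D * phi R0 + / (w0 / c) ^ 2 * (M * phi2 R0 + (Dd - M) * (phi1 R0 / R0))) ->
  PI * w0 ^ d * kappa / c ^ d * ang d D Dd M (R0 / c) (fun x => cos (w0 * x)) =
    4 * PI * (w0 / c) ^ 2 * (D * psi R0 + / (w0 / c) ^ 2 * (M * psi2 R0 + (Dd - M) * (psi1 R0 / R0))) ->
  filterlim
    (fun eps => Cplus (Copp (omega_reg d c w0 mu nu r eps))
                      (Cmult (Cdiv Ci (RtoC 2)) (gamma_ij d c w0 mu nu r)))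
    (at_right 0)
    (locally (rscal (4 * PI * (w0 / c) ^ 2) (dyadic_form d (w0 / c) mu nu r))).
Proof.
  move=> Hal Hd Hc Hw Hin Hr P1 P2 S1 S2 HG R0 D Dd M kappa Hlim HRe HIm.
  have HP := PI_RGT_0.
  rewrite (dyadic_radial d (w0 / c) mu nu r phi phi1 phi2 psi psi1 psi2) // -/R0 -/M -/D -/Dd.
  (* Lengths are measured by travel time, so that the phase variable [k . r / c] is again a scalar
     product with [k]; the ratio [M] is unaffected by the scaling. *)
  set r' := vscal (/ c) r.
  have Hdot : forall k, dot k r / c = dot k r' by move=> k; rewrite /dot /r' /vscal /Rdiv; ring.
  have Hvn : vnorm r' = R0 / c.
  { rewrite /R0 /vnorm. have -> : dot r' r' = (/ c) ^ 2 * dot r r by rewrite /dot /r' /vscal; ring.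
    rewrite sqrt_mult_alt; last exact: pow2_ge_0. rewrite sqrt_pow2; first by rewrite /Rdiv; ring.
    apply: Rlt_le. exact: Rinv_0_lt_compat. }
  have Hr' : 0 < vnorm r' by rewrite Hvn; exact: Rdiv_lt_0_compat.
  have Hin' : in_Rd d r' by move=> l Hl; rewrite /r' /vscal Hin //; ring.
  have HM : dot mu r' * dot nu r' / vnorm r' ^ 2 = M.
  { rewrite Hvn /M -!Hdot. field. rewrite /R0. lra. }
  have [t1 t2] := contdiff_trig w0.
  have Hgam : gamma_ij d c w0 mu nu r = rscal (2 * PI * w0 ^ d / c ^ d) (kappa * ang d D Dd M (R0 / c) (fun x => cos (w0 * x)), 0).
  { rewrite /gamma_ij. congr rscal.
    rewrite (solid_int_ext d _ (fun k => rscal (transv mu nu k * kappa) (cos (w0 * dot k r'), sin (w0 * dot k r')))); last first.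
    { move=> k. rewrite -Hdot /eiC. have -> : w0 * (dot k r / c) = w0 * dot k r / c by rewrite /Rdiv; ring. by []. }
    have HA := Hal mu nu r' kappa (fun x => cos (w0 * x)) (fun x => sin (w0 * x)) Hin' Hr' t1 t2.
    cbv zeta in HA. rewrite HM Hvn in HA. rewrite HA -/D -/Dd.
    rewrite (ang_odd d D Dd M (R0 / c) (fun x => sin (w0 * x))) //; first by rewrite Rmult_0_r.
    - move=> x. exact: contdiff_continuous.
    - move=> x. rewrite -sin_neg. congr sin. ring. }
  have Hom : forall eps, 0 < eps -> omega_reg d c w0 mu nu r eps =
     rscal (- (2 * PI / c ^ d)) (kappa * (/ (2 * PI) * ang d D Dd M (R0 / c) (hR d w0 eps)), 0).
  { move=> eps He. rewrite /omega_reg. congr rscal.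
    have [ch1 ch2] := contdiff_h d w0 eps He.
    rewrite (solid_int_ext d _ (fun k => rscal (transv mu nu k * kappa) (/ (2 * PI) * hR d w0 eps (dot k r'), / (2 * PI) * hI d w0 eps (dot k r')))); last first.
    { move=> k. by rewrite inner_eq // innerC_h // Hdot. }
    have HA := Hal mu nu r' kappa (fun x => / (2 * PI) * hR d w0 eps x) (fun x => / (2 * PI) * hI d w0 eps x) Hin' Hr' (contdiff_scal _ _ ch1) (contdiff_scal _ _ ch2).
    cbv zeta in HA. rewrite HM Hvn in HA. rewrite HA -/D -/Dd.
    rewrite !ang_scal //; try (by move=> x; exact: contdiff_continuous).
    rewrite (ang_odd d D Dd M (R0 / c) (hI d w0 eps)) //; first by rewrite !Rmult_0_r.
    - move=> x. exact: contdiff_continuous.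
    - move=> x. exact: (proj2 (h_parity d w0 eps x He)). }
  have Hcd : c ^ d <> 0 by apply: pow_nonzero; lra.
  have Hw2 : 4 * PI * (w0 / c) ^ 2 <> 0.
  { have : 0 < (w0 / c) ^ 2 by apply: pow_lt; exact: Rdiv_lt_0_compat. nra. }
  apply (filterlim_ext_loc (F := at_right 0) (fun eps => ((kappa / c ^ d * ang d D Dd M (R0 / c) (hR d w0 eps),
     PI * w0 ^ d * kappa / c ^ d * ang d D Dd M (R0 / c) (fun x => cos (w0 * x))) : C))).
  { apply: filter_imp at_right_pos => eps He. rewrite Hom // Hgam.
    apply: injective_projections; rewrite /rscal /=; field; split => //; lra. }
  apply: filterlim_C.
  - apply: fl_val; first by apply: fl_mult; [exact: filterlim_const | exact: Hlim].
    rewrite HRe /rscal /=. ring.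
  - apply: fl_val; first exact: filterlim_const. cbn [fst snd]. rewrite HIm /rscal /=. ring.
Qed.

Lemma aligned_1 : aligned 1.
Proof.
  move=> mu nu r kappa hr hi Hin Hr C1r C1i D Dd M.
  have h1 : r 1%nat = 0 by apply: Hin; lia. have h2 : r 2%nat = 0 by apply: Hin; lia.
  have Hrr : vnorm r = Rabs (r 0%nat).
  { rewrite /vnorm /dot h1 h2. have -> : r 0%nat * r 0%nat + 0 * 0 + 0 * 0 = Rsqr (r 0%nat) by rewrite /Rsqr; ring.
    exact: sqrt_Rsqr_abs. }
  have HM : M = mu 0%nat * nu 0%nat.
  { rewrite /M Hrr /dot h1 h2. have -> : Rabs (r 0%nat) ^ 2 = r 0%nat ^ 2 by rewrite RPow_abs Rabs_pos_eq //; exact: pow2_ge_0.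
    field. move=> H0. move: Hr. rewrite Hrr H0 Rabs_R0. lra. }
  have ht : forall s, s * s = 1 -> transv mu nu (mkvec s 0 0) = D - M.
  { move=> s Hs. rewrite HM /transv /mkvec /D /dot /=.
    transitivity (mu 0%nat * nu 0%nat + mu 1%nat * nu 1%nat + mu 2%nat * nu 2%nat - mu 0%nat * nu 0%nat * (s * s)); first ring.
    rewrite Hs. ring. }
  have d1 : dot (mkvec 1 0 0) r = r 0%nat by rewrite /dot /mkvec; ring.
  have d2 : dot (mkvec (-1) 0 0) r = - r 0%nat by rewrite /dot /mkvec; ring.
  rewrite /solid_int d1 d2 (ht 1) ?(ht (-1)); try ring.
  rewrite /ang Hrr. rewrite /Rabs. case: Rcase_abs => _; apply: injective_projections; rewrite /rscal /= ?Ropp_involutive; ring.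
Qed.

(** * Dimension 1 *)

Lemma lipschitz_by_derive (f df : R -> R) (K x y : R) :
  (forall t, is_derive f t (df t)) -> (forall t, continuous df t) ->
  (forall t, Rmin x y <= t <= Rmax x y -> Rabs (df t) <= K) ->
  Rabs (f y - f x) <= K * Rabs (y - x).
Proof.
  move=> H1 H2 H3. rewrite -(is_RInt_unique _ _ _ _ (RInt_of_derive f df x y (fun t _ => H1 t) (fun t _ => H2 t))).
  apply: abs_RInt_le_mul => //. exact: ex_RInt_cont.
Qed.

Lemma cos_lipschitz (x y : R) : Rabs (cos y - cos x) <= Rabs (y - x).
Proof.
  rewrite -(Rmult_1_l (Rabs (y - x))). apply: (lipschitz_by_derive cos (fun t => - sin t)).
  - exact: is_derive_cos.
  - move=> t. ctn.
  - move=> t _. rewrite Rabs_Ropp. apply: Rabs_le. exact: SIN_bound.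
Qed.

Lemma abs_sin_le (x : R) : Rabs (sin x) <= Rabs x.
Proof.
  have := lipschitz_by_derive sin cos 1 0 x is_derive_sin (fun t => continuous_cos t).
  rewrite sin_0 !Rminus_0_r Rmult_1_l. apply => t _. apply: Rabs_le. exact: COS_bound.
Qed.

Lemma abs_cos_sub1_le (x : R) : Rabs (cos x - 1) <= x ^ 2.
Proof.
  have := lipschitz_by_derive cos (fun t => - sin t) (Rabs x) 0 x is_derive_cos.
  rewrite cos_0 !Rminus_0_r. have -> : Rabs x * Rabs x = x ^ 2.
  { rewrite -Rabs_mult Rabs_pos_eq /=; [ring | nra]. }
  apply.
  - move=> t. ctn.
  - move=> t Ht. rewrite Rabs_Ropp. apply: Rle_trans (abs_sin_le t) _.
    move: Ht. rewrite /Rmin /Rmax. destruct Rle_dec => Ht; rewrite /Rabs; repeat destruct Rcase_abs; lra.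
Qed.

Lemma RInt_ratio (eps a : R) : 0 < eps -> is_RInt (fun s => s / (eps ^ 2 + s ^ 2)) 0 a (ln (eps ^ 2 + a ^ 2) / 2 - ln eps).
Proof.
  move=> He. have Hp := fun s => sumsq_pos eps s He.
  have -> : ln (eps ^ 2 + a ^ 2) / 2 - ln eps = ln (eps ^ 2 + a ^ 2) / 2 - ln (eps ^ 2 + 0 ^ 2) / 2.
  { have -> : eps ^ 2 + 0 ^ 2 = eps * eps by ring. rewrite ln_mult //. field. }
  apply: (RInt_of_derive (fun s => ln (eps ^ 2 + s ^ 2) / 2)) => s _; have Hs := Hp s.
  - auto_derive; first (simpl in Hs; lra). simpl in *. field. lra.
  - ctn. simpl in *. lra.
Qed.

Lemma eps_ln_lim (a : R) : 0 < a ->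
  filterlim (fun eps => eps * (ln (eps ^ 2 + a ^ 2) / 2 - ln eps)) (at_right 0) (locally 0).
Proof.
  move=> Ha. apply: (filterlim_ext (fun eps => eps * (ln (eps ^ 2 + a ^ 2) / 2) - eps * ln eps)); first by move=> e; ring.
  apply: fl_val (Rminus_diag 0). apply: fl_minus; last exact: x_ln_x_lim.
  apply: fl_at_right; last by rewrite Rmult_0_l.
  apply: ex_derive_continuousR. auto_derive. nra.
Qed.

(** The kernel [eps / (eps^2 + s^2)] concentrates at [s = 0], where the sine vanishes: bounding the
    sine by [|w0| s] leaves [eps] times a logarithm. *)
Lemma jes_lim (w0 a : R) : 0 < a -> filterlim (fun eps => jes w0 eps a) (at_right 0) (locally 0).
Proof.
  move=> Ha.
  apply: (filterlim_squeeze0 _ _ (fun eps => Rabs w0 * (eps * (ln (eps ^ 2 + a ^ 2) / 2 - ln eps)))).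
  - apply: filter_imp at_right_pos => eps He. rewrite Rminus_0_r.
    have [h1 _] := j_continuous w0 eps He.
    have Hp := fun s => sumsq_pos eps s He.
    have HI : is_RInt (fun s => Rabs w0 * eps * (s / (eps ^ 2 + s ^ 2))) 0 a (Rabs w0 * eps * (ln (eps ^ 2 + a ^ 2) / 2 - ln eps)).
    { exact: (is_RInt_scal (V := R_NormedModule) _ _ _ (Rabs w0 * eps) _ (RInt_ratio eps a He)). }
    rewrite -Rmult_assoc.
    apply: (norm_RInt_le (fun s => eps * sin (w0 * s) / (eps ^ 2 + s ^ 2)) (fun s => Rabs w0 * eps * (s / (eps ^ 2 + s ^ 2))) 0 a); first lra.
    + move=> s Hs. have Hq := Hp s. change (Rabs (eps * sin (w0 * s) / (eps ^ 2 + s ^ 2)) <= Rabs w0 * eps * (s / (eps ^ 2 + s ^ 2))).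
      have Hsin : Rabs (sin (w0 * s)) <= Rabs w0 * s.
      { apply: Rle_trans (abs_sin_le _) _. rewrite Rabs_mult (Rabs_pos_eq s); lra. }
      rewrite Rabs_div; last lra. rewrite (Rabs_pos_eq (eps ^ 2 + s ^ 2)); last lra.
      rewrite Rabs_mult (Rabs_pos_eq eps); last lra.
      have -> : Rabs w0 * eps * (s / (eps ^ 2 + s ^ 2)) = eps * (Rabs w0 * s) / (eps ^ 2 + s ^ 2).
      { field. simpl in Hq. lra. }
      apply: Rmult_le_compat_r; first by apply: Rlt_le; exact: Rinv_0_lt_compat.
      apply: Rmult_le_compat_l => //. lra.
    + apply: (RInt_correct (V := R_CompleteNormedModule)). exact: ex_RInt_cont.
    + exact: HI.
  - apply: fl_val (Rmult_0_r (Rabs w0)). apply: fl_mult; [exact: filterlim_const | exact: eps_ln_lim].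
Qed.

Lemma atan_quot_lim (a : R) : 0 < a -> filterlim (fun eps => atan (a / eps)) (at_right 0) (locally (PI / 2)).
Proof.
  move=> Ha. apply: (filterlim_ext_loc (fun eps => PI / 2 - atan (eps / a))).
  - apply: filter_imp at_right_pos => eps He.
    have -> : a / eps = / (eps / a) by field; lra. rewrite atan_inv //. exact: Rdiv_lt_0_compat.
  - apply: fl_val (Rminus_0_r (PI / 2)). apply: fl_minus; first exact: filterlim_const.
    apply: fl_at_right; last by rewrite /Rdiv Rmult_0_l atan_0.
    apply: (ct_comp_derive (fun eps => eps / a) atan); last by auto_derive.
    ctn.
Qed.

(** The kernel [eps / (eps^2 + s^2)] has mass [atan (a / eps)] on [[0, a]], and replacing the cosine
    by its value [1] at the point of concentration costs [O(eps)]. This is where the residue at the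
    pole comes from. *)
Lemma jec_lim (w0 a : R) : 0 < a -> filterlim (fun eps => jec w0 eps a) (at_right 0) (locally (PI / 2)).
Proof.
  move=> Ha.
  apply: (filterlim_ext_loc (fun eps => atan (a / eps) + (jec w0 eps a - atan (a / eps)))).
  { apply: filter_forall => eps. ring. }
  apply: fl_val (Rplus_0_r (PI / 2)). apply: fl_plus; first exact: atan_quot_lim.
  apply: (filterlim_squeeze0 _ _ (fun eps => eps * (w0 ^ 2 * a))).
  - apply: filter_imp at_right_pos => eps He. rewrite Rminus_0_r.
    have [_ [_ [h3 _]]] := j_continuous w0 eps He. have Hp := fun s => sumsq_pos eps s He.
    have Hc : forall s, continuous (fun s => eps / (eps ^ 2 + s ^ 2)) s by move=> s; have Hs := Hp s; ctn; simpl in *; lra.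
    have HI : is_RInt (fun s => eps / (eps ^ 2 + s ^ 2)) 0 a (atan (a / eps)).
    { have -> : atan (a / eps) = atan (a / eps) - atan (0 / eps) by rewrite /Rdiv Rmult_0_l atan_0; ring.
      apply: (RInt_of_derive (fun s => atan (s / eps))) => s _ //. have Hs := Hp s.
      auto_derive => //. rewrite /Rsqr. simpl in *. field. split; nra. }
    rewrite -(is_RInt_unique _ _ _ _ HI) /jec -RInt_minusR; try exact: ex_RInt_cont.
    apply: Rle_trans (abs_RInt_le_mul _ _ _ (eps * w0 ^ 2) _ _) _.
    + apply: (ex_RInt_minus (V := R_NormedModule)); exact: ex_RInt_cont.
    + move=> s _. have Hs := Hp s.
      have -> : eps * cos (w0 * s) / (eps ^ 2 + s ^ 2) - eps / (eps ^ 2 + s ^ 2) = eps * ((cos (w0 * s) - 1) / (eps ^ 2 + s ^ 2)) by field; simpl in Hs; lra.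
      rewrite Rabs_mult (Rabs_pos_eq eps); last lra. apply: Rmult_le_compat_l; first lra.
      rewrite Rabs_div; last lra. rewrite (Rabs_pos_eq (eps ^ 2 + s ^ 2)); last lra.
      apply/Rle_div_l => //. apply: Rle_trans (abs_cos_sub1_le _) _. rewrite Rpow_mult_distr.
      apply: Rmult_le_compat_l; first exact: pow2_ge_0. have := pow2_ge_0 eps. lra.
    + rewrite Rminus_0_r (Rabs_pos_eq a); last lra. right. ring.
  - apply: fl_val (Rmult_0_l (w0 ^ 2 * a)). apply: fl_mult; [exact: fl_id_right | exact: filterlim_const].
Qed.

Lemma mR_pI_lim (w0 a : R) : 0 < w0 -> 0 < a ->
  filterlim (fun eps => mR w0 eps a) (at_right 0) (locally (- PI * sin (w0 * a))) /\
  filterlim (fun eps => pI w0 eps a) (at_right 0) (locally (PI * cos (w0 * a))).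
Proof.
  move=> Hw Ha. have [_ Hm] := pole_const_limits w0 Hw.
  have H1 := jes_lim w0 a Ha. have H3 := jec_lim w0 a Ha.
  have Hc : forall k : R, filterlim (fun _ : R => k) (at_right 0) (locally k) by move=> k; exact: filterlim_const.
  split.
  - eapply fl_val.
    + apply: fl_minus; (apply: fl_mult; first exact: Hc); [apply: fl_plus; [exact: Hm | apply: fl_mult; [exact: Hc | exact: H1]] | exact: H3].
    + field.
  - eapply fl_val.
    + apply: fl_plus; (apply: fl_mult; first exact: Hc); [apply: fl_plus; [exact: Hm | apply: fl_mult; [exact: Hc | exact: H1]] | exact: H3].
    + field.
Qed.

Lemma z_lim (a : R) : 0 < a ->
  filterlim (fun eps => zp eps a) (at_right 0) (locally 0) /\ filterlim (fun eps => zq eps a) (at_right 0) (locally (/ a)).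
Proof.
  move=> Ha. split; apply: fl_at_right.
  - apply: ex_derive_continuousR. rewrite /zp. auto_derive. nra.
  - rewrite /zp /Rdiv Rmult_0_l. ring.
  - apply: ex_derive_continuousR. rewrite /zq. auto_derive. nra.
  - rewrite /zq. field. lra.
Qed.

Lemma convergence_1 (c w0 : R) (mu nu r : vec) : 0 < c -> 0 < w0 -> in_Rd 1 r -> 0 < vnorm r ->
  filterlim
    (fun eps => Cplus (Copp (omega_reg 1 c w0 mu nu r eps))
                      (Cmult (Cdiv Ci (RtoC 2)) (gamma_ij 1 c w0 mu nu r)))
    (at_right 0)
    (locally (rscal (4 * PI * (w0 / c) ^ 2) (dyadic_form 1 (w0 / c) mu nu r))).
Proof.
  move=> Hc Hw Hin Hr. have HP := PI_RGT_0. set k0 := w0 / c.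
  have Hk : 0 < k0 by exact: Rdiv_lt_0_compat.
  have Hx : 0 < vnorm r / c by exact: Rdiv_lt_0_compat.
  have [Hm _] := mR_pI_lim w0 (vnorm r / c) Hw Hx. have [Hz _] := z_lim (vnorm r / c) Hx.
  (* On the line, [r] spans the whole space, so the part of the Hessian transverse to [r] is absent
     and the first radial derivative drops out. *)
  have HM : dotd 1 mu nu - dot mu r * dot nu r / vnorm r ^ 2 = 0.
  { have h1 : r 1%nat = 0 by apply: Hin; lia. have h2 : r 2%nat = 0 by apply: Hin; lia.
    have -> : vnorm r ^ 2 = r 0%nat ^ 2.
    { rewrite /vnorm /= Rmult_1_r sqrt_sqrt /dot h1 h2; [ring | nra]. }
    have H0 : r 0%nat <> 0.
    { move=> H0. move: Hr. rewrite /vnorm /dot h1 h2 H0. have -> : 0 * 0 + 0 * 0 + 0 * 0 = 0 by ring. rewrite sqrt_0. lra. }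
    rewrite /dot /dotd h1 h2. field. exact: H0. }
  apply: (reduction 1 c w0 mu nu r (fun x => - sin (k0 * x) / (2 * k0)) (fun x => - cos (k0 * x) / 2) (fun x => k0 * sin (k0 * x) / 2)
     (fun x => cos (k0 * x) / (2 * k0)) (fun x => - sin (k0 * x) / 2) (fun x => - k0 * cos (k0 * x) / 2)
     ((dot mu nu - dot mu r * dot nu r / vnorm r ^ 2) * (2 * (2 * 0 + w0 * (- PI * sin (w0 * (vnorm r / c))))))) => //.
  - exact: aligned_1.
  - lia.
  - move=> x _. auto_derive => //. field. lra.
  - move=> x _. auto_derive => //. field.
  - move=> x _. auto_derive => //. field. lra.
  - move=> x _. auto_derive => //. field.
  - move=> v Hv. exact: Gd_1.
  - rewrite /ang. apply: fl_mult; first exact: filterlim_const.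
    apply: (filterlim_ext_loc (fun eps => 2 * (2 * zp eps (vnorm r / c) + w0 * mR w0 eps (vnorm r / c)))).
    { apply: filter_imp at_right_pos => eps He. rewrite (proj1 (h_parity 1 w0 eps _ He)) /hR /momR. ring. }
    have Hct : forall k : R, filterlim (fun _ : R => k) (at_right 0) (locally k) by move=> k; exact: filterlim_const.
    apply: fl_mult; first exact: Hct. apply: fl_plus; (apply: fl_mult; first exact: Hct); [exact: Hz | exact: Hm].
  - rewrite HM. have -> : w0 * (vnorm r / c) = k0 * vnorm r by rewrite /k0; field; lra.
    rewrite -/k0 /k0 /=. field. lra.
  - rewrite HM /ang. have -> : w0 * - (vnorm r / c) = - (k0 * vnorm r) by rewrite /k0; field; lra.
    have -> : w0 * (vnorm r / c) = k0 * vnorm r by rewrite /k0; field; lra.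
    rewrite cos_neg -/k0 /k0 /=. field. lra.
Qed.

(** * Dimension 3 *)

Lemma polar_angle (a b : R) : exists t, a = sqrt (a ^ 2 + b ^ 2) * cos t /\ b = sqrt (a ^ 2 + b ^ 2) * sin t.
Proof.
  set rho := sqrt (a ^ 2 + b ^ 2).
  have Ha := pow2_ge_0 a. have Hb := pow2_ge_0 b.
  have Hr2 : rho * rho = a ^ 2 + b ^ 2 by apply: sqrt_sqrt; lra.
  have Hr0 : 0 <= rho by exact: sqrt_pos.
  case: (Req_dec rho 0) => H0.
  - have Ha0 : a = 0 by rewrite H0 in Hr2; nra. have Hb0 : b = 0 by rewrite H0 in Hr2; nra.
    exists 0. by rewrite H0 !Rmult_0_l.
  - have Hrp : 0 < rho by lra.
    have Hq : -1 <= a / rho <= 1.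
    { split; [apply/Rle_div_r => //; nra | apply/Rle_div_l => //; nra]. }
    have Hs : sqrt (1 - Rsqr (a / rho)) = Rabs b / rho.
    { have -> : 1 - Rsqr (a / rho) = (Rabs b / rho) ^ 2.
      { rewrite /Rsqr. have -> : (Rabs b / rho) ^ 2 = (Rabs b) ^ 2 / (rho * rho) by field.
        have -> : Rabs b ^ 2 = b ^ 2 by rewrite RPow_abs Rabs_pos_eq.
        have -> : a / rho * (a / rho) = a ^ 2 / (rho * rho) by field. rewrite Hr2. field. rewrite -Hr2. nra. }
      rewrite sqrt_pow2 //. apply: Rmult_le_pos; [exact: Rabs_pos | apply: Rlt_le; exact: Rinv_0_lt_compat]. }
    case: (Rle_dec 0 b) => Hbs.
    + exists (acos (a / rho)). rewrite cos_acos // sin_acos // Hs Rabs_pos_eq //. split; field; lra.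
    + exists (- acos (a / rho)). rewrite cos_neg sin_neg cos_acos // sin_acos // Hs Rabs_left; last lra. split; field; lra.
Qed.

(* [lin v a th ph] is [k . v_a], where [k] is the unit vector with spherical angles [th], [ph] and [v_a] is
   [v] rotated by [a] about the second axis; [lin_a], [lin_t] and [lin_p] are its partial derivatives. *)
Definition lin (v : vec) (a th ph : R) : R :=
  (v 0%nat * cos a + v 2%nat * sin a) * (sin th * cos ph) + v 1%nat * (sin th * sin ph)
    + (v 2%nat * cos a - v 0%nat * sin a) * cos th.
Definition lin_a (v : vec) (a th ph : R) : R :=
  (v 2%nat * cos a - v 0%nat * sin a) * (sin th * cos ph) - (v 0%nat * cos a + v 2%nat * sin a) * cos th.
Definition lin_t (v : vec) (a th ph : R) : R :=
  (v 0%nat * cos a + v 2%nat * sin a) * (cos th * cos ph) + v 1%nat * (cos th * sin ph)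
    - (v 2%nat * cos a - v 0%nat * sin a) * sin th.
Definition lin_p (v : vec) (a th ph : R) : R :=
  v 1%nat * (sin th * cos ph) - (v 0%nat * cos a + v 2%nat * sin a) * (sin th * sin ph).

(* The infinitesimal rotation about the second axis in spherical coordinates. *)
Lemma lin_generator (v : vec) (a th ph : R) :
  sin th * lin_a v a th ph = - (cos ph * sin th) * lin_t v a th ph + cos th * sin ph * lin_p v a th ph.
Proof.
  have Hp : sin ph * sin ph = 1 - cos ph * cos ph by have := sin2_cos2 ph; rewrite /Rsqr; lra.
  have Ht : sin th * sin th = 1 - cos th * cos th by have := sin2_cos2 th; rewrite /Rsqr; lra.
  rewrite /lin_a /lin_t /lin_p.
  set A := v 0%nat * cos a + v 2%nat * sin a. set B := v 2%nat * cos a - v 0%nat * sin a.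
  transitivity (B * cos ph * (sin th * sin th) - A * sin th * cos th); first ring.
  transitivity (B * cos ph * (sin th * sin th) - A * sin th * cos th * (cos ph * cos ph + sin ph * sin ph)); last ring.
  rewrite Hp. ring.
Qed.

Lemma is_RInt_eq (f : R -> R) (a b l l' : R) : is_RInt f a b l -> l = l' -> is_RInt f a b l'.
Proof. by move=> H <-. Qed.

Lemma is_derive_eq (f : R -> R) (x l l' : R) : is_derive f x l -> l = l' -> is_derive f x l'.
Proof. by move=> H <-. Qed.

Lemma lin_derive (v : vec) (a th ph : R) :
  is_derive (fun a => lin v a th ph) a (lin_a v a th ph) /\
  is_derive (fun th => lin v a th ph) th (lin_t v a th ph) /\
  is_derive (fun ph => lin v a th ph) ph (lin_p v a th ph).
Proof.
  rewrite /lin /lin_a /lin_t /lin_p. split; [|split]; auto_derive => //; ring.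
Qed.

Definition integrand3 (D : R) (h : R -> R) (m n s : R) : R := (D - m * n) * h s.
Definition dintegrand3 (D : R) (h dh : R -> R) (m n s m' n' s' : R) : R :=
  - (m' * n + m * n') * h s + (D - m * n) * (dh s * s').

Lemma integrand3_derive (D : R) (h dh m n s : R -> R) (x m' n' s' : R) :
  (forall y, is_derive h y (dh y)) -> is_derive m x m' -> is_derive n x n' -> is_derive s x s' ->
  is_derive (fun x => integrand3 D h (m x) (n x) (s x)) x (dintegrand3 D h dh (m x) (n x) (s x) m' n' s').
Proof.
  move=> Hh Hm Hn Hs.
  have H1 := is_derive_mult (K := R_AbsRing) _ _ _ _ _ Hm Hn Rmult_comm.
  have H2 : is_derive (fun x => D - m x * n x) x (0 - (m' * n x + m x * n')).
  { apply: (is_derive_minus (V := R_NormedModule)) H1. exact: is_derive_const. }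
  have H3 := is_derive_comp (V := R_NormedModule) h s x _ _ (Hh _) Hs.
  have H4 := is_derive_mult (K := R_AbsRing) _ _ _ _ _ H2 H3 Rmult_comm.
  apply: is_derive_eq H4 _. rewrite /plus /mult /scal /= /mult /= /dintegrand3. ring.
Qed.

(* By [lin_generator] the derivative of the integrand in the rotation angle is a divergence on the sphere. *)
Lemma rotation_invariance (D : R) (mu nu r : vec) (h : R -> R) (a b : R) : contdiff h ->
  let K := fun a => RInt (fun th => sin th * RInt (fun ph => integrand3 D h (lin mu a th ph) (lin nu a th ph) (lin r a th ph)) 0 (2 * PI)) 0 PI in
  K a = K b.
Proof.
  move=> Ch K. have hc := fun x => contdiff_continuous h x Ch. case: Ch => [dh [Hh Hdc]].
  set F := fun a th ph => integrand3 D h (lin mu a th ph) (lin nu a th ph) (lin r a th ph).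
  set Fd := fun (l : vec -> R -> R -> R -> R) a th ph => dintegrand3 D h dh (lin mu a th ph) (lin nu a th ph) (lin r a th ph)
      (l mu a th ph) (l nu a th ph) (l r a th ph).
  have Da : forall a th ph, is_derive (fun a => F a th ph) a (Fd lin_a a th ph).
  { move=> a0 th ph. apply: (integrand3_derive D h dh (fun a => lin mu a th ph) (fun a => lin nu a th ph) (fun a => lin r a th ph)) => //; exact: (proj1 (lin_derive _ _ _ _)). }
  have Dt : forall a th ph, is_derive (fun th => F a th ph) th (Fd lin_t a th ph).
  { move=> a0 th ph. apply: (integrand3_derive D h dh (fun th => lin mu a0 th ph) (fun th => lin nu a0 th ph) (fun th => lin r a0 th ph)) => //; exact: (proj1 (proj2 (lin_derive _ _ _ _))). }
  have Dp : forall a th ph, is_derive (fun ph => F a th ph) ph (Fd lin_p a th ph).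
  { move=> a0 th ph. apply: (integrand3_derive D h dh (fun ph => lin mu a0 th ph) (fun ph => lin nu a0 th ph) (fun ph => lin r a0 th ph)) => //; exact: (proj2 (proj2 (lin_derive _ _ _ _))). }
  have cl : forall v (x : (R * R) * R), continuous (fun p : (R * R) * R => lin v (fst (fst p)) (snd (fst p)) (snd p)) x.
  { move=> v x. rewrite /lin. ctn. }
  have cF : forall x : (R * R) * R, continuous (fun p : (R * R) * R => F (fst (fst p)) (snd (fst p)) (snd p)) x.
  { move=> x. rewrite /F /integrand3. apply: ct_mult; last exact: (ct_comp _ h _ (cl r x) (hc _)).
    apply: ct_minus; [exact: continuous_const | apply: ct_mult; exact: cl]. }
  have cFd : forall l : vec -> R -> R -> R -> R,
     (forall v (x : (R * R) * R), continuous (fun p : (R * R) * R => l v (fst (fst p)) (snd (fst p)) (snd p)) x) ->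
     forall x : (R * R) * R, continuous (fun p : (R * R) * R => Fd l (fst (fst p)) (snd (fst p)) (snd p)) x.
  { move=> l Hl x. rewrite /Fd /dintegrand3. apply: ct_plus.
    - apply: ct_mult; last exact: (ct_comp _ h _ (cl r x) (hc _)).
      apply: ct_opp. apply: ct_plus; apply: ct_mult; solve [exact: cl | exact: Hl].
    - apply: ct_mult; last (apply: ct_mult; [exact: (ct_comp _ dh _ (cl r x) (Hdc _)) | exact: Hl]).
      apply: ct_minus; [exact: continuous_const | apply: ct_mult; exact: cl]. }
  have ca : forall v (x : (R * R) * R), continuous (fun p : (R * R) * R => lin_a v (fst (fst p)) (snd (fst p)) (snd p)) x.
  { move=> v x. rewrite /lin_a. ctn. }
  have ctt : forall v (x : (R * R) * R), continuous (fun p : (R * R) * R => lin_t v (fst (fst p)) (snd (fst p)) (snd p)) x.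
  { move=> v x. rewrite /lin_t. ctn. }
  have cp : forall v (x : (R * R) * R), continuous (fun p : (R * R) * R => lin_p v (fst (fst p)) (snd (fst p)) (snd p)) x.
  { move=> v x. rewrite /lin_p. ctn. }
  (* Joint continuity in all three variables is established once; substitution of continuous
     functions then gives continuity in any selection of them, as the different parameter integrals
     demand. *)
  have sub : forall (T : UniformSpace) (G : R -> R -> R -> R) (u v w : T -> R) (x : T),
     (forall x : (R * R) * R, continuous (fun p : (R * R) * R => G (fst (fst p)) (snd (fst p)) (snd p)) x) ->
     continuous u x -> continuous v x -> continuous w x -> continuous (fun y => G (u y) (v y) (w y)) x.
  { move=> T G u v w x HG Hu Hv Hw.
    have Hpair : continuous (fun y => ((u y, v y), w y)) x.
    { apply: (continuous_comp_2 (fun y => (u y, v y)) w (fun p q => (p, q))) => //.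
      - apply: (continuous_comp_2 u v (fun p q => (p, q))) => //.
        apply: (continuous_ext (fun z => z)); [by case | exact: continuous_id].
      - apply: (continuous_ext (fun z => z)); [by case | exact: continuous_id]. }
    exact: (continuous_comp _ (fun p : (R * R) * R => G (fst (fst p)) (snd (fst p)) (snd p)) _ Hpair (HG _)). }
  have s1 : forall G : R -> R -> R -> R, (forall x : (R * R) * R, continuous (fun p : (R * R) * R => G (fst (fst p)) (snd (fst p)) (snd p)) x) ->
     forall x th ph, continuous (fun ph => G x th ph) ph.
  { move=> G HG x th ph. by apply: (sub _ G (fun _ => x) (fun _ => th) (fun ph => ph)) => //; ctn. }
  have s2 : forall G : R -> R -> R -> R, (forall x : (R * R) * R, continuous (fun p : (R * R) * R => G (fst (fst p)) (snd (fst p)) (snd p)) x) ->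
     forall x th ph, continuous (fun p : R * R => G x (fst p) (snd p)) (th, ph).
  { move=> G HG x th ph. by apply: (sub _ G (fun _ => x) (fun p : R * R => fst p) (fun p : R * R => snd p)) => //; ctn. }
  have s3 : forall G : R -> R -> R -> R, (forall x : (R * R) * R, continuous (fun p : (R * R) * R => G (fst (fst p)) (snd (fst p)) (snd p)) x) ->
     forall x th ph, continuous (fun p : R * R => G (fst p) th (snd p)) (x, ph).
  { move=> G HG x th ph. by apply: (sub _ G (fun p : R * R => fst p) (fun _ => th) (fun p : R * R => snd p)) => //; ctn. }
  have HK : forall a, is_derive K a 0.
  { move=> x.
    (* [lin_generator] expresses the derivative along the rotation through those in [th] and [ph].
       The part in [ph] is integrated by parts, with boundary terms killed by [sin ph]. What remains
       is minus the [th]-derivative of [sin th] times the integral of [cos ph F], whose boundary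
       terms at the poles of the sphere vanish with [sin th]. *)
    have key : forall th, sin th * RInt (Fd lin_a x th) 0 (2 * PI) =
        - (cos th * RInt (fun ph => cos ph * F x th ph) 0 (2 * PI) + sin th * RInt (fun ph => cos ph * Fd lin_t x th ph) 0 (2 * PI)).
    { move=> th.
      have c1 : forall ph, continuous (fun ph => F x th ph) ph.
      { move=> ph. exact: (s1 F cF). }
      have c2 : forall l, (forall v (x : (R * R) * R), continuous (fun p : (R * R) * R => l v (fst (fst p)) (snd (fst p)) (snd p)) x) ->
          forall ph, continuous (fun ph => Fd l x th ph) ph by move=> l Hl ph; apply: s1; exact: cFd.
      have c3 : forall ph, continuous (fun ph => cos ph * F x th ph) ph by move=> ph; apply: ct_mult; [ctn | exact: c1].
      have c4 : forall l, (forall v (x : (R * R) * R), continuous (fun p : (R * R) * R => l v (fst (fst p)) (snd (fst p)) (snd p)) x) ->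
          forall ph, continuous (fun ph => cos ph * Fd l x th ph) ph by move=> l Hl ph; apply: ct_mult; [ctn | exact: c2].
      have c5 : forall ph, continuous (fun ph => sin ph * Fd lin_p x th ph) ph by move=> ph; apply: ct_mult; [ctn | exact: c2].
      have parts : RInt (fun ph => cos ph * F x th ph + sin ph * Fd lin_p x th ph) 0 (2 * PI) = 0.
      { apply: is_RInt_unique.
        apply: is_RInt_eq; last by (instantiate (1 := sin (2 * PI) * F x th (2 * PI) - sin 0 * F x th 0); rewrite sin_2PI sin_0; ring).
        apply: (RInt_of_derive (fun ph => sin ph * F x th ph)) => ph _.
        - exact: (is_derive_mult (K := R_AbsRing) _ _ _ _ _ (is_derive_sin ph) (Dp x th ph) Rmult_comm).
        - apply: ct_plus; [exact: c3 | exact: c5]. }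
      rewrite RInt_plusR in parts; try (apply: ex_RInt_cont; assumption).
      rewrite -!RInt_scalR; try (apply: ex_RInt_cont; first [exact: c3 | exact: (c4 _ ctt) | exact: (c2 _ ca)]).
      have -> : RInt (fun t => sin th * Fd lin_a x th t) 0 (2 * PI) =
         RInt (fun ph => cos th * (sin ph * Fd lin_p x th ph) - sin th * (cos ph * Fd lin_t x th ph)) 0 (2 * PI).
      { apply: RInt_ext => ph _. rewrite /Fd /dintegrand3.
        have G := fun v => lin_generator v x th ph.
        set m := lin mu x th ph. set n := lin nu x th ph. set s := lin r x th ph.
        transitivity (- (sin th * lin_a mu x th ph * n + m * (sin th * lin_a nu x th ph)) * h s + (D - m * n) * (dh s * (sin th * lin_a r x th ph))); first rring.
        rewrite !G. rring. }
      rewrite RInt_minusR; try (apply: ex_RInt_cont => t; apply: ct_mult; [exact: continuous_const | first [exact: c5 | exact: (c4 _ ctt)]]).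
      rewrite !RInt_scalR; try (apply: ex_RInt_cont; first [exact: c3 | exact: c5 | exact: (c4 _ ctt)]).
      have -> : RInt (fun t => sin t * Fd lin_p x th t) 0 (2 * PI) = - RInt (fun t => cos t * F x th t) 0 (2 * PI) by lra.
      ring. }
    have HKd : is_derive K x (RInt (fun th => sin th * RInt (Fd lin_a x th) 0 (2 * PI)) 0 PI).
    { apply: (is_derive_RInt_param_continuous (fun a th => sin th * RInt (fun ph => F a th ph) 0 (2 * PI))
         (fun a th => sin th * RInt (Fd lin_a a th) 0 (2 * PI))).
      - move=> y th _. apply: is_derive_scal.
        apply: (is_derive_RInt_param_continuous (fun a ph => F a th ph) (fun a ph => Fd lin_a a th ph)).
        + move=> z ph _. exact: Da.
        + move=> ph _. apply: (s3 (Fd lin_a)). exact: cFd.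
        + move=> z ph _. exact: (s1 F).
      - move=> th _. apply: ct_mult; first ctn.
        apply: (continuous_RInt_param (fun (q : R * R) ph => Fd lin_a (fst q) (snd q) ph)).
        + move=> ph. exact: cFd.
        + move=> y ph. apply: (s1 (Fd lin_a)). exact: cFd.
      - move=> y th _. apply: ct_mult; first ctn.
        apply: (continuous_RInt_param (fun th ph => F y th ph)).
        + move=> ph. exact: (s2 F).
        + move=> z ph. exact: (s1 F). }
    apply: is_derive_eq HKd _.
    apply: is_RInt_unique.
    set Q := fun th => RInt (fun ph => cos ph * F x th ph) 0 (2 * PI).
    apply: is_RInt_eq; last by (instantiate (1 := - (sin PI * Q PI) - - (sin 0 * Q 0)); rewrite sin_PI sin_0; ring).
    apply: (is_RInt_ext (fun th => - (cos th * Q th + sin th * RInt (fun ph => cos ph * Fd lin_t x th ph) 0 (2 * PI)))).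
    { move=> th _. by rewrite key. }
    have HQ : forall th, is_derive Q th (RInt (fun ph => cos ph * Fd lin_t x th ph) 0 (2 * PI)).
    { move=> th. apply: (is_derive_RInt_param_continuous (fun th ph => cos ph * F x th ph) (fun th ph => cos ph * Fd lin_t x th ph)).
      - move=> y ph _. apply: is_derive_scal. exact: Dt.
      - move=> ph _. apply: ct_mult; first ctn. apply: (s2 (Fd lin_t)). exact: cFd.
      - move=> y ph _. apply: ct_mult; first ctn. exact: (s1 F). }
    apply: (RInt_of_derive (fun th => - (sin th * Q th))) => th _.
    - apply: (is_derive_opp (V := R_NormedModule)).
      exact: (is_derive_mult (K := R_AbsRing) _ _ _ _ _ (is_derive_sin th) (HQ th) Rmult_comm).
    - apply: ct_opp. apply: ct_plus; apply: ct_mult; try by ctn.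
      + apply: ex_derive_continuousR. eexists. exact: HQ.
      + apply: (continuous_RInt_param (fun th ph => cos ph * Fd lin_t x th ph)).
        * move=> ph. apply: ct_mult; first ctn. apply: (s2 (Fd lin_t)). exact: cFd.
        * move=> z ph. apply: ct_mult; first ctn. apply: (s1 (Fd lin_t)). exact: cFd. }
  have := eq_by_derive K (fun _ => 0) (fun _ => 0) a b HK (fun x => is_derive_const _ _). lra.
Qed.

Lemma RInt_pair (f g : R -> R) (a b : R) : ex_RInt f a b -> ex_RInt g a b ->
  RInt (V := C_R_CompleteNormedModule) (fun t => ((f t, g t) : C)) a b = (RInt f a b, RInt g a b).
Proof.
  move=> Hf Hg. apply: (is_RInt_unique (V := C_R_CompleteNormedModule)).
  by apply: is_RInt_C; apply: (RInt_correct (V := R_CompleteNormedModule)).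
Qed.

Lemma RInt_sin_cos (g : R -> R) : (forall x, continuous g x) ->
  RInt (fun th => sin th * g (cos th)) 0 PI = RInt g (-1) 1.
Proof.
  move=> Hg. have Hex := fun a b => ex_RInt_cont g a b Hg.
  have := RInt_comp (V := R_CompleteNormedModule) g cos (fun t => - sin t) 0 PI (fun x _ => Hg (cos x)).
  rewrite cos_0 cos_PI => H. rewrite (RInt_swapR g 1 (-1)) // -H.
  - rewrite -RInt_oppR.
    + apply: RInt_ext => t _. rewrite /scal /= /mult /=. rring.
    + apply: ex_RInt_cont => t. apply: ct_mult; first ctn. apply: (ct_comp cos g) => //. exact: continuous_cos.
  - move=> x _. split; [exact: is_derive_cos | ctn].
Qed.

Lemma RInt_azimuth (D a b c a' b' c' s k : R) :
  RInt (fun ph => (D - (a * (s * cos ph) + b * (s * sin ph) + c * k) * (a' * (s * cos ph) + b' * (s * sin ph) + c' * k))) 0 (2 * PI)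
   = PI * (2 * D - 2 * (c * c') * k ^ 2 - (a * a' + b * b') * s ^ 2).
Proof.
  apply: is_RInt_unique.
  set G := fun ph => D * ph - (a * a' * s ^ 2 * (ph / 2 + sin ph * cos ph / 2) + b * b' * s ^ 2 * (ph / 2 - sin ph * cos ph / 2)
      + (a * b' + b * a') * s ^ 2 * (sin ph ^ 2 / 2) + (a * c' + c * a') * s * k * sin ph - (b * c' + c * b') * s * k * cos ph + c * c' * k ^ 2 * ph).
  apply: is_RInt_eq.
  - apply: (RInt_of_derive G) => ph _; last ctn.
    rewrite /G. auto_derive => //.
    have Hs : sin ph * sin ph = 1 - cos ph * cos ph by have := sin2_cos2 ph; rewrite /Rsqr; lra.
    field_simplify. have -> : sin ph ^ 2 = 1 - cos ph * cos ph by rewrite -Hs; ring. field.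
  - rewrite /G sin_2PI cos_2PI sin_0 cos_0. field.
Qed.

Definition zrot (p : R) (v : vec) : vec :=
  mkvec (v 0%nat * cos p + v 1%nat * sin p) (v 1%nat * cos p - v 0%nat * sin p) (v 2%nat).

Lemma lin_zrot (p : R) (v : vec) (th ph : R) :
  lin (zrot p v) 0 th ph = dot (mkvec (sin th * cos (ph + p)) (sin th * sin (ph + p)) (cos th)) v.
Proof. rewrite /lin /zrot /dot /mkvec cos_plus sin_plus cos_0 sin_0. ring. Qed.

(** Two rotations bring [r] onto the polar axis. The one about the third axis is a shift of [ph],
    absorbed by periodicity; the one about the second axis is handled by [rotation_invariance].
    Afterwards [h] depends on [th] only and the azimuth can be integrated out. *)
Lemma sphere_integral (mu nu r : vec) (kappa : R) (h : R -> R) : contdiff h -> 0 < vnorm r ->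
  let k := fun th ph => mkvec (sin th * cos ph) (sin th * sin ph) (cos th) in
  RInt (fun th => RInt (fun ph => sin th * (transv mu nu (k th ph) * kappa * h (dot (k th ph) r))) 0 (2 * PI)) 0 PI =
    kappa * ang 3 (dot mu nu) (dot mu nu) (dot mu r * dot nu r / vnorm r ^ 2) (vnorm r) h.
Proof.
  move=> Ch Hr k. have hc := fun x => contdiff_continuous h x Ch.
  set D := dot mu nu. set R0 := vnorm r.
  have [p [Hp1 Hp2]] := polar_angle (r 0%nat) (r 1%nat).
  set rho := sqrt (r 0%nat ^ 2 + r 1%nat ^ 2) in Hp1 Hp2.
  have Hrho2 : rho ^ 2 = r 0%nat ^ 2 + r 1%nat ^ 2.
  { rewrite /rho /= !Rmult_1_r sqrt_sqrt //. nra. }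
  (* After the first rotation the coordinates of [r] are [rho], [0] and [r 2]. The sign in [- rho]
     is chosen so that [rho cos a + r_2 sin a = 0], the condition for the second rotation to carry
     [r] to the positive polar axis. *)
  have [a [Ha1 Ha2]] := polar_angle (r 2%nat) (- rho).
  have HR0 : sqrt (r 2%nat ^ 2 + (- rho) ^ 2) = R0.
  { rewrite /R0 /vnorm. congr sqrt. have -> : (- rho) ^ 2 = rho ^ 2 by ring. rewrite Hrho2 /dot. ring. }
  rewrite HR0 in Ha1 Ha2.
  set mu' := zrot p mu. set nu' := zrot p nu. set r' := zrot p r.
  have csp : cos p * cos p = 1 - sin p * sin p by have := sin2_cos2 p; rewrite /Rsqr; lra.
  have csa : cos a * cos a = 1 - sin a * sin a by have := sin2_cos2 a; rewrite /Rsqr; lra.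
  have Hr'0 : r' 0%nat = rho.
  { rewrite /r' /zrot /mkvec Hp1 Hp2. transitivity (rho * (cos p * cos p + sin p * sin p)); first ring. rewrite csp. ring. }
  have Hr'1 : r' 1%nat = 0 by rewrite /r' /zrot /mkvec Hp1 Hp2; ring.
  have Hr'2 : r' 2%nat = r 2%nat by [].
  have Hlr : forall th ph, lin r' a th ph = R0 * cos th.
  { move=> th ph. rewrite /lin Hr'0 Hr'1 Hr'2.
    have -> : rho = - (R0 * sin a) by rewrite -Ha2; ring. rewrite Ha1.
    transitivity (R0 * (cos a * cos a + sin a * sin a) * cos th); first ring. rewrite csa. ring. }
  set A := fun v : vec => v 0%nat * cos a + v 2%nat * sin a. set B := fun v : vec => v 1%nat.
  set Cc := fun v : vec => v 2%nat * cos a - v 0%nat * sin a.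
  have Hdot : A mu' * A nu' + B mu' * B nu' + Cc mu' * Cc nu' = D.
  { transitivity ((mu' 0%nat * nu' 0%nat + mu' 2%nat * nu' 2%nat) * (cos a * cos a + sin a * sin a) + mu' 1%nat * nu' 1%nat); first by rewrite /A /B /Cc; ring.
    rewrite csa /mu' /nu' /zrot /mkvec /D /dot.
    transitivity ((mu 0%nat * nu 0%nat + mu 1%nat * nu 1%nat) * (cos p * cos p + sin p * sin p) + mu 2%nat * nu 2%nat); first ring.
    rewrite csp. ring. }
  have Hcr : forall v, Cc (zrot p v) * R0 = dot v r.
  { move=> v. rewrite /Cc.
    have -> : (zrot p v 2%nat * cos a - zrot p v 0%nat * sin a) * R0 = zrot p v 2%nat * (R0 * cos a) - zrot p v 0%nat * (R0 * sin a) by ring.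
    rewrite -Ha1 -Ha2 /zrot /mkvec /dot.
    transitivity (v 0%nat * (rho * cos p) + v 1%nat * (rho * sin p) + v 2%nat * r 2%nat); first ring. by rewrite -Hp1 -Hp2. }
  have HM : dot mu r * dot nu r / R0 ^ 2 = Cc mu' * Cc nu'.
  { rewrite -!Hcr -/mu' -/nu'. field. rewrite /R0. lra. }
  transitivity (kappa * RInt (fun th => sin th * RInt (fun ph => integrand3 D h (lin mu' 0 th ph) (lin nu' 0 th ph) (lin r' 0 th ph)) 0 (2 * PI)) 0 PI).
  - have cin : forall th ph, continuous (fun ph => integrand3 D h (lin mu' 0 th ph) (lin nu' 0 th ph) (lin r' 0 th ph)) ph.
    { move=> th ph. rewrite /integrand3. apply: ct_mult; first by rewrite /lin; ctn.
      apply: (ct_comp _ h) => //. rewrite /lin. ctn. }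
    rewrite -RInt_scalR; last first.
    { apply: ex_RInt_cont => th. apply: ct_mult; first ctn.
      apply: (continuous_RInt_param (fun th ph => integrand3 D h (lin mu' 0 th ph) (lin nu' 0 th ph) (lin r' 0 th ph))) => //.
      move=> ph. rewrite /integrand3. apply: ct_mult; first by rewrite /lin; ctn.
      apply: (ct_comp _ h) => //. rewrite /lin. ctn. }
    apply: RInt_ext => th _.
    have cg : forall ph, continuous (fun ph => sin th * (transv mu nu (k th ph) * kappa * h (dot (k th ph) r))) ph.
    { move=> ph. rewrite /transv /k /dot /mkvec. apply: ct_mult; first ctn. apply: ct_mult; first ctn.
      apply: (ct_comp _ h) => //. ctn. }
    rewrite -(RInt_periodic _ p cg).
    + have -> : kappa * (sin th * RInt (fun ph => integrand3 D h (lin mu' 0 th ph) (lin nu' 0 th ph) (lin r' 0 th ph)) 0 (2 * PI)) =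
         (kappa * sin th) * RInt (fun ph => integrand3 D h (lin mu' 0 th ph) (lin nu' 0 th ph) (lin r' 0 th ph)) 0 (2 * PI) by ring.
      rewrite -RInt_scalR; last by apply: ex_RInt_cont.
      apply: RInt_ext => ph _. rewrite /integrand3 /mu' /nu' /r' !lin_zrot -/(k th (ph + p)) /transv -/D.
      have -> : dot mu (k th (ph + p)) = dot (k th (ph + p)) mu by rewrite /dot; ring. rring.
    + move=> t. rewrite /k. have -> : t + 2 * PI = t + 2 * INR 1 * PI by rewrite /=; ring. by rewrite cos_period sin_period.
  - have HR := rotation_invariance D mu' nu' r' h 0 a Ch. cbv zeta in HR. rewrite HR. congr Rmult.
    transitivity (RInt (fun th => sin th * (PI * ((2 * D - 2 * (Cc mu' * Cc nu') * cos th ^ 2 - (A mu' * A nu' + B mu' * B nu') * (1 - cos th ^ 2)) * h (R0 * cos th)))) 0 PI).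
    + apply: RInt_ext => th _. congr Rmult.
      have -> : 1 - cos th ^ 2 = sin th ^ 2 by have := sin2_cos2 th; rewrite /Rsqr /=; lra.
      have HA := RInt_azimuth D (A mu') (B mu') (Cc mu') (A nu') (B nu') (Cc nu') (sin th) (cos th).
      transitivity (h (R0 * cos th) * (PI * (2 * D - 2 * (Cc mu' * Cc nu') * cos th ^ 2 - (A mu' * A nu' + B mu' * B nu') * sin th ^ 2))); last ring.
      rewrite -HA -RInt_scalR.
      * apply: RInt_ext => ph _. rewrite Hlr /integrand3 /lin -/(A mu') -/(A nu') -/(B mu') -/(B nu') -/(Cc mu') -/(Cc nu'). rring.
      * apply: ex_RInt_cont => ph. ctn.
    + rewrite (RInt_sin_cos (fun u => PI * ((2 * D - 2 * (Cc mu' * Cc nu') * u ^ 2 - (A mu' * A nu' + B mu' * B nu') * (1 - u ^ 2)) * h (R0 * u)))).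
      * rewrite RInt_scalR.
        -- rewrite /ang HM. congr Rmult. apply: RInt_ext => u _. rewrite -Hdot. rring.
        -- apply: ex_RInt_cont => u. apply: ct_mult; first ctn. apply: (ct_comp (fun u => R0 * u) h) => //. ctn.
      * move=> u. apply: ct_mult; first ctn. apply: ct_mult; first ctn. apply: (ct_comp (fun u => R0 * u) h) => //. ctn.
Qed.

Lemma aligned_3 : aligned 3.
Proof.
  move=> mu nu r kappa hr hi _ Hr Cr Ci D Dd M.
  have hrc := fun x => contdiff_continuous hr x Cr. have hic := fun x => contdiff_continuous hi x Ci.
  rewrite /D /Dd /M /dotd -(sphere_integral mu nu r kappa hr Cr Hr) -(sphere_integral mu nu r kappa hi Ci Hr).
  set k := fun th ph => mkvec (sin th * cos ph) (sin th * sin ph) (cos th). cbv zeta.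
  have cj : forall h, (forall x, continuous h x) -> forall x : R * R,
     continuous (fun q : R * R => sin (fst q) * (transv mu nu (k (fst q) (snd q)) * kappa * h (dot (k (fst q) (snd q)) r))) x.
  { move=> h hc x. rewrite /transv /k /dot /mkvec. apply: ct_mult; first ctn. apply: ct_mult; first ctn.
    apply: (ct_comp _ h) => //. ctn. }
  have cg : forall h, (forall x, continuous h x) -> forall th ph,
     continuous (fun ph => sin th * (transv mu nu (k th ph) * kappa * h (dot (k th ph) r))) ph.
  { move=> h hc th ph. rewrite /transv /k /dot /mkvec. apply: ct_mult; first ctn. apply: ct_mult; first ctn.
    apply: (ct_comp _ h) => //. ctn. }
  rewrite -RInt_pair.
  - apply: (RInt_ext (V := C_R_CompleteNormedModule)) => th _.
    rewrite -RInt_pair; try (apply: ex_RInt_cont; exact: cg).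
    apply: (RInt_ext (V := C_R_CompleteNormedModule)) => ph _. rewrite -/(k th ph).
    apply: injective_projections; rewrite /rscal /=; ring.
  - apply: ex_RInt_cont => th.
    apply: (continuous_RInt_param (fun th ph => sin th * (transv mu nu (k th ph) * kappa * hr (dot (k th ph) r)))) => [ph|y ph]; [exact: cj | exact: cg].
  - apply: ex_RInt_cont => th.
    apply: (continuous_RInt_param (fun th ph => sin th * (transv mu nu (k th ph) * kappa * hi (dot (k th ph) r)))) => [ph|y ph]; [exact: cj | exact: cg].
Qed.

Lemma z_derive (eps a : R) : 0 < eps ->
  is_derive (zp eps) a (-2 * (zp eps a * zq eps a)) /\ is_derive (zq eps) a (zp eps a ^ 2 - zq eps a ^ 2).
Proof.
  move=> He. have Hp := sumsq_pos eps a He. rewrite /zp /zq.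
  split; auto_derive; try (simpl in *; lra); simpl in *; field; lra.
Qed.

Lemma mp_parity (w0 eps a : R) : 0 < eps -> mR w0 eps (- a) = mR w0 eps a /\ pI w0 eps (- a) = - pI w0 eps a.
Proof.
  move=> He. have [j1 [j2 [j3 j4]]] := j_parity w0 eps a He.
  have Hsn : sin (w0 * - a) = - sin (w0 * a) by rewrite -sin_neg; congr sin; ring.
  have Hcn : cos (w0 * - a) = cos (w0 * a) by rewrite -cos_neg; congr cos; ring.
  rewrite /mR /pI j1 j3 Hsn Hcn. split; ring.
Qed.

Lemma is_derive_scale_arg (f df : R -> R) (rho u : R) : (forall x, is_derive f x (df x)) ->
  is_derive (fun u => f (rho * u)) u (rho * df (rho * u)).
Proof.
  move=> Hf. have Hl : is_derive (fun u => rho * u) u rho by auto_derive => //; ring.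
  exact: (is_derive_comp (V := R_NormedModule) f _ u _ _ (Hf _) Hl).
Qed.

(* Two integrations by parts, since the three-dimensional frequency integral is minus the second derivative
   of the one-dimensional one. *)
Lemma ang3_hR (w0 eps D M rho : R) : 0 < eps -> 0 < rho ->
  ang 3 D D M rho (hR 3 w0 eps) =
   PI * (2 * (2 * D - 2 * M) * (4 * zp eps rho * zq eps rho + w0 ^ 2 * pI w0 eps rho) / rho
       + 4 * (D - 3 * M) * (2 * zp eps rho + w0 * mR w0 eps rho) / rho ^ 2 - 4 * (D - 3 * M) * pI w0 eps rho / rho ^ 3).
Proof.
  move=> He Hrho. rewrite /ang. congr Rmult. apply: is_RInt_unique.
  have Dz := fun a => z_derive eps a He. have Dm := fun a => mp_derive w0 eps a He.
  set H1 := fun a => 2 * zp eps a + w0 * mR w0 eps a.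
  set H1' := fun a => - 4 * (zp eps a * zq eps a) - w0 ^ 2 * pI w0 eps a.
  have DH1 : forall a, is_derive H1 a (H1' a).
  { move=> a. have h1 := is_derive_scal _ _ 2 _ (proj1 (Dz a)). have h2 := is_derive_scal _ _ w0 _ (proj1 (Dm a)).
    have h3 := is_derive_plus (V := R_NormedModule) _ _ _ _ _ h1 h2.
    apply: is_derive_eq h3 _. rewrite /H1' /plus /=. rring. }
  have DH1' : forall a, is_derive H1' a (- hR 3 w0 eps a).
  { move=> a. have h0 := is_derive_mult (K := R_AbsRing) _ _ _ _ _ (proj1 (Dz a)) (proj2 (Dz a)) Rmult_comm.
    have h1 := is_derive_scal _ _ (-4) _ h0. have h2 := is_derive_scal _ _ (w0 ^ 2) _ (proj1 (proj2 (Dm a))).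
    have h3 := is_derive_minus (V := R_NormedModule) _ _ _ _ _ h1 h2.
    apply: is_derive_eq h3 _. rewrite /hR /momR /minus /plus /opp /mult /=. rring. }
  have DpI : forall a, is_derive (pI w0 eps) a (H1 a).
  { move=> a. apply: is_derive_eq (proj1 (proj2 (Dm a))) _. rewrite /H1. rring. }
  set P := fun u => 2 * D - 2 * M * u ^ 2 - (D - M) * (1 - u ^ 2).
  (* The chain of primitives is [- hR 3], [H1'], [H1], [pI]. The weight [P] is quadratic with
     constant second derivative [2 (D - 3 M)], so after two integrations by parts the remaining
     integral is that of [H1], which is [pI]; each step contributes a factor [1 / rho]. *)
  set G := fun u => (2 * (D - 3 * M) * u) * H1 (rho * u) / rho ^ 2 - P u * H1' (rho * u) / rho - 2 * (D - 3 * M) * pI w0 eps (rho * u) / rho ^ 3.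
  apply: is_RInt_eq.
  - apply: (RInt_of_derive G) => u _.
    + have e1 := is_derive_scale_arg _ _ rho u DH1. have e2 := is_derive_scale_arg _ _ rho u DH1'. have e3 := is_derive_scale_arg _ _ rho u DpI.
      have dP : is_derive P u (2 * (D - 3 * M) * u) by rewrite /P; auto_derive => //; ring.
      have dL : is_derive (fun u => 2 * (D - 3 * M) * u) u (2 * (D - 3 * M)) by auto_derive => //; ring.
      have m1 := is_derive_scal _ _ (/ rho ^ 2) _ (is_derive_mult (K := R_AbsRing) _ _ _ _ _ dL e1 Rmult_comm).
      have m2 := is_derive_scal _ _ (/ rho) _ (is_derive_mult (K := R_AbsRing) _ _ _ _ _ dP e2 Rmult_comm).
      have m3 := is_derive_scal _ _ (2 * (D - 3 * M) / rho ^ 3) _ e3.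
      have m4 := is_derive_minus (V := R_NormedModule) _ _ _ _ _ (is_derive_minus (V := R_NormedModule) _ _ _ _ _ m1 m2) m3.
      apply: (is_derive_ext_loc _ G _ _ _ _); last apply: is_derive_eq m4 _.
      * apply: filter_forall => t. rewrite /G /minus /plus /opp /mult /=. rfield. lra.
      * rewrite /minus /plus /opp /mult /=. rewrite /P /=. rfield. lra.
    + apply: ct_mult; first ctn. apply: (ct_comp (fun u => rho * u) (hR 3 w0 eps)); first ctn.
      exact: contdiff_continuous (proj1 (contdiff_h 3 w0 eps He)).
  - have [p1 p2] := mp_parity w0 eps rho He.
    have [q1 q2] := mom_parity eps rho 0. rewrite /momR /momI in q1 q2.
    rewrite /G /P /H1 /H1'. have -> : rho * -1 = - rho by ring. have -> : rho * 1 = rho by ring. rewrite p1 p2 q1 q2. field. lra.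
Qed.

Lemma ang3_cos (w0 D M rho : R) : 0 < w0 -> 0 < rho ->
  ang 3 D D M rho (fun x => cos (w0 * x)) =
   PI * (2 * (2 * D - 2 * M) * sin (w0 * rho) / (w0 * rho)
       + 4 * (D - 3 * M) * cos (w0 * rho) / (w0 * rho) ^ 2 - 4 * (D - 3 * M) * sin (w0 * rho) / (w0 * rho) ^ 3).
Proof.
  move=> Hw Hrho. rewrite /ang. congr Rmult. apply: is_RInt_unique.
  set x := w0 * rho. have Hx : 0 < x by exact: Rmult_lt_0_compat.
  set P := fun u => 2 * D - 2 * M * u ^ 2 - (D - M) * (1 - u ^ 2).
  set G := fun u => P u * sin (x * u) / x + (2 * (D - 3 * M) * u) * cos (x * u) / x ^ 2 - 2 * (D - 3 * M) * sin (x * u) / x ^ 3.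
  apply: is_RInt_eq.
  - apply: (RInt_of_derive G) => u _; last ctn.
    rewrite /G /P. have -> : w0 * (rho * u) = x * u by rewrite /x; ring.
    auto_derive => //. field. lra.
  - rewrite /G /P. have -> : x * -1 = - x by ring. rewrite Rmult_1_r sin_neg cos_neg. field. lra.
Qed.

Lemma convergence_3 (c w0 : R) (mu nu r : vec) : 0 < c -> 0 < w0 -> in_Rd 3 r -> 0 < vnorm r ->
  filterlim
    (fun eps => Cplus (Copp (omega_reg 3 c w0 mu nu r eps))
                      (Cmult (Cdiv Ci (RtoC 2)) (gamma_ij 3 c w0 mu nu r)))
    (at_right 0)
    (locally (rscal (4 * PI * (w0 / c) ^ 2) (dyadic_form 3 (w0 / c) mu nu r))).
Proof.
  move=> Hc Hw Hin Hr. have HP := PI_RGT_0. set k0 := w0 / c.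
  have Hk : 0 < k0 by exact: Rdiv_lt_0_compat.
  set rho := vnorm r / c.
  have Hx : 0 < rho by exact: Rdiv_lt_0_compat.
  have [Hm Hp] := mR_pI_lim w0 rho Hw Hx. have [Hzp Hzq] := z_lim rho Hx.
  set D := dot mu nu. set M := dot mu r * dot nu r / vnorm r ^ 2.
  have Hpk : w0 * rho = k0 * vnorm r by rewrite /rho /k0; field; lra.
  apply: (reduction 3 c w0 mu nu r
     (fun x => cos (k0 * x) / (4 * PI * x))
     (fun x => (- k0 * sin (k0 * x) / x - cos (k0 * x) / x ^ 2) / (4 * PI))
     (fun x => (- k0 ^ 2 * cos (k0 * x) / x + 2 * k0 * sin (k0 * x) / x ^ 2 + 2 * cos (k0 * x) / x ^ 3) / (4 * PI))
     (fun x => sin (k0 * x) / (4 * PI * x))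
     (fun x => (k0 * cos (k0 * x) / x - sin (k0 * x) / x ^ 2) / (4 * PI))
     (fun x => (- k0 ^ 2 * sin (k0 * x) / x - 2 * k0 * cos (k0 * x) / x ^ 2 + 2 * sin (k0 * x) / x ^ 3) / (4 * PI))
     (PI * (2 * (2 * D - 2 * M) * (4 * 0 * / rho + w0 ^ 2 * (PI * cos (w0 * rho))) / rho
       + 4 * (D - 3 * M) * (2 * 0 + w0 * (- PI * sin (w0 * rho))) / rho ^ 2 - 4 * (D - 3 * M) * (PI * cos (w0 * rho)) / rho ^ 3))) => //.
  - exact: aligned_3.
  - lia.
  - move=> x Hx0. auto_derive; first nra. field. lra.
  - move=> x Hx0. auto_derive; first (repeat split; nra). field. lra.
  - move=> x Hx0. auto_derive; first nra. field. lra.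
  - move=> x Hx0. auto_derive; first (repeat split; nra). field. lra.
  - move=> v Hv. rewrite Gd_3 // -/k0. congr pair; field; lra.
  - apply: (filterlim_ext_loc (fun eps => PI * (2 * (2 * D - 2 * M) * (4 * zp eps rho * zq eps rho + w0 ^ 2 * pI w0 eps rho) / rho
       + 4 * (D - 3 * M) * (2 * zp eps rho + w0 * mR w0 eps rho) / rho ^ 2 - 4 * (D - 3 * M) * pI w0 eps rho / rho ^ 3))).
    { apply: filter_imp at_right_pos => eps He. by rewrite -ang3_hR. }
    have Hct : forall k : R, filterlim (fun _ : R => k) (at_right 0) (locally k) by move=> k; exact: filterlim_const.
    rewrite /Rdiv.
    apply: fl_mult; first exact: Hct. apply: fl_minus; first apply: fl_plus.
    + apply: fl_mult; last exact: Hct. apply: fl_mult; first exact: Hct.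
      apply: fl_plus; [apply: fl_mult; [apply: fl_mult; [exact: Hct | exact: Hzp] | exact: Hzq] | apply: fl_mult; [exact: Hct | exact: Hp]].
    + apply: fl_mult; last exact: Hct. apply: fl_mult; first exact: Hct.
      apply: fl_plus; (apply: fl_mult; first exact: Hct); [exact: Hzp | exact: Hm].
    + apply: fl_mult; last exact: Hct. apply: fl_mult; [exact: Hct | exact: Hp].
  - rewrite Hpk -/D -/M -/k0 /dotd -/D /rho /k0 /=. set cc := cos _. set ss := sin _. field. repeat split; lra.
  - rewrite -/rho -/D -/M /dotd -/D ang3_cos // Hpk -/k0 /k0 /=. set cc := cos _. set ss := sin _. field. repeat split; lra.
Qed.

(** * Dimension 2 *)

(** Shifting the angle by that of [r] leaves one cross term, with [sin th cos th h (R0 cos th)]. It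
    is the derivative of a function of [cos th] and integrates to zero over the period. *)
Lemma circle_integral (mu nu r : vec) (kappa : R) (h : R -> R) : in_Rd 2 r -> 0 < vnorm r -> (forall x, continuous h x) ->
  let k := fun th => mkvec (cos th) (sin th) 0 in
  RInt (fun th => transv mu nu (k th) * kappa * h (dot (k th) r)) 0 (2 * PI) =
    kappa * ang 2 (dot mu nu) (dotd 2 mu nu) (dot mu r * dot nu r / vnorm r ^ 2) (vnorm r) h.
Proof.
  move=> Hin Hr hc k. set R0 := vnorm r.
  have h2 : r 2%nat = 0 by apply: Hin; lia.
  have [p [Hp1 Hp2]] := polar_angle (r 0%nat) (r 1%nat).
  have HR0 : sqrt (r 0%nat ^ 2 + r 1%nat ^ 2) = R0.
  { rewrite /R0 /vnorm /dot h2. congr sqrt. ring. }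
  rewrite HR0 in Hp1 Hp2.
  have csp : cos p * cos p = 1 - sin p * sin p by have := sin2_cos2 p; rewrite /Rsqr; lra.
  set A := fun v : vec => v 0%nat * cos p + v 1%nat * sin p. set B := fun v : vec => v 1%nat * cos p - v 0%nat * sin p.
  have HAR : forall v, dot v r = A v * R0 by move=> v; rewrite /dot h2 Hp1 Hp2 /A; ring.
  have HM : dot mu r * dot nu r / R0 ^ 2 = A mu * A nu by rewrite !HAR; field; rewrite /R0; lra.
  have HD : dotd 2 mu nu = A mu * A nu + B mu * B nu.
  { rewrite /dotd /A /B. transitivity ((mu 0%nat * nu 0%nat + mu 1%nat * nu 1%nat) * (cos p * cos p + sin p * sin p)); last ring. rewrite csp. ring. }
  have Hk : forall th v, dot (k (th + p)) v = cos th * A v + sin th * B v.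
  { move=> th v. rewrite /k /dot /mkvec cos_plus sin_plus /A /B. ring. }
  have cg : forall th, continuous (fun th => transv mu nu (k th) * kappa * h (dot (k th) r)) th.
  { move=> th. rewrite /transv /k /dot /mkvec. apply: ct_mult; first ctn. apply: (ct_comp _ h) => //. ctn. }
  rewrite -(RInt_periodic _ p cg); last first.
  { move=> t. rewrite /k. have -> : t + 2 * PI = t + 2 * INR 1 * PI by rewrite /=; ring. by rewrite cos_period sin_period. }
  rewrite /ang HM HD.
  set f := fun th => (dot mu nu - A mu * A nu * cos th ^ 2 - (A mu * A nu + B mu * B nu - A mu * A nu) * sin th ^ 2) * h (R0 * cos th).
  set g := fun th => sin th * cos th * h (R0 * cos th).
  have cf : forall th, continuous f th.
  { move=> th. rewrite /f. apply: ct_mult; first ctn. apply: (ct_comp (fun th => R0 * cos th) h) => //. ctn. }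
  have cgg : forall th, continuous g th.
  { move=> th. rewrite /g. apply: ct_mult; first ctn. apply: (ct_comp (fun th => R0 * cos th) h) => //. ctn. }
  have Hg : RInt g 0 (2 * PI) = 0.
  { have cxh : forall x, continuous (fun x => x * h x) x by move=> x; apply: ct_mult; [exact: continuous_id | exact: hc].
    set H := fun x => RInt (fun x => x * h x) 0 x.
    have HH : forall x, is_derive H x (x * h x) by move=> x; exact: (is_derive_RInt_upper (fun x => x * h x)).
    apply: is_RInt_unique. apply: is_RInt_eq.
    - apply: (RInt_of_derive (fun th => - / R0 ^ 2 * H (R0 * cos th))) => th _ //.
      have Hl : is_derive (fun th => R0 * cos th) th (- R0 * sin th) by auto_derive => //; ring.
      have H1 := is_derive_comp (V := R_NormedModule) H _ th _ _ (HH _) Hl.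
      have H2 := is_derive_scal _ _ (- / R0 ^ 2) _ H1.
      apply: is_derive_eq H2 _. rewrite /scal /= /mult /= /g. rfield. rewrite /R0. lra.
    - cbv beta. rewrite cos_2PI cos_0. ring. }
  transitivity (RInt (fun th => kappa * f th - kappa * (A mu * B nu + B mu * A nu) * g th) 0 (2 * PI)).
  - apply: RInt_ext => th _. rewrite /transv.
    have -> : dot mu (k (th + p)) = dot (k (th + p)) mu by rewrite /dot; ring.
    rewrite !Hk. have -> : B r = 0 by rewrite /B Hp1 Hp2; ring.
    have -> : A r = R0.
    { rewrite /A Hp1 Hp2. transitivity (R0 * (cos p * cos p + sin p * sin p)); first ring. rewrite csp. ring. }
    have -> : cos th * R0 + sin th * 0 = R0 * cos th by ring.
    rewrite /f /g. rring.
  - rewrite RInt_minusR.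
    + rewrite !RInt_scalR; try exact: ex_RInt_cont. rewrite Hg. rewrite Rmult_0_r Rminus_0_r. by [].
    + apply: ex_RInt_cont => t. apply: ct_mult; [exact: continuous_const | exact: cf].
    + apply: ex_RInt_cont => t. apply: ct_mult; [exact: continuous_const | exact: cgg].
Qed.

Lemma aligned_2 : aligned 2.
Proof.
  move=> mu nu r kappa hr hi Hin Hr Cr Ci D Dd M.
  have hrc := fun x => contdiff_continuous hr x Cr. have hic := fun x => contdiff_continuous hi x Ci.
  rewrite /D /Dd /M -(circle_integral mu nu r kappa hr Hin Hr hrc) -(circle_integral mu nu r kappa hi Hin Hr hic).
  set k := fun th => mkvec (cos th) (sin th) 0. cbv zeta.
  have cg : forall h, (forall x, continuous h x) -> forall th, continuous (fun th => transv mu nu (k th) * kappa * h (dot (k th) r)) th.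
  { move=> h hc th. rewrite /transv /k /dot /mkvec. apply: ct_mult; first ctn. apply: (ct_comp _ h) => //. ctn. }
  rewrite -RInt_pair; try (apply: ex_RInt_cont; exact: cg).
  apply: (RInt_ext (V := C_R_CompleteNormedModule)) => th _. rewrite -/(k th).
  apply: injective_projections; rewrite /rscal /=; ring.
Qed.

(** * Even moments of the cosine, with and without a logarithm *)

Definition cosmom (m : nat) : R := 2 * PI * (INR (fact (2 * m)) / (4 ^ m * INR (fact m) ^ 2)).

Lemma cosmom_S (m : nat) : cosmom (S m) = cosmom m * ((2 * INR m + 1) / (2 * INR m + 2)).
Proof.
  rewrite /cosmom. have -> : (2 * S m = S (S (2 * m)))%nat by lia.
  rewrite (fact_simpl (S (2 * m))) (fact_simpl (2 * m)) (fact_simpl m) !mult_INR !S_INR mult_INR.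
  have -> : INR 2 = 2 by []. have -> : 4 ^ S m = 4 * 4 ^ m by [].
  have h1 := INR_fact_neq_0 m. have h3 : 4 ^ m <> 0 by apply: pow_nonzero; lra. have := pos_INR m => hm.
  field. repeat split => //; lra.
Qed.

Lemma pow_double_S (c : R) (m : nat) : c ^ (2 * S m) = c ^ 2 * c ^ (2 * m).
Proof. have -> : (2 * S m = 2 + 2 * m)%nat by lia. by rewrite pow_add. Qed.

(** Wallis' recursion: the derivative of [sin th cos^(2m+1) th] has zero integral over a full
    period. *)
Lemma RInt_cos_pow (m : nat) : is_RInt (fun th => cos th ^ (2 * m)) 0 (2 * PI) (cosmom m).
Proof.
  have HP := PI_RGT_0.
  elim: m => [|m IH].
  - apply: (is_RInt_ext (fun _ => 1)) => //. rewrite /cosmom.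
    apply: is_RInt_eq; first exact: is_RInt_const. rewrite /scal /= /mult /=. rfield.
  - have Hm := pos_INR m.
    have Hp : is_RInt (fun th => (2 * INR m + 2) * cos th ^ (2 * S m) - (2 * INR m + 1) * cos th ^ (2 * m)) 0 (2 * PI) 0.
    { apply: is_RInt_eq.
      - apply: (RInt_of_derive (fun th => sin th * cos th ^ (2 * m + 1))) => th _; last ctn.
        have Hc := is_derive_pow cos (2 * m + 1) th _ (is_derive_cos th).
        have H := is_derive_mult (K := R_AbsRing) _ _ _ _ _ (is_derive_sin th) Hc Rmult_comm.
        apply: is_derive_eq H _. rewrite pow_double_S.
        have -> : Init.Nat.pred (2 * m + 1) = (2 * m)%nat by lia.
        rewrite plus_INR mult_INR pow_add pow_1. have -> : INR 2 = 2 by []. have -> : INR 1 = 1 by [].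
        have Hs : sin th * sin th = 1 - cos th * cos th by have := sin2_cos2 th; rewrite /Rsqr; lra.
        move: (cos th ^ (2 * m)) => X.
        transitivity (cos th * cos th * X - (2 * INR m + 1) * (sin th * sin th) * X); first (rewrite /plus /mult /=; rring).
        rewrite Hs. rring.
      - cbv beta. rewrite sin_2PI sin_0. ring. }
    have H2 := is_RInt_plus (V := R_NormedModule) _ _ _ _ _ _
        (is_RInt_scal (V := R_NormedModule) _ _ _ (/ (2 * INR m + 2)) _ Hp)
        (is_RInt_scal (V := R_NormedModule) _ _ _ ((2 * INR m + 1) / (2 * INR m + 2)) _ IH).
    apply: is_RInt_eq; first apply: is_RInt_ext H2.
    + move=> th _. rewrite /plus /scal /= /mult /=. rfield. lra.
    + rewrite cosmom_S /plus /scal /= /mult /=. rring.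
Qed.

(** At [a = rho cos th] the logarithm of [eps^2 + a^2] is [2 ln rho] plus this function with
    [eta = eps / rho]. As [eta] tends to [0] it becomes [2 ln |cos th|]. *)
Definition lcos (eta th : R) : R := ln (eta ^ 2 + cos th ^ 2).
Definition logmom (m : nat) (eta : R) : R := RInt (fun th => cos th ^ (2 * m) * lcos eta th) 0 (2 * PI).

Lemma ln_ct {T : UniformSpace} (f : T -> R) (x : T) : continuous f x -> 0 < f x -> continuous (fun y => ln (f y)) x.
Proof. move=> Hf H0. apply: (ct_comp_derive f ln) => //. by auto_derive. Qed.

Lemma continuous_lcos (eta th : R) : 0 < eta -> continuous (lcos eta) th.
Proof. move=> He. have Hp := sumsq_pos eta (cos th) He. rewrite /lcos. apply: ln_ct => //. ctn. Qed.

Lemma continuous_logmom (m : nat) (eta th : R) : 0 < eta -> continuous (fun th => cos th ^ (2 * m) * lcos eta th) th.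
Proof. move=> He. apply: ct_mult; [ctn | exact: continuous_lcos]. Qed.

Lemma logmom_0 (eta : R) : logmom 0 eta = RInt (lcos eta) 0 (2 * PI).
Proof. apply: RInt_ext => th _. rewrite /=. by rewrite Rmult_1_l. Qed.

(* [(eta^2 + cos^2 t) (eta^2 + sin^2 t) = (eta'^2 + sin^2 (2 t)) / 4]; as [eta] tends to [0] this forces the value of the limit. *)
Lemma logmom_doubling (eta : R) : 0 < eta ->
  2 * logmom 0 eta = logmom 0 (2 * eta * sqrt (1 + eta ^ 2)) - 2 * PI * ln 4.
Proof.
  move=> He. have HP := PI_RGT_0. set eta' := 2 * eta * sqrt (1 + eta ^ 2).
  have He2 := pow2_ge_0 eta.
  have Hs0 : 0 < sqrt (1 + eta ^ 2) by apply: sqrt_lt_R0; lra.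
  have Hs2 : sqrt (1 + eta ^ 2) * sqrt (1 + eta ^ 2) = 1 + eta ^ 2 by apply: sqrt_sqrt; lra.
  have He' : 0 < eta' by rewrite /eta'; nra.
  have per : forall e, 0 < e -> forall t, lcos e (t + 2 * PI) = lcos e t.
  { move=> e _ t. rewrite /lcos. have -> : t + 2 * PI = t + 2 * INR 1 * PI by rewrite /=; ring. by rewrite cos_period. }
  have cl : forall e, 0 < e -> forall t, continuous (lcos e) t by move=> e H t; exact: continuous_lcos.
  have shift : forall e, 0 < e -> forall s, RInt (fun t => lcos e (t + s)) 0 (2 * PI) = RInt (lcos e) 0 (2 * PI).
  { move=> e H s. exact: (RInt_periodic (lcos e) s (cl e H) (per e H)). }
  have ex : forall e, 0 < e -> forall a b, ex_RInt (lcos e) a b by move=> e H a b; apply: ex_RInt_cont; exact: cl.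
  rewrite !logmom_0.
  transitivity (RInt (fun t => lcos eta t + lcos eta (t + PI / 2)) 0 (2 * PI)).
  { rewrite RInt_plusR; [rewrite shift //; ring | exact: ex |].
    apply: ex_RInt_cont => t. apply: (ct_comp (fun t => t + PI / 2) (lcos eta)); [ctn | exact: cl]. }
  have Hpt : forall t, lcos eta t + lcos eta (t + PI / 2) = lcos eta' (2 * t + PI / 2) - ln 4.
  { move=> t. have hsin : forall u, cos (u + PI / 2) = - sin u by move=> u; rewrite cos_plus cos_PI2 sin_PI2; ring.
    rewrite /lcos !hsin.
    have p1 := sumsq_pos eta (cos t) He. have p2 := sumsq_pos eta (- sin t) He. have p3 := sumsq_pos eta' (- sin (2 * t)) He'.
    rewrite -ln_mult // -ln_div //; last lra. congr ln. rewrite sin_2a.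
    have hc : cos t ^ 2 = 1 - sin t ^ 2 by have := sin2_cos2 t; rewrite /Rsqr /=; lra.
    have -> : eta' ^ 2 = 4 * eta ^ 2 * (1 + eta ^ 2).
    { transitivity (4 * eta ^ 2 * (sqrt (1 + eta ^ 2) * sqrt (1 + eta ^ 2))); first by rewrite /eta'; ring. by rewrite Hs2. }
    transitivity ((4 * eta ^ 2 * (1 + eta ^ 2) + 4 * sin t ^ 2 * cos t ^ 2) / 4); last field.
    rewrite hc. field. }
  rewrite (RInt_ext _ (fun t => lcos eta' (2 * t + PI / 2) - ln 4)); last by move=> t _; exact: Hpt.
  have ch : forall t, continuous (fun t => lcos eta' (2 * t + PI / 2)) t.
  { move=> t. apply: (ct_comp (fun t => 2 * t + PI / 2) (lcos eta')); [ctn | exact: cl]. }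
  rewrite RInt_minusR; [| exact: ex_RInt_cont | exact: ex_RInt_const].
  rewrite RInt_const. have -> : scal (2 * PI - 0) (ln 4) = 2 * PI * ln 4 by rewrite /scal /= /mult /=; ring.
  congr Rminus.
  have H1 : is_RInt (fun t => scal 2 (lcos eta' (2 * t + PI / 2))) 0 (2 * PI) (RInt (lcos eta') (PI / 2) (2 * (2 * PI) + PI / 2)).
  { apply: (is_RInt_comp_lin (V := R_NormedModule)). have -> : 2 * 0 + PI / 2 = PI / 2 by ring.
    apply: (RInt_correct (V := R_CompleteNormedModule)). exact: ex. }
  have H2 : 2 * RInt (fun t => lcos eta' (2 * t + PI / 2)) 0 (2 * PI) = RInt (lcos eta') (PI / 2) (2 * (2 * PI) + PI / 2).
  { rewrite -RInt_scalR; last exact: ex_RInt_cont. rewrite -(is_RInt_unique _ _ _ _ H1). by []. }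
  have Hseg : forall s, RInt (lcos eta') s (2 * PI + s) = RInt (lcos eta') 0 (2 * PI).
  { move=> s. rewrite -(shift eta' He' s).
    have := is_RInt_comp_lin (V := R_NormedModule) (lcos eta') 1 s 0 (2 * PI) (RInt (lcos eta') s (2 * PI + s)).
    have -> : 1 * 0 + s = s by ring. have -> : 1 * (2 * PI) + s = 2 * PI + s by ring.
    move/(_ (RInt_correct (V := R_CompleteNormedModule) _ _ _ (ex eta' He' _ _))) => H.
    rewrite -(is_RInt_unique _ _ _ _ H). apply: RInt_ext => t _. rewrite /scal /= /mult /= !Rmult_1_l. by []. }
  have H3 : RInt (lcos eta') (PI / 2) (2 * (2 * PI) + PI / 2) = 2 * RInt (lcos eta') 0 (2 * PI).
  { rewrite (RInt_ChaslesR _ (PI / 2) (2 * PI + PI / 2)); try exact: ex.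
    have -> : 2 * (2 * PI) + PI / 2 = 2 * PI + (2 * PI + PI / 2) by ring.
    rewrite !Hseg. rring. }
  lra.
Qed.

Lemma is_derive_multR (f g : R -> R) (x df dg : R) : is_derive f x df -> is_derive g x dg ->
  is_derive (fun x => f x * g x) x (df * g x + f x * dg).
Proof. move=> Hf Hg. exact: (is_derive_mult (K := R_AbsRing) _ _ _ _ _ Hf Hg Rmult_comm). Qed.

Lemma logmom_mono (e f : R) : 0 < e -> e <= f -> logmom 0 e <= logmom 0 f.
Proof.
  move=> He Hef. have HP := PI_RGT_0. rewrite !logmom_0. apply: RInt_le; first lra.
  - apply: ex_RInt_cont => t. exact: continuous_lcos.
  - apply: ex_RInt_cont => t. apply: continuous_lcos. lra.
  - move=> t _. apply: ln_le; first exact: sumsq_pos. nra.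
Qed.

(** The new argument in [logmom_doubling] is at least [eta], so by monotonicity
    [2 L >= L - 2 PI ln 4] for the value [L] at [eta]. *)
Lemma logmom_ge (eta : R) : 0 < eta -> - 2 * PI * ln 4 <= logmom 0 eta.
Proof.
  move=> He. have H := logmom_doubling eta He.
  have Hs : 1 <= sqrt (1 + eta ^ 2).
  { rewrite -{1}sqrt_1. apply: sqrt_le_1_alt. have := pow2_ge_0 eta. lra. }
  have := logmom_mono eta (2 * eta * sqrt (1 + eta ^ 2)) He. nra.
Qed.

(** For [e <= 1] the doubled argument is at most [3 e]. Hence the excess over the claimed value is
    at least halved when the argument is divided by [3], and it is [O(2^(-n))] below [3^(-n)];
    [logmom_ge] bounds it from below by [0]. *)
Lemma logmom_0_lim : filterlim (logmom 0) (at_right 0) (locally (- 2 * PI * ln 4)).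
Proof.
  have step : forall e, 0 < e <= 1 -> logmom 0 e + 2 * PI * ln 4 <= / 2 * (logmom 0 (3 * e) + 2 * PI * ln 4).
  { move=> e [He He1]. have H := logmom_doubling e He.
    have Hs : sqrt (1 + e ^ 2) <= 3 / 2.
    { rewrite -(sqrt_pow2 (3 / 2)); last lra. apply: sqrt_le_1_alt. nra. }
    have Hs0 : 0 < sqrt (1 + e ^ 2) by apply: sqrt_lt_R0; nra.
    have H2 : logmom 0 (2 * e * sqrt (1 + e ^ 2)) <= logmom 0 (3 * e) by apply: logmom_mono; nra.
    lra. }
  have iter : forall n e, 0 < e -> e <= (/ 3) ^ n -> logmom 0 e + 2 * PI * ln 4 <= (/ 2) ^ n * (logmom 0 1 + 2 * PI * ln 4).
  { elim=> [|n IH] e He Hn.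
    - rewrite /= in Hn *. have := logmom_mono e 1 He Hn. lra.
    - have H3 : 0 < (/ 3) ^ n <= 1.
      { split; first by apply: pow_lt; lra. rewrite -(pow1 n). apply: pow_incr. lra. }
      simpl in Hn. have H1 : logmom 0 e + 2 * PI * ln 4 <= / 2 * (logmom 0 (3 * e) + 2 * PI * ln 4) by apply: step; lra.
      have H2 := IH (3 * e) ltac:(lra) ltac:(lra). simpl. lra. }
  set A := logmom 0 1 + 2 * PI * ln 4.
  have HA : 0 <= A by have := logmom_ge 1 Rlt_0_1; rewrite /A; lra.
  apply/filterlim_locally => eps.
  have Hq : Rabs (/ 2) < 1 by rewrite Rabs_pos_eq; lra.
  have Heps : 0 < eps / (A + 1) by apply: Rdiv_lt_0_compat; [exact: cond_pos | lra].
  have [n Hn] := pow_lt_1_zero (/ 2) Hq (eps / (A + 1)) Heps.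
  have H3 : 0 < (/ 3) ^ n by apply: pow_lt; lra.
  apply: filter_imp (at_right_lt _ H3) => e [He1 He2].
  have h1 := iter n e He1 (Rlt_le _ _ He2). have h2 := logmom_ge e He1.
  have h3 := Hn n (le_n n). have H2 : 0 < (/ 2) ^ n by apply: pow_lt; lra.
  rewrite Rabs_pos_eq in h3; last lra.
  have h4 : (/ 2) ^ n * (A + 1) < eps by apply/Rlt_div_r; lra.
  change (Rabs (logmom 0 e - - 2 * PI * ln 4) < eps). rewrite -/A in h1. rewrite Rabs_pos_eq; nra.
Qed.

Definition ratio (eta th : R) : R := eta ^ 2 / (eta ^ 2 + cos th ^ 2).
Definition ratint (eta : R) : R := RInt (ratio eta) 0 (2 * PI).

Lemma continuous_ratio (eta th : R) : 0 < eta -> continuous (ratio eta) th.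
Proof. move=> He. have Hp := sumsq_pos eta (cos th) He. rewrite /ratio. ctn. simpl in *. lra. Qed.

Lemma ratio_bound (eta th : R) : 0 < eta -> 0 <= ratio eta th <= 1.
Proof.
  move=> He. have Hp := sumsq_pos eta (cos th) He. have h1 := pow2_ge_0 eta. have h2 := pow2_ge_0 (cos th).
  rewrite /ratio. split; first by apply: Rdiv_le_0_compat. apply/Rle_div_l => //. lra.
Qed.

Lemma ln_ge_sub (u : R) : 0 < u -> 1 - / u <= ln u.
Proof.
  move=> Hu. have := exp_ineq1_le (ln (/ u)). rewrite exp_ln; last exact: Rinv_0_lt_compat.
  rewrite ln_Rinv //. lra.
Qed.

(** The difference [lcos (2 e) - lcos e] equals [ln (1 + 3 r)] with [r = ratio e], which is at least
    [3 r / 4] since [r <= 1]. So [ratint] is controlled by an increment of [logmom 0], and that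
    increment vanishes because [logmom 0] has a limit. *)
Lemma ratint_lim : filterlim ratint (at_right 0) (locally 0).
Proof.
  have HP := PI_RGT_0.
  apply: (filterlim_squeeze0 _ _ (fun e => 4 / 3 * (logmom 0 (e * 2) - logmom 0 e))).
  - apply: filter_imp at_right_pos => e He. rewrite Rminus_0_r.
    have He2 : 0 < e * 2 by lra.
    have c1 : forall t, continuous (lcos e) t by move=> t; exact: continuous_lcos.
    have c2 : forall t, continuous (lcos (e * 2)) t by move=> t; exact: continuous_lcos.
    have c3 : forall t, continuous (ratio e) t by move=> t; exact: continuous_ratio.
    rewrite Rabs_pos_eq; last first.
    { apply: RInt_ge_0; [lra | exact: ex_RInt_cont | move=> t _; exact: (proj1 (ratio_bound e t He))]. }
    rewrite !logmom_0 -RInt_minusR; [|exact: ex_RInt_cont | exact: ex_RInt_cont].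
    have c4 : forall t, continuous (fun t => lcos (e * 2) t - lcos e t) t by move=> t; apply: ct_minus; [exact: c2 | exact: c1].
    rewrite -RInt_scalR; last exact: ex_RInt_cont.
    apply: RInt_le; [lra | exact: ex_RInt_cont | |].
    + apply: ex_RInt_cont => t. apply: ct_mult; [exact: continuous_const | exact: c4].
    + move=> t _. have Hp := sumsq_pos e (cos t) He. have Hp2 := sumsq_pos (e * 2) (cos t) He2.
      have [r0 r1] := ratio_bound e t He.
      have Hln : lcos (e * 2) t - lcos e t = ln (1 + 3 * ratio e t).
      { rewrite /lcos -ln_div //. congr ln. rewrite /ratio. field. simpl in Hp. lra. }
      rewrite Hln. have Hu : 0 < 1 + 3 * ratio e t by lra.
      have := ln_ge_sub _ Hu.
      have -> : 1 - / (1 + 3 * ratio e t) = 3 * ratio e t * / (1 + 3 * ratio e t) by field; lra.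
      have Hi : / 4 <= / (1 + 3 * ratio e t) by apply: Rinv_le_contravar; lra.
      nra.
  - apply: fl_val; first apply: fl_mult; first exact: filterlim_const.
    + apply: fl_minus; last exact: logmom_0_lim.
      have H2 : 0 < 2 by lra. exact: (fl_scale_right 2 (logmom 0) _ H2 logmom_0_lim).
    + ring.
Qed.

Lemma cos_sq_le (th : R) : 0 <= cos th ^ 2 <= 1.
Proof. have := pow2_ge_0 (cos th). have := COS_bound th. nra. Qed.

Lemma cos_pow_bound (m : nat) (th : R) : 0 <= cos th ^ (2 * m) <= 1.
Proof.
  rewrite pow_mult. have [h1 h2] := cos_sq_le th. split; first exact: pow_le.
  rewrite -(pow1 m). exact: pow_incr.
Qed.

(** Wallis' recursion with a logarithm, from the derivative of [sin cos^(2m+1) lcos] over a period.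
    Differentiating [lcos] produces [cos^2 / (eta^2 + cos^2) = 1 - ratio]; the [1] gives the moments
    without logarithm and the [ratio] is the error. *)
Lemma logmom_rec (m : nat) (eta : R) : 0 < eta ->
  Rabs (logmom (S m) eta - ((2 * INR m + 1) * logmom m eta + 2 * (cosmom m - cosmom (S m))) / (2 * INR m + 2)) <= 2 * ratint eta.
Proof.
  move=> He. have HP := PI_RGT_0. have Hm := pos_INR m.
  set N := 2 * INR m + 2. have HN : 2 <= N by rewrite /N; lra.
  have cl := fun k th => continuous_logmom k eta th He.
  have cr := fun th => continuous_ratio eta th He.
  set R1 := fun th => sin th ^ 2 * cos th ^ (2 * m) * ratio eta th.
  have cR1 : forall th, continuous R1 th by move=> th; apply: ct_mult; [ctn | exact: cr].
  have cd : forall th, continuous (fun th => cos th ^ (2 * m) - cos th ^ (2 * S m)) th by move=> th; ctn.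
  have Hrec : is_RInt (fun th => N * (cos th ^ (2 * S m) * lcos eta th) - (2 * INR m + 1) * (cos th ^ (2 * m) * lcos eta th)
       - (2 * (cos th ^ (2 * m) - cos th ^ (2 * S m)) - 2 * R1 th)) 0 (2 * PI) 0.
  { apply: is_RInt_eq.
    - apply: (RInt_of_derive (fun th => sin th * (cos th ^ (2 * m + 1) * lcos eta th))) => th _.
      + have Hp := sumsq_pos eta (cos th) He.
        have Hc := is_derive_pow cos (2 * m + 1) th _ (is_derive_cos th).
        have HL : is_derive (lcos eta) th (- 2 * sin th * cos th / (eta ^ 2 + cos th ^ 2)).
        { rewrite /lcos. auto_derive; first (simpl in Hp; lra). simpl in *. field. lra. }
        have H := is_derive_multR _ _ _ _ _ (is_derive_sin th) (is_derive_multR _ _ _ _ _ Hc HL).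
        apply: is_derive_eq H _. rewrite pow_double_S.
        have -> : Init.Nat.pred (2 * m + 1) = (2 * m)%nat by lia.
        rewrite plus_INR mult_INR pow_add pow_1. have -> : INR 2 = 2 by []. have -> : INR 1 = 1 by [].
        have Hs : sin th ^ 2 = 1 - cos th ^ 2 by have := sin2_cos2 th; rewrite /Rsqr /=; lra.
        rewrite /R1 /ratio /N. move: (cos th ^ (2 * m)) (lcos eta th) => X L.
        transitivity (cos th ^ 2 * X * L - (2 * INR m + 1) * sin th ^ 2 * X * L - 2 * sin th ^ 2 * X * cos th ^ 2 / (eta ^ 2 + cos th ^ 2)).
        { simpl. simpl in Hp. rfield. lra. }
        rewrite Hs. simpl. simpl in Hp. rfield. lra.
      + apply: ct_minus; first apply: ct_minus.
        * apply: ct_mult; [exact: continuous_const | exact: cl].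
        * apply: ct_mult; [exact: continuous_const | exact: cl].
        * apply: ct_minus; apply: ct_mult; solve [exact: continuous_const | exact: cd | exact: cR1].
    - cbv beta. rewrite sin_2PI sin_0. ring. }
  have ex1 : forall k, ex_RInt (fun th => cos th ^ (2 * k) * lcos eta th) 0 (2 * PI) by move=> k; apply: ex_RInt_cont => th; exact: cl.
  have ex2 : ex_RInt R1 0 (2 * PI) by exact: ex_RInt_cont.
  have ex3 : ex_RInt (fun th => cos th ^ (2 * m) - cos th ^ (2 * S m)) 0 (2 * PI) by exact: ex_RInt_cont.
  have exs : forall k f, ex_RInt f 0 (2 * PI) -> ex_RInt (fun th => k * f th) 0 (2 * PI).
  { move=> k f Hf. exact: (ex_RInt_scal (V := R_NormedModule)). }
  have exm : forall f g, ex_RInt f 0 (2 * PI) -> ex_RInt g 0 (2 * PI) -> ex_RInt (fun th => f th - g th) 0 (2 * PI).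
  { move=> f g Hf Hg. exact: (ex_RInt_minus (V := R_NormedModule)). }
  have Heq : N * logmom (S m) eta - (2 * INR m + 1) * logmom m eta - (2 * (cosmom m - cosmom (S m)) - 2 * RInt R1 0 (2 * PI)) = 0.
  { have <- : RInt (fun th => cos th ^ (2 * m) - cos th ^ (2 * S m)) 0 (2 * PI) = cosmom m - cosmom (S m).
    { rewrite RInt_minusR; try by eexists; exact: RInt_cos_pow. by rewrite !(is_RInt_unique _ _ _ _ (RInt_cos_pow _)). }
    rewrite /logmom -(RInt_scalR _ _ _ N) // -(RInt_scalR _ _ _ (2 * INR m + 1)) // -!(RInt_scalR _ _ _ 2) //.
    rewrite -!RInt_minusR; auto. exact: is_RInt_unique. }
  have HR1 : Rabs (RInt R1 0 (2 * PI)) <= ratint eta.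
  { apply: (norm_RInt_le R1 (ratio eta) 0 (2 * PI)); first lra.
    - move=> th _. rewrite /norm /= /abs /=. have [r0 r1] := ratio_bound eta th He. have [q0 q1] := cos_pow_bound m th.
      have Hs : 0 <= sin th ^ 2 <= 1.
      { have [h1 h2] := cos_sq_le th. have : sin th ^ 2 = 1 - cos th ^ 2 by have := sin2_cos2 th; rewrite /Rsqr /=; lra. lra. }
      rewrite /R1 Rabs_pos_eq.
      + rewrite -{2}(Rmult_1_l (ratio eta th)). apply: Rmult_le_compat_r => //. nra.
      + apply: Rmult_le_pos => //. apply: Rmult_le_pos; lra.
    - exact: (RInt_correct (V := R_CompleteNormedModule)).
    - apply: (RInt_correct (V := R_CompleteNormedModule)). exact: ex_RInt_cont. }
  have Hsol : logmom (S m) eta - ((2 * INR m + 1) * logmom m eta + 2 * (cosmom m - cosmom (S m))) / N = - 2 * RInt R1 0 (2 * PI) / N.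
  { have -> : logmom (S m) eta = ((2 * INR m + 1) * logmom m eta + (2 * (cosmom m - cosmom (S m)) - 2 * RInt R1 0 (2 * PI))) / N.
    { apply: (Rmult_eq_reg_l N); last lra. have -> : forall z, N * (z / N) = z by move=> z; field; lra. lra. }
    field. lra. }
  rewrite Hsol Rabs_div; last lra. rewrite (Rabs_pos_eq N); last lra. apply/Rle_div_l; first lra.
  rewrite Rabs_mult Rabs_left; last lra. have := Rabs_pos (RInt R1 0 (2 * PI)). nra.
Qed.

(** In the limit the recursion becomes exact. Each step adds [1 / (2m+1) - 1 / (2m+2)] to the
    bracket, which is the increment of [harm (2 m) - harm m]; the starting value [- ln 2] is the
    mean of [ln |cos|]. *)
Lemma logmom_lim (m : nat) :
  filterlim (logmom m) (at_right 0) (locally (2 * cosmom m * (harm (2 * m) - harm m - ln 2))).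
Proof.
  have HP := PI_RGT_0.
  elim: m => [|m IH].
  - apply: (fl_val _ _ _ _ logmom_0_lim). rewrite /cosmom /=.
    have -> : ln 4 = ln 2 + ln 2 by rewrite -ln_mult; try lra; congr ln; ring.
    field.
  - have Hm := pos_INR m.
    apply: (filterlim_ext (fun e => ((2 * INR m + 1) * logmom m e + 2 * (cosmom m - cosmom (S m))) / (2 * INR m + 2)
       + (logmom (S m) e - ((2 * INR m + 1) * logmom m e + 2 * (cosmom m - cosmom (S m))) / (2 * INR m + 2)))).
    { move=> e. ring. }
    eapply fl_val.
    + apply: fl_plus.
      * apply: fl_mult; last exact: filterlim_const. apply: fl_plus; last exact: filterlim_const.
        apply: fl_mult; [exact: filterlim_const | exact: IH].
      * apply: (filterlim_squeeze0 _ _ (fun e => 2 * ratint e) 0).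
        -- apply: filter_imp at_right_pos => e He. rewrite Rminus_0_r. exact: logmom_rec.
        -- apply: fl_val (Rmult_0_r 2). apply: fl_mult; [exact: filterlim_const | exact: ratint_lim].
    + rewrite cosmom_S. have -> : (2 * S m = S (S (2 * m)))%nat by lia.
      have -> : harm (S (S (2 * m))) = harm (2 * m) + / INR (S (2 * m)) + / INR (S (S (2 * m))) by [].
      have -> : harm (S m) = harm m + / INR (S m) by [].
      rewrite !S_INR mult_INR. have -> : INR 2 = 2 by []. field. lra.
Qed.

(** Since [lcos <= ln 2], one has [|lcos| <= 2 ln 2 - lcos], and [logmom_ge] bounds the integral of
    the right side independently of [eta]. This is the majorant behind the exchange of limit and
    series in [Lmom_lim]. *)
Lemma logmom_abs_bound (eta : R) : 0 < eta <= 1 ->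
  RInt (fun th => Rabs (lcos eta th)) 0 (2 * PI) <= 2 * PI * (2 * ln 2) + 2 * PI * ln 4.
Proof.
  move=> [He He1]. have HP := PI_RGT_0.
  have cl := fun th => continuous_lcos eta th He.
  have cab : forall th, continuous (fun th => Rabs (lcos eta th)) th by move=> th; apply: (ct_comp (lcos eta) Rabs) => //; exact: continuous_Rabs.
  have Hge := logmom_ge eta He. rewrite logmom_0 in Hge.
  have H : RInt (fun th => Rabs (lcos eta th)) 0 (2 * PI) <= RInt (fun th => 2 * ln 2 - lcos eta th) 0 (2 * PI).
  { apply: RInt_le; [lra | exact: ex_RInt_cont | |].
    - apply: ex_RInt_cont => t. apply: ct_minus; [exact: continuous_const | exact: cl].
    - move=> t _. have Hl : lcos eta t <= ln 2.
      { apply: ln_le; first exact: sumsq_pos. have := cos_sq_le t. nra. }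
      have H2 : 0 < ln 2 by rewrite -ln_1; apply: ln_increasing; lra.
      rewrite /Rabs; destruct Rcase_abs; lra. }
  rewrite RInt_minusR in H; [|exact: ex_RInt_const | exact: ex_RInt_cont].
  rewrite RInt_const /scal /= /mult /= in H. lra.
Qed.

(** Angular moments of the first moment [Re 1 / z^2], that is [momR eps a 1], rescaled to
    [rho = 1]. *)
Definition zmom (p : nat) (eta : R) : R :=
  RInt (fun th => cos th ^ (2 * p) * ((eta ^ 2 - cos th ^ 2) / (eta ^ 2 + cos th ^ 2) ^ 2)) 0 (2 * PI).

(** For [p = 0] the formal limit [- 1 / cos^2] is not integrable. Up to a term bounded by [2 ratio],
    however, the integrand is minus the derivative of the periodic function
    [sin cos / (eta^2 + cos^2)]. For [p = 1] it equals [- 1] plus terms controlled by [ratio]. *)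
Lemma zmom_lim : filterlim (zmom 0) (at_right 0) (locally 0) /\ filterlim (zmom 1) (at_right 0) (locally (- (2 * PI))).
Proof.
  have HP := PI_RGT_0.
  set W := fun eta => RInt (fun th => 2 * (ratio eta th * (cos th ^ 2 / (eta ^ 2 + cos th ^ 2)))) 0 (2 * PI).
  have cW : forall eta th, 0 < eta -> continuous (fun th => 2 * (ratio eta th * (cos th ^ 2 / (eta ^ 2 + cos th ^ 2)))) th.
  { move=> eta th He. have Hp := sumsq_pos eta (cos th) He. apply: ct_mult; first exact: continuous_const.
    apply: ct_mult; first exact: continuous_ratio. ctn. simpl in *. lra. }
  have HW : filterlim W (at_right 0) (locally 0).
  { apply: (filterlim_squeeze0 _ _ (fun e => 2 * ratint e)).
    - apply: filter_imp at_right_pos => e He. rewrite Rminus_0_r /ratint.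
      have cr := fun th => continuous_ratio e th He.
      rewrite -RInt_scalR; last exact: ex_RInt_cont.
      apply: (norm_RInt_le (fun th => 2 * (ratio e th * (cos th ^ 2 / (e ^ 2 + cos th ^ 2)))) (fun th => 2 * ratio e th) 0 (2 * PI)); first lra.
      + move=> th _. change (Rabs (2 * (ratio e th * (cos th ^ 2 / (e ^ 2 + cos th ^ 2)))) <= 2 * ratio e th).
        have Hp := sumsq_pos e (cos th) He. have [r0 r1] := ratio_bound e th He.
        have Hq : 0 <= cos th ^ 2 / (e ^ 2 + cos th ^ 2) <= 1.
        { have h1 := pow2_ge_0 e. have h2 := pow2_ge_0 (cos th). split; first exact: Rdiv_le_0_compat. apply/Rle_div_l => //. lra. }
        rewrite Rabs_pos_eq; nra.
      + apply: (RInt_correct (V := R_CompleteNormedModule)). apply: ex_RInt_cont => th. exact: cW.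
      + apply: (RInt_correct (V := R_CompleteNormedModule)). apply: ex_RInt_cont => th. apply: ct_mult; [exact: continuous_const | exact: cr].
    - apply: fl_val (Rmult_0_r 2). apply: fl_mult; [exact: filterlim_const | exact: ratint_lim]. }
  split.
  - apply: filterlim_ext_loc HW. apply: filter_imp at_right_pos => e He.
    rewrite /W /zmom.
    have H : is_RInt (fun th => 2 * (ratio e th * (cos th ^ 2 / (e ^ 2 + cos th ^ 2))) - cos th ^ (2 * 0) * ((e ^ 2 - cos th ^ 2) / (e ^ 2 + cos th ^ 2) ^ 2)) 0 (2 * PI) 0.
    { apply: is_RInt_eq.
      - apply: (RInt_of_derive (fun th => sin th * cos th / (e ^ 2 + cos th ^ 2))) => th _; have Hp := sumsq_pos e (cos th) He.
        + auto_derive; first (simpl in Hp; lra). rewrite /ratio.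
          have Hs : sin th * sin th = 1 - cos th * cos th by have := sin2_cos2 th; rewrite /Rsqr; lra.
          simpl in *. field_simplify; try lra. have -> : sin th ^ 2 = 1 - cos th * cos th by rewrite -Hs; ring. congr Rdiv. ring.
        + rewrite /ratio. have Hne := Rgt_not_eq _ _ Hp. ctn => //. exact: pow_nonzero.
      - cbv beta. rewrite sin_2PI sin_0. rewrite /Rdiv. ring. }
    have ex : ex_RInt (fun th => cos th ^ (2 * 0) * ((e ^ 2 - cos th ^ 2) / (e ^ 2 + cos th ^ 2) ^ 2)) 0 (2 * PI).
    { apply: ex_RInt_cont => th. have Hp := sumsq_pos e (cos th) He. ctn. apply: pow_nonzero. simpl in *. lra. }
    have H2 := is_RInt_unique _ _ _ _ H. rewrite RInt_minusR // in H2; last by apply: ex_RInt_cont => th; exact: cW. lra.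
  - apply: (filterlim_ext_loc (fun e => W e + ratint e - 2 * PI)).
    + apply: filter_imp at_right_pos => e He. have cr := fun th => continuous_ratio e th He.
      rewrite /W /zmom /ratint.
      have H1 : RInt (fun _ : R => 1) 0 (2 * PI) = 2 * PI by rewrite RInt_const /scal /= /mult /=; ring.
      rewrite -[X in _ - X]H1.
      rewrite -RInt_plusR; [| by apply: ex_RInt_cont => th; exact: cW | exact: ex_RInt_cont].
      rewrite -RInt_minusR; [| by apply: ex_RInt_cont => th; apply: ct_plus; [exact: cW | exact: cr] | exact: ex_RInt_const].
      apply: RInt_ext => th _. have Hp := sumsq_pos e (cos th) He. rewrite /ratio. simpl in *. rfield. lra.
    + apply: fl_val; first by apply: fl_minus; [apply: fl_plus; [exact: HW | exact: ratint_lim] | exact: filterlim_const]. ring.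
Qed.

(** * Angular moments of the frequency integral as power series *)

Definition costerm (m : nat) (x : R) : R := (-1) ^ m * x ^ (2 * m) / INR (fact (2 * m)).

Lemma pow_even_pos (x : R) (m : nat) : 0 <= x ^ (2 * m).
Proof. rewrite pow_mult. apply: pow_le. exact: pow2_ge_0. Qed.

Lemma costerm_abs (m : nat) (x : R) : Rabs (costerm m x) = x ^ (2 * m) / INR (fact (2 * m)).
Proof.
  rewrite /costerm /Rdiv !Rabs_mult -RPow_abs Rabs_Ropp Rabs_R1 pow1 Rmult_1_l.
  rewrite (Rabs_pos_eq (x ^ _)); last exact: pow_even_pos.
  rewrite Rabs_pos_eq //. apply: Rlt_le. apply: Rinv_0_lt_compat. exact: INR_fact_lt_0.
Qed.

(** The extra factor [2 m + 1] leaves room for the harmonic numbers, for which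
    [harm (2 m) <= 2 m]. *)
Lemma ex_series_costerm (x : R) : ex_series (fun m => Rabs (costerm m x) * (2 * INR m + 1)).
Proof.
  apply: (ex_series_le (K := R_AbsRing) (V := R_CompleteNormedModule) _ _ _ (ex_series_exp (4 * x ^ 2))) => m.
  rewrite /norm /= /abs /=. have Hm := pos_INR m. have hx := pow_even_pos x m.
  have hf := INR_fact_lt_0 m. have hf2 := INR_fact_lt_0 (2 * m).
  rewrite Rabs_pos_eq; last by apply: Rmult_le_pos; [exact: Rabs_pos | lra].
  rewrite costerm_abs.
  have -> : (4 * (x * (x * 1))) ^ m = 4 ^ m * x ^ (2 * m) by rewrite Rpow_mult_distr pow_mult.
  have h4 : 2 * INR m + 1 <= 4 ^ m.
  { elim: m {Hm hx hf hf2} => [|m IH]; first by rewrite /=; lra. rewrite S_INR. simpl pow. have := pos_INR m. lra. }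
  have hle : / INR (fact (2 * m)) <= / INR (fact m).
  { apply: Rinv_le_contravar => //. apply: le_INR. apply: fact_le. lia. }
  have hi : 0 < / INR (fact (2 * m)) by exact: Rinv_0_lt_compat.
  rewrite /Rdiv.
  have h5 : 0 < 4 ^ m by apply: pow_lt; lra.
  have h6 : x ^ (2 * m) * / INR (fact (2 * m)) <= x ^ (2 * m) * / INR (fact m) by apply: Rmult_le_compat_l.
  have h7 : 0 <= x ^ (2 * m) * / INR (fact (2 * m)) by apply: Rmult_le_pos; lra.
  have -> : 4 ^ m * x ^ (2 * m) * / INR (fact m) = (x ^ (2 * m) * / INR (fact m)) * 4 ^ m by ring.
  apply: Rmult_le_compat; lra.
Qed.

Lemma costerm_mult (m : nat) (x c : R) : costerm m (x * c) = costerm m x * c ^ (2 * m).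
Proof. rewrite /costerm Rpow_mult_distr /Rdiv. ring. Qed.

Lemma RInt_even_series (x W : R) (w : R -> R) (k : nat -> R) :
  (forall th, continuous w th) -> (forall th, Rabs (w th) <= W) ->
  (forall m, Rabs (k m) <= 2 * INR m + 1) ->
  is_RInt (fun th => w th * Series (fun m => costerm m (x * cos th) * k m)) 0 (2 * PI)
    (Series (fun m => costerm m x * k m * RInt (fun th => cos th ^ (2 * m) * w th) 0 (2 * PI))).
Proof.
  move=> Hw HW Hk. have HP := PI_RGT_0.
  have HW0 : 0 <= W by apply: Rle_trans (HW 0); exact: Rabs_pos.
  have cw : forall m th, continuous (fun th => cos th ^ (2 * m) * w th) th by move=> m th; apply: ct_mult; [ctn | exact: Hw].
  apply: (is_RInt_ext (fun th => Series (fun m => costerm m x * k m * (cos th ^ (2 * m) * w th)))).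
  { move=> th _. rewrite -Series_scal_l. apply: Series_ext => m. rewrite costerm_mult. ring. }
  have -> : Series (fun m => costerm m x * k m * RInt (fun th => cos th ^ (2 * m) * w th) 0 (2 * PI)) =
     Series (fun m => RInt (fun th => costerm m x * k m * (cos th ^ (2 * m) * w th)) 0 (2 * PI)).
  { apply: Series_ext => m. rewrite RInt_scalR //. exact: ex_RInt_cont. }
  apply: (is_RInt_Series (fun m th => costerm m x * k m * (cos th ^ (2 * m) * w th)) (fun m => W * (Rabs (costerm m x) * (2 * INR m + 1)))).
  - lra.
  - apply: (ex_series_scal (K := R_AbsRing) (V := R_NormedModule) W). exact: ex_series_costerm.
  - move=> m th _. rewrite (Rabs_mult (costerm m x * k m)) (Rabs_mult (costerm m x) (k m)) (Rabs_mult (cos th ^ (2 * m))). have [c0 c1] := cos_pow_bound m th. rewrite (Rabs_pos_eq (cos th ^ (2 * m))) //.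
    have := Hk m. have := HW th. have h1 := Rabs_pos (costerm m x). have h2 := Rabs_pos (k m). have h3 := Rabs_pos (w th).
    move=> h4 h5.
    have h6 : cos th ^ (2 * m) * Rabs (w th) <= W by nra.
    have h7 : 0 <= cos th ^ (2 * m) * Rabs (w th) by apply: Rmult_le_pos.
    have h8 : Rabs (costerm m x) * Rabs (k m) <= Rabs (costerm m x) * (2 * INR m + 1) by apply: Rmult_le_compat_l.
    rewrite (Rmult_comm W). apply: Rmult_le_compat; [by apply: Rmult_le_pos | exact: h7 | exact: h8 | exact: h6].
  - move=> m. apply: ex_RInt_cont => th. apply: ct_mult; [exact: continuous_const | exact: cw].
Qed.

Lemma cos_Series (y : R) : cos y = Series (fun m => costerm m y).
Proof. symmetry. apply: is_series_unique. exact: cos_series. Qed.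

Definition Cmom (p : nat) (x : R) : R := Series (fun m => costerm m x * cosmom (m + p)).

Lemma cos_pow_add (p m : nat) (th : R) : cos th ^ (2 * m) * cos th ^ (2 * p) = cos th ^ (2 * (m + p)).
Proof. rewrite -pow_add. congr (_ ^ _). lia. Qed.

Lemma cos_pow_abs (p : nat) (th : R) : Rabs (cos th ^ (2 * p)) <= 1.
Proof. have [h1 h2] := cos_pow_bound p th. rewrite Rabs_pos_eq //. Qed.

Lemma one_le_index (m : nat) : Rabs 1 <= 2 * INR m + 1.
Proof. rewrite Rabs_R1. have := pos_INR m. lra. Qed.

Lemma is_RInt_Cmom (p : nat) (x : R) :
  is_RInt (fun th => cos th ^ (2 * p) * cos (x * cos th)) 0 (2 * PI) (Cmom p x).
Proof.
  have c1 : forall th, continuous (fun th => cos th ^ (2 * p)) th by move=> th; ctn.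
  have H := RInt_even_series x 1 (fun th => cos th ^ (2 * p)) (fun _ => 1) c1 (cos_pow_abs p) one_le_index.
  apply: is_RInt_eq; first apply: is_RInt_ext H.
  - move=> th _. congr Rmult. rewrite (cos_Series (x * cos th)). apply: Series_ext => m. rewrite Rmult_1_r. by [].
  - rewrite /Cmom. apply: Series_ext => m. rewrite Rmult_1_r. congr Rmult. apply: is_RInt_unique.
    apply: is_RInt_ext (RInt_cos_pow (m + p)) => th _. by rewrite cos_pow_add.
Qed.

Definition Lmom (p : nat) (x eta : R) : R := RInt (fun th => cos th ^ (2 * p) * lcos eta th * cos (x * cos th)) 0 (2 * PI).

Lemma lcos_bound (eta : R) : 0 < eta -> exists B, forall th, Rabs (lcos eta th) <= B.
Proof.
  move=> He. exists (Rabs (ln (eta ^ 2)) + Rabs (ln (eta ^ 2 + 1))) => th.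
  have [c0 c1] := cos_sq_le th. have He2 : 0 < eta ^ 2 by apply: pow_lt.
  have h1 : ln (eta ^ 2) <= lcos eta th by apply: ln_le => //; lra.
  have h2 : lcos eta th <= ln (eta ^ 2 + 1) by apply: ln_le; lra.
  move: h1 h2. rewrite /Rabs; repeat destruct Rcase_abs; lra.
Qed.

Lemma Lmom_Series (p : nat) (x eta : R) : 0 < eta ->
  Lmom p x eta = Series (fun m => costerm m x * logmom (m + p) eta).
Proof.
  move=> He. have [B HB] := lcos_bound eta He.
  have c1 : forall th, continuous (fun th => cos th ^ (2 * p) * lcos eta th) th by move=> th; exact: continuous_logmom.
  have HB2 : forall th, Rabs (cos th ^ (2 * p) * lcos eta th) <= B.
  { move=> th. rewrite Rabs_mult. have := cos_pow_abs p th. have := HB th. have := Rabs_pos (lcos eta th). have := Rabs_pos (cos th ^ (2 * p)). nra. }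
  have H := RInt_even_series x B (fun th => cos th ^ (2 * p) * lcos eta th) (fun _ => 1) c1 HB2 one_le_index.
  rewrite /Lmom.
  rewrite (RInt_ext _ (fun th => cos th ^ (2 * p) * lcos eta th * Series (fun m => costerm m (x * cos th) * 1))).
  - rewrite (is_RInt_unique _ _ _ _ H). apply: Series_ext => m. rewrite Rmult_1_r. congr Rmult.
    apply: RInt_ext => th _. by rewrite -cos_pow_add Rmult_assoc.
  - move=> th _. congr Rmult. rewrite (cos_Series (x * cos th)). apply: Series_ext => m. by rewrite Rmult_1_r.
Qed.

Lemma Lmom_lim (p : nat) (x : R) : filterlim (Lmom p x) (at_right 0)
  (locally (Series (fun m => costerm m x * (2 * cosmom (m + p) * (harm (2 * (m + p)) - harm (m + p) - ln 2))))).
Proof.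
  have HP := PI_RGT_0.
  apply: (filterlim_ext_loc (fun eta => Series (fun m => costerm m x * logmom (m + p) eta))).
  { apply: filter_imp at_right_pos => e He. by rewrite Lmom_Series. }
  set B := 2 * PI * (2 * ln 2) + 2 * PI * ln 4.
  have HB : forall m e, 0 < e <= 1 -> Rabs (logmom m e) <= B.
  { move=> m e [He He1]. apply: Rle_trans (logmom_abs_bound e (conj He He1)).
    have cl := fun th => continuous_lcos e th He.
    apply: (norm_RInt_le (fun th => cos th ^ (2 * m) * lcos e th) (fun th => Rabs (lcos e th)) 0 (2 * PI)); first lra.
    - move=> th _. change (Rabs (cos th ^ (2 * m) * lcos e th) <= Rabs (lcos e th)). rewrite Rabs_mult.
      have := cos_pow_abs m th. have := Rabs_pos (lcos e th). have := Rabs_pos (cos th ^ (2 * m)). nra.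
    - apply: (RInt_correct (V := R_CompleteNormedModule)). apply: ex_RInt_cont => th. exact: continuous_logmom.
    - apply: (RInt_correct (V := R_CompleteNormedModule)). apply: ex_RInt_cont => th. apply: (ct_comp (lcos e) Rabs) => //. exact: continuous_Rabs. }
  have HB0 : 0 <= B by apply: Rle_trans (HB 0%nat 1 ltac:(lra)); exact: Rabs_pos.
  apply: (filterlim_Series (at_right 0) (fun m eta => costerm m x * logmom (m + p) eta) _ (fun m => B * (Rabs (costerm m x) * (2 * INR m + 1)))).
  - apply: (ex_series_scal (K := R_AbsRing) (V := R_NormedModule) B). exact: ex_series_costerm.
  - have h2 : 0 < 1 by lra. apply: filter_imp (at_right_lt 1 h2) => e [He He1] m.
    rewrite (Rabs_mult (costerm m x)). have := HB (m + p)%nat e (conj He (Rlt_le _ _ He1)). have := Rabs_pos (costerm m x). have := pos_INR m.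
    move=> h3 h4 h5. have h6 : Rabs (costerm m x) * Rabs (logmom (m + p) e) <= Rabs (costerm m x) * B by apply: Rmult_le_compat_l.
    have h7 : 0 <= B * Rabs (costerm m x) * INR m by apply: Rmult_le_pos => //; exact: Rmult_le_pos. lra.
  - move=> m. apply: fl_mult; [exact: filterlim_const | exact: logmom_lim].
Qed.

(** Euler's integral for the harmonic number: passing from [n] to [n + 1] adds [(1 - t)^n] to the
    integrand and thus [1 / (n + 1)] to the integral. *)
Lemma RInt_harm (n : nat) : is_RInt (fun t => (1 - (1 - t) ^ n) / t) 0 1 (harm n).
Proof.
  elim: n => [|n IH].
  - apply: is_RInt_eq; first apply: (is_RInt_ext (fun _ => 0)).
    + move=> t _. rewrite /= /Rdiv. rring.
    + exact: is_RInt_const.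
    + rewrite /scal /= /mult /=. ring.
  - have H : is_RInt (fun t => (1 - t) ^ n) 0 1 (/ INR (S n)).
    { have Hn : INR (S n) <> 0 by apply: not_0_INR.
      apply: is_RInt_eq.
      - apply: (RInt_of_derive (fun t => - / INR (S n) * (1 - t) ^ S n)) => t _; last ctn.
        have Hl : is_derive (fun t => 1 - t) t (-1) by auto_derive => //; ring.
        apply: is_derive_eq (is_derive_scal _ _ (- / INR (S n)) _ (is_derive_pow _ (S n) t _ Hl)) _.
        simpl Init.Nat.pred. move: (INR (S n)) Hn => N HN. rfield. exact: HN.
      - cbv beta. rewrite Rminus_diag Rminus_0_r pow1 pow_i; [ring | lia]. }
    have H2 := is_RInt_plus (V := R_NormedModule) _ _ _ _ _ _ IH H.
    apply: is_RInt_ext H2 => t. rewrite Rmin_left; last lra. move=> [Ht _]. rewrite /plus /=. rfield. lra.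
Qed.

Lemma harm_ratio_bound (n : nat) (t : R) : 0 <= t <= 1 -> 0 <= (1 - (1 - t) ^ n) / t <= INR n.
Proof.
  move=> [Ht0 Ht1]. case: (Req_dec t 0) => H0.
  - rewrite H0. have -> : (1 - (1 - 0) ^ n) / 0 = 0 by rewrite Rminus_0_r pow1 /Rdiv Rminus_diag Rmult_0_l. split; [lra | exact: pos_INR].
  - have Htp : 0 < t by lra. elim: n => [|n [IH1 IH2]].
    + have -> : (1 - (1 - t) ^ 0) / t = 0 by rewrite /= /Rdiv; ring. rewrite /=. lra.
    + have -> : (1 - (1 - t) ^ S n) / t = (1 - (1 - t) ^ n) / t + (1 - t) ^ n by rewrite /=; field.
      have h1 : 0 <= (1 - t) ^ n by apply: pow_le; lra.
      have h2 : (1 - t) ^ n <= 1 by have h := pow_incr (1 - t) 1 n ltac:(lra); rewrite pow1 in h.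
      rewrite S_INR. lra.
Qed.

(* Limit of [veps] as [eps] tends to [0], as a function of [w0 * a]. *)
Definition vfun (y : R) : R := RInt (fun t => (cos y - cos (y * (1 - t))) / t) 0 1.

Lemma is_RInt_vfun (y : R) :
  is_RInt (fun t => (cos y - cos (y * (1 - t))) / t) 0 1 (Series (fun m => costerm m y * harm (2 * m))).
Proof.
  have H : is_RInt (fun t => Series (fun m => costerm m y * ((1 - (1 - t) ^ (2 * m)) / t))) 0 1
     (Series (fun m => RInt (fun t => costerm m y * ((1 - (1 - t) ^ (2 * m)) / t)) 0 1)).
  { apply: (is_RInt_Series (fun m t => costerm m y * ((1 - (1 - t) ^ (2 * m)) / t)) (fun m => Rabs (costerm m y) * (2 * INR m + 1))).
    - lra.
    - exact: ex_series_costerm.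
    - move=> m t Ht. rewrite Rabs_mult. apply: Rmult_le_compat_l; first exact: Rabs_pos.
      have [h1 h2] := harm_ratio_bound (2 * m) t Ht. rewrite Rabs_pos_eq //. rewrite mult_INR in h2. change (INR 2) with 2 in h2. lra.
    - move=> m. apply: (ex_RInt_scal (V := R_NormedModule)). eexists. exact: RInt_harm. }
  apply: is_RInt_eq; first apply: is_RInt_ext H.
  - move=> t _. rewrite (cos_Series y) (cos_Series (y * (1 - t))).
    have ex1 : forall z, ex_series (fun m => costerm m z) by move=> z; eexists; exact: cos_series.
    rewrite -Series_minus // /Rdiv -Series_scal_r. apply: Series_ext => m. rewrite costerm_mult. ring.
  - apply: Series_ext => m. rewrite RInt_scalR; last by eexists; exact: RInt_harm.
    by rewrite (is_RInt_unique _ _ _ _ (RInt_harm _)).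
Qed.

Lemma vfun_Series (y : R) : vfun y = Series (fun m => costerm m y * harm (2 * m)).
Proof. exact: is_RInt_unique (is_RInt_vfun y). Qed.

Lemma is_RInt_vmom (p : nat) (x : R) :
  is_RInt (fun th => cos th ^ (2 * p) * vfun (x * cos th)) 0 (2 * PI) (Series (fun m => costerm m x * harm (2 * m) * cosmom (m + p))).
Proof.
  have c1 : forall th, continuous (fun th => cos th ^ (2 * p)) th by move=> th; ctn.
  have hb : forall m, Rabs (harm (2 * m)) <= 2 * INR m + 1.
  { move=> m. have [h1 h2] := harm_bound (2 * m). rewrite Rabs_pos_eq //. rewrite mult_INR in h2. change (INR 2) with 2 in h2. lra. }
  have H := RInt_even_series x 1 (fun th => cos th ^ (2 * p)) (fun m => harm (2 * m)) c1 (cos_pow_abs p) hb.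
  apply: is_RInt_eq; first apply: is_RInt_ext H.
  - move=> th _. by rewrite vfun_Series.
  - apply: Series_ext => m. congr Rmult. apply: is_RInt_unique.
    apply: is_RInt_ext (RInt_cos_pow (m + p)) => th _. by rewrite cos_pow_add.
Qed.

(* What remains of [pR] after its logarithm [ln (eps^2 + a^2)] is split off; it converges uniformly in [a]. *)
Definition veps (w0 eps a : R) : R :=
  cos (w0 * a) * (ln (eps ^ 2 + a ^ 2) / 2 - ln eps) - cos (w0 * a) * jsc w0 eps a - sin (w0 * a) * jss w0 eps a.

Lemma pR_veps (w0 eps a : R) :
  pR w0 eps a = cos (w0 * a) * (g0v eps w0 + f0v eps w0 + 2 * ln eps - ln (eps ^ 2 + a ^ 2)) + 2 * veps w0 eps a.
Proof. rewrite /pR /veps. field. Qed.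

(** The logarithm is itself the integral of [s / (eps^2 + s^2)], so the three terms merge by the
    addition theorem into [cos (w0 a) - cos (w0 (a - s))]. The scaling [s = a t] then frees the
    limits of integration from [a]. *)
Lemma veps_RInt (w0 eps a : R) : 0 < eps ->
  is_RInt (fun t => (cos (w0 * a) - cos (w0 * a * (1 - t))) * (a ^ 2 * t / (eps ^ 2 + a ^ 2 * t ^ 2))) 0 1 (veps w0 eps a).
Proof.
  move=> He. have [_ [h2 [_ h4]]] := j_continuous w0 eps He.
  have H1 := RInt_ratio eps a He.
  have H2 : is_RInt (fun s => s * cos (w0 * s) / (eps ^ 2 + s ^ 2)) 0 a (jsc w0 eps a).
  { apply: (RInt_correct (V := R_CompleteNormedModule)). exact: ex_RInt_cont. }
  have H3 : is_RInt (fun s => s * sin (w0 * s) / (eps ^ 2 + s ^ 2)) 0 a (jss w0 eps a).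
  { apply: (RInt_correct (V := R_CompleteNormedModule)). exact: ex_RInt_cont. }
  have sc := fun k f l H => is_RInt_scal (V := R_NormedModule) f 0 a k l H.
  have H := is_RInt_minus (V := R_NormedModule) _ _ _ _ _ _ (is_RInt_minus (V := R_NormedModule) _ _ _ _ _ _ (sc (cos (w0 * a)) _ _ H1) (sc (cos (w0 * a)) _ _ H2)) (sc (sin (w0 * a)) _ _ H3).
  set F := fun s => (cos (w0 * a) - cos (w0 * (a - s))) * (s / (eps ^ 2 + s ^ 2)).
  have HF : is_RInt F (a * 0 + 0) (a * 1 + 0) (veps w0 eps a).
  { have -> : a * 0 + 0 = 0 by ring. have -> : a * 1 + 0 = a by ring.
    apply: is_RInt_eq; first apply: is_RInt_ext H.
    - move=> s _. rewrite /minus /plus /opp /scal /= /mult /= /F.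
      have -> : w0 * (a - s) = w0 * a - w0 * s by ring. rewrite cos_minus /Rdiv. simpl. rring.
    - by rewrite /veps /minus /plus /opp /scal /= /mult /=. }
  have HG := is_RInt_comp_lin (V := R_NormedModule) F a 0 0 1 _ HF.
  apply: is_RInt_ext HG => t _. rewrite /scal /= /mult /= /F.
  have -> : w0 * (a - (a * t + 0)) = w0 * a * (1 - t) by ring.
  have Hp := sumsq_pos eps (a * t) He. simpl in Hp.
  have -> : a * t + 0 = a * t by ring. simpl. rfield.
  apply: Rgt_not_eq. nra.
Qed.

(** The two integrands differ by the kernel [eps^2 / (t (eps^2 + a^2 t^2))], whose factor [1 / t] is
    absorbed by the Lipschitz bound [w0 |a| t] on the cosines. What is left integrates to
    [w0 eps atan (|a| / eps)], which is small uniformly in [a]. *)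
Lemma veps_bound (w0 eps a : R) : 0 < eps -> 0 <= w0 ->
  Rabs (veps w0 eps a - vfun (w0 * a)) <= w0 * eps * (PI / 2).
Proof.
  move=> He Hw.
  have H1 := veps_RInt w0 eps a He. have H2 := is_RInt_vfun (w0 * a). rewrite -vfun_Series in H2.
  have H := is_RInt_minus (V := R_NormedModule) _ _ _ _ _ _ H1 H2.
  have HB : is_RInt (fun t => w0 * (eps * (Rabs a / eps / (1 + (Rabs a * t / eps) ^ 2)))) 0 1 (w0 * eps * atan (Rabs a / eps)).
  { apply: is_RInt_eq.
    - apply: (RInt_of_derive (fun t => w0 * (eps * atan (Rabs a * t / eps)))) => t _.
      + auto_derive => //. rewrite /Rsqr. simpl. field.
        split; first lra. have := pow2_ge_0 (Rabs a * t). simpl. nra.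
      + have Hq : 1 + (Rabs a * t / eps) ^ 2 <> 0 by have := pow2_ge_0 (Rabs a * t / eps); lra.
        ctn => //; lra.
    - cbv beta. rewrite Rmult_0_r /Rdiv Rmult_0_l atan_0 Rmult_1_r. ring. }
  apply: Rle_trans (_ : w0 * eps * atan (Rabs a / eps) <= _); last first.
  { apply: Rmult_le_compat_l; first nra. have := atan_bound (Rabs a / eps). lra. }
  apply: (norm_RInt_le (fun t => minus _ _) _ 0 1 _ _ Rle_0_1 _ H HB) => t Ht.
  rewrite /norm /= /abs /minus /plus /opp /=.
  set d := cos (w0 * a) - cos (w0 * a * (1 - t)).
  have Hd : Rabs d <= w0 * Rabs a * t.
  { rewrite /d. apply: Rle_trans (cos_lipschitz _ _) _.
    have -> : w0 * a - w0 * a * (1 - t) = w0 * a * t by ring. rewrite !Rabs_mult (Rabs_pos_eq w0) // (Rabs_pos_eq t); lra. }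
  have Ha2 : Rabs a * Rabs a = a * a by rewrite -Rabs_mult Rabs_pos_eq //; nra.
  have Hp := sumsq_pos eps (a * t) He. simpl in Hp.
  case: (Req_dec t 0) => H0.
  - subst t. have -> : d = 0 by rewrite /d Rminus_0_r Rmult_1_r; ring.
    have -> : 0 * (a * (a * 1) * 0 / (eps * (eps * 1) + a * (a * 1) * (0 * (0 * 1)))) + - (0 / 0) = 0 by rewrite /Rdiv; ring.
    rewrite Rabs_R0. apply: Rmult_le_pos => //. apply: Rmult_le_pos; first lra.
    apply: Rdiv_le_0_compat; first by apply: Rdiv_le_0_compat; [exact: Rabs_pos | lra].
    nra.
  - have Htp : 0 < t by lra.
    have Hden : eps * (eps * 1) + a * (a * 1) * (t * (t * 1)) = eps * (eps * 1) + a * t * (a * t * 1) by ring.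
    have -> : d * (a * (a * 1) * t / (eps * (eps * 1) + a * (a * 1) * (t * (t * 1)))) + - (d / t) =
       - (d * (eps ^ 2 / (t * (eps * (eps * 1) + a * t * (a * t * 1))))).
    { rewrite Hden. field. split; nra. }
    rewrite Rabs_Ropp Rabs_mult (Rabs_pos_eq (eps ^ 2 / _)); last first.
    { apply: Rdiv_le_0_compat; first exact: pow2_ge_0. exact: Rmult_lt_0_compat. }
    have Hpos : 0 <= eps ^ 2 / (t * (eps * (eps * 1) + a * t * (a * t * 1))).
    { apply: Rdiv_le_0_compat; first exact: pow2_ge_0. exact: Rmult_lt_0_compat. }
    apply: Rle_trans (Rmult_le_compat_r _ _ _ Hpos Hd) _. right.
    have Hden2 : eps * (eps * 1) + a * t * (a * t * 1) = eps * eps + (Rabs a * Rabs a) * (t * t) by rewrite Ha2; ring.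
    rewrite Hden2. rewrite Hden2 in Hp. simpl. rfield. repeat split; nra.
Qed.

Definition Smom (p : nat) (w0 rho eps : R) : R := RInt (fun th => cos th ^ (2 * p) * hR 2 w0 eps (rho * cos th)) 0 (2 * PI).

(* Limit of the [2 p]-th angular moment of [pR]: the three summands come from the constant, the logarithm and [veps]. *)
Definition Wser (p : nat) (x : R) : R :=
  2 * (gamma1 - ln x) * Cmom p x
  - Series (fun m => costerm m x * (2 * cosmom (m + p) * (harm (2 * (m + p)) - harm (m + p) - ln 2)))
  + 2 * Series (fun m => costerm m x * harm (2 * m) * cosmom (m + p)).

(** In [pR_veps] the logarithm becomes [2 ln rho] plus [lcos] at [eps / rho]. The constants with
    their [2 ln eps] converge by [pole_const_limits], the part with [lcos] by [Lmom_lim], and the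
    rest uniformly by [veps_bound]. *)
Lemma pRmom_lim (p : nat) (w0 rho : R) : 0 < w0 -> 0 < rho ->
  filterlim (fun eps => RInt (fun th => cos th ^ (2 * p) * pR w0 eps (rho * cos th)) 0 (2 * PI)) (at_right 0)
    (locally (Wser p (w0 * rho))).
Proof.
  move=> Hw Hr. have HP := PI_RGT_0. set x := w0 * rho. have Hx : 0 < x by exact: Rmult_lt_0_compat.
  have [HP0 _] := pole_const_limits w0 Hw.
  set V := fun eps => RInt (fun th => cos th ^ (2 * p) * veps w0 eps (rho * cos th)) 0 (2 * PI).
  have cv : forall eps th, 0 < eps -> continuous (fun th => veps w0 eps (rho * cos th)) th.
  { move=> eps th He. have [_ [d2 [_ d4]]] := j_derive w0 eps (rho * cos th) He.
    apply: (ct_comp (fun th => rho * cos th) (veps w0 eps)); first ctn.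
    rewrite /veps. have Hp := sumsq_pos eps (rho * cos th) He.
    have k2 : continuous (jsc w0 eps) (rho * cos th) by apply: ex_derive_continuousR; eexists; exact: d2.
    have k4 : continuous (jss w0 eps) (rho * cos th) by apply: ex_derive_continuousR; eexists; exact: d4.
    have kl : continuous (fun a => ln (eps ^ 2 + a ^ 2)) (rho * cos th) by apply: ln_ct => //; ctn.
    apply: ct_minus; first apply: ct_minus.
    - apply: ct_mult; first ctn. apply: ct_minus; last exact: continuous_const. apply: ct_mult => //. exact: continuous_const.
    - apply: ct_mult => //. ctn.
    - apply: ct_mult => //. ctn. }
  have HV : filterlim V (at_right 0) (locally (Series (fun m => costerm m x * harm (2 * m) * cosmom (m + p)))).
  { apply: (filterlim_squeeze0 _ _ (fun eps => eps * (w0 * (PI / 2) * (2 * PI)))).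
    - apply: filter_imp at_right_pos => eps He.
      have H1 : is_RInt (fun th => cos th ^ (2 * p) * veps w0 eps (rho * cos th)) 0 (2 * PI) (V eps).
      { apply: (RInt_correct (V := R_CompleteNormedModule)). apply: ex_RInt_cont => th. apply: ct_mult; [ctn | exact: cv]. }
      have H := is_RInt_minus (V := R_NormedModule) _ _ _ _ _ _ H1 (is_RInt_vmom p x).
      have -> : eps * (w0 * (PI / 2) * (2 * PI)) = (2 * PI - 0) * (w0 * eps * (PI / 2)) by ring.
      have H2PI : 0 <= 2 * PI by lra.
      apply: (norm_RInt_le_const (fun th => minus _ _) 0 (2 * PI) _ _ H2PI _ H) => th _.
      change (Rabs (cos th ^ (2 * p) * veps w0 eps (rho * cos th) - cos th ^ (2 * p) * vfun (x * cos th)) <= w0 * eps * (PI / 2)).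
      rewrite -Rmult_minus_distr_l Rabs_mult. have hb := veps_bound w0 eps (rho * cos th) He (Rlt_le _ _ Hw).
      have -> : x * cos th = w0 * (rho * cos th) by rewrite /x; ring.
      have := cos_pow_abs p th. have := Rabs_pos (cos th ^ (2 * p)). have := Rabs_pos (veps w0 eps (rho * cos th) - vfun (w0 * (rho * cos th))). nra.
    - apply: fl_val (Rmult_0_l (w0 * (PI / 2) * (2 * PI))). apply: fl_mult; [exact: fl_id_right | exact: filterlim_const]. }
  apply: (filterlim_ext_loc (fun eps => (g0v eps w0 + f0v eps w0 + 2 * ln eps - 2 * ln rho) * Cmom p x - Lmom p x (eps * / rho) + 2 * V eps)).
  - apply: filter_imp at_right_pos => eps He.
    have Heta : 0 < eps * / rho by apply: Rmult_lt_0_compat => //; exact: Rinv_0_lt_compat.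
    set A := g0v eps w0 + f0v eps w0 + 2 * ln eps - 2 * ln rho.
    have H1 := is_RInt_scal (V := R_NormedModule) _ _ _ A _ (is_RInt_Cmom p x).
    have H2 : is_RInt (fun th => cos th ^ (2 * p) * lcos (eps * / rho) th * cos (x * cos th)) 0 (2 * PI) (Lmom p x (eps * / rho)).
    { apply: (RInt_correct (V := R_CompleteNormedModule)). apply: ex_RInt_cont => th. apply: ct_mult; [exact: continuous_logmom | ctn]. }
    have H3 : is_RInt (fun th => 2 * (cos th ^ (2 * p) * veps w0 eps (rho * cos th))) 0 (2 * PI) (2 * V eps).
    { apply: (is_RInt_scal (V := R_NormedModule)). apply: (RInt_correct (V := R_CompleteNormedModule)). apply: ex_RInt_cont => th. apply: ct_mult; [ctn | exact: cv]. }
    symmetry. apply: is_RInt_unique.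
    apply: is_RInt_ext (is_RInt_plus (V := R_NormedModule) _ _ _ _ _ _ (is_RInt_minus (V := R_NormedModule) _ _ _ _ _ _ H1 H2) H3).
    move=> th _. rewrite pR_veps.
    have Hl : ln (eps ^ 2 + (rho * cos th) ^ 2) = 2 * ln rho + lcos (eps * / rho) th.
    { have Hp := sumsq_pos (eps * / rho) (cos th) Heta. rewrite /lcos.
      have -> : eps ^ 2 + (rho * cos th) ^ 2 = (rho * rho) * ((eps * / rho) ^ 2 + cos th ^ 2) by field; lra.
      rewrite ln_mult //; last by apply: Rmult_lt_0_compat. rewrite ln_mult //. ring. }
    rewrite Hl. have -> : w0 * (rho * cos th) = x * cos th by rewrite /x; ring.
    rewrite /minus /plus /opp /scal /= /mult /= /A. rring.
  - have Hct : forall k : R, filterlim (fun _ : R => k) (at_right 0) (locally k) by move=> k; exact: filterlim_const.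
    apply: fl_val.
    + apply: fl_plus; last by apply: fl_mult; [exact: Hct | exact: HV].
      apply: fl_minus.
      * apply: fl_mult; last exact: Hct. apply: fl_minus; [exact: HP0 | exact: Hct].
      * exact: (fl_scale_right (/ rho) _ _ (Rinv_0_lt_compat _ Hr) (Lmom_lim p x)).
    + rewrite /Wser. have -> : ln x = ln w0 + ln rho by rewrite /x ln_mult. ring.
Qed.

(** The first moment is homogeneous of degree [- 2] in [(eps, a)], which gives the factor
    [1 / rho^2] and the argument [eps / rho] of [zmom]. *)
Lemma Smom_lim (p : nat) (w0 rho Z : R) : 0 < w0 -> 0 < rho ->
  filterlim (zmom p) (at_right 0) (locally Z) ->
  filterlim (Smom p w0 rho) (at_right 0) (locally (2 / rho ^ 2 * Z + w0 ^ 2 * Wser p (w0 * rho))).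
Proof.
  move=> Hw Hr HZ.
  apply: (filterlim_ext_loc (fun eps => 2 / rho ^ 2 * zmom p (eps * / rho)
     + w0 ^ 2 * RInt (fun th => cos th ^ (2 * p) * pR w0 eps (rho * cos th)) 0 (2 * PI))).
  - apply: filter_imp at_right_pos => eps He.
    have Heta : 0 < eps * / rho by apply: Rmult_lt_0_compat => //; exact: Rinv_0_lt_compat.
    have cz : forall th, continuous (fun th => cos th ^ (2 * p) * (((eps * / rho) ^ 2 - cos th ^ 2) / ((eps * / rho) ^ 2 + cos th ^ 2) ^ 2)) th.
    { move=> th. have Hp := sumsq_pos (eps * / rho) (cos th) Heta. have Hne := Rgt_not_eq _ _ Hp. ctn. exact: pow_nonzero. }
    have cp : forall th, continuous (fun th => cos th ^ (2 * p) * pR w0 eps (rho * cos th)) th.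
    { move=> th. have [_ [_ [_ c4]]] := contdiff_mp w0 eps He. apply: ct_mult; first ctn.
      apply: (ct_comp (fun th => rho * cos th) (pR w0 eps)); first ctn. exact: contdiff_continuous. }
    rewrite /zmom /Smom -!RInt_scalR; try exact: ex_RInt_cont.
    rewrite -RInt_plusR.
    + apply: RInt_ext => th _. have Hp := sumsq_pos (eps * / rho) (cos th) Heta. have Hp2 := sumsq_pos eps (rho * cos th) He.
      rewrite /hR /momR /zp /zq.
      have -> : eps ^ 2 + (rho * cos th) ^ 2 = rho ^ 2 * ((eps * / rho) ^ 2 + cos th ^ 2) by field; lra.
      set Dn := (eps * / rho) ^ 2 + cos th ^ 2 in Hp *.
      have -> : (eps * / rho) ^ 2 = eps ^ 2 / rho ^ 2 by field; lra.
      move: (cos th ^ (2 * p)) (pR w0 eps (rho * cos th)) => X Y. rfield. split; lra.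
    + apply: ex_RInt_cont => th. apply: ct_mult; [exact: continuous_const | exact: cz].
    + apply: ex_RInt_cont => th. apply: ct_mult; [exact: continuous_const | exact: cp].
  - apply: fl_plus; (apply: fl_mult; first exact: filterlim_const).
    + exact: (fl_scale_right (/ rho) _ _ (Rinv_0_lt_compat _ Hr) HZ).
    + exact: pRmom_lim.
Qed.

(** * Entire series in [x ^ 2] and Bessel's equation *)

Lemma is_series_entire (a : nat -> R) (y : R) : CV_radius a = p_infty -> is_series (fun m => a m * y ^ m) (PSeries a y).
Proof.
  move=> Ha. apply: is_series_ext (PSeries_correct _ _ (CV_radius_inside _ _ (Rbar_lt_infty y _ Ha))) => m.
  rewrite pow_n_pow /scal /= /mult /=. rring.
Qed.

Lemma is_series_eq (a : nat -> R) (l l' : R) : is_series a l -> l = l' -> is_series a l'.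
Proof. by move=> H <-. Qed.

Definition evenS1 (a : nat -> R) (x : R) : R := 2 * x * PSeries (PS_derive a) (x ^ 2).
Definition evenS2 (a : nat -> R) (x : R) : R :=
  2 * PSeries (PS_derive a) (x ^ 2) + 4 * x ^ 2 * PSeries (PS_derive (PS_derive a)) (x ^ 2).

Lemma evenS_derive (a : nat -> R) (x : R) : CV_radius a = p_infty ->
  is_derive (fun x => PSeries a (x ^ 2)) x (evenS1 a x) /\ is_derive (evenS1 a) x (evenS2 a x).
Proof.
  move=> Ha.
  have Hsq : is_derive (fun x => x ^ 2) x (2 * x) by auto_derive => //; ring.
  have H : forall b, CV_radius b = p_infty -> is_derive (fun x => PSeries b (x ^ 2)) x (2 * x * PSeries (PS_derive b) (x ^ 2)).
  { move=> b Hb.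
    exact: (is_derive_comp (V := R_NormedModule) (PSeries b) _ x _ _ (is_derive_PSeries b _ (Rbar_lt_infty _ _ Hb)) Hsq). }
  split; first exact: H.
  have H1 := H (PS_derive a) (eq_trans (CV_radius_derive a) Ha).
  have Hl : is_derive (fun x => 2 * x) x 2 by auto_derive => //; ring.
  apply: is_derive_eq (is_derive_mult (K := R_AbsRing) _ _ _ _ _ Hl H1 Rmult_comm) _.
  rewrite /evenS2 /plus /mult /=. rring.
Qed.

Lemma is_series_derive_1 (a : nat -> R) (y : R) : CV_radius a = p_infty ->
  is_series (fun m => INR (S m) * a (S m) * y ^ m) (PSeries (PS_derive a) y).
Proof. move=> Ha. apply: (is_series_entire (PS_derive a)). by rewrite CV_radius_derive. Qed.

Lemma is_series_derive_2 (a : nat -> R) (y : R) : CV_radius a = p_infty ->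
  is_series (fun m => INR m * INR (S m) * a (S m) * y ^ m) (y * PSeries (PS_derive (PS_derive a)) y).
Proof.
  move=> Ha. have Hb : CV_radius (PS_derive (PS_derive a)) = p_infty by rewrite !CV_radius_derive.
  have H := is_pseries_incr_1 _ _ _ (PSeries_correct _ _ (CV_radius_inside _ _ (Rbar_lt_infty y _ Hb))).
  apply: is_series_ext H => -[|m]; rewrite pow_n_pow.
  - rewrite /scal /= /mult /= /zero /=. rring.
  - change (y ^ S m * (INR (S m) * (INR (S (S m)) * a (S (S m)))) = INR (S m) * INR (S (S m)) * a (S (S m)) * y ^ S m). ring.
Qed.

Lemma is_series_evenS2 (a : nat -> R) (x : R) : CV_radius a = p_infty ->
  is_series (fun m => (2 * INR m + 2) * (2 * INR m + 1) * a (S m) * (x ^ 2) ^ m) (evenS2 a x).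
Proof.
  move=> Ha. have H1 := is_series_derive_1 a (x ^ 2) Ha. have H2 := is_series_derive_2 a (x ^ 2) Ha.
  have H := is_series_plus (V := R_NormedModule) _ _ _ _ (is_series_scal (V := R_NormedModule) 2 _ _ H1) (is_series_scal (V := R_NormedModule) 4 _ _ H2).
  apply: is_series_eq; first apply: is_series_ext H => m.
  - rewrite /plus /scal /= /mult /=. rewrite -/(INR (S m)) S_INR. rring.
  - rewrite /evenS2 /plus /scal /= /mult /=. rring.
Qed.

(** The operator [f'' + f' / x] sends [x^(2m+2)] to [4 (m+1)^2 x^(2m)], which explains the recursion
    asked of the coefficients. *)
Lemma evenS_ode (a b : nat -> R) (x : R) : CV_radius a = p_infty -> x <> 0 ->
  (forall m, 4 * INR (S m) ^ 2 * a (S m) + a m = b m) ->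
  evenS2 a x + evenS1 a x / x + PSeries a (x ^ 2) = PSeries b (x ^ 2).
Proof.
  move=> Ha Hx Hab.
  have H1 := is_series_derive_1 a (x ^ 2) Ha. have H2 := is_series_derive_2 a (x ^ 2) Ha. have H0 := is_series_entire a (x ^ 2) Ha.
  have H := is_series_plus (V := R_NormedModule) _ _ _ _ (is_series_plus (V := R_NormedModule) _ _ _ _
    (is_series_scal (V := R_NormedModule) 4 _ _ H1) (is_series_scal (V := R_NormedModule) 4 _ _ H2)) H0.
  have -> : PSeries b (x ^ 2) = 4 * PSeries (PS_derive a) (x ^ 2) + 4 * (x ^ 2 * PSeries (PS_derive (PS_derive a)) (x ^ 2)) + PSeries a (x ^ 2).
  { apply: is_series_unique. apply: is_series_ext H => m. rewrite -Hab /plus /scal /= /mult /= -/(INR (S m)) S_INR. rring. }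
  rewrite /evenS2 /evenS1. field. exact: Hx.
Qed.

Lemma aJ_S (m : nat) : 4 * INR (S m) ^ 2 * aJ (S m) = - aJ m.
Proof.
  rewrite /aJ fact_simpl mult_INR. have h1 := INR_fact_neq_0 m. have h2 : INR (S m) <> 0 by apply: not_0_INR.
  have h3 : 4 ^ m <> 0 by apply: pow_nonzero; lra. change (4 ^ S m) with (4 * 4 ^ m). change ((-1) ^ S m) with (-1 * (-1) ^ m).
  field. by repeat split.
Qed.

Lemma J0_ode (x : R) : x <> 0 -> evenS2 aJ x + evenS1 aJ x / x + J0 x = 0.
Proof.
  move=> Hx. rewrite /J0 (evenS_ode aJ (fun _ => 0) x aJ_CV Hx).
  - by rewrite /PSeries Series_scal_l Rmult_0_l.
  - move=> m. rewrite aJ_S. ring.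
Qed.

(** The right side is exactly what Bessel's operator produces from the logarithm in front of [J0],
    so the two contributions cancel in [Y0_ode]. It comes from the increment [1 / (m + 1)] of the
    harmonic numbers. *)
Lemma N0_ode (x : R) : x <> 0 -> evenS2 aN x + evenS1 aN x / x + N0ser x = 2 * evenS1 aJ x / x.
Proof.
  move=> Hx. rewrite /N0ser (evenS_ode aN (fun m => 4 * PS_derive aJ m) x aN_CV Hx).
  - rewrite /evenS1 /PSeries (Series_ext _ (fun k => 4 * (PS_derive aJ k * (x ^ 2) ^ k))); last by move=> m; ring.
    rewrite Series_scal_l. field. exact: Hx.
  - move=> m. rewrite /PS_derive /aN. have h := aJ_S m. have h2 : INR (S m) <> 0 by apply: not_0_INR.
    change (harm (S m)) with (harm m + / INR (S m)).
    transitivity (4 * INR (S m) ^ 2 * aJ (S m) * harm m + 4 * INR (S m) * aJ (S m) + aJ m * harm m); first by field.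
    rewrite h. ring.
Qed.

Definition Y0d1 (x : R) : R := 2 / PI * (J0 x / x + (ln (x / 2) - gamma1) * evenS1 aJ x - evenS1 aN x).
Definition Y0d2 (x : R) : R :=
  2 / PI * (- J0 x / x ^ 2 + 2 * evenS1 aJ x / x + (ln (x / 2) - gamma1) * evenS2 aJ x - evenS2 aN x).

Lemma Y0_derive (x : R) : 0 < x -> is_derive Y0 x (Y0d1 x) /\ is_derive Y0d1 x (Y0d2 x).
Proof.
  move=> Hx. have HP := PI_RGT_0. have [j1 j2] := evenS_derive aJ x aJ_CV. have [n1 n2] := evenS_derive aN x aN_CV.
  have Hl : is_derive (fun x => ln (x / 2) - gamma1) x (/ x) by auto_derive; [lra | field; lra].
  have Hi : is_derive (fun x => / x) x (- / x ^ 2) by auto_derive; [lra | field; lra].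
  have pl := fun f g l k => is_derive_plus (V := R_NormedModule) f g x l k.
  have mi := fun f g l k => is_derive_minus (V := R_NormedModule) f g x l k.
  have mu := fun f g l k H1 H2 => is_derive_mult (K := R_AbsRing) f g x l k H1 H2 Rmult_comm.
  split.
  - apply: is_derive_eq (is_derive_scal _ _ (2 / PI) _ (mi _ _ _ _ (mu _ _ _ _ Hl j1) n1)) _.
    rewrite /Y0d1 /minus /plus /opp /mult /= -/(J0 x). rfield. lra.
  - apply: is_derive_eq (is_derive_scal _ _ (2 / PI) _ (mi _ _ _ _ (pl _ _ _ _ (mu _ _ _ _ j1 Hi) (mu _ _ _ _ Hl j2)) n2)) _.
    rewrite /Y0d2 /minus /plus /opp /mult /= -/(J0 x). rfield. lra.
Qed.

Lemma Y0_ode (x : R) : 0 < x -> Y0d2 x + Y0d1 x / x + Y0 x = 0.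
Proof.
  move=> Hx. have HP := PI_RGT_0. have Hx0 : x <> 0 by lra. have hJ := J0_ode x Hx0. have hN := N0_ode x Hx0.
  have -> : Y0d2 x + Y0d1 x / x + Y0 x = 2 / PI * ((ln (x / 2) - gamma1) * (evenS2 aJ x + evenS1 aJ x / x + J0 x)
     + (2 * evenS1 aJ x / x - (evenS2 aN x + evenS1 aN x / x + N0ser x))).
  { rewrite /Y0d2 /Y0d1 /Y0. field. lra. }
  rewrite hJ hN. ring.
Qed.

Lemma costerm_cosmom (m : nat) (x : R) : costerm m x * cosmom m = 2 * PI * (aJ m * (x ^ 2) ^ m).
Proof.
  rewrite /costerm /cosmom /aJ -pow_mult. have h1 := INR_fact_neq_0 m. have h2 := INR_fact_neq_0 (2 * m).
  have h3 : 4 ^ m <> 0 by apply: pow_nonzero; lra. field. by repeat split.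
Qed.

Lemma costerm_cosmom_S (m : nat) (x : R) :
  costerm m x * cosmom (S m) = - 2 * PI * ((2 * INR m + 2) * (2 * INR m + 1) * aJ (S m) * (x ^ 2) ^ m).
Proof.
  have Hm := pos_INR m. have h := aJ_S m.
  have h2 : aJ (S m) = - aJ m / (4 * (INR m + 1) ^ 2) by rewrite -h S_INR; field; lra.
  rewrite cosmom_S h2 -Rmult_assoc costerm_cosmom. field. lra.
Qed.

Lemma Cmom_0 (x : R) : Cmom 0 x = 2 * PI * J0 x.
Proof.
  rewrite /Cmom /J0 /PSeries -Series_scal_l. apply: Series_ext => m. by rewrite Nat.add_0_r costerm_cosmom.
Qed.

Lemma Cmom_1 (x : R) : Cmom 1 x = - 2 * PI * evenS2 aJ x.
Proof.
  rewrite -(is_series_unique _ _ (is_series_evenS2 aJ x aJ_CV)) /Cmom -Series_scal_l.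
  apply: Series_ext => m. by rewrite Nat.add_1_r costerm_cosmom_S.
Qed.

Lemma cosmom_bound (m : nat) : 0 <= cosmom m <= 2 * PI.
Proof.
  have HP := PI_RGT_0. elim: m => [|m [h1 h2]]; first by rewrite /cosmom /=; lra.
  rewrite cosmom_S. have Hm := pos_INR m.
  have hr : 0 <= (2 * INR m + 1) / (2 * INR m + 2) <= 1.
  { split; first by apply: Rdiv_le_0_compat; lra. apply/Rle_div_l; lra. }
  nra.
Qed.

Lemma ex_series_costerm_le (x K : R) (k : nat -> R) : (forall m, Rabs (k m) <= K * (2 * INR m + 1)) ->
  ex_series (fun m => costerm m x * k m).
Proof.
  move=> Hk.
  apply: (ex_series_le (K := R_AbsRing) (V := R_CompleteNormedModule) _ (fun m => K * (Rabs (costerm m x) * (2 * INR m + 1)))).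
  - move=> m. change (Rabs (costerm m x * k m) <= K * (Rabs (costerm m x) * (2 * INR m + 1))).
    rewrite (Rabs_mult (costerm m x)).
    have -> : K * (Rabs (costerm m x) * (2 * INR m + 1)) = Rabs (costerm m x) * (K * (2 * INR m + 1)) by ring.
    apply: Rmult_le_compat_l => //. exact: Rabs_pos.
  - apply: (ex_series_scal (K := R_AbsRing) (V := R_NormedModule) K). exact: ex_series_costerm.
Qed.

(** The harmonic numbers [harm (2 m)] stemming from [veps] are subtracted inside the logarithmic
    series. For [p = 0] only [- harm m] remains there; for [p = 1] only [- harm (m + 1)] and two
    explicit fractions remain. *)
Lemma Wser_merge (p : nat) (x l : R) :
  is_series (fun m => costerm m x * cosmom (m + p) * (harm (2 * (m + p)) - harm (m + p) - harm (2 * m))) l ->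
  Wser p x = 2 * (gamma1 - ln x + ln 2) * Cmom p x - 2 * l.
Proof.
  move=> Hl. have HP := PI_RGT_0.
  have HK : forall m (u : R), Rabs u <= 2 * INR (m + p) + 2 -> Rabs (cosmom (m + p) * u) <= 2 * PI * (2 * INR p + 2) * (2 * INR m + 1).
  { move=> m u Hu. have [c0 c1] := cosmom_bound (m + p). rewrite Rabs_mult (Rabs_pos_eq (cosmom _)) // Rmult_assoc.
    rewrite plus_INR in Hu. have hm := pos_INR m. have hp := pos_INR p.
    apply: Rmult_le_compat => //; [exact: Rabs_pos | nra]. }
  have hb := fun m => harm_bound (2 * m). have hs : forall m, INR (2 * m) = 2 * INR m by move=> m; rewrite mult_INR.
  have e0 : ex_series (fun m => costerm m x * cosmom (m + p)).
  { apply: (ex_series_ext (fun m => costerm m x * (cosmom (m + p) * 1))); first by move=> m; rewrite Rmult_1_r.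
    apply: ex_series_costerm_le => m. apply: HK. rewrite Rabs_R1. have := pos_INR (m + p). lra. }
  have e2 : ex_series (fun m => costerm m x * harm (2 * m) * cosmom (m + p)).
  { apply: (ex_series_ext (fun m => costerm m x * (cosmom (m + p) * harm (2 * m)))); first by move=> m; rring.
    apply: ex_series_costerm_le => m. apply: HK. have [h1 h2] := hb m. rewrite Rabs_pos_eq // plus_INR.
    rewrite hs in h2. have := pos_INR p. lra. }
  have i0 := Series_correct _ e0. have i2 := Series_correct _ e2. rewrite -/(Cmom p x) in i0.
  rewrite /Wser. set T := Series (fun m => costerm m x * harm (2 * m) * cosmom (m + p)) in i2 *.
  have -> : Series (fun m => costerm m x * (2 * cosmom (m + p) * (harm (2 * (m + p)) - harm (m + p) - ln 2))) = 2 * l + 2 * T - 2 * ln 2 * Cmom p x.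
  { apply: is_series_unique.
    have H := is_series_minus (V := R_NormedModule) _ _ _ _ (is_series_plus (V := R_NormedModule) _ _ _ _
      (is_series_scal (V := R_NormedModule) 2 _ _ Hl) (is_series_scal (V := R_NormedModule) 2 _ _ i2)) (is_series_scal (V := R_NormedModule) (2 * ln 2) _ _ i0).
    apply: is_series_ext H => m.
    set A := harm (2 * (m + p)). set B := harm (m + p). set E := harm (2 * m).
    rewrite /minus /plus /opp /scal /= /mult /=. rring. }
  ring.
Qed.

Lemma Wser_0 (x : R) : 0 < x -> Wser 0 x = - 2 * PI ^ 2 * Y0 x.
Proof.
  move=> Hx. have HP := PI_RGT_0.
  rewrite (Wser_merge 0 x (- 2 * PI * N0ser x)).
  - rewrite Cmom_0 /Y0 ln_div //; last lra. field. lra.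
  - have H := is_series_scal (V := R_NormedModule) (- 2 * PI) _ _ (is_series_entire aN (x ^ 2) aN_CV).
    apply: is_series_ext H => m. rewrite Nat.add_0_r costerm_cosmom /aN /scal /= /mult /=.
    move: (harm (m + (m + 0))) (harm m) => A B. rring.
Qed.

(** The two fractions [1 / (2m+1)] and [1 / (2m+2)] produce the terms of [Y0d2] with [J0] and its
    first derivative. The shifted series of [J0] lacks its constant term, hence [J0 - 1]; the
    resulting [4 PI / x^2] is later cancelled in [Smom] by the limit [- 2 PI] of [zmom 1]. *)
Lemma Wser_1 (x : R) : 0 < x -> Wser 1 x = 2 * PI ^ 2 * Y0d2 x + 4 * PI / x ^ 2.
Proof.
  move=> Hx. have HP := PI_RGT_0.
  rewrite (Wser_merge 1 x (2 * PI * ((J0 x - 1) / x ^ 2 - 2 * evenS1 aJ x / x + evenS2 aN x))).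
  - rewrite Cmom_1 /Y0d2 ln_div //; last lra. field. lra.
  - have h0 : is_series (fun m => aJ (S m) * (x ^ 2) ^ m) ((J0 x - 1) / x ^ 2).
    { have H := is_series_entire aJ (x ^ 2) aJ_CV. have hx2 : x ^ 2 <> 0 by apply: pow_nonzero; lra.
      have H1 : is_series (fun m => aJ (S m) * (x ^ 2) ^ S m) (J0 x - 1).
      { apply: (is_series_incr_1 (V := R_NormedModule) (fun m => aJ m * (x ^ 2) ^ m)). apply: is_series_eq H _.
        rewrite /J0 /plus /aJ /=. field. }
      apply: is_series_eq; first apply: is_series_ext (is_series_scal (V := R_NormedModule) (/ x ^ 2) _ _ H1) => m.
      - change ((x ^ 2) ^ S m) with (x ^ 2 * (x ^ 2) ^ m). rewrite /scal /= /mult /=. simpl in hx2. rfield. lra.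
      - rewrite /scal /= /mult /=. rfield. lra. }
    have h1 := is_series_derive_1 aJ (x ^ 2) aJ_CV. have h2 := is_series_evenS2 aN x aN_CV.
    have H := is_series_scal (V := R_NormedModule) (2 * PI) _ _ (is_series_plus (V := R_NormedModule) _ _ _ _ (is_series_minus (V := R_NormedModule) _ _ _ _ h0
       (is_series_scal (V := R_NormedModule) 4 _ _ h1)) h2).
    apply: is_series_eq; first apply: is_series_ext H => m.
    + rewrite Nat.add_1_r costerm_cosmom_S /aN.
      have -> : (2 * S m = S (S (2 * m)))%nat by lia.
      change (harm (S (S (2 * m)))) with (harm (2 * m) + / INR (S (2 * m)) + / INR (S (S (2 * m)))).
      rewrite !S_INR mult_INR. change (INR 2) with 2. have hm := pos_INR m.
      move: (harm (2 * m)) (harm (S m)) (aJ (S m)) ((x ^ 2) ^ m) (INR m) hm => A B E X N hm.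
      rewrite /minus /plus /opp /scal /= /mult /=. rfield. lra.
    + rewrite /evenS1 /minus /plus /opp /scal /= /mult /=. rfield. lra.
Qed.

Lemma ang2_moments (D Dd M rho I0 I1 : R) (h : R -> R) :
  is_RInt (fun th => cos th ^ (2 * 0) * h (rho * cos th)) 0 (2 * PI) I0 ->
  is_RInt (fun th => cos th ^ (2 * 1) * h (rho * cos th)) 0 (2 * PI) I1 ->
  ang 2 D Dd M rho h = D * I0 - M * I1 - (Dd - M) * (I0 - I1).
Proof.
  move=> H0 H1. apply: is_RInt_unique.
  have sc := fun k f l H => is_RInt_scal (V := R_NormedModule) f 0 (2 * PI) k l H.
  have H := is_RInt_plus (V := R_NormedModule) _ _ _ _ _ _ (sc (D - (Dd - M)) _ _ H0) (sc (Dd - 2 * M) _ _ H1).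
  apply: is_RInt_eq; first apply: is_RInt_ext H.
  - move=> th _. have Hs : sin th ^ 2 = 1 - cos th ^ 2 by have := sin2_cos2 th; rewrite /Rsqr /=; lra.
    rewrite Hs. change (2 * 0)%nat with 0%nat. change (2 * 1)%nat with 2%nat.
    rewrite /plus /scal /= /mult /=. rring.
  - rewrite /plus /scal /= /mult /=. rring.
Qed.

Lemma convergence_2 (c w0 : R) (mu nu r : vec) : 0 < c -> 0 < w0 -> in_Rd 2 r -> 0 < vnorm r ->
  filterlim
    (fun eps => Cplus (Copp (omega_reg 2 c w0 mu nu r eps))
                      (Cmult (Cdiv Ci (RtoC 2)) (gamma_ij 2 c w0 mu nu r)))
    (at_right 0)
    (locally (rscal (4 * PI * (w0 / c) ^ 2) (dyadic_form 2 (w0 / c) mu nu r))).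
Proof.
  move=> Hc Hw Hin Hr. have HP := PI_RGT_0. set k0 := w0 / c.
  have Hk : 0 < k0 by exact: Rdiv_lt_0_compat.
  set rho := vnorm r / c.
  have Hrho : 0 < rho by exact: Rdiv_lt_0_compat.
  have Hpk : w0 * rho = k0 * vnorm r by rewrite /rho /k0; field; lra.
  set x := k0 * vnorm r. have Hx : 0 < x by exact: Rmult_lt_0_compat.
  set D := dot mu nu. set Dd := dotd 2 mu nu. set M := dot mu r * dot nu r / vnorm r ^ 2.
  have [z0 z1] := zmom_lim.
  have L0 := Smom_lim 0 w0 rho 0 Hw Hrho z0. have L1 := Smom_lim 1 w0 rho _ Hw Hrho z1.
  rewrite Hpk -/x (Wser_0 x Hx) in L0. rewrite Hpk -/x (Wser_1 x Hx) in L1.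
  have sc : forall (f df : R -> R) y, is_derive f (k0 * y) (df (k0 * y)) -> forall s, is_derive (fun y => s * f (k0 * y)) y (s * k0 * df (k0 * y)).
  { move=> f df y Hf s. have Hl : is_derive (fun y => k0 * y) y k0 by auto_derive => //; ring.
    apply: is_derive_eq (is_derive_scal _ _ s _ (is_derive_comp (V := R_NormedModule) f _ y _ _ Hf Hl)) _.
    rewrite /scal /= /mult /=. rring. }
  have ky : forall y, 0 < y -> 0 < k0 * y by move=> y Hy; exact: Rmult_lt_0_compat.
  apply: (reduction 2 c w0 mu nu r
     (fun y => - / 4 * Y0 (k0 * y)) (fun y => - / 4 * k0 * Y0d1 (k0 * y)) (fun y => - / 4 * k0 * k0 * Y0d2 (k0 * y))
     (fun y => / 4 * J0 (k0 * y)) (fun y => / 4 * k0 * evenS1 aJ (k0 * y)) (fun y => / 4 * k0 * k0 * evenS2 aJ (k0 * y))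
     (D * (2 / rho ^ 2 * 0 + w0 ^ 2 * (- 2 * PI ^ 2 * Y0 x)) - M * (2 / rho ^ 2 * - (2 * PI) + w0 ^ 2 * (2 * PI ^ 2 * Y0d2 x + 4 * PI / x ^ 2))
      - (Dd - M) * ((2 / rho ^ 2 * 0 + w0 ^ 2 * (- 2 * PI ^ 2 * Y0 x)) - (2 / rho ^ 2 * - (2 * PI) + w0 ^ 2 * (2 * PI ^ 2 * Y0d2 x + 4 * PI / x ^ 2))))) => //.
  - exact: aligned_2.
  - lia.
  - move=> y Hy. exact: (sc _ _ _ (proj1 (Y0_derive _ (ky y Hy)))).
  - move=> y Hy. exact: (sc _ _ _ (proj2 (Y0_derive _ (ky y Hy)))).
  - move=> y Hy. exact: (sc _ _ _ (proj1 (evenS_derive aJ _ aJ_CV))).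
  - move=> y Hy. exact: (sc _ _ _ (proj2 (evenS_derive aJ _ aJ_CV))).
  - move=> v Hv. rewrite Gd_2 // -/k0. congr pair; field.
  - rewrite -/rho -/D -/Dd -/M.
    have H0 : forall p eps, 0 < eps -> is_RInt (fun th => cos th ^ (2 * p) * hR 2 w0 eps (rho * cos th)) 0 (2 * PI) (Smom p w0 rho eps).
    { move=> p eps He. apply: (RInt_correct (V := R_CompleteNormedModule)). apply: ex_RInt_cont => th.
      apply: ct_mult; first ctn. apply: (ct_comp (fun th => rho * cos th) (hR 2 w0 eps)); first ctn.
      exact: contdiff_continuous (proj1 (contdiff_h 2 w0 eps He)). }
    apply: (filterlim_ext_loc (fun eps => D * Smom 0 w0 rho eps - M * Smom 1 w0 rho eps - (Dd - M) * (Smom 0 w0 rho eps - Smom 1 w0 rho eps))).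
    { apply: filter_imp at_right_pos => eps He. by rewrite (ang2_moments D Dd M rho _ _ _ (H0 0%nat eps He) (H0 1%nat eps He)). }
    have Hct : forall k : R, filterlim (fun _ : R => k) (at_right 0) (locally k) by move=> k; exact: filterlim_const.
    apply: fl_minus; first apply: fl_minus; (apply: fl_mult; first exact: Hct) => //. exact: fl_minus.
  - rewrite -/D -/Dd -/M -/k0 -/x. have ho := Y0_ode x Hx.
    (* The angular moments deliver only [Y0] and [Y0d2]; Bessel's equation eliminates the first
       derivative from the transverse part of the Hessian. *)
    have -> : Y0d1 x = - x * (Y0 x + Y0d2 x).
    { have -> : Y0d1 x = x * ((Y0d2 x + Y0d1 x / x + Y0 x) - (Y0 x + Y0d2 x)) by field; lra. rewrite ho. ring. }
    rewrite /x /rho /k0 /=. move: (Y0 _) (Y0d2 _) => A B. field. repeat split; lra.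
  - rewrite -/rho -/D -/Dd -/M -/k0 -/x. have Hx0 : x <> 0 by lra. have ho := J0_ode x Hx0.
    have C := fun p => is_RInt_Cmom p x.
    have E : forall p th, cos th ^ (2 * p) * cos (x * cos th) = cos th ^ (2 * p) * cos (w0 * (rho * cos th)).
    { move=> p th. congr (_ * cos _). rewrite /x -Hpk. ring. }
    rewrite (ang2_moments D Dd M rho (Cmom 0 x) (Cmom 1 x) (fun y => cos (w0 * y))).
    + rewrite Cmom_0 Cmom_1.
      have -> : evenS1 aJ x = - x * (J0 x + evenS2 aJ x).
      { have -> : evenS1 aJ x = x * ((evenS2 aJ x + evenS1 aJ x / x + J0 x) - (J0 x + evenS2 aJ x)) by field. rewrite ho. ring. }
      rewrite /x /k0 /=. move: (J0 _) (evenS2 _ _) => A B. field. repeat split; lra.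
    + apply: is_RInt_ext (C 0%nat) => th _. exact: E.
    + apply: is_RInt_ext (C 1%nat) => th _. exact: E.
Qed.

Theorem theorem2 (d : nat) (c w0 : R) (mu_i mu_j r : vec) :
  (1 <= d <= 3)%nat -> 0 < c -> 0 < w0 ->
  in_Rd d r -> dot r r <> 0 ->
  filterlim
    (fun eps => Cplus (Copp (omega_reg d c w0 mu_i mu_j r eps))
                      (Cmult (Cdiv Ci (RtoC 2)) (gamma_ij d c w0 mu_i mu_j r)))
    (at_right 0)
    (locally (rscal (4 * PI * (w0 / c) ^ 2) (dyadic_form d (w0 / c) mu_i mu_j r))).
Proof.
  move=> Hd Hc Hw Hin Hr.
  have Hr0 : 0 < vnorm r by apply: sqrt_lt_R0; move: Hr; rewrite /dot; nra.
  case: d Hd Hin => [|[|[|[|d]]]] Hd Hin; try lia.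
  - exact: convergence_1.
  - exact: convergence_2.
  - exact: convergence_3.
Qed.
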